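(* Let $\Bbbk$ be a field, $G$ a discrete group with augmentation ideal $\mathfrak a\lhd\Bbbk[G]$, $F$ a discrete left $G$-space, $X$ a simplicial set, $\tau\colon X_{>0}\to G$ a twisting function and $t\colon C(X)\to C(G)=\Bbbk[G]$ Szczarba's twisting cochain. The filtration $$\mathcal F_{-p}(X,F)=C(X)\otimes_t\mathfrak a^p\,C(F),\qquad p\ge0,$$ of $C(X)\otimes_tC(F)$ gives rise to a spectral sequence of coalgebras. As a dgc, its first page is given by $$\mathcal E^1_{p,q}=H_{p+q}(X)\otimes_{t_*}\mathrm{gr}_q(F)$$ with the componentwise coproduct. If the augmentation ideal $\mathfrak a$ is nilpotent, then the spectral sequence converges to $H(X\times_\tau F)$ as a graded coalgebra.
   Context: **Conventions.** $C(-)$ denotes normalized chains over $\Bbbk$, a differential graded coalgebra (dgc) via the Alexander–Whitney diagonal; the Koszul sign rule is used. For $x\in X_n$ and a weakly increasing sequence $v_0\le\dots\le v_m$ in $\{0,\dots,n\}$, $x(v_0,\dots,v_m)\in X_m$ is the corresponding (possibly degenerate) simplex. The discrete group $G$ is regarded as a constant simplicial group and the $G$-set $F$ as a constant simplicial set, so $C(G)=C_0(G)=\Bbbk[G]$, $C(F)=C_0(F)$. **Twisting function.** $\tau\colon X_{>0}\to G$ satisfies, for $x\in X_n$, $n>0$ (whenever defined): $\partial_0\tau(x)=\tau(\partial_0x)^{-1}\tau(\partial_1x)$; $\partial_k\tau(x)=\tau(\partial_{k+1}x)$ for $0<k<n$; $s_k\tau(x)=\tau(s_{k+1}x)$ for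 $0\le k<n$; and $\tau(s_0x)=1$ for all $x$ (here the faces and degeneracies of the constant simplicial group $G$ are identities). $X\times_\tau F$ is $X\times F$ with $\partial_0(x,y)=(\partial_0x,\tau(x)\partial_0y)$. Since $G$ is discrete, Szczarba's twisting cochain is $t(x)=\tau(x)^{-1}-1$ for $x\in X_1$ and $t(x)=0$ for $x\in X_n$, $n\ne1$. **Dgc $C(X)\otimes_tC(F)$.** Differential: $d_t(c\otimes m)=dc\otimes m-\sum_{(c)}(-1)^{|c_{(1)}|}c_{(1)}\otimes t(c_{(2)})m$. Let $$\mathfrak F(x)=1\otimes x+\sum_{k=1}^n\sum_{\mathbf p}(-1)^{\epsilon(\mathbf p)+n-|x^{\mathbf p}_{k+1}|}\,t(x_1^{\mathbf p})\cdots t(x_k^{\mathbf p})\otimes x_{k+1}^{\mathbf p}\in\Bbbk[G]\otimes C(X),\qquad x\in X_n,$$ where $\mathbf p$ runs over all $0=p_0\le p_1\le\dots\le p_{2k+1}=n$, $x^{\mathbf p}_s=x(p_{2s-1},p_{2s-1}+1,\dots,p_{2s})$ for $1\le s\le k$, $x^{\mathbf p}_{k+1}=x(p_0,\dots,p_1,p_2,\dots,p_3,\dots,p_{2k},\dots,p_{2k+1})$ (concatenation of the intervals $[p_{2i},p_{2i+1}]$), and $$\epsilon(\mathbf p)=\tfrac{k(k-1)}2+\sum_{s=1}^k(k+1-s)(p_{2s}-p_{2s-1})+\sum_{s=1}^kp_{2s-1}+\sum_{s=1}^k(p_{2s}-p_{2s-1})\sum_{i=0}^{s-1}(p_{2i+1}-p_{2i}+1).$$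 If $\mathfrak F(c_{(2)})=\sum_ia_i\otimes c_i$, the diagonal is $\Delta(c\otimes m)=\sum_{(c),(m)}\sum_i(c_{(1)}\otimes a_im_{(1)})\otimes(c_i\otimes m_{(2)})$. This is a dgc quasi-isomorphic to $C(X\times_\tau F)$. **Associated graded objects.** $\mathcal F_{-p}(F)=\mathfrak a^pC(F)$ ($\mathfrak a^0=\Bbbk[G]$), $\mathrm{gr}_{-p}(F)=\mathcal F_{-p}(F)/\mathcal F_{-p-1}(F)$, and similarly $\mathrm{gr}_*(G)$ for $F=G$; $\mathrm{gr}_*(F)$ is a module over the graded algebra $\mathrm{gr}_*(G)$ and has the coproduct induced by that of $C(F)$ (the filtration satisfies $\Delta\mathcal F_{-p}(F)\subset\sum_{q+r=p}\mathcal F_{-q}(F)\otimes\mathcal F_{-r}(F)$). In $\mathcal E^r_{p,q}$ the index $q\le0$ is the filtration degree and $p+q$ the total (homological) degree; $\mathrm{gr}_*(F)$ carries homological degree $0$. $H(X)$ is a graded coalgebra via the Künneth isomorphism. The map $t_*\colon H(X)\to\mathrm{gr}_*(G)$ is $[c]\mapsto[t(c)]\in\mathrm{gr}_{-1}(G)$ if $|c|=1$ and $0$ otherwise; it is a well-defined twisting cochain. $H(X)\otimes_{t_*}\mathrm{gr}_*(F)$ is $H(X)\otimes\mathrm{gr}_*(F)$ with differential $c\otimes m\mapsto-\sum_{(c)}(-1)^{|c_{(1)}|}c_{(1)}\otimes t_*(c_{(2)})m$. *)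

(* Defs.v *)
From HB Require Import structures.
From mathcomp Require Import all_boot all_order all_algebra.
From mathcomp Require Import boolp classical_sets functions cardinality fsbigop.

Set Implicit Arguments.
Unset Strict Implicit.
Unset Printing Implicit Defensive.

Import Order.TTheory GRing.Theory Num.Theory.
Local Open Scope classical_set_scope.
Local Open Scope ring_scope.
Local Open Scope quotient_scope.

Section Span.
Variables (k : fieldType) (V : lmodType k) (S : set V).

Definition is_subspace (W : set V) : Prop :=
  W 0 /\ forall (a : k) u v, W u -> W v -> W (a *: u + v).

Definition lspan : {pred V} :=
  fun x => `[< forall W : set V, is_subspace W -> S `<=` W -> W x >].

Fact lspan_submod_closed : submod_closed lspan.
Proof.
split=> [|a u v]; rewrite ?unfold_in; first by apply/asboolP=> W [].
move=> /asboolP uS /asboolP vS; apply/asboolP=> W WV SW.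
by apply: WV.2; [apply: uS|apply: vS].
Qed.
HB.instance Definition _ :=
  GRing.isSubmodClosed.Build k V lspan (GRing.submod_closed_semi lspan_submod_closed).

(* [lspan S] is the subspace spanned by S, [spanned] the corresponding type, and
   [quo] the quotient of V by that subspace. *)
Definition spanned := {x : V | x \in lspan}.
HB.instance Definition _ := [isSub of spanned for @sval V (fun x => x \in lspan)].
HB.instance Definition _ := [Choice of spanned by <:].
HB.instance Definition _ := [SubChoice_isSubLmodule of spanned by <:].

Definition quo := Quotient.quot lspan.
HB.instance Definition _ := GRing.Zmodule.on quo.
HB.instance Definition _ := EqQuotient.on quo.

Definition qclass (v : V) : quo := \pi_quo v.
Definition qrep (x : quo) : V := repr x.

Lemma qrepK x : qclass (qrep x) = x. Proof. exact: reprK. Qed.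

Lemma qclass_eq (u v : V) : (qclass u == qclass v) = (u - v \in lspan).
Proof. by rewrite -Quotient.idealrBE. Qed.

Lemma qclassD (u v : V) : qclass (u + v) = qclass u + qclass v.
Proof. exact: Quotient.pi_add. Qed.

Definition quo_scale (a : k) (x : quo) : quo := qclass (a *: qrep x).

Lemma quo_scaleE a (v : V) : quo_scale a (qclass v) = qclass (a *: v).
Proof.
apply/eqP; rewrite qclass_eq -scalerBr; apply: rpredZ.
by rewrite -qclass_eq qrepK.
Qed.

Fact quo_scaleA a b x : quo_scale a (quo_scale b x) = quo_scale (a * b) x.
Proof. by rewrite -[x]qrepK !quo_scaleE scalerA. Qed.
Fact quo_scale1 : left_id 1 quo_scale.
Proof. by move=> x; rewrite -[x]qrepK quo_scaleE scale1r. Qed.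
Fact quo_scaleDr : right_distributive quo_scale +%R.
Proof.
move=> a x y; rewrite -[x]qrepK -[y]qrepK -qclassD !quo_scaleE.
by rewrite scalerDr qclassD.
Qed.
Fact quo_scaleDl x : {morph quo_scale^~ x : a b / a + b}.
Proof. by move=> a b; rewrite /= -[x]qrepK !quo_scaleE scalerDl qclassD. Qed.
HB.instance Definition _ := GRing.Zmodule_isLmodule.Build k quo
  quo_scaleA quo_scale1 quo_scaleDr quo_scaleDl.

End Span.

Section FinSupp.
Variables (k : fieldType) (I : Type) (V : lmodType k).

(* finitely supported functions *)
Definition fs_pred : {pred I -> V} :=
  fun f => `[< finite_set [set i | f i != 0] >].

Fact fs_submod_closed : submod_closed fs_pred.
Proof.
split=> [|a f g]; rewrite ?unfold_in.
  apply/asboolP; apply: (@sub_finite_set _ _ set0) => //.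
  by move=> i /=; rewrite eqxx.
move=> /asboolP ff /asboolP fg; apply/asboolP.
have fU : finite_set ([set i | f i != 0] `|` [set i | g i != 0]).
  by rewrite finite_setU.
apply: sub_finite_set fU => i /= afg; apply/orP; apply: contraT.
rewrite negb_or !negbK => /andP[/eqP f0 /eqP g0].
by case/eqP: afg; rewrite /GRing.add /GRing.scale /= f0 g0 scaler0 addr0.
Qed.
HB.instance Definition _ :=
  GRing.isSubmodClosed.Build k (I -> V) fs_pred
    (GRing.submod_closed_semi fs_submod_closed).

Definition fs := {f : I -> V | f \in fs_pred}.
HB.instance Definition _ := [isSub of fs for @sval (I -> V) (fun x => x \in fs_pred)].
HB.instance Definition _ := [Choice of fs by <:].
HB.instance Definition _ := [SubChoice_isSubLmodule of fs by <:].
Definition fs_fun (f : fs) : I -> V := val f.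
Coercion fs_fun : fs >-> Funclass.

Fact single_proof (i : I) (v : V) :
  (fun j => if `[< j = i >] then v else 0) \in fs_pred.
Proof.
rewrite unfold_in; apply/asboolP; apply: (@sub_finite_set _ _ [set i]).
  by move=> j /=; case: asboolP => // _; rewrite eqxx.
exact: finite_set1.
Qed.
Definition single i v : fs := exist (fun f => f \in fs_pred) _ (single_proof i v).
End FinSupp.

Arguments single {k I V} i v.
Arguments qclass {k V S} v.
Arguments qrep {k V S} x.

Section FreeTensor.
Variable k : fieldType.

Definition freemod (T : Type) : lmodType k := fs T k^o.
Definition basis (T : Type) (t : T) : freemod T := single t (1 : k^o).

(* linear extension of a map defined on a basis *)
Definition lext (T : Type) (V : lmodType k) (g : T -> V) (u : freemod T) : V :=
  \sum_(t \in [set: {classic T}]) ((u : fs T k^o) t : k) *: g t.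

Definition bilin_rel (V W : lmodType k) : set (freemod (V * W)) :=
  [set z | (exists a v v' w,
              z = basis (a *: v + v', w) - (a *: basis (v, w) + basis (v', w)))
        \/ (exists a v w w',
              z = basis (v, a *: w + w') - (a *: basis (v, w) + basis (v, w')))].

Definition tensor (V W : lmodType k) : lmodType k := quo (@bilin_rel V W).

Definition tens (V W : lmodType k) (v : V) (w : W) : tensor V W :=
  qclass (basis (v, w)).

(* the linear map on [tensor V W] induced by a bilinear map f *)
Definition tlift (V W U : lmodType k) (f : V -> W -> U) (t : tensor V W) : U :=
  lext (fun vw : V * W => f vw.1 vw.2) (qrep t).

Definition tmap (V W V' W' : lmodType k) (f : V -> V') (g : W -> W') :
    tensor V W -> tensor V' W' :=
  tlift (fun v w => tens (f v) (g w)).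

Definition tassoc (U V W : lmodType k) :
    tensor (tensor U V) W -> tensor U (tensor V W) :=
  tlift (fun t w => tlift (fun u v => tens u (tens v w)) t).

(* (u (x) u') (x) (v (x) v') |-> (u (x) v) (x) (u' (x) v') *)
Definition tswap (U U' V V' : lmodType k)
    (s : tensor U U') (t : tensor V V') : tensor (tensor U V) (tensor U' V') :=
  tlift (fun u u' => tlift (fun v v' => tens (tens u v) (tens u' v')) t) s.

(* the subquotient Z/B; [rep] picks representatives, [cls] is meaningful on Z *)
Definition sq (V : lmodType k) (Z B : set V) : lmodType k :=
  quo [set x : spanned Z | B (val x)].
Definition cls (V : lmodType k) (Z B : set V) (v : V) : sq Z B :=
  qclass (insubd (0 : spanned Z) v).
Definition rep (V : lmodType k) (Z B : set V) (x : sq Z B) : V := val (qrep x).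

End FreeTensor.

(* the inverse of f when f is bijective *)
Definition preinv (A : choiceType) (B : Type) (a0 : A) (f : A -> B) (b : B) : A :=
  xget a0 [set a | f a = b].

(* Graded differential coalgebras, internally graded by I: [pc i] is the piece
   of degree i, [deg i] its homological degree.  The data carry no laws; these
   are in [is_dgc]. *)
Record dgc (k : fieldType) (I : zmodType) := Dgc {
  carrier :> lmodType k;
  deg : I -> int;
  pc  : I -> set carrier;
  dif : carrier -> carrier;
  cop : carrier -> tensor carrier carrier;
  eps : carrier -> k }.

Section Dgc.
Variables (k : fieldType) (I : zmodType).
Implicit Types C D : dgc k I.

Definition decomposes C (x : C) (f : fs I C) : Prop :=
  (forall i, pc i (f i)) /\ x = \sum_(i \in [set: {classic I}]) f i.

(* the homogeneous components of x *)
Definition hcomp C (x : C) : fs I C := xget 0 [set f | decomposes x f].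

Definition is_grading C : Prop :=
  (forall i, is_subspace (@pc _ _ C i)) /\
  forall x : C, exists! f, decomposes x f.

(* x |-> (-1)^|x| x *)
Definition sgn C (x : C) : C :=
  \sum_(i \in [set: {classic I}]) ((-1) ^ deg C i : k) *: hcomp x i.

Definition dif2 C : tensor C C -> tensor C C :=
  tlift (fun x y => tens (dif x) y + tens (sgn x) (dif y)).

(* the piece of degree q of a tensor product of two graded or filtered spaces *)
Definition pc2 (V W : lmodType k) (J : zmodType)
    (P : J -> set V) (Q : J -> set W) (q : J) : set (tensor V W) :=
  [set t | t \in lspan [set t' | exists i j x y,
     [/\ i + j = q, P i x, Q j y & t' = tens x y]]].

(* s is the degree of the differential *)
Record is_dgc (s : I) C : Prop := IsDgc {
  dgc_grading : is_grading C;
  dgc_dif_linear : linear (@dif _ _ C);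
  dgc_cop_linear : linear (@cop _ _ C);
  dgc_eps_linear : linear (@eps _ _ C : C -> k^o);
  dgc_dif_pc : forall i (x : C), pc i x -> pc (i + s) (dif x);
  dgc_cop_pc : forall i (x : C),
    pc i x -> pc2 (@pc _ _ C) (@pc _ _ C) i (cop x);
  dgc_eps_pc : forall i (x : C), pc i x -> i != 0 -> eps x = 0;
  dgc_dif_dif : forall x : C, dif (dif x) = 0;
  dgc_coassoc : forall x : C,
    tassoc (tmap (@cop _ _ C) id (cop x)) = tmap id (@cop _ _ C) (cop x);
  dgc_counitl : forall x : C, tlift (fun y z => eps y *: z) (cop x) = x;
  dgc_counitr : forall x : C, tlift (fun y z => eps z *: y) (cop x) = x;
  dgc_cop_dif : forall x : C, cop (dif x) = dif2 (cop x);
  dgc_eps_dif : forall x : C, eps (dif x) = 0 }.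

Record is_coalg_iso C D (f : C -> D) : Prop := IsCoalgIso {
  iso_linear : linear f;
  iso_bij : bijective f;
  iso_pc : forall i x, pc i x -> pc i (f x);
  iso_cop : forall x, cop (f x) = tmap f f (cop x);
  iso_eps : forall x, eps (f x) = eps x }.

Definition is_dgc_iso C D (f : C -> D) : Prop :=
  is_coalg_iso f /\ forall x, f (dif x) = dif (f x).

Section Homology.
Variable C : dgc k I.

Definition cycles (V : lmodType k) (d : V -> V) : set V := [set x | d x = 0].

Definition homology (V : lmodType k) (d : V -> V) : lmodType k :=
  sq (cycles d) (range d).
Definition hcls (V : lmodType k) (d : V -> V) (z : V) : homology d :=
  cls (cycles d) (range d) z.

Definition kunneth :
    tensor (homology (@dif _ _ C)) (homology (@dif _ _ C)) ->
    homology (@dif2 C) :=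
  tlift (fun g h => hcls (@dif2 C) (tens (rep g) (rep h))).

(* the homology coalgebra; the coproduct is H(C) -> H(C (x) C) followed by the
   inverse of the Kuenneth isomorphism *)
Definition hdgc : dgc k I := {|
  carrier := homology (@dif _ _ C);
  deg := deg C;
  pc i := [set h | exists z : C, [/\ pc i z, dif z = 0 & h = hcls (@dif _ _ C) z]];
  dif := fun=> 0;
  cop h := preinv 0 kunneth (hcls (@dif2 C) (cop (rep h)));
  eps h := eps (rep h) |}.

End Homology.
End Dgc.

Arguments hdgc {k I} C.

Section Filtered.
Variable k : fieldType.

(* \bigoplus_q Z q / \bigoplus_q B q, which is \bigoplus_q Z q / B q *)
Definition dsumset (V : lmodType k) (Z : int -> set V) : set (fs int V) :=
  [set f | forall q, Z q (f q)].
Definition sqsum (V : lmodType k) (Z B : int -> set V) : lmodType k :=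
  sq (dsumset Z) (dsumset B).
Definition scls (V : lmodType k) (Z B : int -> set V) (f : fs int V) :
    sqsum Z B := cls (dsumset Z) (dsumset B) f.

Definition smap (V W : lmodType k) (s : int) (f : V -> W) (e : fs int V) :
    fs int W :=
  \sum_(i \in [set: int]) single (i + s) (f (e i)).
Definition smul (U V W : lmodType k) (f : U -> V -> W)
    (e : fs int U) (e' : fs int V) : fs int W :=
  \sum_(i \in [set: int]) \sum_(j \in [set: int]) single (i + j) (f (e i) (e' j)).

(* Increasing filtrations indexed by all integers *)
Record is_filtered_dgc (C : dgc k int) (Fil : int -> set C) : Prop := IsFilteredDgc {
  fil_subspace : forall q, is_subspace (Fil q);
  fil_graded : forall q x, Fil q x -> forall i, Fil q (hcomp x i);
  fil_incr : forall q, Fil (q - 1) `<=` Fil q;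
  fil_dif : forall q x, Fil q x -> Fil q (dif x);
  fil_cop : forall q x, Fil q x -> pc2 Fil Fil q (cop x) }.

Section Cross.
Variables (V : lmodType k) (Z B : int -> set V).
Variables (Z2 B2 : int -> set (tensor V V)).

Definition cross : tensor (sqsum Z B) (sqsum Z B) -> sqsum Z2 B2 :=
  tlift (fun e e' => scls Z2 B2 (smul (@tens _ V V) (rep e) (rep e'))).
End Cross.

(* The bigraded coalgebra \bigoplus_q Z q / B q of subquotients of C.  As for
   homology, the coproduct is the map induced by that of C followed by the
   inverse of the Kuenneth map [cross]; Z2 and B2 are the subspaces of C (x) C
   corresponding to Z and B.  In bidegree (p, q), q is the filtration degree
   and p + q the homological degree. *)
Definition sqdgc (C : dgc k int) (Z B : int -> set C)
    (Z2 B2 : int -> set (tensor C C)) (d : sqsum Z B -> sqsum Z B) :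
    dgc k (int * int)%type := {|
  carrier := sqsum Z B;
  deg pq := pq.1 + pq.2;
  pc pq := [set e | exists z, [/\ Z pq.2 z, pc (pq.1 + pq.2) z
                                & e = scls Z B (single pq.2 z)]];
  dif := d;
  cop e := preinv 0 (cross Z2 B2) (scls Z2 B2 (smap 0 (@cop _ _ C) (rep e)));
  eps e := eps ((rep e : fs int C) 0) |}.

Section Gr.
Variables (C : dgc k int) (Fil : int -> set C).

Definition below (V : lmodType k) (Fi : int -> set V) : int -> set V :=
  fun q => Fi (q - 1).

Definition gr : dgc k (int * int)%type :=
  let Fil2 := pc2 Fil Fil in
  sqdgc (Z := Fil) (B := below Fil) Fil2 (below Fil2) (fun=> 0).
Definition gr_cls (q : int) (m : C) : gr := scls Fil (below Fil) (single q m).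

(* the part of filtration degree q, all homological degrees together *)
Definition gr_part (q : int) : set gr :=
  [set e | exists m, Fil q m /\ e = gr_cls q m].
End Gr.

Section Pages.

Definition Zr (V : lmodType k) (d : V -> V) (Fi : int -> set V) (r q : int) :
    set V :=
  [set x | Fi q x /\ Fi (q - r) (d x)].
Definition Br (V : lmodType k) (d : V -> V) (Fi : int -> set V) (r q : int) :
    set V :=
  [set x | exists y z, [/\ Zr d Fi (r - 1) (q - 1) y,
                           Zr d Fi (r - 1) (q + r - 1) z & x = y + d z]].

Variables (C : dgc k int) (Fil : int -> set C).
Let d := @dif _ _ C.
Let d2 := @dif2 _ _ C.
Let Fil2 := pc2 Fil Fil.

Definition page (r : nat) : dgc k (int * int)%type :=
  sqdgc (Z := Zr d Fil r) (B := Br d Fil r) (Zr d2 Fil2 r) (Br d2 Fil2 r)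
    (fun e => scls (Zr d Fil r) (Br d Fil r) (smap (- r%:Z) d (rep e))).
Definition page_cls (r : nat) (q : int) (z : C) : page r :=
  scls (Zr d Fil r) (Br d Fil r) (single q z).

Definition page_kunneth (r : nat) :
    tensor (page r) (page r) -> sqsum (Zr d2 Fil2 r) (Br d2 Fil2 r) :=
  cross (Z := Zr d Fil r) (B := Br d Fil r) (Zr d2 Fil2 r) (Br d2 Fil2 r).

(* The pages are bigraded dgcs for the coproduct induced by that of C, and each
   page is the homology of the preceding one as a coalgebra. *)
Definition spectral_sequence_of_coalgebras : Prop :=
  forall r : nat,
    [/\ bijective (@page_kunneth r),
        is_dgc (r%:Z - 1, - r%:Z) (page r) &
        exists phi : hdgc (page r) -> page r.+1,
          is_coalg_iso (D := page r.+1) phi /\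
          forall q (z : C), Zr d Fil r.+1 q z ->
            phi (hcls (@dif _ _ (page r)) (page_cls r q z)) = page_cls r.+1 q z].

Definition Hfil (q : int) : set (hdgc C) :=
  [set h | exists z : C, [/\ Fil q z, dif z = 0 & h = hcls (@dif _ _ C) z]].

(* H is identified with H(C), and E^R = E^oo with the associated graded
   coalgebra of H for the (finite) filtration induced by that of C. *)
Definition converges_to (H : dgc k int) : Prop :=
  exists Theta : hdgc C -> H,
    is_coalg_iso (C := hdgc C) Theta /\
    let FH q := Theta @` (Hfil q) in
    [/\ is_filtered_dgc FH,
        exists a b, FH a = [set 0] /\ FH b = setT &
        exists R : nat,
          (forall r : nat, (R <= r)%N -> forall e : page r, dif e = 0) /\
          exists phi : page R -> gr FH,
            is_coalg_iso (D := gr FH) phi /\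
            forall q (z : C), Fil q z -> dif z = 0 ->
              phi (page_cls R q z) = gr_cls FH q (Theta (hcls (@dif _ _ C) z))].

End Pages.
End Filtered.

(* Faces and degeneracies with index out of range carry no meaning. *)
Record sset := SSet {
  simp :> nat -> Type;
  face : forall n, nat -> simp n.+1 -> simp n;
  degen : forall n, nat -> simp n -> simp n.+1;
  face_face : forall n (x : simp n.+2) i j, (i < j)%N -> (j <= n.+2)%N ->
    face i (face j x) = face j.-1 (face i x);
  degen_degen : forall n (x : simp n) i j, (i <= j)%N -> (j <= n)%N ->
    degen i (degen j x) = degen j.+1 (degen i x);
  face_degen_lt : forall n (x : simp n.+1) i j, (i < j)%N -> (j <= n.+1)%N ->
    face i (degen j x) = degen j.-1 (face i x);
  face_degen_eq : forall n (x : simp n) j, (j <= n)%N -> face j (degen j x) = x;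
  face_degen_succ : forall n (x : simp n) j, (j <= n)%N ->
    face j.+1 (degen j x) = x;
  face_degen_gt : forall n (x : simp n.+1) i j, (j.+1 < i)%N -> (i <= n.+2)%N ->
    face i (degen j x) = degen j (face i.-1 x) }.

Section Simplices.
Variable X : sset.

Definition simplex := {n : nat & X n}.
Definition smk n (x : X n) : simplex := existT _ n x.
Definition sdim (s : simplex) : nat := projT1 s.

Definition sface (i : nat) (s : simplex) : simplex :=
  match s with
  | existT n x => match n return X n -> simplex with
                  | 0 => fun x => smk x
                  | n'.+1 => fun x => smk (face i x)
                  end x
  end.
Definition sdegen (i : nat) (s : simplex) : simplex :=
  match s with existT n x => smk (degen i x) end.

Definition degenerate (s : simplex) : Prop :=
  exists n (x : X n) i, (i <= n)%N /\ s = smk (degen i x).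

(* x(v_0,...,v_m) for a nonempty weakly increasing sequence v of vertices of x:
   drop the vertices not in v, last one first, then repeat the repeated ones. *)
Definition svert (s : simplex) (v : seq nat) : simplex :=
  let y := foldr (fun i s' => if i \in v then s' else sface i s')
                 s (iota 0 (sdim s).+1) in
  foldl (fun s' j => if nth 0%N v j == nth 0%N v j.+1 then sdegen j s' else s')
        y (iota 0 (size v).-1).

(* the interval a, a+1, ..., b *)
Definition ival (a b : nat) : seq nat := iota a (b - a).+1.

End Simplices.

Section Chains.
Variables (k : fieldType) (X : sset).

Definition nchains : lmodType k :=
  quo [set u : freemod k (simplex X) | exists s, degenerate s /\ u = basis k s].
Definition chain (s : simplex X) : nchains := qclass (basis k s).
Definition chain_ext (V : lmodType k) (g : simplex X -> V) (c : nchains) : V :=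
  lext g (qrep c).

Definition boundary (s : simplex X) : nchains :=
  if sdim s is 0 then 0
  else \sum_(0 <= i < (sdim s).+1) (-1) ^+ i *: chain (sface i s).
Definition alexander_whitney (s : simplex X) : tensor nchains nchains :=
  \sum_(0 <= i < (sdim s).+1)
    tens (chain (svert s (ival 0 i))) (chain (svert s (ival i (sdim s)))).

Definition chains : dgc k int := {|
  carrier := nchains;
  deg := id;
  pc i := [set c | c \in lspan [set c' | exists s, (sdim s)%:Z = i /\ c' = chain s]];
  dif := chain_ext boundary;
  cop := chain_ext alexander_whitney;
  eps := chain_ext (fun s => (sdim s == 0%N)%:R : k^o) |}.

End Chains.

Record gset (G : groupType) := GSet {
  gcar :> Type;
  gop : G -> gcar -> gcar;
  gop1 : forall y, gop 1%g y = y;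
  gopM : forall g h y, gop (g * h)%g y = gop g (gop h y) }.

Definition gset_self (G : groupType) : gset G :=
  @GSet G G (fun g h => (g * h)%g) (@mul1g G) (fun g h y => esym (mulgA g h y)).

Section GroupRing.
Variables (k : fieldType) (G : groupType).

(* C(G) = C_0(G) = k[G] is freemod k G, and C(F) = C_0(F) is freemod k F. *)
Definition kact (F : gset G) (u : freemod k G) (m : freemod k F) : freemod k F :=
  lext (fun g => lext (fun y => basis k (gop g y)) m) u.
Definition gmul : freemod k G -> freemod k G -> freemod k G := @kact (gset_self G).

Definition aug (T : Type) (u : freemod k T) : k := lext (fun=> 1 : k^o) u.
Definition aug_ideal : set (freemod k G) := [set u | aug u = 0].

Fixpoint aug_pow (p : nat) : set (freemod k G) :=
  if p is p'.+1 then
    [set u | u \in lspan [set w | exists a b,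
       [/\ aug_ideal a, aug_pow p' b & w = gmul a b]]]
  else setT.

Definition aug_nilpotent : Prop := exists N, aug_pow N = [set 0].

(* C(F) for the discrete G-set F *)
Definition Cset (F : gset G) : dgc k int := {|
  carrier := freemod k F;
  deg := id;
  pc i := if i == 0 then setT else [set 0];
  dif := fun=> 0;
  cop := lext (fun y => tens (basis k y) (basis k y));
  eps := @aug F |}.

(* \mathcal F_q(F), which is a^p C(F) for q = -p <= 0 and C(F) for q >= 0 *)
Definition filF (F : gset G) (q : int) : set (Cset F) :=
  [set m | m \in lspan [set w | exists u m',
     aug_pow (if q <= 0 then `|q|%N else 0%N) u /\ w = kact u m']].

Definition grF (F : gset G) : dgc k (int * int)%type := gr (@filF F).

Definition gr_kact (F : gset G) (a : grF (gset_self G)) (m : grF F) : grF F :=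
  scls (@filF F) (below (@filF F)) (smul (@kact F) (rep a) (rep m)).

End GroupRing.

Record twisting_function (G : groupType) (X : sset)
    (tau : forall n, X n.+1 -> G) : Prop := TwistingFunction {
  tau_face0 : forall n (x : X n.+2),
    tau n.+1 x = ((tau n (face 0 x))^-1 * tau n (face 1 x))%g;
  tau_face : forall n (x : X n.+2) i, (0 < i)%N -> (i < n.+2)%N ->
    tau n.+1 x = tau n (face i.+1 x);
  tau_degen : forall n (x : X n.+1) i, (i < n.+1)%N ->
    tau n x = tau n.+1 (degen i.+1 x);
  tau_degen0 : forall n (x : X n), tau n (degen 0 x) = 1%g }.

Section Twisted.
Variables (k : fieldType) (G : groupType) (X : sset) (F : gset G).
Variable tau : forall n, X n.+1 -> G.

Definition tface n (i : nat) (z : X n.+1 * F) : X n * F :=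
  (face i z.1, if i == 0%N then gop (tau z.1) z.2 else z.2).
Definition tdegen n (i : nat) (z : X n * F) : X n.+1 * F := (degen i z.1, z.2).

Section Identities.
Hypothesis ht : twisting_function tau.

Fact tface_face n (z : X n.+2 * F) i j : (i < j)%N -> (j <= n.+2)%N ->
  tface i (tface j z) = tface j.-1 (tface i z).
Proof.
case: z => x y lij jn; rewrite /tface /= face_face //.
case: j lij jn => // j; case: i => [|i] /= lij jn; last first.
  by case: j lij {jn} => // j.
case: j {lij} jn => [|j] jn /=; congr pair.
  by rewrite -gopM (tau_face0 ht) mulgA mulgV mul1g.
by rewrite (tau_face ht x (i := j.+1)).
Qed.

Fact tdegen_degen n (z : X n * F) i j : (i <= j)%N -> (j <= n)%N ->
  tdegen i (tdegen j z) = tdegen j.+1 (tdegen i z).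
Proof. by move=> lij jn; rewrite /tdegen /= degen_degen. Qed.

Fact tface_degen_lt n (z : X n.+1 * F) i j : (i < j)%N -> (j <= n.+1)%N ->
  tface i (tdegen j z) = tdegen j.-1 (tface i z).
Proof.
case: j => // j lij jn; rewrite /tface /tdegen /= face_degen_lt //.
by case: i lij => //= _; rewrite -(tau_degen ht).
Qed.

Fact tface_degen_eq n (z : X n * F) j : (j <= n)%N -> tface j (tdegen j z) = z.
Proof.
case: z => x y jn; rewrite /tface /tdegen /= face_degen_eq //.
by case: j jn => //= _; rewrite (tau_degen0 ht) gop1.
Qed.

Fact tface_degen_succ n (z : X n * F) j : (j <= n)%N ->
  tface j.+1 (tdegen j z) = z.
Proof. by case: z => x y jn; rewrite /tface /tdegen /= face_degen_succ. Qed.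

Fact tface_degen_gt n (z : X n.+1 * F) i j : (j.+1 < i)%N -> (i <= n.+2)%N ->
  tface i (tdegen j z) = tdegen j (tface i.-1 z).
Proof.
move=> ji lin; rewrite /tface /tdegen /= face_degen_gt //.
by case: i ji lin => [|[|i]].
Qed.

(* X x_tau F *)
Definition twisted_product : sset :=
  SSet tface_face tdegen_degen tface_degen_lt tface_degen_eq tface_degen_succ
       tface_degen_gt.

End Identities.

(* Szczarba's twisting cochain *)
Definition szczarba0 (s : simplex X) : freemod k G :=
  match s with
  | existT n x => match n return X n -> freemod k G with
                  | 1 => fun x => basis k (tau x)^-1%g - basis k 1%g
                  | _ => fun=> 0
                  end x
  end.
Definition szczarba : chains k X -> freemod k G := chain_ext szczarba0.

Section FrakF.
Variables (n : nat) (s : simplex X) (kk : nat) (p : seq nat).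
Let P i := nth 0%N p i.
Let len r := (P (2 * r) - P (2 * r).-1)%N.

Definition frak_part (r : nat) : simplex X := svert s (ival (P (2 * r).-1) (P (2 * r))).
Definition frak_last : simplex X :=
  svert s (flatten [seq ival (P (2 * i)) (P (2 * i).+1) | i <- iota 0 kk.+1]).

Definition frakF_eps : nat :=
  ((kk * kk.-1)./2 + \sum_(1 <= r < kk.+1) (kk.+1 - r) * len r
   + \sum_(1 <= r < kk.+1) P (2 * r).-1
   + \sum_(1 <= r < kk.+1)
       len r * \sum_(0 <= i < r) (P (2 * i).+1 - P (2 * i) + 1))%N.

(* The sign exponent is eps + n - |frak_last|; the difference may be negative,
   hence the sum, which has the same parity. *)
Definition frakF_term : tensor (freemod k G) (chains k X) :=
  (-1) ^+ (frakF_eps + n + sdim frak_last) *: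
  tens (foldr (@gmul k G) (basis k 1%g)
              [seq szczarba (chain k (frak_part r)) | r <- iota 1 kk])
       (chain k frak_last).
End FrakF.

Definition frakF0 (s : simplex X) : tensor (freemod k G) (chains k X) :=
  let n := sdim s in
  tens (basis k 1%g) (chain k s) +
  \sum_(1 <= kk < n.+1)
    \sum_(p : (2 * kk).+2.-tuple 'I_n.+1 |
          let v := map val p in
          [&& sorted leq v, nth 0 v 0 == 0 & nth 0 v (2 * kk).+1 == n]%N)
      frakF_term n s kk (map val p).
Definition frakF : chains k X -> tensor (freemod k G) (chains k X) :=
  chain_ext frakF0.

(* C(X) (x)_t C(F).  C(F) sits in degree 0, so no Koszul signs arise from it. *)
Definition twisted_tensor : dgc k int := {|
  carrier := tensor (chains k X) (Cset k F);
  deg := id;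
  pc := pc2 (@pc _ _ (chains k X)) (@pc _ _ (Cset k F));
  dif := tlift (fun (c : chains k X) (m : Cset k F) =>
    tens (dif c) m
    - tlift (fun c1 c2 : chains k X => tens (sgn c1) (kact (szczarba c2) m))
            (cop c));
  cop := tlift (fun (c : chains k X) (m : Cset k F) =>
    tlift (fun c1 c2 : chains k X => tlift (fun m1 m2 : Cset k F =>
      tlift (fun (a : freemod k G) (c' : chains k X) =>
        tens (tens c1 (kact a m1)) (tens c' m2)) (frakF c2)) (cop m)) (cop c));
  eps := tlift (fun (c : chains k X) (m : Cset k F) => eps c * eps m : k^o) |}.

(* \mathcal F_q(X,F) = C(X) (x)_t \mathcal F_q(F) *)
Definition twisted_fil (q : int) : set twisted_tensor :=
  [set w | w \in lspan [set w' | exists (c : chains k X) m,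
                         filF q m /\ w' = tens c m]].

(* szczarba vanishes outside degree 1, and the class does not depend on the
   cycle chosen by [rep]. *)
Definition tstar (h : hdgc (chains k X)) : grF k (gset_self G) :=
  gr_cls (C := Cset k (gset_self G)) (@filF k G (gset_self G)) (-1)
         (szczarba (rep (hcomp h 1))).

(* H(X) (x)_{t_*} gr(F) with the componentwise coproduct *)
Definition first_page : dgc k (int * int)%type :=
  let H := hdgc (chains k X) in {|
  carrier := tensor H (grF k F);
  deg pq := pq.1 + pq.2;
  pc pq := [set t | t \in lspan [set t' | exists (h : H) (m : grF k F),
     [/\ pc (pq.1 + pq.2) h, gr_part (Fil := @filF k G F) pq.2 m & t' = tens h m]]];
  dif := tlift (fun (h : H) (m : grF k F) =>
    - tlift (fun h1 h2 : H => tens (sgn h1) (gr_kact (tstar h2) m)) (cop h));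
  cop := tlift (fun (h : H) (m : grF k F) => tswap (cop h) (cop m));
  eps := tlift (fun (h : H) (m : grF k F) => eps h * eps m : k^o) |}.

End Twisted.

(* Main.v *)
Require Import Defs.
From mathcomp Require Import all_boot all_order all_algebra finmap ssrAC zify.
From mathcomp Require Import boolp classical_sets functions cardinality fsbigop.

(* Over a field every linear map d has a linear s with d s d = d.  For a complex,
   p = 1 - d s - s d then satisfies 1 - p (x) p = [d, K] for an explicit K, which
   gives the Kuenneth isomorphism without any boundedness assumption.  A leading
   term argument gives its analogue for associated graded objects, i.e. for E^0,
   and the isomorphism E^{r+1} = H(E^r) propagates it to all pages, so that every
   page is a dgc.

   For x in X_n let T(x) in G be the product of the values of tau on the edges
   (i, i+1) of x, later edges to the left.  As G is discrete, only intervals of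
   length 1 contribute to F(x), and F(x) = T(x)^-1 (x) x is the expansion of the
   product of the 1 + t(i, i+1).  Therefore x (x) y |-> (x, T(x)^-1 y) is an
   isomorphism from C(X) (x)_t C(F) onto C(X x_tau F), and the former is a dgc.

   Modulo lower filtration d_t is d (x) 1, hence E^1 = H(X) (x) gr(F): the inverse
   is induced by p (x) 1.  The next term of d_t is the twisting term, and F(x) is
   1 (x) x modulo the augmentation ideal, which gives d^1 and the coproduct.

   If the augmentation ideal is nilpotent, the filtration is finite and the pages
   are eventually constant.  Surjectivity of the Kuenneth map of a late page shows,
   by induction on q, that a cycle of filtration q in the tensor square is up to a
   boundary a sum of products of cycles of filtrations adding up to q.  Hence the
   coproduct of homology respects the induced filtration. *)

Set Implicit Arguments.
Unset Strict Implicit.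
Unset Printing Implicit Defensive.

Import Order.TTheory GRing.Theory Num.Theory.
Local Open Scope classical_set_scope.
Local Open Scope ring_scope.

(** * Linear algebra *)

(** Coproducts on homology, on associated graded objects and on pages are defined by choosing a
    preimage under a Kuenneth map, so not even their linearity is visible before that map is known
    to be bijective. Identities are therefore checked after applying an injective Kuenneth map, and
    bijectivity and dgc laws advance together from page to page.

    The second obstacle is that cycles of a tensor square are not literally sums of products of
    cycles. Two devices deal with it. A class map, meaningful only on cycles or on one filtration
    step, is extended linearly to the whole space, so that it can be tensored with itself. And two
    linear maps agree on all cycles of C (x) C once they agree on products of cycles and on
    boundaries of pure tensors.

    The exact value of F is what makes the twisted tensor product a dgc; on the first page F enters
    only through its leading term. *)

Section LinearMaps.
Variables (k : fieldType) (V W U : lmodType k).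

Lemma lin0 (f : V -> W) : linear f -> f 0 = 0.
Proof. by move=> hf; have := hf (-1) 0 0; rewrite !scaleN1r oppr0 addr0 addNr. Qed.

Lemma linD (f : V -> W) : linear f -> {morph f : x y / x + y}.
Proof. by move=> hf x y; have := hf 1 x y; rewrite !scale1r. Qed.

Lemma linZ (f : V -> W) a : linear f -> {morph f : x / a *: x}.
Proof. by move=> hf x; have := hf a x 0; rewrite !addr0 (lin0 hf) addr0. Qed.

Lemma linN (f : V -> W) : linear f -> {morph f : x / - x}.
Proof. by move=> hf x; rewrite -scaleN1r (linZ _ hf) scaleN1r. Qed.

Lemma linB (f : V -> W) : linear f -> {morph f : x y / x - y}.
Proof. by move=> hf x y; rewrite (linD hf) (linN hf). Qed.

Lemma lin_sum (f : V -> W) (I : Type) (r : seq I) (P : pred I) (F : I -> V) :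
  linear f -> f (\sum_(i <- r | P i) F i) = \sum_(i <- r | P i) f (F i).
Proof. by move=> hf; apply: (big_morph f (linD hf) (lin0 hf)). Qed.

Lemma linP (f : V -> W) :
  (forall x y, f (x + y) = f x + f y) -> (forall a x, f (a *: x) = a *: f x) -> linear f.
Proof. by move=> fD fZ a x y; rewrite fD fZ. Qed.

Lemma lin_id : linear (fun x : V => x). Proof. by []. Qed.
Lemma lin_zero : linear (fun x : V => 0 : W).
Proof. by move=> a x y; rewrite scaler0 addr0. Qed.
Lemma lin_comp (f : W -> U) (g : V -> W) : linear f -> linear g -> linear (fun x => f (g x)).
Proof. by move=> hf hg a x y; rewrite hg hf. Qed.
Lemma lin_add (f g : V -> W) : linear f -> linear g -> linear (fun x => f x + g x).
Proof. by move=> hf hg a x y; rewrite hf hg scalerDr addrACA. Qed.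
Lemma lin_opp (f : V -> W) : linear f -> linear (fun x => - f x).
Proof. by move=> hf a x y; rewrite hf scalerN opprD. Qed.
Lemma lin_scale (b : k) (f : V -> W) : linear f -> linear (fun x => b *: f x).
Proof. by move=> hf a x y; rewrite hf scalerDr !scalerA mulrC. Qed.
Lemma lin_scalel (f : V -> k^o) (w : W) : linear f -> linear (fun x => (f x : k) *: w).
Proof. by move=> hf a x y; rewrite hf scalerDl scalerA. Qed.
Lemma lin_bigsum (I : Type) (r : seq I) (P : pred I) (f : I -> V -> W) :
  (forall i, linear (f i)) -> linear (fun x => \sum_(i <- r | P i) f i x).
Proof.
move=> hf a x y; rewrite scaler_sumr -big_split /=.
by apply: eq_bigr => i _; rewrite hf.
Qed.
Lemma lin_eq (f g : V -> W) : f =1 g -> linear f -> linear g.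
Proof. by move=> /funext <-. Qed.

Lemma can_linear (f : V -> W) (g : W -> V) :
  linear f -> cancel g f -> cancel f g -> linear g.
Proof. by move=> hf gK fK a x y; apply: (can_inj fK); rewrite hf !gK. Qed.

Lemma lin_inj (f : V -> W) : linear f -> (forall x, f x = 0 -> x = 0) -> injective f.
Proof. by move=> hf h x y e; apply/eqP; rewrite -subr_eq0; apply/eqP/h;
  rewrite (linB hf) e subrr. Qed.
End LinearMaps.

Lemma bijective_of (A B : Type) (f : A -> B) :
  injective f -> (forall b, exists a, f a = b) -> bijective f.
Proof.
move=> fi fs; have /choice[g gK] := fs.
by exists g => // x; apply: fi; rewrite gK.
Qed.

Section Subspaces.
Variables (k : fieldType) (V : lmodType k).
Implicit Types (S W : set V).

Lemma subsp0 W : is_subspace W -> W 0. Proof. by case. Qed.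
Lemma subspD W x y : is_subspace W -> W x -> W y -> W (x + y).
Proof. by move=> [_ h] Wx Wy; rewrite -[x]scale1r; apply: h. Qed.
Lemma subspZ W a x : is_subspace W -> W x -> W (a *: x).
Proof. by move=> [h0 h] Wx; rewrite -[_ *: _]addr0; apply: h. Qed.
Lemma subspN W x : is_subspace W -> W x -> W (- x).
Proof. by move=> hW Wx; rewrite -scaleN1r; apply: subspZ. Qed.
Lemma subspB W x y : is_subspace W -> W x -> W y -> W (x - y).
Proof. by move=> hW Wx Wy; apply: subspD => //; apply: subspN. Qed.
Lemma subsp_sum W (I : Type) (r : seq I) (P : pred I) (F : I -> V) :
  is_subspace W -> (forall i, P i -> W (F i)) -> W (\sum_(i <- r | P i) F i).
Proof.
move=> hW h; apply: big_ind => //; first exact: subsp0.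
by move=> x y; apply: subspD.
Qed.

Lemma lspan_sub S W : is_subspace W -> S `<=` W -> forall x, x \in lspan S -> W x.
Proof. by move=> hW SW x; rewrite unfold_in => /asboolP; apply. Qed.

Lemma lspan_mem S x : S x -> x \in lspan S.
Proof. by move=> Sx; rewrite unfold_in; apply/asboolP => W _; apply. Qed.

Lemma lspan_subspace S : is_subspace [set x | x \in lspan S].
Proof.
split=> [|a u v uS vS] /=; first exact: rpred0.
by rewrite rpredD // rpredZ.
Qed.

Lemma lspan_ind S (P : V -> Prop) :
  P 0 -> (forall x y, P x -> P y -> P (x + y)) ->
  (forall a x, S x -> P (a *: x)) -> forall x, x \in lspan S -> P x.
Proof.
move=> P0 PD PZ x.
suff h : x \in lspan S -> forall a, P (a *: x) by move/h/(_ 1); rewrite scale1r.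
apply: (@lspan_sub _ (fun x => forall a, P (a *: x))) => [|y Sy a]; last exact: PZ.
split=> [a|a u v hu hv b]; rewrite ?scaler0 // scalerDr scalerA.
exact: PD.
Qed.

End Subspaces.

Section SubspaceConstructions.
Variables (k : fieldType) (V : lmodType k).
Implicit Types (S W : set V).

Lemma subspace_all : is_subspace (setT : set V). Proof. by []. Qed.
Lemma subspace_preim (W : lmodType k) (f : V -> W) (Q : set W) :
  linear f -> is_subspace Q -> is_subspace [set x | Q (f x)].
Proof.
move=> hf hQ; split=> [|a u v] /=; first by rewrite (lin0 hf); apply: subsp0.
by rewrite hf => Qu Qv; apply: hQ.2.
Qed.
Lemma subspaceI S W : is_subspace S -> is_subspace W -> is_subspace (S `&` W).
Proof.
move=> hS hW; split=> [|a u v [Su Wu] [Sv Wv]]; first by split; apply: subsp0.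
by split; [apply: hS.2|apply: hW.2].
Qed.
Lemma subspace0 : is_subspace [set 0 : V].
Proof. by split=> // a u v /= -> ->; rewrite scaler0 addr0. Qed.
Lemma subspace_eq0 (W : lmodType k) (f g : V -> W) :
  linear f -> linear g -> is_subspace [set x | f x = g x].
Proof.
move=> hf hg; split=> [|a u v /= eu ev] /=; first by rewrite (lin0 hf) (lin0 hg).
by rewrite hf hg eu ev.
Qed.
Lemma subspace_range (W : lmodType k) (f : W -> V) : linear f -> is_subspace (range f).
Proof.
move=> hf; split; first by exists 0 => //; apply: lin0.
by move=> a _ _ [x _ <-] [y _ <-]; exists (a *: x + y); rewrite ?hf.
Qed.
End SubspaceConstructions.

(** * Complements and generalized inverses over a field *)

Section GenInverse.
Variable k : fieldType.

(** Zorn's lemma for the subspaces that meet K only in 0: if some x were outside A + K, the span of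
    A and x would be a larger one. *)
Lemma complement (V : lmodType k) (K : set V) : is_subspace K ->
  exists U : set V, [/\ is_subspace U, forall x, U x -> K x -> x = 0 &
    forall x, exists u v, [/\ U u, K v & x = u + v]].
Proof.
move=> hK.
pose P (A : set V) := A = set0 \/ is_subspace A /\ forall x, A x -> K x -> x = 0.
have [F FP Ftot|A [PA Amax]] := @Zorn_bigcup V P.
  have [[A [FA A0]]|noA] := pselect (exists A, F A /\ A !=set0); last first.
    left; rewrite -subset0 => x [A FA Ax]; apply: noA; exists A; split=> //.
    by exists x.
  right; have [AE|[hA AK]] := FP _ FA; first by case: A0 => x; rewrite AE.
  split.
    split; first by exists A => //; apply: subsp0.
    move=> a u v [B FB Bu] [B' FB' Bv].
    have [BB|BB] := Ftot _ _ FB FB'.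
      exists B' => //; have [E|[h _]] := FP _ FB'; first by rewrite E in Bv.
      by apply: h.2 => //; apply: BB.
    exists B => //; have [E|[h _]] := FP _ FB; first by rewrite E in Bu.
    by apply: h.2 => //; apply: BB.
  move=> x [B FB Bx] Kx; have [E|[_ h]] := FP _ FB; first by rewrite E in Bx.
  exact: h.
have [A0|[hA AK]] := PA.
  exfalso; apply: (Amax [set 0]).
    by rewrite A0; split=> // /(_ 0 erefl).
  by right; split; [exact: subspace0|].
exists A; split=> // x.
have [//|nx] := pselect (exists u v, [/\ A u, K v & x = u + v]).
pose B := [set z | exists a u, A u /\ z = a *: x + u].
exfalso; apply: (Amax B).
  split; first by move=> u Au; exists 0, u; rewrite scale0r add0r.
  move/(_ x) => h; apply: nx; exists x, 0; split; rewrite ?addr0 //; last exact: subsp0.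
  by apply: h; exists 1, 0; rewrite scale1r addr0; split=> //; apply: subsp0.
right; split.
  split; first by exists 0, 0; rewrite scale0r addr0; split=> //; apply: subsp0.
  move=> a _ _ [b [u [Au ->]]] [c [v [Av ->]]].
  exists (a * b + c), (a *: u + v); split; first exact: hA.2.
  by rewrite scalerDr scalerA scalerDl addrACA.
move=> _ [a [u [Au ->]]] Kz.
(* An element [a *: x + u] of K with nonzero a would write x as an element of A plus an element of
   K. *)
have [a0|a0] := eqVneq a 0.
  by move: Kz; rewrite a0 scale0r add0r => /AK->.
exfalso; apply: nx; exists (- (a^-1 *: u)), (a^-1 *: (a *: x + u)); split.
- by apply: subspN => //; apply: subspZ.
- exact: subspZ.
- by rewrite scalerDr scalerA mulVf // scale1r addrCA addNr addr0.
Qed.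

(** With U a complement of the kernel and R one of the range, s w is the unique u in U such that d u
    is the component of w along the range, that is, such that w - d u lies in R. *)
Lemma generalized_inverse (V W : lmodType k) (d : V -> W) : linear d ->
  exists s : W -> V, linear s /\ forall x, d (s (d x)) = d x.
Proof.
move=> hd.
have hker : is_subspace [set x | d x = 0].
  by apply: subspace_preim (@subspace0 _ _).
have [U [hU UK Udec]] := complement hker.
have [R [hR RB Rdec]] := complement (subspace_range hd).
have ex w : exists u, U u /\ R (w - d u).
  have [r [_ [Rr [x _ <-] ->]]] := Rdec w.
  have [u [v [Uu Kv ->]]] := Udec x.
  by exists u; rewrite (linD hd) Kv addr0 addrK.
have un w u v : U u -> R (w - d u) -> U v -> R (w - d v) -> u = v.
  move=> Uu Ru Uv Rv; apply/eqP; rewrite -subr_eq0; apply/eqP/UK; first exact: subspB.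
  apply: RB; last by exists (u - v).
  rewrite (linB hd) -[d u](subrK w) -addrA addrC -opprB.
  by apply: subspB.
have [s hs] := choice ex.
exists s; split.
  move=> a x y; have [? ?] := hs x; have [? ?] := hs y; have [? ?] := hs (a *: x + y).
  apply: (un (a *: x + y)) => //; first exact: hU.2.
  by rewrite hd opprD addrACA -scalerBr; apply: hR.2.
move=> x; have [Us] := hs (d x); rewrite -(linB hd) => /RB h.
by apply/esym/eqP; rewrite -subr_eq0 -(linB hd); apply/eqP/h; exists (x - s (d x)).
Qed.

End GenInverse.

(** * Finitely supported functions and free modules *)

Section FinSuppTheory.
Variables (k : fieldType) (I : Type) (V : lmodType k).
Implicit Types f g : fs I V.

Lemma fs0E i : (0 : fs I V) i = 0. Proof. by []. Qed.
Lemma fsDE f g i : (f + g : fs I V) i = f i + g i. Proof. by []. Qed.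
Lemma fsZE a f i : (a *: f : fs I V) i = a *: f i. Proof. by []. Qed.
Lemma fs_eval_lin i : linear (fun f : fs I V => f i : V). Proof. by []. Qed.

Lemma fsP f g : (forall i, f i = g i) -> f = g.
Proof. by move=> fg; apply: val_inj; apply: funext. Qed.

Lemma singleE (i : I) (v : V) j : single i v j = if `[< j = i >] then v else 0.
Proof. by []. Qed.

Lemma single_id (i : I) (v : V) : single i v i = v.
Proof. by rewrite singleE asboolT. Qed.

Lemma single_lin (i : I) : linear (single i : V -> fs I V).
Proof.
move=> a x y; apply: fsP => j; rewrite fsDE fsZE !singleE.
by case: ifP; rewrite // scaler0 addr0.
Qed.

Lemma fs_support f : exists s : seq {classic I}, uniq s /\ forall i, i \notin s -> f i = 0.
Proof.
have := valP f; rewrite unfold_in => /asboolP ff.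
exists (fset_set ([set i | f i != 0] : set {classic I})); split; first exact: fset_uniq.
move=> i; rewrite in_fset_set // => /negP h; apply/eqP; apply: contra_notT h => fi.
by rewrite inE.
Qed.

Lemma fs_sumE f (s : seq {classic I}) : uniq s -> (forall i, i \notin s -> f i = 0) ->
  f = \sum_(i <- s) single (i : I) (f i).
Proof.
move=> us fs0; apply: fsP => j; rewrite (lin_sum _ _ _ (fs_eval_lin j)).
have [js|js] := boolP ((j : {classic I}) \in s); last first.
  rewrite fs0 // big_seq big1 // => i si; rewrite singleE asboolF // => ji.
  by rewrite ji si in js.
rewrite (bigD1_seq (j : {classic I})) //= single_id big1 ?addr0 // => i ij.
by rewrite singleE asboolF // => ji; rewrite ji eqxx in ij.
Qed.

Lemma fs_ind (P : fs I V -> Prop) :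
  P 0 -> (forall f g, P f -> P g -> P (f + g)) -> (forall i v, P (single i v)) ->
  forall f, P f.
Proof.
move=> P0 PD Ps f; have [s [us fs0]] := fs_support f.
by rewrite (fs_sumE us fs0); apply: big_ind.
Qed.
End FinSuppTheory.

Section FsSum.
Variables (k : fieldType) (J : choiceType) (V W : lmodType k) (phi : J -> V -> W).
Hypothesis phi_lin : forall j, linear (phi j).

(** Variant of [fs_support] for an index type with its own choice structure: sums such as those in
    [smap] range over [int] itself and not over [{classic int}]. *)
Lemma fs_supportJ (f : fs J V) : exists s : seq J, uniq s /\ forall i, i \notin s -> f i = 0.
Proof.
have := valP f; rewrite unfold_in => /asboolP ff.
exists (fset_set [set i | f i != 0]); split; first exact: fset_uniq.
move=> i; rewrite in_fset_set // => /negP h; apply/eqP; apply: contra_notT h => fi.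
by rewrite inE.
Qed.

Lemma fsum_seq (f : fs J V) (s : seq J) : uniq s -> (forall i, i \notin s -> f i = 0) ->
  \sum_(i \in [set: J]) phi i (f i) = \sum_(i <- s) phi i (f i).
Proof.
move=> us fs0; rewrite (@fsbigE _ _ _ _ _ s) //.
  by apply: eq_bigl => i; rewrite in_setT.
by move=> i _ si; rewrite fs0 // (lin0 (phi_lin i)).
Qed.

Lemma fsum_lin : linear (fun f : fs J V => \sum_(i \in [set: J]) phi i (fs_fun f i)).
Proof.
move=> a f g; have [s [us hs]] := fs_supportJ f; have [t [ut ht]] := fs_supportJ g.
have h i : i \notin undup (s ++ t) -> fs_fun f i = 0 /\ fs_fun g i = 0.
  by rewrite mem_undup mem_cat negb_or => /andP[/hs ? /ht ?].
have uu := undup_uniq (s ++ t).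
rewrite !(fsum_seq uu); last 3 first.
- by move=> i /h[].
- by move=> i /h[].
- by move=> i /h[fi gi]; rewrite fsDE fsZE fi gi scaler0 addr0.
by rewrite scaler_sumr -big_split; apply: eq_bigr => i _; rewrite fsDE fsZE phi_lin.
Qed.

Lemma fsum_single j v : \sum_(i \in [set: J]) phi i (single j v i) = phi j v.
Proof.
rewrite (@fsum_seq _ [:: j]) ?big_seq1 ?single_id // => i; rewrite inE => ij.
by rewrite singleE asboolF // => e; rewrite e eqxx in ij.
Qed.
End FsSum.

Section LinExt.
Variables (k : fieldType) (T : Type) (V : lmodType k).

Lemma lext_phi_lin (g : T -> V) : forall t : T, linear (fun a : k^o => (a : k) *: g t).
Proof. by move=> t a x y; rewrite scalerDl scalerA. Qed.

Lemma lext_lin (g : T -> V) : linear (lext g : freemod k T -> V).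
Proof. exact: (@fsum_lin _ {classic T} _ _ _ (lext_phi_lin g)). Qed.

Lemma lext_basis (g : T -> V) t : lext g (basis k t) = g t.
Proof. by rewrite /lext (@fsum_single _ {classic T} _ _ _ (lext_phi_lin g)) scale1r. Qed.

Lemma freemod_ind (P : freemod k T -> Prop) :
  P 0 -> (forall f g, P f -> P g -> P (f + g)) -> (forall a t, P (a *: basis k t)) ->
  forall f, P f.
Proof.
move=> P0 PD Pb; apply: fs_ind => // t a; rewrite (_ : single t a = a *: basis k t) //.
apply: fsP => i; rewrite fsZE !singleE; case: ifP => _; last by rewrite scaler0.
by rewrite /GRing.scale /= mulr1.
Qed.

Lemma lin_basis_ext (f g : freemod k T -> V) : linear f -> linear g ->
  (forall t, f (basis k t) = g (basis k t)) -> f =1 g.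
Proof.
move=> hf hg fg; apply: freemod_ind => [|x y fx fy|a t].
- by rewrite (lin0 hf) (lin0 hg).
- by rewrite (linD hf) (linD hg) fx fy.
- by rewrite (linZ _ hf) (linZ _ hg) fg.
Qed.

Lemma lext_linF (W : lmodType k) (g : W -> T -> V) (u : freemod k T) :
  (forall t, linear (fun w => g w t)) -> linear (fun w => lext (g w) u).
Proof.
move=> hg a x y; move: u; apply: lin_basis_ext; first exact: lext_lin.
  by apply: lin_add; [apply: lin_scale|]; apply: lext_lin.
by move=> t; rewrite !lext_basis hg.
Qed.
End LinExt.

Section QuotientMaps.
Variables (k : fieldType) (V W : lmodType k) (S : set V).

Lemma qclass_lin : linear (qclass : V -> quo S).
Proof.
by apply: linP => [x y|a x]; [exact: qclassD|rewrite -quo_scaleE].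
Qed.

Lemma qclass0 (v : V) : (qclass v : quo S) = 0 <-> v \in lspan S.
Proof.
by rewrite -(lin0 qclass_lin) -[v in v \in _]subr0 -qclass_eq; split=> [->|/eqP].
Qed.

Variable f : V -> W.
Hypotheses (f_lin : linear f) (fS : forall v, S v -> f v = 0).

Lemma quo_lift_ker v : v \in lspan S -> f v = 0.
Proof. by apply: lspan_sub fS _; apply: subspace_preim f_lin (@subspace0 _ _). Qed.

Lemma quo_liftE v : f (qrep (qclass v : quo S)) = f v.
Proof.
apply/eqP; rewrite -subr_eq0 -(linB f_lin); apply/eqP/quo_lift_ker.
by rewrite -qclass_eq qrepK.
Qed.

Lemma quo_lift_lin : linear (fun x : quo S => f (qrep x)).
Proof.
move=> a x y; rewrite -[x]qrepK -[y]qrepK.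
by rewrite -(linZ _ qclass_lin) -(linD qclass_lin) !quo_liftE f_lin.
Qed.
End QuotientMaps.

(** * Tensor products and subquotients *)

Section TensorTheory.
Variables (k : fieldType).

Definition bilin (V W U : lmodType k) (f : V -> W -> U) : Prop :=
  (forall w, linear (fun v => f v w)) /\ (forall v, linear (fun w => f v w)).

Variables (V W U : lmodType k).

Lemma tens_linl (w : W) : linear (fun v : V => tens v w).
Proof.
move=> a x y; rewrite -(linZ _ (@qclass_lin _ _ _)) -(linD (@qclass_lin _ _ _)).
by apply/eqP; rewrite qclass_eq; apply: lspan_mem; left; exists a, x, y, w.
Qed.
Lemma tens_linr (v : V) : linear (fun w : W => tens v w).
Proof.
move=> a x y; rewrite -(linZ _ (@qclass_lin _ _ _)) -(linD (@qclass_lin _ _ _)).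
by apply/eqP; rewrite qclass_eq; apply: lspan_mem; right; exists a, v, x, y.
Qed.
Lemma tens_bilin : bilin (@tens k V W).
Proof. by split; [exact: tens_linl|exact: tens_linr]. Qed.
Lemma tens0l (w : W) : tens (0 : V) w = 0. Proof. exact: lin0 (tens_linl w). Qed.
Lemma tens0r (v : V) : tens v (0 : W) = 0. Proof. exact: lin0 (tens_linr v). Qed.

(** Scalars are absorbed into the left factor, so closure under sums and the pure tensors
    suffice. *)
Lemma tens_ind (P : tensor V W -> Prop) :
  P 0 -> (forall s t, P s -> P t -> P (s + t)) -> (forall v w, P (tens v w)) ->
  forall t, P t.
Proof.
move=> P0 PD Pt t; rewrite -[t]qrepK; elim/freemod_ind: (qrep t).
- by rewrite (lin0 (@qclass_lin _ _ _)).
- by move=> f g Pf Pg; rewrite (linD (@qclass_lin _ _ _)); apply: PD.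
- move=> a [v w]; rewrite (linZ _ (@qclass_lin _ _ _)) -/(tens v w).
  by rewrite -(linZ _ (tens_linl w)).
Qed.

Lemma tens_ext (f g : tensor V W -> U) : linear f -> linear g ->
  (forall v w, f (tens v w) = g (tens v w)) -> f =1 g.
Proof.
move=> hf hg fg; apply: tens_ind => // [|x y fx fy].
- by rewrite (lin0 hf) (lin0 hg).
- by rewrite (linD hf) (linD hg) fx fy.
Qed.

Section Lift.
Variable f : V -> W -> U.
Hypothesis hf : bilin f.

Let f_rel (z : freemod k (V * W)) : @bilin_rel k V W z ->
  lext (fun vw : V * W => f vw.1 vw.2) z = 0.
Proof.
have hl := @lext_lin k _ _ (fun vw : V * W => f vw.1 vw.2).
by case=> [[a [v [v' [w ->]]]]|[a [v [w [w' ->]]]]];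
  rewrite (linB hl) (linD hl) (linZ _ hl) !lext_basis /= ?hf.1 ?hf.2 subrr.
Qed.

Lemma tliftE v w : tlift f (tens v w) = f v w.
Proof. by rewrite /tlift (quo_liftE (lext_lin _) f_rel) lext_basis. Qed.

Lemma tlift_lin : linear (tlift f).
Proof. exact: quo_lift_lin (lext_lin _) f_rel. Qed.
End Lift.

Lemma tlift_linF (A : lmodType k) (F : A -> V -> W -> U) (t : tensor V W) :
  (forall v w, linear (fun a => F a v w)) -> linear (fun a => tlift (F a) t).
Proof. by move=> hF; apply: lext_linF => -[v w]; apply: hF. Qed.

Lemma tlift_eq (f g : V -> W -> U) (t : tensor V W) :
  (forall v w, f v w = g v w) -> tlift f t = tlift g t.
Proof. by move=> fg; congr (tlift _ t); apply: funext => v; apply: funext. Qed.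

End TensorTheory.

(** Proves linearity and bilinearity by recursion on the syntactic form of the map. The last two
    cases split off an outer map; they reject the identity as inner map, with which the recursion
    would not terminate. *)
Ltac lin :=
  first
  [ assumption
  | match goal with
    | |- forall _, _ => intro; lin
    | |- _ /\ _ => split; lin
    | |- bilin _ => split; intro; cbn beta; lin
    | |- linear (fun x => x) => exact: lin_id
    | |- linear (fun x => 0) => exact: lin_zero
    | |- linear (fun x => @?f x + @?g x) => apply: (@lin_add _ _ _ f g); lin
    | |- linear (fun x => - (@?f x)) => apply: (@lin_opp _ _ _ f); lin
    | |- linear (fun x => ?b *: (@?f x)) => apply: (@lin_scale _ _ _ b f); lin
    | |- linear (fun x => (@?f x) *: ?w) => apply: (@lin_scalel _ _ _ f w); lin
    | |- linear (fun x => \sum_(i <- _ | _) (@?f i x)) => apply: lin_bigsum => ?; lin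
    | |- linear (tens ?v) => exact: tens_linr
    | |- linear (fun x => tens (@?f x) ?w) =>
        apply: (@lin_comp _ _ _ _ (fun v => tens v w) f (tens_linl w)); lin
    | |- linear (fun x => tens ?v (@?f x)) =>
        apply: (@lin_comp _ _ _ _ (fun w => tens v w) f (tens_linr v)); lin
    | |- linear (tlift ?F) => apply: (@tlift_lin _ _ _ _ F); lin
    | |- linear (fun x => tlift ?F (@?f x)) =>
        apply: (@lin_comp _ _ _ _ (tlift F) f); [apply: (@tlift_lin _ _ _ _ F)|]; lin
    | |- linear (fun x => tlift (@?F x) ?t) =>
        apply: (@tlift_linF _ _ _ _ _ F t) => ? ?; cbn beta; lin
    | |- linear (lext ?F) => exact: (@lext_lin _ _ _ F)
    | |- linear (fun x => lext ?F (@?f x)) =>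
        apply: (@lin_comp _ _ _ _ (lext F) f (@lext_lin _ _ _ F)); lin
    | |- linear (fun x => lext (@?F x) ?t) =>
        apply: (@lext_linF _ _ _ _ F t) => ?; cbn beta; lin
    end
  | match goal with
    | |- linear (fun x => ?g (@?f x)) =>
        lazymatch f with fun x => x => fail | _ =>
        apply: (@lin_comp _ _ _ _ g f); lin end
    | |- linear (fun x => ?g (@?f x) ?y) =>
        lazymatch f with fun x => x => fail | _ =>
        apply: (@lin_comp _ _ _ _ (fun z => g z y) f); lin end
    end ].

Section TensorMaps.
Variable k : fieldType.
Variables (V W V' W' V'' W'' U : lmodType k).

Lemma tmap_bilin (f : V -> V') (g : W -> W') : linear f -> linear g ->
  bilin (fun v w => tens (f v) (g w)).
Proof. by move=> hf hg; lin. Qed.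
Lemma tmapE (f : V -> V') (g : W -> W') v w : linear f -> linear g ->
  tmap f g (tens v w) = tens (f v) (g w).
Proof. by move=> hf hg; rewrite /tmap tliftE //; apply: tmap_bilin. Qed.
Lemma tmap_lin (f : V -> V') (g : W -> W') : linear f -> linear g -> linear (tmap f g).
Proof. by move=> hf hg; apply: tlift_lin; apply: tmap_bilin. Qed.

Lemma tassoc_bilin2 (w : W) : bilin (fun (u : U) (v : V) => tens u (tens v w)).
Proof. by lin. Qed.
Lemma tassoc_bilin : bilin (fun (t : tensor U V) (w : W) => tlift (fun u v => tens u (tens v w)) t).
Proof. by lin. Qed.
Lemma tassocE (u : U) (v : V) (w : W) : tassoc (tens (tens u v) w) = tens u (tens v w).
Proof. by rewrite /tassoc tliftE ?tliftE //; [exact: tassoc_bilin2|exact: tassoc_bilin]. Qed.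
Lemma tassoc_lin : linear (@tassoc k U V W).
Proof. exact: tlift_lin tassoc_bilin. Qed.

Lemma tswap_bilin2 (u : V) (u' : V') :
  bilin (fun (v : W) (v' : W') => tens (tens u v) (tens u' v')).
Proof. by lin. Qed.
Lemma tswap_bilin1 (t : tensor W W') :
  bilin (fun (u : V) (u' : V') => tlift (fun v v' => tens (tens u v) (tens u' v')) t).
Proof. by lin. Qed.
Lemma tswapE (u : V) (u' : V') (v : W) (v' : W') :
  tswap (tens u u') (tens v v') = tens (tens u v) (tens u' v').
Proof. by rewrite /tswap tliftE ?tliftE //; [exact: tswap_bilin2|exact: tswap_bilin1]. Qed.
Lemma tswap_bilin : bilin (@tswap k V V' W W').
Proof. by rewrite /tswap; lin. Qed.
End TensorMaps.

Lemma tmap_comp (k : fieldType) (V W V' W' V'' W'' : lmodType k)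
    (f : V -> V') (g : W -> W') (f' : V' -> V'') (g' : W' -> W'') t :
  linear f -> linear g -> linear f' -> linear g' ->
  tmap f' g' (tmap f g t) = tmap (f' \o f) (g' \o g) t.
Proof.
move=> hf hg hf' hg'; have hf2 := lin_comp hf' hf; have hg2 := lin_comp hg' hg.
move: t; apply: tens_ext => [||v w].
- by apply: lin_comp; apply: tmap_lin.
- exact: tmap_lin.
- by rewrite !tmapE.
Qed.

Lemma tassoc_tmap (k : fieldType) (U V W U' V' W' : lmodType k)
    (f : U -> U') (g : V -> V') (h : W -> W') t :
  linear f -> linear g -> linear h ->
  tassoc (tmap (tmap f g) h t) = tmap f (tmap g h) (tassoc t).
Proof.
move=> hf hg hh; have fgl := tmap_lin hf hg; have ghl := tmap_lin hg hh.
move: t; apply: (tens_ext (f := fun t => tassoc (tmap (tmap f g) h t))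
  (g := fun t => tmap f (tmap g h) (tassoc t))) => [||t z].
- exact: lin_comp (@tassoc_lin _ _ _ _) (tmap_lin fgl hh).
- exact: lin_comp (tmap_lin hf ghl) (@tassoc_lin _ _ _ _).
rewrite (tmapE _ _ fgl hh).
move: t; apply: (tens_ext (f := fun t => tassoc (tens (tmap f g t) (h z)))
  (g := fun t => tmap f (tmap g h) (tassoc (tens t z)))) => [||x y].
- exact: lin_comp (@tassoc_lin _ _ _ _) (lin_comp (tens_linl _) fgl).
- exact: lin_comp (tmap_lin hf ghl) (lin_comp (@tassoc_lin _ _ _ _) (tens_linl _)).
by rewrite !tassocE (tmapE _ _ hf ghl) (tmapE _ _ hf hg) (tmapE _ _ hg hh) tassocE.
Qed.

Lemma tmap_id (k : fieldType) (V W : lmodType k) (t : tensor V W) :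
  tmap (fun v => v) (fun w => w) t = t.
Proof.
have hV := @lin_id k V; have hW := @lin_id k W.
by move: t; apply: tens_ext => [||v w]; [exact: tmap_lin| |rewrite tmapE].
Qed.

Lemma tmap_eq (k : fieldType) (V W V' W' : lmodType k) (f f' : V -> V') (g g' : W -> W') t :
  f =1 f' -> g =1 g' -> tmap f g t = tmap f' g' t.
Proof. by move=> /funext -> /funext ->. Qed.

Section SubQuotients.
Variables (k : fieldType) (V : lmodType k) (Z B : set V).
Hypotheses (hZ : is_subspace Z) (hB : is_subspace B).

Lemma spannedP (x : spanned Z) : Z (val x).
Proof. exact: (lspan_sub hZ (fun _ h => h) (valP x)). Qed.

Lemma val_lin : linear (val : spanned Z -> V). Proof. by []. Qed.

Lemma insubd_span v : Z v -> val (insubd (0 : spanned Z) v) = v.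
Proof. by move=> Zv; rewrite val_insubd lspan_mem. Qed.

Lemma rep_mem (x : sq Z B) : Z (rep x). Proof. exact: spannedP. Qed.

Lemma repK (x : sq Z B) : cls Z B (rep x) = x.
Proof. by rewrite /cls /rep valKd qrepK. Qed.

Lemma cls_eq0 v : Z v -> cls Z B v = 0 <-> B v.
Proof.
move=> Zv; rewrite /cls qclass0; split=> [|Bv].
  move/(lspan_sub (W := [set x | B (val x)]) (subspace_preim val_lin hB) (fun _ h => h)).
  by rewrite /= insubd_span.
by apply: lspan_mem; rewrite /= insubd_span.
Qed.

Lemma cls_lin a u v : Z u -> Z v -> cls Z B (a *: u + v) = a *: cls Z B u + cls Z B v.
Proof.
move=> Zu Zv; rewrite /cls -(qclass_lin _ a); congr qclass; apply: val_inj.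
by rewrite val_lin !insubd_span //; apply: hZ.2.
Qed.

Lemma clsD u v : Z u -> Z v -> cls Z B (u + v) = cls Z B u + cls Z B v.
Proof. by move=> Zu Zv; rewrite -[u]scale1r cls_lin // !scale1r. Qed.
Lemma cls0 : cls Z B 0 = 0. Proof. by apply/(cls_eq0 (subsp0 hZ)); apply: (subsp0 hB). Qed.
Lemma clsZ a u : Z u -> cls Z B (a *: u) = a *: cls Z B u.
Proof. by move=> Zu; rewrite -[a *: u]addr0 cls_lin ?cls0 ?addr0 //; apply: (subsp0 hZ). Qed.
Lemma clsB u v : Z u -> Z v -> cls Z B (u - v) = cls Z B u - cls Z B v.
Proof.
by move=> Zu Zv; rewrite -scaleN1r addrC cls_lin // scaleN1r addrC.
Qed.

Lemma cls_eq u v : Z u -> Z v -> cls Z B u = cls Z B v <-> B (u - v).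
Proof.
move=> Zu Zv; rewrite -cls_eq0; last exact: subspB.
by rewrite clsB //; split=> [->|/eqP]; rewrite ?subrr // subr_eq0 => /eqP.
Qed.

Lemma cls_sum (I : Type) (r : seq I) (P : pred I) (F : I -> V) : (forall i, P i -> Z (F i)) ->
  cls Z B (\sum_(i <- r | P i) F i) = \sum_(i <- r | P i) cls Z B (F i).
Proof.
move=> ZF; elim: r => [|i r IH]; first by rewrite !big_nil cls0.
by rewrite !big_cons; case: ifP => // Pi; rewrite clsD ?IH //; [apply: ZF|apply: subsp_sum].
Qed.

Lemma rep_cls v : Z v -> B (rep (cls Z B v) - v).
Proof. by move=> Zv; rewrite -cls_eq ?repK //; apply: rep_mem. Qed.

Lemma rep_lin a x y : B (rep (a *: x + y : sq Z B) - (a *: rep x + rep y)).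
Proof.
have h := hZ.2 a _ _ (rep_mem x) (rep_mem y); have h' := rep_mem (a *: x + y).
by rewrite -(cls_eq h' h) cls_lin ?repK //; apply: rep_mem.
Qed.

Lemma sq_ind (P : sq Z B -> Prop) : (forall v, Z v -> P (cls Z B v)) -> forall x, P x.
Proof. by move=> h x; rewrite -[x]repK; apply: h; apply: rep_mem. Qed.

Section Lift.
Variables (W : lmodType k) (f : V -> W).
Hypotheses (f_lin : forall a u v, Z u -> Z v -> f (a *: u + v) = a *: f u + f v)
  (fB : forall v, Z v -> B v -> f v = 0).

Let f0 : f 0 = 0. Proof. by rewrite fB //; [exact: (subsp0 hZ)|exact: (subsp0 hB)]. Qed.
Let fD_ u v : Z u -> Z v -> f (u + v) = f u + f v.
Proof. by move=> Zu Zv; rewrite -[u]scale1r f_lin // !scale1r. Qed.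

(** Linearity of f is assumed on Z only: the maps lifted later are often themselves of the form
    [cls] after another map, and [cls] is meaningful only on a subspace. *)
Lemma sq_liftE v : Z v -> f (rep (cls Z B v)) = f v.
Proof.
move=> Zv; have Zd := subspB hZ (rep_mem (cls Z B v)) Zv.
by rewrite -[LHS]/(f _) -[rep _](subrK v) fD_ // (fB Zd (rep_cls Zv)) add0r.
Qed.

Lemma sq_lift_lin : linear (fun x : sq Z B => f (rep x)).
Proof.
move=> a x y; have Zx := rep_mem x; have Zy := rep_mem y; have Zxy := rep_mem (a *: x + y).
have Zl := hZ.2 a _ _ Zx Zy; have Zd := subspB hZ Zxy Zl.
rewrite -[rep (a *: x + y)](subrK (a *: rep x + rep y)) fD_ //.
by rewrite (fB Zd (rep_lin a x y)) add0r f_lin.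
Qed.
End Lift.

End SubQuotients.

Lemma preinvE (A : choiceType) (B : Type) (a0 : A) (f : A -> B) (b : B) :
  bijective f -> f (preinv a0 f b) = b.
Proof.
by move=> [g fK gK]; exact: (@xgetPex _ a0 [set x | f x = b] (ex_intro _ (g b) (gK b))).
Qed.

Section Pc2.
Variables (k : fieldType) (J : zmodType).

Lemma pc2_subspace (V W : lmodType k) (P : J -> set V) (Q : J -> set W) q :
  is_subspace (pc2 P Q q).
Proof. exact: lspan_subspace. Qed.

Lemma pc2_tens (V W : lmodType k) (P : J -> set V) (Q : J -> set W) i j x y :
  P i x -> Q j y -> pc2 P Q (i + j) (tens x y).
Proof. by move=> Px Qy; apply: lspan_mem; exists i, j, x, y. Qed.

Lemma pc2_sub (V W : lmodType k) (P : J -> set V) (Q : J -> set W) q (S : set (tensor V W)) :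
  is_subspace S -> (forall i j x y, i + j = q -> P i x -> Q j y -> S (tens x y)) ->
  pc2 P Q q `<=` S.
Proof.
move=> hS h t; apply: lspan_sub => // _ [i [j [x [y [ij Px Qy ->]]]]].
exact: h ij Px Qy.
Qed.

Lemma pc2_tmap (V W V' W' : lmodType k) (P : J -> set V) (Q : J -> set W)
    (P' : J -> set V') (Q' : J -> set W') f g q t : linear f -> linear g ->
  (forall i x, P i x -> P' i (f x)) -> (forall i x, Q i x -> Q' i (g x)) ->
  pc2 P Q q t -> pc2 P' Q' q (tmap f g t).
Proof.
move=> hf hg fP gQ.
have h := @pc2_sub _ _ P Q q [set t | pc2 P' Q' q (tmap f g t)].
apply: h; first by apply: subspace_preim; [exact: tmap_lin|exact: pc2_subspace].
by move=> i j x y <- Px Qy /=; rewrite tmapE //; apply: pc2_tens; [exact: fP|exact: gQ].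
Qed.
End Pc2.

(** * Gradings and the Kuenneth homotopy *)

Section Grading.
Variables (k : fieldType) (I : zmodType) (C : dgc k I).

Let id_lin : forall i : {classic I}, linear (fun x : C => x).
Proof. by []. Qed.

Lemma decomposes_single i (x : C) : (forall j, is_subspace (@pc _ _ C j)) ->
  pc i x -> decomposes x (single i x).
Proof.
move=> hs xi; split; last by rewrite (@fsum_single _ {classic I} _ _ _ id_lin).
by move=> j; rewrite singleE; case: asboolP => [->|_] //; apply: subsp0.
Qed.

Lemma decomposesD (x y : C) f g : (forall j, is_subspace (@pc _ _ C j)) ->
  decomposes x f -> decomposes y g -> decomposes (x + y) (f + g).
Proof.
move=> hs [fx ->] [gy ->]; split; first by move=> i; rewrite fsDE; apply: subspD.
by rewrite -(linD (@fsum_lin _ {classic I} _ _ _ id_lin)).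
Qed.

(** Projections onto the pieces force uniqueness: the components of any decomposition of x must be
    the elements [pr i x]. *)
Lemma grading_criterion (pr : I -> C -> C) :
  (forall i, is_subspace (@pc _ _ C i)) ->
  (forall P : C -> Prop, P 0 -> (forall x y, P x -> P y -> P (x + y)) ->
     (forall i x, pc i x -> P x) -> forall x, P x) ->
  (forall i, linear (pr i)) -> (forall i x, pc i x -> pr i x = x) ->
  (forall i j x, pc j x -> i <> j -> pr i x = 0) -> is_grading C.
Proof.
move=> hs hind prl pri prj; split=> // x.
have [f fx] : exists f, decomposes x f.
  move: x; apply: hind.
  - exists 0; rewrite -{1}(lin0 (@fsum_lin _ {classic I} _ _ _ id_lin)).
    by split=> // i; rewrite fs0E; apply: subsp0.
  - by move=> x y [f fx] [g gy]; exists (f + g); apply: decomposesD.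
  - by move=> i x xi; exists (single i x); apply: decomposes_single.
exists f; split=> // g gx.
suff h e : decomposes x e -> forall i, e i = pr i x.
  by apply: fsP => i; rewrite (h f) // (h g).
move=> [ei ->] i; have [s [us hs0]] := fs_support e.
rewrite (@fsum_seq _ {classic I} _ _ _ id_lin e s us hs0) (lin_sum _ _ _ (prl i)).
have [si|si] := boolP ((i : {classic I}) \in s).
  rewrite (bigD1_seq (i : {classic I})) //= pri // big1 ?addr0 // => j ji.
  by apply: prj (ei j) _ => ij; rewrite ij eqxx in ji.
rewrite hs0 // big_seq big1 // => j sj.
by apply: prj (ei j) _ => ij; rewrite ij sj in si.
Qed.

Hypothesis hg : is_grading C.

Lemma pc_subspace i : is_subspace (@pc _ _ C i). Proof. exact: hg.1. Qed.

Lemma hcompP (x : C) : decomposes x (hcomp x).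
Proof.
have [f [fx _]] := hg.2 x.
exact: (@xgetPex _ 0 [set g | decomposes x g] (ex_intro _ f fx)).
Qed.

Lemma hcomp_unique (x : C) f : decomposes x f -> hcomp x = f.
Proof. by move=> fx; have [g [_ gu]] := hg.2 x; rewrite -(gu _ (hcompP x)) -(gu _ fx). Qed.

Lemma hcomp_mem (x : C) i : pc i (hcomp x i). Proof. exact: (hcompP x).1. Qed.

Lemma hcomp_pc i (x : C) : pc i x -> hcomp x = single i x.
Proof. by move=> xi; apply: hcomp_unique; apply: decomposes_single => //; exact: hg.1. Qed.

Lemma hcomp_id i (x : C) : pc i x -> hcomp x i = x.
Proof. by move=> /hcomp_pc ->; rewrite single_id. Qed.

Lemma hcomp_lin : linear (@hcomp _ _ C).
Proof.
move=> a x y; apply: hcomp_unique; have [ax ex] := hcompP x; have [ay ey] := hcompP y.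
split; first by move=> i; rewrite fsDE fsZE; apply: (pc_subspace i).2.
rewrite {1}ex {1}ey; exact: esym (@fsum_lin _ {classic I} _ _ _ id_lin a _ _).
Qed.

Lemma hcompi_lin i : linear (fun x : C => hcomp x i : C).
Proof. exact: lin_comp (@fs_eval_lin _ _ _ i) hcomp_lin. Qed.

Lemma homog_ind (P : C -> Prop) : P 0 -> (forall x y, P x -> P y -> P (x + y)) ->
  (forall i x, pc i x -> P x) -> forall x, P x.
Proof.
move=> P0 PD Pi x; rewrite (hcompP x).2; have [s [us hs0]] := fs_support (hcomp x).
rewrite (@fsum_seq _ {classic I} _ _ _ id_lin _ s us hs0).
by apply: big_ind => // i _; apply: (Pi i); exact: hcomp_mem.
Qed.

Lemma homog_ext (W : lmodType k) (f g : C -> W) : linear f -> linear g ->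
  (forall i x, pc i x -> f x = g x) -> f =1 g.
Proof.
move=> hf hg' fg; apply: homog_ind => // [|x y fx fy].
  by rewrite (lin0 hf) (lin0 hg').
by rewrite (linD hf) (linD hg') fx fy.
Qed.

(** A linear map prescribed degree by degree. The sign involution is one instance, a homogeneous
    generalized inverse is another. *)
Definition gext (W : lmodType k) (phi : I -> C -> W) (x : C) : W :=
  \sum_(i \in [set: {classic I}]) phi i (hcomp x i).

Lemma gext_lin (W : lmodType k) (phi : I -> C -> W) :
  (forall i, linear (phi i)) -> linear (gext phi).
Proof. by move=> hphi; exact: (lin_comp (@fsum_lin _ {classic I} _ _ _ hphi) hcomp_lin). Qed.

Lemma gext_pc (W : lmodType k) (phi : I -> C -> W) i x :
  (forall i, linear (phi i)) -> pc i x -> gext phi x = phi i x.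
Proof. by move=> hphi /hcomp_pc; rewrite /gext => ->; exact: (@fsum_single _ {classic I}). Qed.

Lemma hcomp_neq i j (x : C) : pc j x -> i <> j -> hcomp x i = 0.
Proof. by move=> /hcomp_pc -> ij; rewrite singleE asboolF. Qed.

Lemma sgn_lin : linear (@sgn _ _ C).
Proof.
exact: (@gext_lin _ (fun i x => (-1) ^ deg C i *: x) (fun i => lin_scale _ (@lin_id _ _))).
Qed.

Lemma sgn_pc i (x : C) : pc i x -> sgn x = (-1) ^ deg C i *: x.
Proof.
exact: (@gext_pc _ (fun i x => (-1) ^ deg C i *: x) i x (fun i => lin_scale _ (@lin_id _ _))).
Qed.

Lemma sgn_mem i (x : C) : pc i x -> pc i (sgn x).
Proof. by move=> xi; rewrite (sgn_pc xi); apply: subspZ => //; exact: pc_subspace. Qed.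

Lemma sgnK : involutive (@sgn _ _ C).
Proof.
apply: homog_ext => [||i x xi]; [exact: lin_comp sgn_lin sgn_lin|by []|].
rewrite (sgn_pc (sgn_mem xi)) (sgn_pc xi) scalerA -expfzMl.
by rewrite mulrNN mulr1 exp1rz scale1r.
Qed.
End Grading.

Arguments gext {k I C W} phi x.

Section Kunneth.
Variables (k : fieldType) (V : lmodType k) (d sg s : V -> V).
Hypotheses (d_lin : linear d) (dd : forall x, d (d x) = 0).
Hypotheses (sg_lin : linear sg) (sgsg : involutive sg) (dsg : forall x, d (sg x) = - sg (d x)).
Hypotheses (s_lin : linear s) (dsd : forall x, d (s (d x)) = d x).

Definition dtens : tensor V V -> tensor V V :=
  tlift (fun x y => tens (d x) y + tens (sg x) (d y)).

Lemma dtens_bilin : bilin (fun x y => tens (d x) y + tens (sg x) (d y)).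
Proof. by lin. Qed.
Lemma dtens_lin : linear dtens. Proof. exact: tlift_lin dtens_bilin. Qed.
Lemma dtensE x y : dtens (tens x y) = tens (d x) y + tens (sg x) (d y).
Proof. exact: tliftE dtens_bilin _ _. Qed.

Lemma dtens_dtens t : dtens (dtens t) = 0.
Proof.
move: t; apply: tens_ext => [||x y].
- exact: lin_comp dtens_lin dtens_lin.
- exact: lin_zero.
rewrite dtensE (linD dtens_lin) !dtensE !dd tens0r addr0 tens0l add0r dsg.
by rewrite (linN (tens_linl _)) addrN.
Qed.

Definition hproj (x : V) : V := x - d (s x) - s (d x).

Lemma hproj_lin : linear hproj. Proof. by rewrite /hproj; lin. Qed.
Lemma d_hproj x : d (hproj x) = 0.
Proof. by rewrite /hproj !(linB d_lin) dd dsd subr0 subrr. Qed.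
Lemma hproj_d x : hproj (d x) = 0.
Proof. by rewrite /hproj dd dsd (lin0 s_lin) subr0 subrr. Qed.

(** The usual homotopy for a tensor product: 1 (x) 1 - p (x) p is the sum of 1 (x) (1 - p) and (1 -
    p) (x) p, and s contracts 1 - p in either factor. The sign [sg] comes from moving s past the
    left factor. *)
Definition ktens : tensor V V -> tensor V V :=
  tlift (fun x y => tens (sg x) (s y) + tens (s x) (hproj y)).

Lemma ktens_bilin : bilin (fun x y => tens (sg x) (s y) + tens (s x) (hproj y)).
Proof. by have := hproj_lin; lin. Qed.

Lemma ktens_lin : linear ktens. Proof. exact: tlift_lin ktens_bilin. Qed.

Lemma kunneth_homotopy t : t = tmap hproj hproj t + (dtens (ktens t) + ktens (dtens t)).
Proof.
have hl := hproj_lin; have kl := ktens_lin; have dl := dtens_lin; have tl := tmap_lin hl hl.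
move: t; apply: tens_ext => // [|x y].
  by apply: lin_add => //; apply: lin_add; apply: lin_comp.
rewrite tmapE // /ktens tliftE; last exact: ktens_bilin.
rewrite (linD dl) !dtensE d_hproj tens0r addr0 -/ktens (linD kl) /ktens.
rewrite !tliftE; try exact: ktens_bilin.
rewrite hproj_d tens0r addr0 sgsg dsg (linN (tens_linl _)).
rewrite addrA [RHS](AC (1*3*3) (1*4*6*(2*5)*3*7))%AC /= addNr addr0.
rewrite -!(linD (tens_linl _)) -!addrA -!(linD (tens_linr _)).
rewrite [- s (d x) + _]addrC addrK addNr addr0.
rewrite -(linD (tens_linr _)); congr tens.
by rewrite /hproj addrA [_ + d (s y)]addrAC !subrK.
Qed.

Lemma kunneth_cycle t : dtens t = 0 -> t = tmap hproj hproj t + dtens (ktens t).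
Proof. by move=> t0; rewrite {1}(kunneth_homotopy t) t0 (lin0 ktens_lin) addr0. Qed.

End Kunneth.

Section Homology.
Variables (k : fieldType) (V : lmodType k) (d : V -> V).
Hypotheses (d_lin : linear d) (dd : forall x, d (d x) = 0).

Lemma cycles_subspace : is_subspace (cycles d).
Proof. exact: subspace_preim d_lin (@subspace0 _ _). Qed.
Let hZ := cycles_subspace.
Let hB : is_subspace (range d) := subspace_range d_lin.

Lemma hrep_cycle (h : homology d) : d (rep h) = 0. Proof. exact: rep_mem hZ h. Qed.
Lemma hrepK (h : homology d) : hcls d (rep h) = h. Proof. exact: repK. Qed.
Lemma hcls_eq0 z : d z = 0 -> hcls d z = 0 <-> range d z. Proof. exact: cls_eq0. Qed.
Lemma hcls_eq z z' : d z = 0 -> d z' = 0 -> hcls d z = hcls d z' <-> range d (z - z').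
Proof. exact: cls_eq. Qed.
Lemma hcls_bound x : hcls d (d x) = 0. Proof. by apply/hcls_eq0 => //; exists x. Qed.
Lemma hcls_linZ a u v : d u = 0 -> d v = 0 -> hcls d (a *: u + v) = a *: hcls d u + hcls d v.
Proof. exact: cls_lin. Qed.
Lemma hclsD u v : d u = 0 -> d v = 0 -> hcls d (u + v) = hcls d u + hcls d v.
Proof. exact: clsD. Qed.
Lemma hcls0 : hcls d 0 = 0. Proof. exact: cls0. Qed.
Lemma hclsZ a u : d u = 0 -> hcls d (a *: u) = a *: hcls d u.
Proof. exact: clsZ. Qed.
Lemma homology_ind (P : homology d -> Prop) : (forall z, d z = 0 -> P (hcls d z)) -> forall h, P h.
Proof. exact: sq_ind. Qed.
Lemma hrep_hcls z : d z = 0 -> exists x, rep (hcls d z) = z + d x.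
Proof. by move=> /(rep_cls hZ hB)[x _ e]; exists x; rewrite e addrC subrK. Qed.

Lemma hlin_comp (W : lmodType k) (f : W -> V) : linear f -> (forall x, d (f x) = 0) ->
  linear (fun x => hcls d (f x)).
Proof. by move=> hf df a x y; rewrite hf hcls_linZ. Qed.

Section Lift.
Variables (W : lmodType k) (f : V -> W).
Hypotheses (f_lin : forall a u v, d u = 0 -> d v = 0 -> f (a *: u + v) = a *: f u + f v)
  (fB : forall x, f (d x) = 0).
Let fB' v : cycles d v -> range d v -> f v = 0. Proof. by move=> _ [x _ <-]. Qed.
Lemma h_liftE v : d v = 0 -> f (rep (hcls d v)) = f v.
Proof. exact: (sq_liftE hZ hB f_lin fB'). Qed.
Lemma h_lift_lin : linear (fun x : homology d => f (rep x)).
Proof. exact: (sq_lift_lin hZ hB f_lin fB'). Qed.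
End Lift.

Variable s : V -> V.
Hypotheses (s_lin : linear s) (dsd : forall x, d (s (d x)) = d x).
(** Extends the class map from cycles to all of V ([hpi_cycle]) and vanishes on boundaries; being
    defined everywhere, it can be tensored with itself. *)
Definition hpi (x : V) : homology d := hcls d (hproj d s x).
Lemma hpi_lin : linear hpi.
Proof. by apply: hlin_comp; [apply: hproj_lin|move=> x; apply: d_hproj]. Qed.
Lemma hpi_d x : hpi (d x) = 0. Proof. by rewrite /hpi hproj_d // hcls0. Qed.
Lemma hpi_cycle z : d z = 0 -> hpi z = hcls d z.
Proof.
move=> z0; have pz := d_hproj d_lin dd dsd z; apply/hcls_eq => //.
by exists (- s z) => //; rewrite (linN d_lin) /hproj z0 (lin0 s_lin) subr0 addrAC subrr add0r.
Qed.
End Homology.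

Section HomologyMap.
Variables (k : fieldType) (V W : lmodType k) (d : V -> V) (e : W -> W) (f : V -> W).
Hypotheses (d_lin : linear d) (e_lin : linear e) (f_lin : linear f)
  (dd : forall x, d (d x) = 0) (ee : forall x, e (e x) = 0)
  (fd : forall x, f (d x) = e (f x)).
Definition hmap (h : homology d) : homology e := hcls e (f (rep h)).
Let g_lin a u v : d u = 0 -> d v = 0 -> hcls e (f (a *: u + v)) = a *: hcls e (f u) + hcls e (f v).
Proof. by move=> u0 v0; rewrite f_lin hcls_linZ // -fd ?u0 ?v0 (lin0 f_lin). Qed.
Let gB x : hcls e (f (d x)) = 0. Proof. by rewrite fd hcls_bound. Qed.
Lemma hmapE z : d z = 0 -> hmap (hcls d z) = hcls e (f z).
Proof. exact: (h_liftE d_lin g_lin gB). Qed.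
Lemma hmap_lin : linear hmap.
Proof. exact: (h_lift_lin d_lin g_lin gB). Qed.
Lemma hmap_bij : bijective f -> bijective hmap.
Proof.
move=> [g fK gK].
have gl := can_linear f_lin gK fK.
have ge y : g (e y) = d (g y) by apply: (can_inj fK); rewrite fd !gK.
apply: bijective_of.
  apply: lin_inj; first exact: hmap_lin.
  apply: homology_ind => // z z0; rewrite hmapE // => /hcls_eq0; case=> //;
    first by rewrite -fd z0 (lin0 f_lin).
  by move=> y _ /(congr1 g); rewrite ge fK => <-; apply: hcls_bound.
apply: homology_ind => // z z0; exists (hcls d (g z)).
by rewrite hmapE ?gK // -ge z0 (lin0 gl).
Qed.
End HomologyMap.

(** * The homology coalgebra *)

Section HomologyCoalgebra.
Variables (k : fieldType) (I : zmodType) (C : dgc k I) (s0 : I).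
Hypothesis hC : is_dgc s0 C.
Hypothesis deg_dif : forall i, (-1) ^ deg C (i + s0) = - (-1) ^ deg C i :> k.

Let hg := dgc_grading hC.
Let d_lin := dgc_dif_linear hC.
Let dd := dgc_dif_dif hC.
Let sgl := sgn_lin hg.

Lemma sgn_dif x : dif (sgn x) = - sgn (dif x) :> C.
Proof.
move: x; apply: (homog_ext hg) => [||i x xi].
- exact: lin_comp.
- exact: lin_opp (lin_comp _ _).
by rewrite (sgn_pc hg xi) (linZ _ d_lin) (sgn_pc hg (dgc_dif_pc hC xi)) deg_dif scaleNr opprK.
Qed.
Let dsg := sgn_dif.

Lemma hcomp_dif x i : hcomp (dif x : C) (i + s0) = dif (hcomp x i).
Proof.
move: x; apply: (homog_ext hg) => [||j x xj].
- exact: lin_comp (hcompi_lin hg _) d_lin.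
- exact: lin_comp d_lin (hcompi_lin hg _).
rewrite (hcomp_pc hg xj) (hcomp_pc hg (dgc_dif_pc hC xj)) !singleE.
case: asboolP => [/addIr ->|ij]; first by rewrite asboolT.
by rewrite asboolF ?(lin0 d_lin) // => ij'; apply: ij; rewrite ij'.
Qed.

(** Only the component of degree - s0 of an arbitrary generalized inverse is kept. The identity d s
    d = d is homogeneous, so it survives. *)
Lemma homogeneous_inverse : exists s : C -> C, [/\ linear s,
  forall x, dif (s (dif x)) = dif x & forall i x, pc i x -> pc (i - s0) (s x)].
Proof.
have [s [sl dsd]] := generalized_inverse d_lin.
pose phi i (x : C) : C := hcomp (s x) (i - s0).
have phil i : linear (phi i) by exact: lin_comp (hcompi_lin hg _) sl.
exists (gext phi); split; first exact: gext_lin.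
- apply: (homog_ext hg) => [||i x xi] //.
    exact: lin_comp d_lin (lin_comp (gext_lin hg phil) d_lin).
  rewrite (gext_pc hg phil (dgc_dif_pc hC xi)) /phi addrK -hcomp_dif dsd.
  by rewrite hcomp_dif (hcomp_id hg xi).
- by move=> i x xi; rewrite (gext_pc hg phil xi); apply: hcomp_mem.
Qed.

Lemma dif2_lin : linear (@dif2 _ _ C). Proof. exact: (dtens_lin d_lin sgl). Qed.
Lemma dif2E (x y : C) : dif2 (tens x y) = tens (dif x) y + tens (sgn x) (dif y).
Proof. exact: (dtensE d_lin sgl). Qed.
Lemma dif2_dif2 t : dif2 (dif2 t) = 0 :> tensor C C.
Proof. exact: (dtens_dtens d_lin dd sgl dsg). Qed.
Lemma dif2_cycle (x y : C) : dif x = 0 -> dif y = 0 -> dif2 (tens x y) = 0.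
Proof. by move=> x0 y0; rewrite dif2E x0 y0 tens0l tens0r addr0. Qed.

Let H := homology (@dif _ _ C).
Let hc := hcls (@dif _ _ C).
Let hc2 := hcls (@dif2 _ _ C).

Let kun_l (h : H) : forall a u v, dif u = 0 -> dif v = 0 ->
  hc2 (tens (a *: u + v) (rep h)) = a *: hc2 (tens u (rep h)) + hc2 (tens v (rep h)).
Proof.
move=> a u v u0 v0; rewrite (tens_linl (rep h)) /hc2 hcls_linZ //; [exact: dif2_lin|..];
  apply: dif2_cycle => //; exact: hrep_cycle d_lin h.
Qed.
Let kun_r (u : C) : dif u = 0 -> forall a v w, dif v = 0 -> dif w = 0 ->
  hc2 (tens u (a *: v + w)) = a *: hc2 (tens u v) + hc2 (tens u w).
Proof.
move=> u0 a v w v0 w0; rewrite (tens_linr u) /hc2 hcls_linZ //; [exact: dif2_lin|..];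
  exact: dif2_cycle.
Qed.
Let kun_bl (h : H) x : hc2 (tens (dif x) (rep h)) = 0.
Proof.
rewrite (_ : tens (dif x) (rep h) = dif2 (tens x (rep h))); last first.
  by rewrite dif2E (hrep_cycle d_lin) tens0r addr0.
by apply: hcls_bound; [exact: dif2_lin|exact: dif2_dif2].
Qed.
Let kun_br (u : C) : dif u = 0 -> forall x, hc2 (tens u (dif x)) = 0.
Proof.
move=> u0 x; rewrite (_ : tens u (dif x) = dif2 (tens (sgn u) x)); last first.
  by rewrite dif2E dsg u0 (lin0 sgl) oppr0 tens0l add0r (sgnK hg).
by apply: hcls_bound; [exact: dif2_lin|exact: dif2_dif2].
Qed.

Lemma kunneth_bilin : bilin (fun g h : H => hc2 (tens (rep g) (rep h))).
Proof.
split=> h.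
  exact: (h_lift_lin d_lin (kun_l h) (kun_bl h)).
have r0 := hrep_cycle d_lin h.
exact: (h_lift_lin d_lin (f := fun y => hc2 (tens (rep h) y)) (kun_r r0) (kun_br r0)).
Qed.

Lemma kunneth_lin : linear (@kunneth _ _ C).
Proof. exact: tlift_lin kunneth_bilin. Qed.

Lemma kunnethE x y : dif x = 0 -> dif y = 0 -> kunneth (tens (hc x) (hc y)) = hc2 (tens x y).
Proof.
move=> x0 y0; rewrite /kunneth tliftE; last exact: kunneth_bilin.
have e1 := h_liftE d_lin (kun_l (hc y)) (kun_bl (hc y)) x0.
by apply: (etrans e1); exact: (h_liftE d_lin (kun_r x0) (kun_br x0) y0).
Qed.

(* By [kunneth_cycle], a cycle t differs from (p (x) p) t by a boundary. *)
Lemma cycle_ext (W : lmodType k) (f g : tensor C C -> W) : linear f -> linear g ->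
  (forall x y, dif x = 0 -> dif y = 0 -> f (tens x y) = g (tens x y)) ->
  (forall x y, f (dif2 (tens x y)) = g (dif2 (tens x y))) ->
  forall t, dif2 t = 0 -> f t = g t.
Proof.
move=> hf hg' fg fgd t t0; have [s [sl dsd]] := generalized_inverse d_lin.
have pl := hproj_lin d_lin sl; have dp := d_hproj d_lin dd dsd.
rewrite (kunneth_cycle d_lin dd sgl (sgnK hg) dsg sl dsd t0) (linD hf) (linD hg').
congr (_ + _).
  move: (t); apply: (tens_ext (f := fun t => f (tmap _ _ t)) (g := fun t => g (tmap _ _ t))).
  - exact: lin_comp hf (tmap_lin pl pl).
  - exact: lin_comp hg' (tmap_lin pl pl).
  - by move=> x y; rewrite tmapE //; apply: fg.
move: (ktens _ _ _ t); apply: (tens_ext (f := fun t => f (dif2 t)) (g := fun t => g (dif2 t))) =>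
  //.
- exact: lin_comp hf dif2_lin.
- exact: lin_comp hg' dif2_lin.
Qed.

Section WithInverse.
Variable s : C -> C.
Hypotheses (s_lin : linear s) (dsd : forall x, dif (s (dif x)) = dif x).
Let pi : C -> H := hpi (@dif _ _ C) s.
Let pil : linear pi. Proof. exact: hpi_lin. Qed.
Let pid x : pi (dif x) = 0. Proof. exact: hpi_d. Qed.
Let pic z : dif z = 0 -> pi z = hc z. Proof. exact: hpi_cycle. Qed.
Let pipil := tmap_lin pil pil.

Lemma hpi_dif2 t : tmap pi pi (dif2 t) = 0.
Proof.
move: t; apply: tens_ext => [||x y]; [exact: lin_comp pipil dif2_lin|exact: lin_zero|].
by rewrite dif2E (linD pipil) !tmapE // !pid tens0l tens0r addr0.
Qed.

(** By the homotopy, t is homologous to its image under p (x) p, which is a sum of products of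
    cycles; this gives an explicit preimage under the Kuenneth map. *)
Lemma kunneth_hpi t : dif2 t = 0 -> kunneth (tmap pi pi t) = hc2 t.
Proof.
move=> t0; have [p0 pl] := (d_hproj d_lin dd dsd, hproj_lin d_lin s_lin).
have e := kunneth_cycle d_lin dd sgl (sgnK hg) dsg s_lin dsd t0.
have c2 u : dif2 (tmap (hproj (@dif _ _ C) s) (hproj (@dif _ _ C) s) u) = 0.
  move: u; apply: tens_ext => [||x y]; [exact: lin_comp dif2_lin (tmap_lin pl pl)|exact: lin_zero|].
  by rewrite tmapE // dif2_cycle.
have -> : hc2 t = hc2 (tmap (hproj (@dif _ _ C) s) (hproj (@dif _ _ C) s) t).
  apply/(hcls_eq dif2_lin) => //; exists (ktens (@dif _ _ C) (@sgn _ _ C) s t) => //.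
  by apply/eqP; rewrite eq_sym subr_eq addrC; apply/eqP.
move: (t); apply: tens_ext => [||x y].
- exact: lin_comp kunneth_lin pipil.
- by apply: hlin_comp => //; [exact: dif2_lin|exact: tmap_lin].
- by rewrite !tmapE // kunnethE.
Qed.

(** The map induced by [pi] (x) [pi] on the homology of the tensor square is a left inverse of the
    Kuenneth map. So elements defined through [preinv] are computed by [pi] (x) [pi] on any
    representing cycle. *)
Lemma hpi_kunneth t u : dif2 u = 0 -> kunneth t = hc2 u -> t = tmap pi pi u.
Proof.
have qB x : tmap pi pi (dif2 x) = 0 by exact: hpi_dif2.
have ql a x y : dif2 x = 0 -> dif2 y = 0 ->
  tmap pi pi (a *: x + y) = a *: tmap pi pi x + tmap pi pi y by rewrite pipil.
pose q (h : homology (@dif2 _ _ C)) := tmap pi pi (rep h).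
have qE v : dif2 v = 0 -> q (hc2 v) = tmap pi pi v by exact: (h_liftE dif2_lin ql qB).
have qlin : linear q by exact: (h_lift_lin dif2_lin ql qB).
have qk t' : q (kunneth t') = t'.
  move: t'; apply: tens_ext => [||x y]; [exact: lin_comp qlin kunneth_lin|by []|].
  elim/(homology_ind d_lin): x => x x0; elim/(homology_ind d_lin): y => y y0.
  by rewrite kunnethE // qE ?dif2_cycle // tmapE // !pic.
by move=> u0 /(congr1 q); rewrite qk qE.
Qed.
End WithInverse.

Lemma kunneth_bij : bijective (@kunneth _ _ C).
Proof.
have [s [sl dsd]] := generalized_inverse d_lin.
apply: bijective_of; last first.
  apply: (homology_ind dif2_lin) => t t0; exists (tmap (hpi (@dif _ _ C) s) (hpi (@dif _ _ C) s) t).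
  exact: kunneth_hpi.
apply: lin_inj; first exact: kunneth_lin.
move=> t; rewrite -(hcls0 dif2_lin) => /(hpi_kunneth sl dsd) ->.
  by apply: (lin0 (tmap_lin _ _)); apply: hpi_lin.
exact: (lin0 dif2_lin).
Qed.

Lemma kunneth_cop h : kunneth (cop (h : hdgc C)) = hc2 (cop (rep h)).
Proof. exact: preinvE kunneth_bij. Qed.

Lemma cop_cycle z : dif z = 0 -> dif2 (cop z : tensor C C) = 0.
Proof. by move=> z0; rewrite -(dgc_cop_dif hC) z0 (lin0 (dgc_cop_linear hC)). Qed.

Lemma kunneth_cop_hcls z : dif z = 0 -> kunneth (cop (hc z : hdgc C)) = hc2 (cop z).
Proof.
move=> z0; rewrite kunneth_cop; have [x ->] := hrep_hcls d_lin z0.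
rewrite (linD (dgc_cop_linear hC)) (dgc_cop_dif hC) /hc2 hclsD //; last 3 first.
- exact: dif2_lin.
- exact: cop_cycle.
- exact: dif2_dif2.
by rewrite hcls_bound ?addr0 //; [exact: dif2_lin|exact: dif2_dif2].
Qed.

(** The coproduct is defined by choosing preimages, so linearity is checked after the injective
    Kuenneth map. *)
Lemma hcop_lin : linear (@cop _ _ (hdgc C)).
Proof.
move=> a; apply: (homology_ind d_lin) => x x0; apply: (homology_ind d_lin) => y y0.
apply: (bij_inj kunneth_bij); rewrite kunneth_lin -(hcls_linZ d_lin) //.
rewrite !kunneth_cop_hcls //; last by rewrite d_lin x0 y0 scaler0 addr0.
by rewrite (dgc_cop_linear hC) /hc2 hcls_linZ //;
  [exact: dif2_lin|exact: cop_cycle|exact: cop_cycle].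
Qed.

Lemma heps_hcls z : dif z = 0 -> eps (hc z : hdgc C) = eps z.
Proof.
move=> z0; rewrite /= ; have [x ->] := hrep_hcls d_lin z0.
by rewrite (linD (dgc_eps_linear hC)) (dgc_eps_dif hC) addr0.
Qed.

Lemma heps_lin : linear (@eps _ _ (hdgc C) : hdgc C -> k^o).
Proof.
move=> a; apply: (homology_ind d_lin) => x x0; apply: (homology_ind d_lin) => y y0.
rewrite -(hcls_linZ d_lin) // !heps_hcls //; last by rewrite d_lin x0 y0 scaler0 addr0.
exact: (dgc_eps_linear hC).
Qed.

Lemma hcomp_cycle z i : dif z = 0 -> dif (hcomp z i : C) = 0.
Proof. by move=> z0; rewrite -hcomp_dif z0 (lin0 (hcomp_lin hg)). Qed.

Lemma hdgc_pc_hcls z i : dif z = 0 -> pc i (hc (hcomp z i) : hdgc C).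
Proof.
move=> z0; exists (hcomp z i); split=> //; first exact: hcomp_mem.
exact: hcomp_cycle.
Qed.

(** The second clause is the working form. It makes sense because the differential shifts
    homogeneous components by s0, so components of cycles are cycles and components of boundaries
    are boundaries. *)
Lemma hdgc_grading : is_grading (hdgc C) /\
  forall z i, dif z = 0 -> hcomp (hc z : hdgc C) i = hc (hcomp z i).
Proof.
pose pr i (h : hdgc C) : hdgc C := hc (hcomp (rep h) i).
have fl i a u v : dif u = 0 -> dif v = 0 ->
    hc (hcomp (a *: u + v : C) i) = a *: hc (hcomp u i) + hc (hcomp v i).
  by move=> u0 v0; rewrite (hcompi_lin hg) /hc hcls_linZ //; apply: hcomp_cycle.
have fB i x : hc (hcomp (dif x : C) i) = 0.
  by rewrite -[i](subrK s0) hcomp_dif /hc hcls_bound.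
have prE i z : dif z = 0 -> pr i (hc z) = hc (hcomp z i) by exact: (h_liftE d_lin (fl i) (fB i)).
have prl i : linear (pr i) by exact: (h_lift_lin d_lin (fl i) (fB i)).
have g : is_grading (hdgc C).
  apply: (@grading_criterion _ _ _ pr) => //.
  - move=> i; split; first by exists 0; split;
    [exact: subsp0 (pc_subspace hg i)|exact: lin0|rewrite hcls0].
    move=> a _ _ [x [xi x0 ->]] [y [yi y0 ->]]; exists (a *: x + y); split.
    + by apply: (pc_subspace hg i).2.
    + by rewrite d_lin x0 y0 scaler0 addr0.
    + by rewrite hcls_linZ.
  - move=> P P0 PD Pi; apply: (homology_ind d_lin) => z z0.
    have [s [us hs]] := fs_support (hcomp z).
    rewrite (_ : z = \sum_(i <- s) hcomp z i); last first.
      rewrite {1}(hcompP hg z).2.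
      by rewrite (@fsum_seq _ {classic I} _ _ (fun _ x => x) _ (hcomp z) s us hs).
    elim: (s) => [|i r IH]; first by rewrite big_nil hcls0.
    rewrite big_cons hclsD //; last 2 first.
    + exact: hcomp_cycle.
    + by rewrite (lin_sum _ _ _ d_lin) big1 // => j _; apply: hcomp_cycle.
    by apply: PD => //; apply: (Pi i); apply: hdgc_pc_hcls.
  - by move=> i _ [z [zi z0 ->]]; rewrite prE // (hcomp_id hg zi).
  - by move=> i j _ [z [zj z0 ->]] ij; rewrite prE // (hcomp_neq hg zj ij) /hc hcls0.
split=> // z i z0.
rewrite -prE //.
move: (hc z : hdgc C); apply: (homog_ext g) => //; first exact: (hcompi_lin g).
move=> j x xj; case: (pselect (i = j)) => [->|ij].
  by rewrite (hcomp_id g xj); case: xj => y [yj y0 ->]; rewrite prE // (hcomp_id hg yj).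
by rewrite (hcomp_neq g xj ij); case: xj => y [yj y0 ->];
  rewrite prE // (hcomp_neq hg yj ij) /hc hcls0.
Qed.

Lemma hsgn z : dif z = 0 -> sgn (hc z : hdgc C) = hc (sgn z).
Proof.
move=> z0; have [g hE] := hdgc_grading.
have fl a u v : dif u = 0 -> dif v = 0 -> hc (sgn (a *: u + v)) = a *: hc (sgn u) + hc (sgn v).
  by move=> u0 v0; rewrite sgl /hc hcls_linZ // dsg ?u0 ?v0 (lin0 sgl) oppr0.
have fB x : hc (sgn (dif x)) = 0.
  by rewrite -[sgn _]opprK -dsg -(linN d_lin) /hc hcls_bound.
have fE := h_liftE d_lin (f := fun v => hc (sgn v)) fl fB; rewrite -fE //.
have fl' := h_lift_lin d_lin (f := fun v => hc (sgn v)) fl fB.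
suff: forall h : hdgc C, sgn h = hc (sgn (rep h)) by apply.
apply: (homog_ext g (sgn_lin g) fl') => i x xi.
 rewrite (sgn_pc g xi); case: xi => y [yi y0 ->].
by rewrite fE // (sgn_pc hg yi) /hc hclsZ.
Qed.

(** The coassociativity and counit laws compare linear maps on the cycle [cop z]; by [cycle_ext]
    these have to agree on products of cycles and on boundaries, and on the latter they vanish. The
    degree [s'] is free because the differential is zero. *)
Lemma hdgc_is_dgc s' : is_dgc s' (hdgc C).
Proof.
have [s [sl dsd sp]] := homogeneous_inverse.
have g := hdgc_grading.1.
pose pi : C -> H := hpi (@dif _ _ C) s.
have pil : linear pi by exact: hpi_lin.
have pid x : pi (dif x) = 0 by exact: hpi_d.
have pic z (z0 : dif z = 0) : pi z = hc z by exact: hpi_cycle.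
have ppl := tmap_lin pil pil.
have cl := dgc_cop_linear hC; have el := dgc_eps_linear hC.
have copE z : dif z = 0 -> cop (hc z : hdgc C) = tmap pi pi (cop z).
  by move=> z0; apply: (hpi_kunneth sl dsd); [exact: cop_cycle|exact: kunneth_cop_hcls].
have idl := @lin_id k H.
have ppd t : tmap pi pi (dif2 t) = 0 by exact: hpi_dif2 sl dsd t.
have copd x : tmap pi pi (cop (dif x)) = 0 by rewrite (dgc_cop_dif hC) ppd.
have cidl : linear (tmap (@cop _ _ (hdgc C)) (id : hdgc C -> hdgc C)) by exact: tmap_lin hcop_lin
  idl.
have idcl : linear (tmap (id : hdgc C -> hdgc C) (@cop _ _ (hdgc C))) by exact: tmap_lin idl
  hcop_lin.
split.
- exact: g.
- exact: lin_zero.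
- exact: hcop_lin.
- exact: heps_lin.
- by move=> i x _; apply: subsp0; exact: (pc_subspace g).
(* As s shifts degrees by - s0, the map p preserves them, and [pi] carries the degrees of [cop z]
   over to homology. *)
- move=> i _ [z [zi z0 ->]]; rewrite copE //; apply: (pc2_tmap pil pil _ _ (dgc_cop_pc hC zi)).
    move=> j x xj; exists (hproj (@dif _ _ C) s x); split=> //; last exact: d_hproj.
    have h := pc_subspace hg j; rewrite /hproj; apply: subspB => //; first apply: subspB => //.
      by rewrite -[j](subrK s0); apply: (dgc_dif_pc hC); apply: sp.
    by rewrite -[j](addrK s0); apply: sp; apply: (dgc_dif_pc hC).
  move=> j x xj; exists (hproj (@dif _ _ C) s x); split=> //; last exact: d_hproj.
  have h := pc_subspace hg j; rewrite /hproj; apply: subspB => //; first apply: subspB => //.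
    by rewrite -[j](subrK s0); apply: (dgc_dif_pc hC); apply: sp.
  by rewrite -[j](addrK s0); apply: sp; apply: (dgc_dif_pc hC).
- by move=> i _ [z [zi z0 ->]] i0; rewrite heps_hcls // (dgc_eps_pc hC zi).
- by [].
- apply: (homology_ind d_lin) => z z0.
  rewrite copE //.
  (* On the cycle [cop z], applying [pi] and then the coproduct of homology agrees with applying the
     coproduct of C and then [pi] in every factor. The same is done on the right-hand side below,
     which leaves coassociativity of C. *)
  rewrite (cycle_ext (f := fun t => tmap (@cop _ _ (hdgc C)) id (tmap pi pi t))
    (g := fun t => tmap (tmap pi pi) pi (tmap (@cop _ _ C) id t))); last exact: cop_cycle;
      first last.
  + move=> x y; rewrite ppd (lin0 cidl) dif2E.
    by rewrite (linD (tmap_lin cl (@lin_id _ _))) (linD (tmap_lin ppl pil)) !tmapE // copd !pid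
      tens0l tens0r addr0.
  + move=> x y x0 y0; rewrite (tmapE x y pil pil) (tmapE x y cl (@lin_id _ _)).
    by rewrite (tmapE (pi x) _ hcop_lin idl) (tmapE _ _ ppl pil) (pic _ x0) (copE x x0).
  + exact: lin_comp (tmap_lin ppl pil) (tmap_lin cl (@lin_id _ _)).
  + exact: lin_comp (tmap_lin hcop_lin idl) ppl.
  rewrite (cycle_ext (f := fun t => tmap id (@cop _ _ (hdgc C)) (tmap pi pi t))
    (g := fun t => tmap pi (tmap pi pi) (tmap id (@cop _ _ C) t))); last exact: cop_cycle;
      first last.
  + move=> x y; rewrite ppd (lin0 idcl) dif2E.
    by rewrite (linD (tmap_lin (@lin_id _ _) cl)) (linD (tmap_lin pil ppl)) !tmapE // copd !pid
      tens0l tens0r addr0.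
  + move=> x y x0 y0; rewrite (tmapE x y pil pil) (tmapE x y (@lin_id _ _) cl).
    by rewrite (tmapE _ (pi y) idl hcop_lin) (tmapE _ _ pil ppl) (pic _ y0) (copE y y0).
  + exact: lin_comp (tmap_lin pil ppl) (tmap_lin (@lin_id _ _) cl).
  + exact: lin_comp (tmap_lin idl hcop_lin) ppl.
  by rewrite -(dgc_coassoc hC) tassoc_tmap.
- have eb : bilin (fun y z : H => eps (y : hdgc C) *: z).
    by split=> w; [apply: lin_scalel; exact: heps_lin|apply: lin_scale].
  have eb' : bilin (fun y z : C => eps y *: z).
    by split=> w; [apply: lin_scalel|apply: lin_scale].
  apply: (homology_ind d_lin) => z z0; rewrite copE //.
  rewrite (cycle_ext (f := fun t => tlift (fun y z : H => eps (y : hdgc C) *: z) (tmap pi pi t))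
    (g := fun t => pi (tlift (fun y z : C => eps y *: z) t))); last exact: cop_cycle; first last.
  + move=> x y; rewrite ppd (lin0 (tlift_lin eb)) dif2E.
    by rewrite (linD (tlift_lin eb')) !tliftE // (dgc_eps_dif hC) scale0r add0r (linZ _ pil) pid
      scaler0.
  + move=> x y x0 y0; rewrite (tmapE x y pil pil) (tliftE eb) (tliftE eb') (linZ _ pil).
    by rewrite (pic x x0) (pic y y0); congr (_ *: _); exact: heps_hcls.
  + exact: lin_comp pil (tlift_lin eb').
  + exact: lin_comp (tlift_lin eb) ppl.
  by rewrite (dgc_counitl hC) pic.
- have eb : bilin (fun y z : H => eps (z : hdgc C) *: y).
    by split=> w; [apply: lin_scale|apply: lin_scalel; exact: heps_lin].
  have eb' : bilin (fun y z : C => eps z *: y).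
    by split=> w; [apply: lin_scale|apply: lin_scalel].
  apply: (homology_ind d_lin) => z z0; rewrite copE //.
  rewrite (cycle_ext (f := fun t => tlift (fun y z : H => eps (z : hdgc C) *: y) (tmap pi pi t))
    (g := fun t => pi (tlift (fun y z : C => eps z *: y) t))); last exact: cop_cycle; first last.
  + move=> x y; rewrite ppd (lin0 (tlift_lin eb)) dif2E.
    by rewrite (linD (tlift_lin eb')) !tliftE // (dgc_eps_dif hC) scale0r addr0 (linZ _ pil) pid
      scaler0.
  + move=> x y x0 y0; rewrite (tmapE x y pil pil) (tliftE eb) (tliftE eb') (linZ _ pil).
    by rewrite (pic x x0) (pic y y0); congr (_ *: _); exact: heps_hcls.
  + exact: lin_comp pil (tlift_lin eb').
  + exact: lin_comp (tlift_lin eb) ppl.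
  by rewrite (dgc_counitr hC) pic.
- move=> h; rewrite (lin0 hcop_lin); apply/esym.
  move: (cop h); apply: tens_ext => [||x y]; last 1 first.
  + rewrite /dif2 tliftE; first by rewrite tens0l tens0r addr0.
    by have sl' := sgn_lin g; split=> w; apply: lin_add;
      rewrite /=; [apply: lin_comp (tens_linl _) (@lin_zero _ _ _)|apply: lin_comp (tens_linl _)
        sl'|apply: tens_linr|apply: lin_comp (tens_linr _) (@lin_zero _ _ _)].
  + apply: tlift_lin.
    by have sl' := sgn_lin g; split=> w; apply: lin_add;
      rewrite /=; [apply: lin_comp (tens_linl _) (@lin_zero _ _ _)|apply: lin_comp (tens_linl _)
        sl'|apply: tens_linr|apply: lin_comp (tens_linr _) (@lin_zero _ _ _)].
  + exact: lin_zero.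
- by move=> h; rewrite (lin0 heps_lin).
Qed.

End HomologyCoalgebra.

(** * Transport of structure and componentwise comparison *)

Section Transport.
Variables (k : fieldType) (I : zmodType) (C D : dgc k I) (f : C -> D).
Hypotheses (f_lin : linear f) (f_bij : bijective f)
  (f_pc : forall i x, pc i x <-> pc i (f x))
  (f_cop : forall x, cop (f x) = tmap f f (cop x))
  (f_eps : forall x, eps (f x) = eps x).

Lemma coalg_iso_inverse : exists g : D -> C, [/\ is_coalg_iso g, cancel f g & cancel g f].
Proof.
have [g fK gK] := f_bij; have gl := can_linear f_lin gK fK.
exists g; split=> //; split=> //; first by exists f.
- by move=> i y; rewrite -{1}[y]gK -f_pc.
- move=> y; rewrite -{2}[y]gK f_cop (tmap_comp (cop (g y)) f_lin f_lin gl gl).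
  by rewrite (tmap_eq (f' := fun x => x) (g' := fun x => x) _ fK fK) tmap_id.
- by move=> y; rewrite -{2}[y]gK f_eps.
Qed.

Hypotheses (f_deg : forall i, deg C i = deg D i) (f_dif : forall x, f (dif x) = dif (f x)).

(** The laws hold in C because they hold after f or a tensor power of f, all of which are injective.
    Linearity of the operations of C is part of the conclusion. *)
Lemma dgc_transport s : is_dgc s D -> is_dgc s C.
Proof.
move=> hD; have hg := dgc_grading hD; have [g fK gK] := f_bij.
have gl := can_linear f_lin gK fK.
have fi := can_inj fK.
have tfi : injective (tmap f f).
  apply: (can_inj (g := tmap g g)) => t; rewrite (tmap_comp t f_lin f_lin gl gl).
  by rewrite (tmap_eq (f' := fun x => x) (g' := fun x => x) _ fK fK) tmap_id.
have g_pc i y : pc i y -> pc i (g y) by move=> yi; apply/f_pc; rewrite gK.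
have hgC : is_grading C.
  apply: (@grading_criterion _ _ _ (fun i x => g (hcomp (f x) i))).
  - move=> i; have -> : @pc _ _ C i = [set x : C | pc i (f x)].
      by apply/seteqP; split=> x /f_pc.
    exact: (subspace_preim f_lin (pc_subspace hg i)).
  - move=> P P0 PD Pi x; rewrite -[x]fK; move: (f x); apply: (homog_ind hg).
    + by rewrite (lin0 gl).
    + by move=> y z Py Pz; rewrite (linD gl); apply: PD.
    + by move=> i y yi; apply: (Pi i); apply: g_pc.
  - by move=> i; exact: lin_comp gl (lin_comp (hcompi_lin hg i) f_lin).
  - by move=> i x /f_pc xi; rewrite (hcomp_id hg xi).
  - by move=> i j x /f_pc xj ij; rewrite (hcomp_neq hg xj ij) (lin0 gl).
have difl : linear (@dif _ _ C).
  move=> a x y; apply: fi; rewrite f_lin !f_dif f_lin.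
  exact: (dgc_dif_linear hD).
have copl : linear (@cop _ _ C).
  move=> a x y; apply: tfi; rewrite (tmap_lin f_lin f_lin) -!f_cop f_lin.
  exact: (dgc_cop_linear hD).
have epsl : linear (@eps _ _ C : C -> k^o).
  by move=> a x y; rewrite -!f_eps f_lin; exact: (dgc_eps_linear hD).
have f_sgn x : f (sgn x) = sgn (f x).
  move: x; apply: (homog_ext hgC) => [||i x xi].
  - exact: lin_comp f_lin (sgn_lin hgC).
  - exact: lin_comp (sgn_lin hg) f_lin.
  by rewrite (sgn_pc hgC xi) (linZ _ f_lin) f_deg; move/f_pc: xi => /(sgn_pc hg) ->.
have idl V := @lin_id k V.
split=> //.
- by move=> i x xi; apply/f_pc; rewrite f_dif; apply: (dgc_dif_pc hD); apply/f_pc.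
- move=> i x /f_pc xi; have -> : cop x = tmap g g (cop (f x)).
    rewrite f_cop (tmap_comp (cop x) f_lin f_lin gl gl).
    by rewrite (tmap_eq (f' := fun x => x) (g' := fun x => x) _ fK fK) tmap_id.
  exact: (pc2_tmap gl gl g_pc g_pc (dgc_cop_pc hD xi)).
- by move=> i x /f_pc xi i0; rewrite -f_eps (dgc_eps_pc hD xi).
- by move=> x; apply: fi; rewrite !f_dif (dgc_dif_dif hD) (lin0 f_lin).
- move=> x.
  have tffi : injective (tmap f (tmap f f)).
    apply: (can_inj (g := tmap g (tmap g g))) => t.
    rewrite (tmap_comp t f_lin (tmap_lin f_lin f_lin) gl (tmap_lin gl gl)).
    rewrite (tmap_eq (f' := fun x => x) (g' := fun x => x)) ?tmap_id // => u /=.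
    rewrite (tmap_comp u f_lin f_lin gl gl).
    by rewrite (tmap_eq (f' := fun x => x) (g' := fun x => x) _ fK fK) tmap_id.
  apply: tffi.
  have ffl := tmap_lin f_lin f_lin.
  have copDl := dgc_cop_linear hD.
  rewrite -tassoc_tmap // (tmap_comp _ copl (idl _) ffl f_lin) (tmap_comp _ (idl _) copl f_lin ffl).
  have := dgc_coassoc hD (f x); rewrite f_cop.
  rewrite (tmap_comp _ f_lin f_lin copDl (idl _)) (tmap_comp _ f_lin f_lin (idl _) copDl).
  have -> : tmap (@cop _ _ D \o f) (id \o f) (cop x) = tmap (tmap f f \o @cop _ _ C) (f \o id)
    (cop x).
    by apply: tmap_eq => // y /=.
  have -> // : tmap (id \o f) (@cop _ _ D \o f) (cop x) = tmap (f \o id) (tmap f f \o @cop _ _ C)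
    (cop x).
  by apply: tmap_eq => // y /=.
- move=> x; apply: fi; rewrite -[RHS](dgc_counitl hD) f_cop.
  have eb : bilin (fun y z : C => eps y *: z) by split=> w; [apply: lin_scalel|apply: lin_scale].
  have epsDl := dgc_eps_linear hD.
  have eb' : bilin (fun y z : D => eps y *: z) by split=> w; [apply: lin_scalel|apply: lin_scale].
  move: (cop x); apply: (tens_ext (f := fun t => f (tlift _ t)) (g := fun t => tlift _ (tmap f f
    t))).
  - exact: lin_comp f_lin (tlift_lin eb).
  - exact: lin_comp (tlift_lin eb') (tmap_lin f_lin f_lin).
  - by move=> y z; rewrite (tliftE eb) (tmapE _ _ f_lin f_lin) (tliftE eb') f_eps (linZ _ f_lin).
- move=> x; apply: fi; rewrite -[RHS](dgc_counitr hD) f_cop.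
  have eb : bilin (fun y z : C => eps z *: y) by split=> w; [apply: lin_scale|apply: lin_scalel].
  have epsDl := dgc_eps_linear hD.
  have eb' : bilin (fun y z : D => eps z *: y) by split=> w; [apply: lin_scale|apply: lin_scalel].
  move: (cop x); apply: (tens_ext (f := fun t => f (tlift _ t)) (g := fun t => tlift _ (tmap f f
    t))).
  - exact: lin_comp f_lin (tlift_lin eb).
  - exact: lin_comp (tlift_lin eb') (tmap_lin f_lin f_lin).
  - by move=> y z; rewrite (tliftE eb) (tmapE _ _ f_lin f_lin) (tliftE eb') f_eps (linZ _ f_lin).
- move=> x; apply: tfi; rewrite -f_cop f_dif (dgc_cop_dif hD) f_cop.
  have sl := sgn_lin hg; have slC := sgn_lin hgC; have dDl := dgc_dif_linear hD.
  move: (cop x); apply: (tens_ext (f := fun t => dif2 (tmap f f t)) (g := fun t => tmap f f (dif2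
    t))).
  - exact: lin_comp (dtens_lin dDl sl) (tmap_lin f_lin f_lin).
  - exact: lin_comp (tmap_lin f_lin f_lin) (dtens_lin difl slC).
  move=> y z; have dE u v : dif2 (tens u v) = tens (dif u) v + tens (sgn u) (dif v) :> tensor D D.
    exact: dtensE dDl sl u v.
  rewrite (tmapE _ _ f_lin f_lin) dE [dif2 _](dtensE difl slC).
  by rewrite (linD (tmap_lin f_lin f_lin)) !(tmapE _ _ f_lin f_lin) !f_dif f_sgn.
- by move=> x; rewrite -f_eps f_dif (dgc_eps_dif hD).
Qed.
End Transport.

(** With the differential replaced by zero, the coalgebra laws of a page can be obtained before its
    differential is dealt with. *)
Definition coalg_of (k : fieldType) (I : zmodType) (C : dgc k I) : dgc k I := {|
  carrier := C; deg := deg C; pc := @pc _ _ C; dif := fun=> 0;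
  cop := @cop _ _ C; eps := @eps _ _ C |}.

Section Decompositions.
Variable k : fieldType.

(** Serves to prove equalities in tensor powers component by component: such families separate
    points and pass to tensor products. *)
Definition decomposition (V : lmodType k) (J : choiceType) (P : J -> V -> V) : Prop :=
  forall v, exists s : seq J, [/\ uniq s, forall i, i \notin s -> P i v = 0 &
    v = \sum_(i <- s) P i v].

Lemma decomposition_widen (V : lmodType k) (J : choiceType) (P : J -> V -> V) v (s s' : seq J) :
  uniq s -> uniq s' -> {subset s <= s'} -> (forall i, i \notin s -> P i v = 0) ->
  \sum_(i <- s') P i v = \sum_(i <- s) P i v.
Proof.
move=> us us' ss' h; rewrite (bigID (mem s)) /= [X in _ + X]big1 ?addr0; last by move=> i /h.
rewrite -big_filter; apply: perm_big; apply: uniq_perm => //; first exact: filter_uniq.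
by move=> i; rewrite mem_filter; case: (boolP (i \in s)) => //= /ss' ->.
Qed.

Lemma decomposition_ind (V : lmodType k) (J : choiceType) (P : J -> V -> V) (Q : V -> Prop) :
  (forall i, linear (P i)) -> 
  (forall R : V -> Prop, R 0 -> (forall x y, R x -> R y -> R (x + y)) ->
     (forall x, Q x -> R x) -> forall x, R x) ->
  (forall v, Q v -> exists s : seq J, [/\ uniq s, forall i, i \notin s -> P i v = 0 &
    v = \sum_(i <- s) P i v]) -> decomposition P.
Proof.
move=> Pl ind h; apply: ind => //.
  by exists [::]; split=> // [i _|]; rewrite ?big_nil // (lin0 (Pl i)).
move=> x y [s [us sx xE]] [t [ut ty yE]].
have mem1 : {subset s <= undup (s ++ t)} by move=> i si; rewrite mem_undup mem_cat si.
have mem2 : {subset t <= undup (s ++ t)} by move=> i si; rewrite mem_undup mem_cat si orbT.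
exists (undup (s ++ t)); split; first exact: undup_uniq.
  move=> i; rewrite mem_undup mem_cat negb_or => /andP[/sx xi /ty yi].
  by rewrite (linD (Pl i)) xi yi addr0.
rewrite (eq_bigr (fun i => P i x + P i y)); last by move=> i _; rewrite (linD (Pl i)).
rewrite big_split /= (decomposition_widen us (undup_uniq _) mem1 sx).
by rewrite (decomposition_widen ut (undup_uniq _) mem2 ty) -xE -yE.
Qed.

Lemma decomposition_sep (V : lmodType k) (J : choiceType) (P : J -> V -> V) v w :
  (forall i, linear (P i)) -> decomposition P -> (forall i, P i v = P i w) -> v = w.
Proof.
move=> Pl dec h; apply/eqP; rewrite -subr_eq0; apply/eqP.
have [s [_ _ ->]] := dec (v - w).
by rewrite big1 // => i _; rewrite (linB (Pl i)) h subrr.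
Qed.

Lemma decomposition_tens (V W : lmodType k) (J K : choiceType) (P : J -> V -> V) (Q : K -> W -> W) :
  (forall i, linear (P i)) -> (forall i, linear (Q i)) -> decomposition P -> decomposition Q ->
  decomposition (fun ij : J * K => tmap (P ij.1) (Q ij.2)).
Proof.
move=> Pl Ql dP dQ.
apply: (@decomposition_ind _ _ _ (fun t => exists v w, t = tens v w)).
- by move=> i; apply: tmap_lin.
- by move=> R R0 RD Rt; apply: tens_ind => // v w; apply: Rt; exists v, w.
move=> _ [v [w ->]]; have [s [us s0 vE]] := dP v; have [t [ut t0 wE]] := dQ w.
exists [seq (i, j) | i <- s, j <- t]; split.
- by apply: allpairs_uniq => // -[a b] [c e] _ _ [-> ->].
- move=> [i j] /= ijs; rewrite tmapE //.
  have [si|si] := boolP (i \in s); last by rewrite s0 // tens0l.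
  have [tj|tj] := boolP (j \in t); last by rewrite t0 // tens0r.
  by case/negP: ijs; apply/allpairsP; exists (i, j).
rewrite big_allpairs /= {1}vE {1}wE (lin_sum _ _ _ (tens_linl _)).
apply: eq_bigr => i _; rewrite (lin_sum _ _ _ (tens_linr _)).
by apply: eq_bigr => j _; rewrite tmapE.
Qed.

Lemma decomposition_hcomp (I : zmodType) (C : dgc k I) : is_grading C ->
  decomposition (fun (i : {classic I}) (x : C) => hcomp x i : C).
Proof.
move=> hg x; have [s [us hs]] := fs_support (hcomp x); exists s; split=> //.
by rewrite {1}(hcompP hg x).2 (@fsum_seq _ {classic I} _ _ (fun _ x => x) _ (hcomp x) s us hs).
Qed.
End Decompositions.

Section FsMaps.
Variables (k : fieldType) (J : choiceType).

Lemma fsum_mem (V W : lmodType k) (phi : J -> V -> W) (S : set W) (f : fs J V) :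
  (forall j, linear (phi j)) -> is_subspace S -> (forall i, S (phi i (f i))) ->
  S (\sum_(i \in [set: J]) phi i (f i)).
Proof.
move=> phil hS h; have [s [us hs]] := fs_supportJ f.
by rewrite (fsum_seq phil us hs); apply: subsp_sum.
Qed.

(** A generalized inverse of the inclusion of Z is a linear retraction onto Z; compose f with it. *)
Lemma lin_extend (V W : lmodType k) (Z : set V) (f : V -> W) : is_subspace Z ->
  (forall a u v, Z u -> Z v -> f (a *: u + v) = a *: f u + f v) ->
  exists g : V -> W, linear g /\ forall v, Z v -> g v = f v.
Proof.
move=> hZ fl; have [r [rl rK]] := generalized_inverse (@val_lin _ _ Z).
have fvl : linear (fun x : spanned Z => f (val x)).
  by move=> a x y; rewrite val_lin fl //; apply: spannedP.
exists (fun v => f (val (r v))); split; first exact: lin_comp fvl rl.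
by move=> v Zv; rewrite -{1}(insubd_span Zv) rK insubd_span.
Qed.
End FsMaps.

(** * Graded subquotients of a filtered dgc *)

Section SqSum.
Variables (k : fieldType) (V : lmodType k) (Z B : int -> set V).
Hypotheses (hZ : forall q, is_subspace (Z q)) (hB : forall q, is_subspace (B q)).

Lemma dsumset_subspace (Y : int -> set V) : (forall q, is_subspace (Y q)) -> is_subspace (dsumset
  Y).
Proof.
move=> hY; split=> [q|a u v Yu Yv q]; first by rewrite fs0E; apply: subsp0.
by rewrite fsDE fsZE; apply: (hY q).2.
Qed.
Let hdZ := dsumset_subspace hZ.
Let hdB := dsumset_subspace hB.

(** Common form of [gr_cls] and [page_cls]. *)
Definition ecl (q : int) (z : V) : sqsum Z B := scls Z B (single q z).

Lemma dsumset_single (Y : int -> set V) q z : (forall q, is_subspace (Y q)) ->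
  Y q z -> dsumset Y (single q z).
Proof.
by move=> hY Yz i; rewrite singleE; case: asboolP => [->|_] //; apply: subsp0.
Qed.

Lemma ecl_lin q a u v : Z q u -> Z q v -> ecl q (a *: u + v) = a *: ecl q u + ecl q v.
Proof.
by move=> Zu Zv; rewrite /ecl /scls single_lin (cls_lin _ hdZ) //; apply: dsumset_single.
Qed.

Lemma eclD q u v : Z q u -> Z q v -> ecl q (u + v) = ecl q u + ecl q v.
Proof. by move=> Zu Zv; rewrite -[u]scale1r ecl_lin // !scale1r. Qed.

Lemma ecl_eq0 q z : Z q z -> ecl q z = 0 <-> B q z.
Proof.
move=> Zz; rewrite /ecl /scls cls_eq0 //; last exact: dsumset_single.
by split=> [/(_ q)|]; [rewrite single_id|exact: dsumset_single].
Qed.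

Lemma ecl0 q : ecl q 0 = 0. Proof. by apply/ecl_eq0; apply: subsp0. Qed.
Lemma eclZ q a u : Z q u -> ecl q (a *: u) = a *: ecl q u.
Proof. by move=> Zu; rewrite -[a *: u]addr0 ecl_lin ?ecl0 ?addr0 //; exact: (subsp0 (hZ q)). Qed.
Lemma eclB q u v : Z q u -> Z q v -> ecl q (u - v) = ecl q u - ecl q v.
Proof. by move=> Zu Zv; rewrite addrC -scaleN1r ecl_lin // scaleN1r addrC. Qed.

Lemma ecl_eq q u v : Z q u -> Z q v -> ecl q u = ecl q v <-> B q (u - v).
Proof.
move=> Zu Zv; rewrite -ecl_eq0; last exact: subspB.
by rewrite eclB //; split=> [->|/eqP]; rewrite ?subrr // subr_eq0 => /eqP.
Qed.

Lemma scls_ecl (f : fs int V) : dsumset Z f -> exists s : seq int,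
  scls Z B f = \sum_(q <- s) ecl q (f q).
Proof.
move=> Zf; have [s [us fs0]] := fs_support f; exists s.
rewrite {1}(fs_sumE us fs0) /scls (cls_sum hdZ hdB) // => i _.
exact: dsumset_single.
Qed.

Lemma sqsum_ind (P : sqsum Z B -> Prop) : P 0 -> (forall x y, P x -> P y -> P (x + y)) ->
  (forall q z, Z q z -> P (ecl q z)) -> forall e, P e.
Proof.
move=> P0 PD Pe; apply: (sq_ind hdZ) => f Zf; rewrite -/(scls Z B f).
have [s ->] := scls_ecl Zf; apply: big_ind => // q _; apply: Pe; exact: Zf.
Qed.

Lemma sqsum_ext (W : lmodType k) (F G : sqsum Z B -> W) : linear F -> linear G ->
  (forall q z, Z q z -> F (ecl q z) = G (ecl q z)) -> F =1 G.
Proof.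
move=> hF hG FG; apply: sqsum_ind => // [|x y Fx Fy].
  by rewrite (lin0 hF) (lin0 hG).
by rewrite (linD hF) (linD hG) Fx Fy.
Qed.

(** Each f q is first extended linearly from Z q to V, so that the extensions can be summed over an
    arbitrary finitely supported family. *)
Lemma sqlift (W : lmodType k) (f : int -> V -> W) :
  (forall q a u v, Z q u -> Z q v -> f q (a *: u + v) = a *: f q u + f q v) ->
  (forall q v, Z q v -> B q v -> f q v = 0) ->
  exists F : sqsum Z B -> W, linear F /\ forall q z, Z q z -> F (ecl q z) = f q z.
Proof.
move=> fl fB; have /choice[g gP] q := lin_extend (hZ q) (fl q).
have gl q : linear (g q) by have [] := gP q.
have gE q v : Z q v -> g q v = f q v by have [_] := gP q; apply.
have phil := fsum_lin gl.
have phi0 v : dsumset Z v -> dsumset B v -> \sum_(q \in [set: int]) g q (v q) = 0.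
  by move=> Zv Bv; apply: fsbig1 => q _; rewrite gE // fB.
exists (fun e => \sum_(q \in [set: int]) g q ((rep e : fs int V) q)); split.
  exact: (sq_lift_lin hdZ hdB (f := fun v : fs int V => \sum_(q \in [set: int]) g q (v q))
    (fun a u v _ _ => phil a u v) phi0).
move=> q z Zz; rewrite -gE // /ecl /scls.
have sz := dsumset_single hZ Zz.
apply: (etrans (sq_liftE hdZ hdB (f := fun v : fs int V => \sum_(q \in [set: int]) g q (v q))
  (fun a u v _ _ => phil a u v) phi0 sz)).
exact: fsum_single.
Qed.

Lemma sqproj_ex : exists P : int -> sqsum Z B -> sqsum Z B,
  (forall i, linear (P i)) /\
  (forall i q z, Z q z -> P i (ecl q z) = if q == i then ecl q z else 0).
Proof.
have h i : exists F : sqsum Z B -> sqsum Z B, linear F /\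
    forall q z, Z q z -> F (ecl q z) = if q == i then ecl q z else 0.
  apply: (sqlift (f := fun q z => if q == i then ecl q z else 0)).
    by move=> q a u v Zu Zv; case: ifP => _; [exact: ecl_lin|rewrite scaler0 addr0].
  by move=> q v Zv Bv; case: ifP => // _; apply/ecl_eq0.
have [P hP] := choice h.
by exists P; split=> i; have [] := hP i.
Qed.

Lemma sqproj_dec (P : int -> sqsum Z B -> sqsum Z B) : (forall i, linear (P i)) ->
  (forall i q z, Z q z -> P i (ecl q z) = if q == i then ecl q z else 0) -> decomposition P.
Proof.
move=> Pl PE; apply: (@decomposition_ind _ _ _ _ (fun e => exists q z, Z q z /\ e = ecl q z)) => //.
  by move=> R R0 RD Re; apply: sqsum_ind => // q z Zz; apply: Re; exists q, z.
move=> _ [q [z [Zz ->]]]; exists [:: q]; split=> //.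
  by move=> i; rewrite inE eq_sym PE // => /negPf ->.
by rewrite big_seq1 PE // eqxx.
Qed.

(** Plays for subquotients the role that [hpi] plays for homology. *)
Lemma ecl_ext q : exists pi : V -> sqsum Z B, linear pi /\ forall v, Z q v -> pi v = ecl q v.
Proof. exact: lin_extend (hZ q) (@ecl_lin q). Qed.
End SqSum.

Section SqMaps.
Variable k : fieldType.

Section Smap.
Variables (V W : lmodType k) (Z B : int -> set V) (Z' B' : int -> set W) (s : int) (f : V -> W).
Hypotheses (hZ : forall q, is_subspace (Z q)) (hB : forall q, is_subspace (B q))
  (hZ' : forall q, is_subspace (Z' q)) (hB' : forall q, is_subspace (B' q)) (f_lin : linear f)
  (fZ : forall q x, Z q x -> Z' (q + s) (f x)) (fB : forall q x, Z q x -> B q x -> B' (q + s) (f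
    x)).

Let phil i : linear (fun x => single (i + s) (f x) : fs int W).
Proof. exact: lin_comp (@single_lin _ _ _ _) f_lin. Qed.

Lemma smap_lin : linear (smap s f). Proof. exact: fsum_lin phil. Qed.

Lemma smap_single q x : smap s f (single q x) = single (q + s) (f x).
Proof. exact: (fsum_single phil). Qed.

Lemma smap_mem (Y : int -> set V) (Y' : int -> set W) e : (forall q, is_subspace (Y' q)) ->
  (forall q x, Y q x -> Y' (q + s) (f x)) -> dsumset Y e -> dsumset Y' (smap s f e).
Proof.
move=> hY' fY Ye; apply: (fsum_mem phil (dsumset_subspace hY')) => i.
by apply: dsumset_single => //; apply: fY.
Qed.

Let g_lin a u v : dsumset Z u -> dsumset Z v ->
  scls Z' B' (smap s f (a *: u + v)) = a *: scls Z' B' (smap s f u) + scls Z' B' (smap s f v).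
Proof.
move=> Zu Zv; rewrite smap_lin /scls (cls_lin _ (dsumset_subspace hZ')) //.
  exact: (smap_mem hZ' fZ Zu).
exact: (smap_mem hZ' fZ Zv).
Qed.
Let gB e : dsumset Z e -> dsumset B e -> scls Z' B' (smap s f e) = 0.
Proof.
move=> Ze Be; apply/(cls_eq0 (dsumset_subspace hB')).
  exact: (smap_mem hZ' fZ Ze).
apply: (@smap_mem (fun q => Z q `&` B q) B' e hB'); first by move=> q x [Zx Bx]; apply: fB.
by move=> q; split.
Qed.

Lemma smap_cls_lin : linear (fun e : sqsum Z B => scls Z' B' (smap s f (rep e))).
Proof.
exact: (sq_lift_lin (dsumset_subspace hZ) (dsumset_subspace hB)
  (f := fun v => scls Z' B' (smap s f v)) g_lin gB).
Qed.

Lemma smap_ecl q z : Z q z -> scls Z' B' (smap s f (rep (ecl Z B q z))) = ecl Z' B' (q + s) (f z).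
Proof.
move=> Zz; rewrite /ecl -smap_single.
exact: (sq_liftE (dsumset_subspace hZ) (dsumset_subspace hB)
  (f := fun v => scls Z' B' (smap s f v)) g_lin gB (dsumset_single hZ Zz)).
Qed.
End Smap.

Section Smul.
Variables (U V W : lmodType k) (f : U -> V -> W).
Variables (Z B : int -> set U) (Z' B' : int -> set V) (Z2 B2 : int -> set W).
Hypotheses (hZ : forall q, is_subspace (Z q)) (hB : forall q, is_subspace (B q))
  (hZ' : forall q, is_subspace (Z' q)) (hB' : forall q, is_subspace (B' q))
  (hZ2 : forall q, is_subspace (Z2 q)) (hB2 : forall q, is_subspace (B2 q)) (hf : bilin f)
  (fZ : forall i j x y, Z i x -> Z' j y -> Z2 (i + j) (f x y))
  (fBl : forall i j x y, Z i x -> B i x -> Z' j y -> B2 (i + j) (f x y))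
  (fBr : forall i j x y, Z i x -> Z' j y -> B' j y -> B2 (i + j) (f x y)).

Let phir x i j : linear (fun y => single (i + j) (f x y) : fs int W).
Proof. exact: lin_comp (@single_lin _ _ _ _) (hf.2 x). Qed.
Let phil (e' : fs int V) i : linear (fun x => \sum_(j \in [set: int]) single (i + j) (f x (e' j))
  : fs int W).
Proof.
move=> a x y; move: e'.
pose F x (e' : fs int V) := \sum_(j \in [set: int]) single (i + j) (f x (e' j)) : fs int W.
have Fl x' : linear (F x') by exact: (fsum_lin (phir x' i)).
have FE x' j y' : F x' (single j y') = single (i + j) (f x' y') by exact: (fsum_single (phir x' i)).
suff h e' : F (a *: x + y) e' = a *: F x e' + F y e' by [].
move: e'; apply: fs_ind.
- by rewrite !(lin0 (Fl _)) scaler0 addr0.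
- by move=> g g' hg hg'; rewrite !(linD (Fl _)) hg hg' scalerDr addrACA.
- by move=> j v; rewrite !FE (hf.1 v) single_lin.
Qed.

Lemma smul_linl (e' : fs int V) : linear (fun e => smul f e e').
Proof. exact: fsum_lin (phil e'). Qed.
Lemma smul_singlel i x (e' : fs int V) :
  smul f (single i x) e' = \sum_(j \in [set: int]) single (i + j) (f x (e' j)).
Proof. exact: (fsum_single (phil e')). Qed.
Lemma smul_single i j x y : smul f (single i x) (single j y) = single (i + j) (f x y).
Proof. by rewrite smul_singlel; exact: (fsum_single (phir x i)). Qed.
Lemma smul_linr (e : fs int U) : linear (fun e' => smul f e e').
Proof.
move=> a u v; move: e; apply: fs_ind.
- by rewrite !(lin0 (smul_linl _)) scaler0 addr0.
- by move=> g g' hg hg'; rewrite !(linD (smul_linl _)) hg hg' scalerDr addrACA.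
- by move=> i x; rewrite !smul_singlel; exact: (fsum_lin (phir x i)).
Qed.

Lemma smul_mem (Y : int -> set U) (Y' : int -> set V) (Y2 : int -> set W) e e' :
  (forall q, is_subspace (Y2 q)) ->
  (forall i j x y, Y i x -> Y' j y -> Y2 (i + j) (f x y)) ->
  dsumset Y e -> dsumset Y' e' -> dsumset Y2 (smul f e e').
Proof.
move=> hY2 fY Ye Ye'; apply: (fsum_mem (phil e') (dsumset_subspace hY2)) => i.
apply: (fsum_mem (phir (e i) i) (dsumset_subspace hY2)) => j.
by apply: dsumset_single => //; apply: fY.
Qed.

Let M (u : fs int U) (v : fs int V) := scls Z2 B2 (smul f u v).
Let dZ2 := dsumset_subspace hZ2.
Let dB2 := dsumset_subspace hB2.

Let Ml v : dsumset Z' v -> forall a x y, dsumset Z x -> dsumset Z y ->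
  M (a *: x + y) v = a *: M x v + M y v.
Proof.
move=> Zv a x y Zx Zy; rewrite /M smul_linl /scls (cls_lin _ dZ2) //.
  exact: (smul_mem hZ2 fZ Zx Zv).
exact: (smul_mem hZ2 fZ Zy Zv).
Qed.
Let Mr u : dsumset Z u -> forall a x y, dsumset Z' x -> dsumset Z' y ->
  M u (a *: x + y) = a *: M u x + M u y.
Proof.
move=> Zv a x y Zx Zy; rewrite /M smul_linr /scls (cls_lin _ dZ2) //.
  exact: (smul_mem hZ2 fZ Zv Zx).
exact: (smul_mem hZ2 fZ Zv Zy).
Qed.
Let MBl v : dsumset Z' v -> forall x, dsumset Z x -> dsumset B x -> M x v = 0.
Proof.
move=> Zv x Zx Bx; apply/(cls_eq0 dB2); first exact: (smul_mem hZ2 fZ Zx Zv).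
apply: (@smul_mem (fun q => Z q `&` B q) Z' B2 x v hB2).
- by move=> i j x' y' [? ?] ?; apply: fBl.
- by move=> q; split; [exact: Zx|exact: Bx].
- exact: Zv.
Qed.
Let MBr u : dsumset Z u -> forall x, dsumset Z' x -> dsumset B' x -> M u x = 0.
Proof.
move=> Zv x Zx Bx; apply/(cls_eq0 dB2); first exact: (smul_mem hZ2 fZ Zv Zx).
apply: (@smul_mem Z (fun q => Z' q `&` B' q) B2 u x hB2).
- by move=> i j x' y' ? [? ?]; apply: fBr.
- exact: Zv.
- by move=> q; split; [exact: Zx|exact: Bx].
Qed.

Let dZ := dsumset_subspace hZ.
Let dB := dsumset_subspace hB.
Let dZ' := dsumset_subspace hZ'.
Let dB' := dsumset_subspace hB'.

Lemma smul_cls_bilin :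
  bilin (fun (e : sqsum Z B) (e' : sqsum Z' B') => scls Z2 B2 (smul f (rep e) (rep e'))).
Proof.
split=> e.
  have Ze := rep_mem dZ' e.
  exact: (sq_lift_lin dZ dB (f := fun x => M x (rep e)) (Ml Ze) (MBl Ze)).
have Ze := rep_mem dZ e.
exact: (sq_lift_lin dZ' dB' (f := fun x => M (rep e) x) (Mr Ze) (MBr Ze)).
Qed.

Lemma smul_cls_ecl i j x y : Z i x -> Z' j y ->
  scls Z2 B2 (smul f (rep (ecl Z B i x)) (rep (ecl Z' B' j y))) = ecl Z2 B2 (i + j) (f x y).
Proof.
move=> Zx Zy; rewrite /ecl -smul_single.
have sx := dsumset_single hZ Zx; have sy := dsumset_single hZ' Zy.
have Zr := rep_mem dZ' (scls Z' B' (single j y)).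
apply: (etrans (sq_liftE dZ dB (f := fun x => M x (rep _)) (Ml Zr) (MBl Zr) sx)).
exact: (sq_liftE dZ' dB' (f := fun y => M (single i x) y) (Mr sx) (MBr sx) sy).
Qed.
End Smul.

Section Cross.
Variables (V : lmodType k) (Z B : int -> set V) (Z2 B2 : int -> set (tensor V V)).
Hypotheses (hZ : forall q, is_subspace (Z q)) (hB : forall q, is_subspace (B q))
  (hZ2 : forall q, is_subspace (Z2 q)) (hB2 : forall q, is_subspace (B2 q))
  (fZ : forall i j x y, Z i x -> Z j y -> Z2 (i + j) (tens x y))
  (fBl : forall i j x y, Z i x -> B i x -> Z j y -> B2 (i + j) (tens x y))
  (fBr : forall i j x y, Z i x -> Z j y -> B j y -> B2 (i + j) (tens x y)).

Lemma cross_lin : linear (@cross _ _ Z B Z2 B2).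
Proof.
by apply: tlift_lin; exact: (smul_cls_bilin hZ hB hZ hB hZ2 hB2 (@tens_bilin _ _ _) fZ fBl fBr).
Qed.
Lemma crossE i j x y : Z i x -> Z j y ->
  cross Z2 B2 (tens (ecl Z B i x) (ecl Z B j y)) = ecl Z2 B2 (i + j) (tens x y).
Proof.
move=> Zx Zy; rewrite /cross tliftE.
  exact: (smul_cls_ecl hZ hB hZ hB hZ2 hB2 (@tens_bilin _ _ _) fZ fBl fBr).
exact: (smul_cls_bilin hZ hB hZ hB hZ2 hB2 (@tens_bilin _ _ _) fZ fBl fBr).
Qed.
End Cross.
End SqMaps.

Lemma lin_of_inj (k : fieldType) (V W U : lmodType k) (f : W -> U) (g : V -> W) :
  linear f -> injective f -> linear (fun x => f (g x)) -> linear g.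
Proof. by move=> hf fi hfg a x y; apply: fi; rewrite hf hfg. Qed.

Lemma fil_mono (T : Type) (Fi : int -> set T) : (forall q, Fi (q - 1) `<=` Fi q) ->
  forall i j, i <= j -> Fi i `<=` Fi j.
Proof.
move=> Fi1 i j; rewrite -subr_ge0 => ij; rewrite -[j](subrK i) -(gez0_abs ij) addrC.
elim: `|_|%N => [|n IH]; first by rewrite addr0.
by move=> x /IH Fx; apply: Fi1; rewrite -addn1 PoszD addrA addrK.
Qed.

Section SqDgc.
Variables (k : fieldType) (C : dgc k int) (Z B : int -> set C) (Z2 B2 : int -> set (tensor C C)).
Variable dd : sqsum Z B -> sqsum Z B.
Hypotheses (hg : is_grading C) (hZ : forall q, is_subspace (Z q)) (hB : forall q, is_subspace (B
  q)).
Hypotheses (gZ : forall q x, Z q x -> forall i, Z q (hcomp x i))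
  (gB : forall q x, Z q x -> B q x -> forall i, B q (hcomp x i)).
Let D := sqdgc Z2 B2 dd.
Let cl := ecl Z B.

(** The projection onto bidegree (p, q) takes the component of degree p + q of a representative in
    filtration q. It descends to the quotient because Z and B are closed under homogeneous
    components. *)
Lemma sqdgc_grading : is_grading D.
Proof.
have prh (pq : int * int) : exists F : sqsum Z B -> sqsum Z B, linear F /\
    forall q z, Z q z -> F (cl q z) = if q == pq.2 then cl q (hcomp z (pq.1 + pq.2)) else 0.
  apply: (sqlift hZ hB (f := fun q z => if q == pq.2 then cl q (hcomp z (pq.1 + pq.2)) else 0)).
    move=> q a u v Zu Zv; case: ifP => _; last by rewrite scaler0 addr0.
    by rewrite (hcompi_lin hg) /cl ecl_lin //; apply: gZ.
  move=> q v Zv Bv; case: ifP => // _; apply/ecl_eq0 => //; first exact: gZ.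
  exact: gB.
have /choice[pr prP] := prh.
have prl pq : linear (pr pq) by have [] := prP pq.
have prE pq q z : Z q z ->
    pr pq (cl q z) = if q == pq.2 then cl q (hcomp z (pq.1 + pq.2)) else 0.
  by have [_] := prP pq; apply.
apply: (@grading_criterion _ _ D pr).
- move=> [p q]; split.
    exists 0; split; [exact: subsp0|exact: (subsp0 (pc_subspace hg _))|].
    by rewrite -[RHS]/(cl q 0) /cl ecl0.
  move=> a _ _ [x [Zx px ->]] [y [Zy py ->]]; exists (a *: x + y); split.
  + exact: (hZ q).2.
  + exact: (pc_subspace hg _).2.
  + by rewrite -[RHS]/(cl q (a *: x + y)) /cl ecl_lin.
- move=> P P0 PD Pi; apply: (sqsum_ind hZ hB) => // q z Zz.
  have [s [_ _ zE]] := decomposition_hcomp hg z.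
  have -> : ecl Z B q z = \sum_(i <- s) cl q (hcomp z i).
    rewrite {1}zE; elim: (s) => [|i r IH]; first by rewrite !big_nil ecl0.
    rewrite !big_cons eclD ?IH //; first exact: gZ.
    by apply: subsp_sum => // j _; apply: gZ.
  apply: big_ind => // i _; apply: (Pi (i - q, q)); exists (hcomp z i) => /=.
  by rewrite subrK; split=> //; [exact: gZ|exact: hcomp_mem].
- exact: prl.
- move=> [p q] _ [z [/= Zz pz ->]]; rewrite -/(ecl Z B q z) -/(cl q z) prE // eqxx.
  by rewrite (hcomp_id hg pz).
- move=> [p q] [p' q'] _ [z [/= Zz pz ->]] ne.
  rewrite -/(ecl Z B q' z) -/(cl q' z) prE //=; case: eqP => // qq.
  rewrite (hcomp_neq hg pz) ?/cl ?ecl0 // => e; apply: ne.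
  by move: e; rewrite qq => /addIr ->.
Qed.

Lemma sqdgc_sgn q z : (forall i, deg C i = i) -> Z q z -> sgn (cl q z : D) = cl q (sgn z).
Proof.
move=> hdeg Zz; have g := sqdgc_grading.
have gsgn (Y : set C) x : is_subspace Y -> (forall i, Y (hcomp x i)) -> Y (sgn x).
  by move=> hY h; apply: (fsum_mem (J := {classic int})
    (phi := fun i x => (-1) ^ deg C i *: x)) => // i; [apply: lin_scale|apply: subspZ].
have sZ q' x : Z q' x -> Z q' (sgn x) by move=> Zx; apply: gsgn => //; apply: gZ.
have [F [Fl FE]] : exists F : D -> D, linear F /\ forall q z, Z q z -> F (cl q z) = cl q (sgn z).
  apply: (sqlift hZ hB (f := fun q z => cl q (sgn z))).
    move=> q' a u v Zu Zv; rewrite (sgn_lin hg) /cl ecl_lin //; exact: sZ.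
  move=> q' v Zv Bv; apply/ecl_eq0 => //; first exact: sZ.
  by apply: gsgn => //; apply: gB.
rewrite -FE //; move: (cl q z : D); apply: (homog_ext g (sgn_lin g) Fl).
move=> [p q'] x xp; rewrite (sgn_pc g xp) /=; case: xp => y [/= Zy py ->].
rewrite -/(ecl Z B q' y) -/(cl q' y) FE // (sgn_pc hg py) hdeg /cl eclZ //.
Qed.

Hypotheses (el : linear (@eps _ _ C : C -> k^o)) (eB : forall x, Z 0 x -> B 0 x -> eps x = 0).

Let e0l a (u v : fs int C) : dsumset Z u -> dsumset Z v ->
  (eps ((a *: u + v : fs int C) 0) : k^o) = a *: (eps (u 0) : k^o) + eps (v 0).
Proof. by move=> _ _; rewrite fsDE fsZE el. Qed.
Let e0B (v : fs int C) : dsumset Z v -> dsumset B v -> (eps (v 0) : k^o) = 0.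
Proof. by move=> Zv Bv; apply: eB. Qed.

Lemma sqdgc_eps_lin : linear (@eps _ _ D : D -> k^o).
Proof.
exact: (sq_lift_lin (dsumset_subspace hZ) (dsumset_subspace hB)
  (f := fun v : fs int C => eps (v 0) : k^o) e0l e0B).
Qed.
Lemma sqdgc_eps_ecl q z : Z q z -> eps (cl q z : D) = if q == 0 then eps z else 0.
Proof.
move=> Zz; apply: (etrans (sq_liftE (dsumset_subspace hZ) (dsumset_subspace hB)
  (f := fun v : fs int C => eps (v 0) : k^o) e0l e0B (dsumset_single hZ Zz))).
rewrite singleE eq_sym; case: asboolP => [<-|/eqP/negPf ->]; first by rewrite eqxx.
by rewrite (lin0 el).
Qed.
End SqDgc.

(** * The Kuenneth map and the coalgebra laws of associated graded objects *)

Section Symbols.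
Variables (k : fieldType) (V : lmodType k) (Fil : int -> set V).
Hypotheses (hF : forall q, is_subspace (Fil q)) (F1 : forall q, Fil (q - 1) `<=` Fil q).
Let Fil2 := pc2 Fil Fil.
Let B := below Fil.
Let B2 := below Fil2.
Let hB q : is_subspace (B q). Proof. exact: hF. Qed.
Let hF2 q : is_subspace (Fil2 q). Proof. exact: pc2_subspace. Qed.
Let hB2 q : is_subspace (B2 q). Proof. exact: pc2_subspace. Qed.
Let E := sqsum Fil B.
Let E2 := sqsum Fil2 B2.
Let el : int -> V -> E := ecl Fil B.
Let el2 : int -> tensor V V -> E2 := ecl Fil2 B2.

Lemma gr_cross_lin : linear (@cross _ _ Fil B Fil2 B2).
Proof.
apply: cross_lin => //.
- by move=> i j x y Fx Fy; apply: pc2_tens.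
- by move=> i j x y _ Bx Fy; rewrite /B2 /below addrAC; apply: pc2_tens.
- by move=> i j x y Fx _ By; rewrite /B2 /below -addrA; apply: pc2_tens.
Qed.

Lemma gr_crossE i j x y : Fil i x -> Fil j y ->
  cross Fil2 B2 (tens (el i x) (el j y)) = el2 (i + j) (tens x y).
Proof.
apply: crossE => //.
- by move=> i' j' x' y' Fx Fy; apply: pc2_tens.
- by move=> i' j' x' y' _ Bx Fy; rewrite /B2 /below addrAC; apply: pc2_tens.
- by move=> i' j' x' y' Fx _ By; rewrite /B2 /below -addrA; apply: pc2_tens.
Qed.

Lemma gr_cross_surj e2 : exists t : tensor E E, cross Fil2 B2 t = e2.
Proof.
move: e2; apply: (sqsum_ind hF2 hB2).
- by exists 0; rewrite (lin0 gr_cross_lin).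
- by move=> x y [s <-] [t <-]; exists (s + t); rewrite (linD gr_cross_lin).
move=> q z Fz.
have h : forall z, Fil2 q z -> Fil2 q z /\ exists t : tensor E E, cross Fil2 B2 t = el2 q z.
  apply: pc2_sub => [|i j x y <- Fx Fy]; last first.
    by split; [exact: pc2_tens|exists (tens (el i x) (el j y)); apply: gr_crossE].
  split; first by split; [exact: (subsp0 (hF2 q))|exists 0; rewrite (lin0 gr_cross_lin) /el2 ecl0].
  move=> a u v [Fu [s es]] [Fv [t et]]; split; first exact: (hF2 q).2.
  by exists (a *: s + t); rewrite gr_cross_lin es et /el2 ecl_lin.
exact: (h z Fz).2.
Qed.

Section Leading.
Variables (P : int -> E -> E) (pi : int -> V -> E).
Hypotheses (Pl : forall i, linear (P i))
  (PE : forall i q z, Fil q z -> P i (el q z) = if q == i then el q z else 0)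
  (pil : forall i, linear (pi i)) (piE : forall i v, Fil i v -> pi i v = el i v).

Lemma pi_below i j x : Fil j x -> j < i -> pi i x = 0.
Proof.
move=> Fx ji; have Fx' : Fil (i - 1) x.
  by apply: (fil_mono F1) Fx; rewrite -ltzD1 subrK.
by rewrite piE; [apply/ecl_eq0 => //; exact: F1|exact: F1].
Qed.

(* The leading part in bidegree (i,j) of an element of [Fil2 (i + j)]: the map
   [pi i (x) pi j] vanishes on [Fil a (x) Fil b] unless [a >= i] and [b >= j]. *)
Lemma tmap_pi_tens i j a b x y : Fil a x -> Fil b y -> a + b = i + j ->
  tmap (pi i) (pi j) (tens x y) = tmap (P i) (P j) (tens (el a x) (el b y)).
Proof.
move=> Fx Fy ab; rewrite !tmapE // !PE //.
have [ai|ai|ai] := ltgtP a i.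
- by rewrite (pi_below Fx ai) !tens0l.
- have bj : b < j by rewrite -(ltrD2l a) ab ltrD2r.
  by rewrite (pi_below Fy bj) tens0r tens0l.
move: ab; rewrite ai => /addrI bj; subst a b.
by rewrite eqxx !piE.
Qed.

Lemma tmap_pi_below i j t : Fil2 (i + j - 1) t -> tmap (pi i) (pi j) t = 0.
Proof.
move: t; apply: pc2_sub => [|a b x y ab Fx Fy].
  exact: (subspace_eq0 (tmap_lin (pil i) (pil j)) (@lin_zero _ _ _)).
have ab' : a < i \/ b < j.
  have [|ia] := ltP a i; [by left|right]; rewrite -(ltrD2l i).
  apply: (le_lt_trans (y := a + b)); first by rewrite lerD2r.
  by rewrite ab ltrBlDr ltrDl.
rewrite /= tmapE //; case: ab' => [ai|bj].
  by rewrite (pi_below Fx ai) tens0l.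
by rewrite (pi_below Fy bj) tens0r.
Qed.

(** [Phi i j] reads off the part of bidegree (i, j) of a tensor of filtration i + j. After the
    Kuenneth map it gives P i (x) P j, so an element of the kernel of that map has no components at
    all. *)
Lemma symbol_ex : exists Phi : int -> int -> E2 -> tensor E E,
  [/\ forall i j, linear (Phi i j),
      forall i j q w, Fil2 q w ->
        Phi i j (el2 q w) = if q == i + j then tmap (pi i) (pi j) w else 0 &
      forall i j t, Phi i j (cross Fil2 B2 t) = tmap (P i) (P j) t].
Proof.
have h (ij : int * int) : exists F : E2 -> tensor E E, linear F /\ forall q w, Fil2 q w ->
    F (el2 q w) = if q == ij.1 + ij.2 then tmap (pi ij.1) (pi ij.2) w else 0.
  apply: (sqlift hF2 hB2 (f := fun q w => if q == ij.1 + ij.2 then tmap (pi ij.1) (pi ij.2) w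
    else 0)).
    by move=> q a u v _ _; case: ifP => _; [rewrite tmap_lin|rewrite scaler0 addr0].
  by move=> q v _ Bv; case: eqP => // qE; apply: tmap_pi_below; rewrite -qE.
have [Phi PhiP] := choice h.
have Phil i j : linear (Phi (i, j)) by have [] := PhiP (i, j).
have PhiE i j q w : Fil2 q w ->
    Phi (i, j) (el2 q w) = if q == i + j then tmap (pi i) (pi j) w else 0.
  by have [_] := PhiP (i, j); apply.
exists (fun i j => Phi (i, j)); split=> // i j.
have cl := gr_cross_lin.
apply: tens_ext => [||e e']; [exact: lin_comp (Phil i j) cl|exact: tmap_lin|].
move: e; apply: (sqsum_ext hF hB) => [||a x Fx].
- exact: lin_comp (Phil i j) (lin_comp cl (tens_linl _)).
- exact: lin_comp (tmap_lin (Pl i) (Pl j)) (tens_linl _).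
move: e'; apply: (sqsum_ext hF hB) => [||b y Fy].
- exact: lin_comp (Phil i j) (lin_comp cl (tens_linr _)).
- exact: lin_comp (tmap_lin (Pl i) (Pl j)) (tens_linr _).
rewrite [cross _ _ _]gr_crossE // PhiE; last exact: pc2_tens.
case: eqP => [ab|ab]; first exact: tmap_pi_tens.
rewrite tmapE // !PE //; case: eqP => [ai|_]; last by rewrite tens0l.
by case: eqP => [bj|_]; [case: ab; rewrite ai bj|rewrite tens0r].
Qed.
End Leading.

Lemma leading_ex : exists P pi, [/\ forall i, linear (P i),
    (forall i q z, Fil q z -> P i (el q z) = if q == i then el q z else 0) /\ decomposition P,
    forall i, linear (pi i) & forall i v, Fil i v -> pi i v = el i v].
Proof.
have [P [Pl PE]] := sqproj_ex hF hB.
have /choice[pi piP] := ecl_ext B hF.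
exists P, pi; split=> //; first by split=> //; exact: (sqproj_dec hF hB Pl PE).
- by move=> i; have [] := piP i.
- by move=> i; have [_] := piP i.
Qed.

Lemma gr_cross_bij : bijective (@cross _ _ Fil B Fil2 B2).
Proof.
apply: bijective_of; last exact: gr_cross_surj.
apply: lin_inj gr_cross_lin _ => t t0.
have [P [pi [Pl [PE dP] pil piE]]] := leading_ex.
have [Phi [Phil PhiE PhiC]] := symbol_ex Pl PE pil piE.
apply: (decomposition_sep _ (decomposition_tens Pl Pl dP dP)) => [ij|[i j] /=].
  exact: tmap_lin.
by rewrite -PhiC t0 (lin0 (Phil i j)) (lin0 (tmap_lin (Pl i) (Pl j))).
Qed.
End Symbols.

Section Leading.
Variables (k : fieldType) (V E : lmodType k) (Fil : int -> set V) (el : int -> V -> E).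
Hypotheses (hFs : forall q, is_subspace (Fil q)) (F1 : forall q, Fil (q - 1) `<=` Fil q).
Variables (cE : E -> tensor E E) (cV : V -> tensor V V).
Hypotheses (clE : linear cE) (cl : linear cV).
Variables (P : int -> E -> E) (pi : int -> V -> E).
Hypotheses (Pl : forall i, linear (P i))
  (PE : forall i q z, Fil q z -> P i (el q z) = if q == i then el q z else 0)
  (dP : decomposition P) (pil : forall i, linear (pi i))
  (piE : forall i v, Fil i v -> pi i v = el i v)
  (pi_lt : forall i j x, Fil j x -> j < i -> pi i x = 0).
Hypothesis el_ind : forall R : E -> Prop, R 0 -> (forall x y, R x -> R y -> R (x + y)) ->
  (forall q z, Fil q z -> R (el q z)) -> forall e, R e.
Hypothesis Tcop : forall i j q x, Fil q x ->
  tmap (P i) (P j) (cE (el q x)) = if q == i + j then tmap (pi i) (pi j) (cV x) else 0.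
Hypothesis copF : forall q x, Fil q x -> pc2 Fil Fil q (cV x).
Let Fil2 := pc2 Fil Fil.

Let el_ext (W : lmodType k) (f g : E -> W) : linear f -> linear g ->
  (forall q z, Fil q z -> f (el q z) = g (el q z)) -> f =1 g.
Proof.
move=> hf hg fg; apply: el_ind => // [|x y fx fy].
  by rewrite (lin0 hf) (lin0 hg).
by rewrite (linD hf) (linD hg) fx fy.
Qed.

Let Tl i j : linear (fun e => tmap (P i) (P j) (cE e)).
Proof. exact: lin_comp (tmap_lin (Pl i) (Pl j)) clE. Qed.

Let TP i j e : tmap (P i) (P j) (cE e) = tmap (P i) (P j) (cE (P (i + j) e)).
Proof.
move: e; apply: el_ext => [||q x Fx]; first exact: Tl.
  exact: lin_comp (Tl i j) (Pl _).
rewrite Tcop // PE //; case: ifP => [qE|_]; first by rewrite Tcop // qE.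
by rewrite (lin0 (Tl i j)).
Qed.

(** If the left factor has filtration at most i + j, then [Tcop] applies to it; otherwise the right
    factor has filtration below l and is killed by [pi l]. *)
Let Tpi i j l w : Fil2 (i + j + l) w ->
    tmap (fun x => tmap (P i) (P j) (cE (pi (i + j) x))) (pi l) w =
    tmap (fun x => tmap (pi i) (pi j) (cV x)) (pi l) w.
Proof.
have l1 : linear (fun x => tmap (P i) (P j) (cE (pi (i + j) x))) by exact: lin_comp (Tl i j) (pil
  _).
have l2 : linear (fun x => tmap (pi i) (pi j) (cV x)) by exact: lin_comp (tmap_lin (pil i) (pil
  j)) cl.
move: w; apply: pc2_sub => [|a b x y ab Fx Fy];
  first exact: (subspace_eq0 (tmap_lin l1 (pil l)) (tmap_lin l2 (pil l))).
rewrite /mkset (tmapE _ _ l1 (pil l)) (tmapE _ _ l2 (pil l)); have [aij|aij] := leP a (i + j).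
  have Fx' := fil_mono F1 aij Fx.
  by rewrite piE // Tcop // eqxx.
have bl : b < l by rewrite -(ltrD2l a) ab ltrD2r.
by rewrite (pi_lt Fy bl) !tens0r.
Qed.

Let Tpi' i j l w : Fil2 (i + (j + l)) w ->
    tmap (pi i) (fun x => tmap (P j) (P l) (cE (pi (j + l) x))) w =
    tmap (pi i) (fun x => tmap (pi j) (pi l) (cV x)) w.
Proof.
have l1 : linear (fun x => tmap (P j) (P l) (cE (pi (j + l) x))) by exact: lin_comp (Tl j l) (pil
  _).
have l2 : linear (fun x => tmap (pi j) (pi l) (cV x)) by exact: lin_comp (tmap_lin (pil j) (pil
  l)) cl.
move: w; apply: pc2_sub => [|a b x y ab Fx Fy];
  first exact: (subspace_eq0 (tmap_lin (pil i) l1) (tmap_lin (pil i) l2)).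
rewrite /mkset (tmapE _ _ (pil i) l1) (tmapE _ _ (pil i) l2); have [bjl|bjl] := leP b (j + l).
  have Fy' := fil_mono F1 bjl Fy.
  by rewrite [pi (j + l) y]piE // Tcop // eqxx.
have ai : a < i by rewrite -(ltrD2r b) ab ltrD2l.
by rewrite (pi_lt Fx ai) !tens0l.
Qed.

(** In component (i, j, l) both sides become [pi i], [pi j] and [pi l] applied to the iterated
    coproduct of x, where coassociativity is given. *)
Lemma leading_coassoc : (forall x, tassoc (tmap cV id (cV x)) = tmap id cV (cV x)) ->
  forall e, tassoc (tmap cE id (cE e)) = tmap id cE (cE e).
Proof.
move=> coassoc.
have idE := @lin_id k E; have idC := @lin_id k V.
have l1 : linear (tmap cE id) := tmap_lin clE idE.
have l2 : linear (tmap id cE) := tmap_lin idE clE.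
apply: el_ext => [||q x Fx].
- exact: lin_comp (@tassoc_lin _ _ _ _) (lin_comp l1 clE).
- exact: lin_comp l2 clE.
have PPl i j := tmap_lin (Pl i) (Pl j).
have dPP := decomposition_tens Pl Pl dP dP.
apply: (decomposition_sep _ (decomposition_tens Pl (fun ij => PPl ij.1 ij.2) dP dPP)).
  by move=> [i [j l]]; exact: tmap_lin (Pl _) (PPl _ _).
move=> [i [j l]] /=; rewrite -tassoc_tmap // (tmap_comp _ clE idE (PPl i j) (Pl l)).
rewrite (tmap_comp _ idE clE (Pl i) (PPl j l)).
rewrite (tmap_eq (f' := (fun e => tmap (P i) (P j) (cE e)) \o P (i + j)) (g' := id \o P l) _ (TP
  i j) (fun=> erefl)).
rewrite -(tmap_comp _ (Pl (i + j)) (Pl l) (Tl i j) idE) Tcop //.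
rewrite (tmap_eq (f' := id \o P i) (g' := (fun e => tmap (P j) (P l) (cE e)) \o P (j + l)) _
  (fun=> erefl) (TP j l)).
rewrite -(tmap_comp _ (Pl i) (Pl (j + l)) idE (Tl j l)) Tcop // addrA.
case: eqP => [qE|_]; last first.
  by rewrite (lin0 (tmap_lin (Tl i j) idE)) (lin0 (@tassoc_lin _ _ _ _)) (lin0 (tmap_lin idE (Tl
    j l))).
have Fc := copF Fx; rewrite qE in Fc.
rewrite (tmap_comp _ (pil (i + j)) (pil l) (Tl i j) idE) [tmap _ _ (cV x)]Tpi //.
rewrite (tmap_comp _ (pil i) (pil (j + l)) idE (Tl j l)).
rewrite -addrA in Fc; rewrite [in RHS]Tpi' //.
have pipil i' j' := tmap_lin (pil i') (pil j').
have -> : tmap (fun x => tmap (pi i) (pi j) (cV x)) (pi l) (cV x)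
   = tmap (tmap (pi i) (pi j)) (pi l) (tmap cV id (cV x)).
  by rewrite (tmap_comp _ cl idC (pipil i j) (pil l)).
have -> : tmap (pi i) (fun x => tmap (pi j) (pi l) (cV x)) (cV x)
   = tmap (pi i) (tmap (pi j) (pi l)) (tmap id cV (cV x)).
  by rewrite (tmap_comp _ idC cl (pil i) (pipil j l)).
by rewrite tassoc_tmap // coassoc.
Qed.

Variables (eE : E -> k) (eV : V -> k).
Hypotheses (eEl : linear (eE : E -> k^o)) (eVl : linear (eV : V -> k^o))
  (eel : forall q z, Fil q z -> eE (el q z) = if q == 0 then eV z else 0).

Let eP y : eE y = eE (P 0 y).
Proof.
move: y; apply: (el_ext (W := k^o)) => [//||a y Fy]; first exact: lin_comp eEl (Pl 0).
rewrite PE // eel //; have [a0|_] := eqVneq a 0; last by rewrite (lin0 eEl).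
by rewrite eel // a0 eqxx.
Qed.

(** The counit of E factors through [P 0], so component l only involves [P 0] (x) [P l]. In the
    coproduct of x, a term whose left filtration exceeds 0 has right filtration below l and vanishes
    under [pi l]. *)
Lemma leading_counitl : (forall x, tlift (fun y z => eV y *: z) (cV x) = x) ->
  forall e, tlift (fun y z => eE y *: z) (cE e) = e.
Proof.
move=> counit.
have eb : bilin (fun y z : E => eE y *: z).
  by split=> w; [apply: lin_scalel|apply: lin_scale].
have eb' : bilin (fun y z : V => eV y *: z).
  by split=> w; [apply: lin_scalel|apply: lin_scale].
have L := tlift_lin eb; have L' := tlift_lin eb'.
apply: el_ext => [||q x Fx]; [exact: lin_comp L clE|by []|].
apply: (decomposition_sep Pl dP) => l.
have -> u : P l (tlift (fun y z : E => eE y *: z) u) = tlift (fun y z : E => eE y *: z) (tmap (P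
  0) (P l) u).
  move: u; apply: tens_ext => [||y z]; [exact: lin_comp (Pl l) L|exact: lin_comp L (tmap_lin (Pl
    0) (Pl l))|].
  by rewrite (tmapE _ _ (Pl _) (Pl _)) !(tliftE eb) (linZ _ (Pl l)) -eP.
rewrite Tcop // PE // add0r; case: eqP => [ql|_]; last by rewrite (lin0 L).
subst q; rewrite -piE // -[in RHS](counit x).
have := copF Fx; move: (cV x); apply: pc2_sub => [|a b y z ab Fy Fz].
  exact: (subspace_eq0 (lin_comp L (tmap_lin (pil _) (pil _))) (lin_comp (pil l) L')).
rewrite /mkset (tmapE _ _ (pil _) (pil _)) (tliftE eb) (tliftE eb') (linZ _ (pil l)).
have [a0|a0] := leP a 0.
  by have Fy0 := fil_mono F1 a0 Fy; rewrite [pi 0 y]piE // eel.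
have bl : b < l by rewrite -(ltrD2l a) ab ltrDr.
by rewrite (pi_lt Fz bl) !scaler0.
Qed.

Lemma leading_counitr : (forall x, tlift (fun y z => eV z *: y) (cV x) = x) ->
  forall e, tlift (fun y z => eE z *: y) (cE e) = e.
Proof.
move=> counit.
have eb : bilin (fun y z : E => eE z *: y).
  by split=> w; [apply: lin_scale|apply: lin_scalel].
have eb' : bilin (fun y z : V => eV z *: y).
  by split=> w; [apply: lin_scale|apply: lin_scalel].
have L := tlift_lin eb; have L' := tlift_lin eb'.
apply: el_ext => [||q x Fx]; [exact: lin_comp L clE|by []|].
apply: (decomposition_sep Pl dP) => l.
have -> u : P l (tlift (fun y z : E => eE z *: y) u) = tlift (fun y z : E => eE z *: y) (tmap (P
  l) (P 0) u).
  move: u; apply: tens_ext => [||y z]; [exact: lin_comp (Pl l) L|exact: lin_comp L (tmap_lin (Pl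
    l) (Pl 0))|].
  by rewrite (tmapE _ _ (Pl _) (Pl _)) !(tliftE eb) (linZ _ (Pl l)) -eP.
rewrite Tcop // PE // addr0; case: eqP => [ql|_]; last by rewrite (lin0 L).
subst q; rewrite -piE // -[in RHS](counit x).
have := copF Fx; move: (cV x); apply: pc2_sub => [|a b y z ab Fy Fz].
  exact: (subspace_eq0 (lin_comp L (tmap_lin (pil _) (pil _))) (lin_comp (pil l) L')).
rewrite /mkset (tmapE _ _ (pil _) (pil _)) (tliftE eb) (tliftE eb') (linZ _ (pil l)).
have [b0|b0] := leP b 0.
  by have Fz0 := fil_mono F1 b0 Fz; rewrite [pi 0 z]piE // eel.
have al : a < l by rewrite -(ltrD2r b) ab ltrDl.
by rewrite (pi_lt Fy al) !scaler0.
Qed.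
End Leading.

Section GrDgc.
Variables (k : fieldType) (C : dgc k int) (Fil : int -> set C) (s : int).
Hypotheses (hC : is_dgc s C) (hF : is_filtered_dgc Fil).
Hypothesis epsF : forall x, Fil (-1) x -> eps x = 0.
Let hg := dgc_grading hC.
Let hFs := fil_subspace hF.
Let F1 := fil_incr hF.
Let Fil2 := pc2 Fil Fil.
Let E := gr Fil.
Let el : int -> C -> E := ecl Fil (below Fil).
Let el2 := ecl Fil2 (below Fil2).
Let hB q : is_subspace (below Fil q). Proof. exact: hFs. Qed.
Let hF2 q : is_subspace (Fil2 q). Proof. exact: pc2_subspace. Qed.
Let hB2 q : is_subspace (below Fil2 q). Proof. exact: pc2_subspace. Qed.
Let cl := dgc_cop_linear hC.
Let epl := dgc_eps_linear hC.

Let copF q x : Fil q x -> Fil2 (q + 0) (cop x).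
Proof. by rewrite addr0; exact: (fil_cop hF). Qed.
Let copB q x : Fil q x -> below Fil q x -> below Fil2 (q + 0) (cop x).
Proof. by rewrite addr0 => _; exact: (fil_cop hF). Qed.

Let cross_cop (e : E) :
  cross Fil2 (below Fil2) (cop e) = scls Fil2 (below Fil2) (smap 0 (@cop _ _ C) (rep e)).
Proof. exact: (preinvE _ _ (gr_cross_bij hFs F1)). Qed.

Lemma gr_cross_cop q x : Fil q x ->
  cross Fil2 (below Fil2) (cop (el q x)) = el2 q (cop x).
Proof.
move=> Fx; rewrite cross_cop.
apply: (etrans (smap_ecl hFs hB hF2 hB2 cl copF copB Fx)).
by rewrite addr0.
Qed.

Lemma gr_cop_lin : linear (@cop _ _ E).
Proof.
have h : linear (fun e : E => cross Fil2 (below Fil2) (cop e)).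
  by apply: lin_eq (smap_cls_lin hFs hB hF2 hB2 cl copF copB) => e; rewrite cross_cop.
exact: (@lin_of_inj k E (tensor E E) _ _ (@cop _ _ E) (gr_cross_lin hFs)
  (bij_inj (gr_cross_bij hFs F1)) h).
Qed.

Let gr_grading : is_grading E.
Proof.
apply: sqdgc_grading => //.
- by move=> q x Fx i; exact: (fil_graded hF Fx).
- by move=> q x _ Bx i; exact: (fil_graded hF Bx).
Qed.
Let eps_lin : linear (@eps _ _ E : E -> k^o).
Proof. by apply: sqdgc_eps_lin => // x _; rewrite /below sub0r; apply: epsF. Qed.
Let eps_ecl q z : Fil q z -> eps (el q z) = if q == 0 then eps z else 0.
Proof. by move=> Fz; apply: sqdgc_eps_ecl => // x _; rewrite /below sub0r; apply: epsF. Qed.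

(** Projecting to pairs of homogeneous components respects the filtration and kills all pairs whose
    degrees do not add up to i. *)
Lemma pc2_homogeneous q i t : Fil2 q t -> pc2 (@pc _ _ C) (@pc _ _ C) i t ->
  t \in lspan [set t' | exists a b i1 i2 x y, [/\ a + b = q, i1 + i2 = i,
    Fil a x /\ pc i1 x, Fil b y /\ pc i2 y & t' = tens x y]].
Proof.
move=> Ft it; have hl := hcompi_lin hg; have dh := decomposition_hcomp hg.
have [r [_ _ ->]] := @decomposition_tens _ _ _ {classic int} {classic int} _ _ hl hl dh dh t.
apply: rpred_sum => -[i1 i2] _ /=.
have [ij|ij] := eqVneq (i1 + i2) i; last first.
  have -> : tmap (fun x : C => hcomp x i1 : C) (fun x : C => hcomp x i2) t = 0; last exact: rpred0.
  move: it; clear Ft; move: t; apply: pc2_sub => [|a b x y ab ax bY].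
    exact: (subspace_eq0 (tmap_lin (hl i1) (hl i2)) (@lin_zero _ _ _)).
  rewrite /= tmapE //; have [ai|ai] := eqVneq i1 a; last first.
    by rewrite (hcomp_neq hg ax (elimN eqP ai)) tens0l.
  have [bi|bi] := eqVneq i2 b; last by rewrite (hcomp_neq hg bY (elimN eqP bi)) tens0r.
  by rewrite ai bi ab eqxx in ij.
move: Ft; clear it; move: t; apply: pc2_sub => [|a b x y ab Fx Fy].
  exact: (subspace_preim (tmap_lin (hl i1) (hl i2)) (lspan_subspace _)).
rewrite /= tmapE //; apply: lspan_mem.
exists a, b, i1, i2, (hcomp x i1), (hcomp y i2); split=> //.
  by split; [exact: (fil_graded hF Fx)|apply: hcomp_mem].
by split; [exact: (fil_graded hF Fy)|apply: hcomp_mem].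
Qed.

Lemma gr_is_dgc s' : is_dgc s' E.
Proof.
have [P [pi [Pl [PE dP] pil piE]]] : exists (P : int -> E -> E) (pi : int -> C -> E),
    [/\ forall i, linear (P i),
      (forall i q z, Fil q z -> P i (el q z) = if q == i then el q z else 0) /\ decomposition P,
      forall i, linear (pi i) & forall i v, Fil i v -> pi i v = el i v] := leading_ex hFs.
have [Phi [Phil PhiE PhiC]] := symbol_ex hFs F1 Pl PE pil piE.
have clE := gr_cop_lin.
have idE := @lin_id k E; have idC := @lin_id k C.
have Tcop i j q x : Fil q x ->
    tmap (P i) (P j) (cop (el q x)) = if q == i + j then tmap (pi i) (pi j) (cop x) else 0.
  by move=> Fx; rewrite -PhiC (gr_cross_cop Fx) PhiE //; exact: (fil_cop hF).
have pi_lt i j x : Fil j x -> j < i -> pi i x = 0 by exact: (pi_below hFs F1 piE).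
have gr_ind (R : E -> Prop) : R 0 -> (forall x y, R x -> R y -> R (x + y)) ->
    (forall q z, Fil q z -> R (el q z)) -> forall e, R e by exact: (sqsum_ind hFs hB).
split.
- exact: gr_grading.
- exact: lin_zero.
- exact: clE.
- exact: eps_lin.
- by move=> i x _; apply: subsp0; exact: (pc_subspace gr_grading).
- move=> [p q] _ [z [/= Fz pz ->]].
  have := pc2_homogeneous (fil_cop hF Fz) (dgc_cop_pc hC pz).
  rewrite -/(ecl Fil (below Fil) q z) -/(el q z).
  set S := [set t' | _] => zS.
  (* The coproduct of a class is known only through the Kuenneth map. So a preimage t of bidegree
     (p, q) is built from bihomogeneous products and then identified with the coproduct by
     injectivity. *)
  have [t tpc tE] : exists2 t : tensor E E, pc2 (@pc _ _ E) (@pc _ _ E) (p, q) t &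
      cross Fil2 (below Fil2) t = el2 q (cop z).
    have h : Fil2 q (cop z) /\ exists2 t : tensor E E, pc2 (@pc _ _ E) (@pc _ _ E) (p, q) t &
        cross Fil2 (below Fil2) t = el2 q (cop z).
      move: (cop z) zS; apply: lspan_ind.
      + split; first exact: subsp0.
        exists 0; first exact: subsp0 (pc2_subspace _ _ _).
        by rewrite (lin0 (gr_cross_lin hFs)) /el2 ecl0.
      + move=> u v [Fu [t tp te]] [Fv [t' tp' te']]; split; first exact: subspD.
        exists (t + t'); first exact: subspD (pc2_subspace _ _ _) _ _.
        by rewrite (linD (gr_cross_lin hFs)) te te' /el2 eclD.
      + move=> c _ [a [b [i1 [i2 [x [y [ab i12 [Fx px] [Fy py] ->]]]]]]].
        have Fxy : Fil2 q (tens x y) by rewrite -ab; apply: pc2_tens.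
        split; first exact: subspZ.
        exists (c *: tens (el a x) (el b y)).
          apply: subspZ; first exact: pc2_subspace.
          have -> : (p, q) = (i1 - a, a) + (i2 - b, b).
            by congr pair; rewrite /= ?ab // addrACA -opprD ab i12 addrK.
          by apply: pc2_tens; [exists x|exists y]; split=> //=; rewrite subrK.
        rewrite (linZ _ (gr_cross_lin hFs)) [cross _ _ _](gr_crossE hFs) // ab.
        by rewrite /el2 eclZ.
    exact: h.2.
  have copE : cop (el q z) = t.
    by apply: (bij_inj (gr_cross_bij hFs F1)); rewrite tE; exact: gr_cross_cop.
  by move: tpc; rewrite -copE.
- move=> [p q] _ [z [/= Fz pz ->]] pq0; apply: (etrans (eps_ecl Fz)).
  have [q0|//] := eqVneq q 0; subst q; apply: (dgc_eps_pc hC pz); apply: contraNN pq0.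
  by rewrite /= addr0 => /eqP ->.
- by [].
- exact: (leading_coassoc F1 clE cl Pl PE dP pil piE pi_lt gr_ind Tcop (fil_cop hF) (dgc_coassoc
  hC)).
- exact: (leading_counitl F1 clE Pl PE dP pil piE pi_lt gr_ind Tcop (fil_cop hF) eps_lin epl
  eps_ecl (dgc_counitl hC)).
- exact: (leading_counitr F1 clE Pl PE dP pil piE pi_lt gr_ind Tcop (fil_cop hF) eps_lin epl
  eps_ecl (dgc_counitr hC)).
- move=> e; rewrite (lin0 clE); apply/esym.
  have sl := sgn_lin gr_grading.
  move: (cop e); apply: tens_ext => [||x y].
  + exact: (dtens_lin (@lin_zero _ _ _) sl).
  + exact: lin_zero.
  + by rewrite [dif2 _](dtensE (@lin_zero _ _ _) sl) tens0l tens0r addr0.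
- by move=> e; rewrite (lin0 eps_lin).
Qed.
End GrDgc.

Lemma tmap_bij (k : fieldType) (V W V' W' : lmodType k) (f : V -> V') (g : W -> W') :
  linear f -> linear g -> bijective f -> bijective g -> bijective (tmap f g).
Proof.
move=> hf hg [f' fK f'K] [g' gK g'K].
have hf' := can_linear hf f'K fK; have hg' := can_linear hg g'K gK.
exists (tmap f' g') => t; rewrite tmap_comp //.
  by rewrite (tmap_eq (f' := fun x => x) (g' := fun x => x) _ fK gK) tmap_id.
by rewrite (tmap_eq (f' := fun x => x) (g' := fun x => x) _ f'K g'K) tmap_id.
Qed.

(** f commutes with homogeneous components; if f x is homogeneous of degree i, injectivity gives x =
    [hcomp x i]. *)
Lemma graded_inj_pc (k : fieldType) (I : zmodType) (C D : dgc k I) (f : C -> D) :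
  is_grading C -> is_grading D -> linear f -> injective f ->
  (forall i x, pc i x -> pc i (f x)) -> forall i x, pc i x <-> pc i (f x).
Proof.
move=> hC hD fl fi fpc i x; split=> [|fx]; first exact: fpc.
have h j y : hcomp (f y : D) j = f (hcomp y j).
  move: y; apply: (homog_ext hC) => [||j' y yj].
  - exact: lin_comp (hcompi_lin hD j) fl.
  - exact: lin_comp fl (hcompi_lin hC j).
  rewrite (hcomp_pc hC yj) (hcomp_pc hD (fpc _ _ yj)) !singleE.
  by case: asboolP => // _; rewrite (lin0 fl).
suff -> : x = hcomp x i by exact: hcomp_mem.
by apply: fi; rewrite -h (hcomp_id hD fx).
Qed.

(** * The spectral sequence *)

Section FilteredComplex.
Variables (k : fieldType) (V : lmodType k) (d : V -> V) (Fi : int -> set V).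
Hypotheses (d_lin : linear d) (dd : forall x, d (d x) = 0).
Hypotheses (hF : forall q, is_subspace (Fi q)) (F1 : forall q, Fi (q - 1) `<=` Fi q)
  (dF : forall q x, Fi q x -> Fi q (d x)).

Lemma Zr_subspace r q : is_subspace (Zr d Fi r q).
Proof. exact: subspaceI (hF q) (subspace_preim d_lin (hF (q - r))). Qed.

Lemma Br_subspace r q : is_subspace (Br d Fi r q).
Proof.
split.
  exists 0, 0; split; [exact: subsp0 (Zr_subspace _ _)|exact: subsp0 (Zr_subspace _ _)|].
  by rewrite (lin0 d_lin) addr0.
move=> a _ _ [y [z [Zy Zz ->]]] [y' [z' [Zy' Zz' ->]]].
exists (a *: y + y'), (a *: z + z'); split.
- exact: (Zr_subspace _ _).2.
- exact: (Zr_subspace _ _).2.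
- by rewrite d_lin scalerDr addrACA.
Qed.

Lemma ZrE r q q' x : Fi q x -> Fi q' (d x) -> q' <= q - r -> Zr d Fi r q x.
Proof. by move=> Fx Fdx le; split=> //; apply: (fil_mono F1 le). Qed.

Lemma Zr0 : Zr d Fi 0 = Fi.
Proof.
apply: funext => q; apply/seteqP; split=> [x []|x Fx] //.
by split=> //; rewrite subr0; apply: dF.
Qed.

(** At r = 0 the index q + r - 1 of the bounding elements is q - 1, so boundaries add nothing to the
    filtration step below q. *)
Lemma Br0 : Br d Fi 0 = below Fi.
Proof.
apply: funext => q; apply/seteqP; split=> [x [y [z [Zy Zz ->]]]|x Fx].
  apply: (subspD (hF (q - 1)) Zy.1); apply: dF.
  by have := Zz.1; rewrite addr0.
exists x, 0; split; last by rewrite (lin0 d_lin) addr0.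
  split=> //; apply: (fil_mono F1 (i := q - 1)); first lia.
  exact: dF.
exact: subsp0 (Zr_subspace _ _).
Qed.

Variable r : nat.
Let Z := Zr d Fi r.
Let B := Br d Fi r.
Let Z' := Zr d Fi r.+1.
Let B' := Br d Fi r.+1.
Let hZ := Zr_subspace r.
Let hB := Br_subspace r.
Let hZ' := Zr_subspace r.+1.
Let hB' := Br_subspace r.+1.

Definition pagedif (e : sqsum Z B) : sqsum Z B := scls Z B (smap (- r%:Z) d (rep e)).

Let dZ q x : Z q x -> Z (q + - r%:Z) (d x).
Proof. by move=> [Fx Fdx]; split=> //; rewrite dd; apply: subsp0. Qed.
Let dB q x : Z q x -> B q x -> B (q + - r%:Z) (d x).
Proof.
move=> _ [y [z [Zy Zz ->]]]; exists 0, y; split.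
- exact: subsp0 (Zr_subspace _ _).
- by rewrite subrK.
- by rewrite (linD d_lin) dd addr0 add0r.
Qed.

Lemma pagedif_lin : linear pagedif.
Proof. exact: (smap_cls_lin hZ hB hZ hB d_lin dZ dB). Qed.
Lemma pagedif_ecl q z : Z q z -> pagedif (ecl Z B q z) = ecl Z B (q - r%:Z) (d z).
Proof. exact: (smap_ecl hZ hB hZ hB d_lin dZ dB). Qed.
Lemma pagedif_pagedif e : pagedif (pagedif e) = 0.
Proof.
move: e; apply: (sqsum_ext hZ hB) => [||q z Zz].
- exact: lin_comp pagedif_lin pagedif_lin.
- exact: lin_zero.
by rewrite pagedif_ecl // pagedif_ecl ?dd ?(ecl0 hZ hB) //; exact: dZ.
Qed.

Lemma Zr_succ q z : Z' q z -> Z q z.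
Proof. by move=> [Fz Fdz]; apply: ZrE Fz Fdz _; lia. Qed.

Lemma pagedif_Zr_succ q z : Z' q z -> pagedif (ecl Z B q z) = 0.
Proof.
move=> Zz; rewrite pagedif_ecl; last exact: Zr_succ.
apply/(ecl_eq0 hZ hB); first exact: dZ (Zr_succ Zz).
exists (d z), 0; split; last by rewrite (lin0 d_lin) addr0.
  case: Zz => _ Fdz; split; last by rewrite dd; apply: subsp0.
  by apply: (fil_mono F1) Fdz; lia.
exact: subsp0 (Zr_subspace _ _).
Qed.

Let smap_eval (f : fs int V) q : smap (- r%:Z) d f q = d (f (q + r%:Z)).
Proof.
move: f; apply: fs_ind.
- by rewrite (lin0 (smap_lin _ d_lin)) !fs0E (lin0 d_lin).
- by move=> f g hf hg; rewrite (linD (smap_lin _ d_lin)) !fsDE (linD d_lin) hf hg.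
move=> i v; rewrite (smap_single _ d_lin) !singleE.
case: asboolP => [->|ne]; first by rewrite subrK asboolT.
by rewrite asboolF ?(lin0 d_lin) // => e; apply: ne; rewrite -e addrK.
Qed.

Let pl := pagedif_lin.
Let pp := pagedif_pagedif.

(** The map leaves page r + 1 because an element of [Zr] for r + 1 is visibly a cycle of page r. On
    the other side cycles are finitely supported families, treated one filtration degree at a
    time. *)
Lemma page_homology : exists psi : sqsum Z' B' -> homology pagedif,
  [/\ linear psi, bijective psi &
      forall q z, Z' q z -> psi (ecl Z' B' q z) = hcls pagedif (ecl Z B q z)].
Proof.
have [psi [psil psiE]] : exists psi : sqsum Z' B' -> homology pagedif,
    linear psi /\ forall q z, Z' q z -> psi (ecl Z' B' q z) = hcls pagedif (ecl Z B q z).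
  apply: (sqlift hZ' hB' (f := fun q z => hcls pagedif (ecl Z B q z))).
    move=> q a u v Zu Zv; rewrite (ecl_lin B hZ) ?hcls_linZ //; try exact: Zr_succ;
      exact: pagedif_Zr_succ.
  (* On page r the class of y is zero, as y has filtration q - 1, and d z is the page differential
     of the class of z in filtration q + r. *)
  move=> q v Zv [y [z [Zy Zz vE]]].
  have Zdz : Z q (d z).
    by case: Zz => _ Fdz; split; [apply: (fil_mono F1) Fdz; lia|rewrite dd; apply: subsp0].
  have Zy' : Z q y by case: Zy => Fy Fdy; apply: (ZrE (q' := q - 1 - (r.+1%:Z - 1))) => //;
    [apply: (fil_mono F1) Fy|]; lia.
  rewrite vE (eclD B hZ) // (_ : ecl Z B q y = 0); last first.
    apply/(ecl_eq0 hZ hB) => //; exists y, 0; split; last by rewrite (lin0 d_lin) addr0.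
      by case: Zy => Fy Fdy; apply: ZrE Fy Fdy _; lia.
    exact: subsp0 (Zr_subspace _ _).
  have Zz' : Z (q + r%:Z) z.
    by case: Zz => Fz Fdz; apply: ZrE Fdz _; [apply: (fil_mono F1) Fz|]; lia.
  by rewrite add0r -{1}[q](addrK r%:Z) -pagedif_ecl // hcls_bound.
exists psi; split=> //; apply: bijective_of.
  suff h (f : fs int V) : dsumset Z' f -> psi (cls (dsumset Z') (dsumset B') f) = 0 ->
      cls (dsumset Z') (dsumset B') f = 0.
    by apply: (lin_inj psil); exact: (sq_ind (dsumset_subspace hZ')).
  move=> Zf; have [s [us fs0]] := fs_support f.
  have fE : f = \sum_(q <- s) single (q : int) (f q) := fs_sumE us fs0.
  have dZf : dsumset Z f by move=> q; apply: Zr_succ; exact: Zf.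
  have e1 : cls (dsumset Z') (dsumset B') f = \sum_(q <- s) ecl Z' B' q (f q).
    rewrite {1}fE (cls_sum (dsumset_subspace hZ') (dsumset_subspace hB')) // => q _.
    exact: (dsumset_single hZ' (Zf q)).
  have e2 : scls Z B f = \sum_(q <- s) ecl Z B q (f q).
    rewrite {1}fE /scls (cls_sum (dsumset_subspace hZ) (dsumset_subspace hB)) // => q _.
    exact: (dsumset_single hZ (dZf q)).
  have pc0 q : pagedif (ecl Z B q (f q)) = 0 by apply: pagedif_Zr_succ; exact: Zf.
  have pc1 : pagedif (scls Z B f) = 0 by rewrite e2 (lin_sum _ _ _ pl) big1.
  have -> : psi (cls (dsumset Z') (dsumset B') f) = hcls pagedif (scls Z B f).
    rewrite e1 (lin_sum _ _ _ psil) e2.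
    elim: (s) => [|q t IH]; first by rewrite !big_nil hcls0.
    rewrite !big_cons (hclsD pl (pc0 q)); last by rewrite (lin_sum _ _ _ pl) big1.
    by rewrite IH (psiE _ _ (Zf q)).
  move=> /(hcls_eq0 pl) -/(_ pc1)[e _ eE].
  pose g : fs int V := rep e; have Zg : dsumset Z g by exact: (rep_mem (dsumset_subspace hZ)).
  have Zsg : dsumset Z (smap (- r%:Z) d g) by exact: (smap_mem d_lin hZ dZ Zg).
  have /(cls_eq (dsumset_subspace hZ) (dsumset_subspace hB) dZf Zsg) fg : scls Z B f = scls Z B
    (smap (- r%:Z) d g).
    by rewrite -eE.
  apply/(cls_eq0 (dsumset_subspace hB') Zf) => q.
  have [y [v [Zy Zv yv]]] := fg q.
  (* The sharper conditions required by [Br] for r + 1 follow from this equation: d y = d (f q), and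
     d v is a combination of elements of filtration q. *)
  have fqE : f q = y + d (v + g (q + r%:Z)).
    rewrite (linD d_lin) addrA -yv.
    have -> : (f - smap (- r%:Z) d g : fs int V) q = f q - d (g (q + r%:Z)).
      by rewrite -smap_eval; exact: (linB (@fs_eval_lin _ _ _ q)).
    by rewrite subrK.
  exists y, (v + g (q + r%:Z)); split=> //.
  - case: Zy => Fy _; split; first exact: Fy.
    have -> : d y = d (f q) by rewrite fqE (linD d_lin) dd addr0.
    by case: (Zf q) => _; apply: (fil_mono F1); lia.
  - have -> : (Posz r.+1 - 1 : int) = r%:Z by lia.
    have -> : q + Posz r.+1 - 1 = q + r%:Z by lia.
    apply: subspD; [exact: hZ| |exact: Zg].
    case: Zv => Fv _; split; first by apply: (fil_mono F1) Fv; lia.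
    rewrite addrK; have -> : d v = f q - y - d (g (q + r%:Z)).
      by rewrite fqE (linD d_lin) [y + _]addrC addrK addrK.
    apply: subspB => //; last by case: (Zg (q + r%:Z)) => _; rewrite addrK.
    apply: subspB => //; first by case: (Zf q).
    by case: Zy => Fy _; apply: F1.
suff h (f : fs int V) : dsumset Z f -> pagedif (scls Z B f) = 0 ->
    exists e, psi e = hcls pagedif (scls Z B f).
  by apply: (homology_ind pl); exact: (sq_ind (dsumset_subspace hZ)).
move=> Zf pf0.
have Zsf : dsumset Z (smap (- r%:Z) d f) by exact: (smap_mem d_lin hZ dZ Zf).
have Bsf : dsumset B (smap (- r%:Z) d f).
  apply/(cls_eq0 (dsumset_subspace hB) Zsf); rewrite -/(scls Z B _) -pf0 /pagedif.
  have Zr := rep_mem (dsumset_subspace hZ) (scls Z B f).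
  have Br := rep_cls (dsumset_subspace hZ) (dsumset_subspace hB) Zf.
  apply/esym/(cls_eq (dsumset_subspace hZ) (dsumset_subspace hB)) => //.
    exact: (smap_mem d_lin hZ dZ Zr).
  rewrite -(linB (smap_lin _ d_lin)).
  have ZBr : dsumset (fun q => Z q `&` B q) (rep (scls Z B f) - f).
    by move=> q; split; [exact: (subspB (dsumset_subspace hZ) Zr Zf q)|exact: Br].
  by apply: (smap_mem d_lin hB _ ZBr) => q x [Zx Bx]; apply: dB.
(* From d (f q) = y + d v with v of filtration q - 1, the element f q - v represents the same class
   and has differential y, of filtration q - r - 1. *)
have step q : pagedif (ecl Z B q (f q)) = 0 /\ exists e, psi e = hcls pagedif (ecl Z B q (f q)).
  have [y [v [Zy Zv yv]]] := Bsf (q - r%:Z); rewrite smap_eval subrK in yv.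
  have Zv' : Z q v.
    case: Zv => Fv Fdv; split; first by apply: (fil_mono F1) Fv; lia.
    by apply: (fil_mono F1) Fdv; lia.
  have Zfv : Z' q (f q - v).
    split; first by apply: subspB => //; [case: (Zf q)|case: Zv'].
    rewrite (linB d_lin) yv addrK; case: Zy => Fy _.
    by apply: (fil_mono F1) Fy; lia.
  have eE : ecl Z B q (f q) = ecl Z B q (f q - v).
    apply/(ecl_eq hZ hB) => //; [exact: Zf|exact: Zr_succ|].
    exists v, 0; split; last by rewrite (lin0 d_lin) addr0 opprB addrC subrK.
      by case: Zv => Fv Fdv; split; [apply: (fil_mono F1) Fv|apply: (fil_mono F1) Fdv]; lia.
    exact: subsp0 (Zr_subspace _ _).
  rewrite eE; split; first exact: pagedif_Zr_succ.
  by exists (ecl Z' B' q (f q - v)); rewrite psiE.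
have [s ->] := scls_ecl hZ hB Zf.
suff: pagedif (\sum_(q <- s) ecl Z B q (f q)) = 0 /\
  exists e, psi e = hcls pagedif (\sum_(q <- s) ecl Z B q (f q)) by case.
elim: s => [|q t [IH0 [e eE]]].
  rewrite big_nil (lin0 pl); split=> //; exists 0.
  by rewrite (lin0 psil) hcls0.
rewrite big_cons; have [q0 [e' e'E]] := step q.
split; first by rewrite (linD pl) q0 IH0 addr0.
by exists (e' + e); rewrite (linD psil) eE e'E hclsD.
Qed.
End FilteredComplex.

Lemma pc2_tens_eq (k : fieldType) (J : zmodType) (V W : lmodType k) (P : J -> set V)
    (Q : J -> set W) i j q x y : P i x -> Q j y -> i + j = q -> pc2 P Q q (tens x y).
Proof. by move=> Px Qy <-; apply: pc2_tens. Qed.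

(** * The pages as coalgebras *)

Section SpectralSequence.
Variables (k : fieldType) (C : dgc k int) (Fil : int -> set C).
Hypotheses (hC : is_dgc (-1) C) (hF : is_filtered_dgc Fil).
Hypotheses (hdeg : forall i, deg C i = i) (epsF : forall x, Fil (-1) x -> eps x = 0).
Let hg := dgc_grading hC.
Let d := @dif _ _ C.
Let d2 := @dif2 _ _ C.
Let d_lin : linear d := dgc_dif_linear hC.
Let dd : forall x, d (d x) = 0 := dgc_dif_dif hC.
Let cl := dgc_cop_linear hC.
Let sgl := sgn_lin hg.
Let hFs := fil_subspace hF.
Let F1 := fil_incr hF.
Let dF := fil_dif hF.
Let Fil2 := pc2 Fil Fil.

Lemma sign_pred (n : int) : (-1) ^ (n - 1) = - (-1) ^ n :> k.
Proof. by rewrite expfzDr ?oppr_eq0 ?oner_eq0 // exprN1 invrN1 mulrN1. Qed.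

Let deg_dif (i : int) : (-1) ^ deg C (i + -1) = - (-1) ^ deg C i :> k.
Proof. by rewrite !hdeg sign_pred. Qed.

Let d2_lin : linear d2 := dif2_lin hC.
Let d2E (x y : C) : d2 (tens x y) = tens (d x) y + tens (sgn x) (d y) := dif2E hC x y.
Let d2d2 t : d2 (d2 t) = 0 := dif2_dif2 hC deg_dif t.
Let dsg x : d (sgn x) = - sgn (d x) := sgn_dif hC deg_dif x.

Lemma fil_sgn q x : Fil q x -> Fil q (sgn x).
Proof.
move=> Fx; apply: (fsum_mem (J := {classic int}) (phi := fun i x => (-1) ^ deg C i *: x)) => // i.
  exact: lin_scale.
by apply: subspZ => //; apply: (fil_graded hF).
Qed.

Let F2s q : is_subspace (Fil2 q). Proof. exact: pc2_subspace. Qed.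

Lemma fil2_incr q : Fil2 (q - 1) `<=` Fil2 q.
Proof.
apply: pc2_sub => [|i j x y ij Fx Fy]; first exact: F2s.
apply: (@pc2_tens_eq _ _ _ _ _ _ (i + 1) j) => //; last by lia.
by apply: F1; rewrite addrK.
Qed.

Lemma fil2_dif2 q t : Fil2 q t -> Fil2 q (d2 t).
Proof.
move: t; apply: pc2_sub => [|i j x y <- Fx Fy]; first exact: subspace_preim d2_lin (F2s q).
rewrite /mkset d2E; apply: subspD => //; apply: pc2_tens => //; try exact: dF.
exact: fil_sgn.
Qed.

Lemma fil2_tens i j q x y : Fil i x -> Fil j y -> i + j <= q -> Fil2 q (tens x y).
Proof. by move=> Fx Fy ijq; apply: (fil_mono fil2_incr ijq); apply: pc2_tens. Qed.
Let F21 := fil2_incr.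
Let d2F := fil2_dif2.
Let Ft := fil2_tens.

Section Page.
Variable r : nat.
Let Z := Zr d Fil r.
Let B := Br d Fil r.
Let Z2 := Zr d2 Fil2 r.
Let B2 := Br d2 Fil2 r.
Let hZ : forall q, is_subspace (Z q) := Zr_subspace d_lin hFs r.
Let hB : forall q, is_subspace (B q) := Br_subspace d_lin hFs r.
Let hZ2 : forall q, is_subspace (Z2 q) := Zr_subspace d2_lin F2s r.
Let hB2 : forall q, is_subspace (B2 q) := Br_subspace d2_lin F2s r.
Let el : int -> C -> page Fil r := ecl Z B.
Let el2 := ecl Z2 B2.

Lemma Zr_tens i j x y : Z i x -> Z j y -> Z2 (i + j) (tens x y).
Proof.
move=> [Fx Fdx] [Fy Fdy]; split; first exact: pc2_tens.
rewrite d2E; apply: subspD => //.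
  by apply: (Ft Fdx Fy); lia.
by apply: (Ft (fil_sgn Fx) Fdy); lia.
Qed.

(** By the Leibniz rule d z (x) y equals d (z (x) y) minus sgn z (x) d y. The last term has
    filtration (i + r - 1) + (j - r), one less than i + j, and joins x' (x) y. *)
Lemma Br_tensl i j x y : Z i x -> B i x -> Z j y -> B2 (i + j) (tens x y).
Proof.
move=> _ [x' [z [[Fx' Fdx'] [Fz Fdz] ->]]] [Fy Fdy].
exists (tens x' y - tens (sgn z) (d y)), (tens z y); split.
- apply: subspB; first exact: Zr_subspace.
    split; first by apply: (Ft Fx' Fy); lia.
    rewrite d2E; apply: subspD => //.
      by apply: (Ft Fdx' Fy); lia.
    by apply: (Ft (fil_sgn Fx') Fdy); lia.
  split; first by apply: (Ft (fil_sgn Fz) Fdy); lia.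
  rewrite d2E dd tens0r addr0 dsg (linN (tens_linl _)); apply: subspN => //.
  by apply: (Ft (fil_sgn Fdz) Fdy); lia.
- split; first by apply: (Ft Fz Fy); lia.
  rewrite d2E; apply: subspD => //; first by apply: (Ft Fdz Fy); lia.
  by apply: (Ft (fil_sgn Fz) Fdy); lia.
- by rewrite d2E [tens (d z) y + _]addrC addrA subrK -(linD (tens_linl _)).
Qed.

(** As for the left factor, with sgn x (x) z as bounding tensor: since [sgn] is an involution, x (x)
    d z then occurs with sign +1. *)
Lemma Br_tensr i j x y : Z i x -> Z j y -> B j y -> B2 (i + j) (tens x y).
Proof.
move=> [Fx Fdx] _ [y' [z [[Fy' Fdy'] [Fz Fdz] ->]]].
have sx := fil_sgn Fx.
exists (tens x y' - tens (d (sgn x)) z), (tens (sgn x) z); split.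
- apply: subspB; first exact: Zr_subspace.
    split; first by apply: (Ft Fx Fy'); lia.
    rewrite d2E; apply: subspD => //.
      by apply: (Ft Fdx Fy'); lia.
    by apply: (Ft sx Fdy'); lia.
  rewrite dsg (linN (tens_linl _)); apply: subspN; first exact: Zr_subspace.
  have sdx := fil_sgn Fdx.
  split; first by apply: (Ft sdx Fz); lia.
  rewrite d2E dsg dd (lin0 sgl) oppr0 tens0l add0r (sgnK hg).
  by apply: (Ft Fdx Fdz); lia.
- split; first by apply: (Ft sx Fz); lia.
  rewrite d2E (sgnK hg); apply: subspD => //; last by apply: (Ft Fx Fdz); lia.
  rewrite dsg (linN (tens_linl _)); apply: subspN => //.
  by apply: (Ft (fil_sgn Fdx) Fz); lia.
- by rewrite d2E (sgnK hg) addrA subrK -(linD (tens_linr _)).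
Qed.

Lemma page_cross_lin : linear (@page_kunneth _ _ Fil r).
Proof. exact: (cross_lin hZ hB hZ2 hB2 Zr_tens Br_tensl Br_tensr). Qed.
Lemma page_crossE i j x y : Z i x -> Z j y ->
  page_kunneth (tens (el i x) (el j y)) = el2 (i + j) (tens x y).
Proof. exact: (crossE hZ hB hZ2 hB2 Zr_tens Br_tensl Br_tensr). Qed.

Let gZ q x : Z q x -> forall i, Z q (hcomp x i).
Proof.
move=> [Fx Fdx] i; split; first exact: (fil_graded hF Fx).
rewrite /d -[dif _](hcomp_dif hC); exact: (fil_graded hF Fdx).
Qed.
Let gZ' (s q : int) x : Zr d Fil s q x -> forall i, Zr d Fil s q (hcomp x i).
Proof.
move=> [Fx Fdx] i; split; first exact: (fil_graded hF Fx).
rewrite /d -[dif _](hcomp_dif hC); exact: (fil_graded hF Fdx).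
Qed.
Let gB q x : Z q x -> B q x -> forall i, B q (hcomp x i).
Proof.
move=> _ [y [z [Zy Zz ->]]] i; exists (hcomp y i), (hcomp z (i + 1)); split; try exact: gZ'.
by rewrite (linD (hcompi_lin hg i)) /d -[dif (hcomp z _)](hcomp_dif hC) addrK.
Qed.

Lemma page_grading : is_grading (page Fil r).
Proof. exact: (sqdgc_grading _ _ _ hg hZ hB gZ gB). Qed.

Let page_sgn q z : Z q z -> sgn (el q z) = el q (sgn z).
Proof. exact: (sqdgc_sgn _ _ _ hg hZ hB gZ gB hdeg). Qed.

Let epl := dgc_eps_linear hC.
Let epsB x : Z 0 x -> B 0 x -> eps x = 0.
Proof.
move=> _ [y [z [[Fy _] _ ->]]]; rewrite (linD epl) (dgc_eps_dif hC) addr0.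
by apply: epsF; rewrite -[X in Fil X]/(-1 : int) in Fy.
Qed.
Lemma page_eps_lin : linear (@eps _ _ (page Fil r) : page Fil r -> k^o).
Proof. exact: (sqdgc_eps_lin hZ hB epl epsB). Qed.
Lemma page_eps_ecl q z : Z q z -> eps (el q z) = if q == 0 then eps z else 0.
Proof. exact: (sqdgc_eps_ecl _ _ _ hZ hB epl epsB). Qed.

Let pd : page Fil r -> page Fil r := @pagedif _ _ d Fil r.
Let pdl : linear pd. Proof. exact: pagedif_lin. Qed.
Let pdE q z : Z q z -> pd (el q z) = el (q - r%:Z) (d z).
Proof. exact: pagedif_ecl. Qed.
Let pdpd e : pd (pd e) = 0.
Proof. exact: pagedif_pagedif. Qed.
Let pd2 : sqsum Z2 B2 -> sqsum Z2 B2 := @pagedif _ _ d2 Fil2 r.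
Let pd2l : linear pd2. Proof. exact: pagedif_lin. Qed.
Let pd2E q z : Z2 q z -> pd2 (el2 q z) = el2 (q - r%:Z) (d2 z).
Proof. exact: pagedif_ecl. Qed.

Let Zd q x : Z q x -> Z (q - r%:Z) (d x).
Proof. by move=> [Fx Fdx]; split=> //; rewrite dd; apply: subsp0. Qed.
Let Z2d q x : Z2 q x -> Z2 (q - r%:Z) (d2 x).
Proof. by move=> [Fx Fdx]; split=> //; rewrite d2d2; apply: subsp0. Qed.

Let Zsgn q x : Z q x -> Z q (sgn x).
Proof.
move=> [Fx Fdx]; split; first exact: fil_sgn.
by rewrite dsg; apply: subspN => //; apply: fil_sgn.
Qed.

Lemma cop_Zr q x : Z q x -> Z2 (q + 0) (cop x).
Proof.
move=> [Fx Fdx]; rewrite addr0; split; first exact: (fil_cop hF Fx).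
by rewrite /d2 -(dgc_cop_dif hC); exact: (fil_cop hF Fdx).
Qed.
Lemma cop_Br q x : Z q x -> B q x -> B2 (q + 0) (cop x).
Proof.
move=> _ [y [z [[Fy Fdy] [Fz Fdz] ->]]]; exists (cop y), (cop z); rewrite addr0.
split; last by rewrite (linD cl) (dgc_cop_dif hC).
  split; first exact: (fil_cop hF Fy).
  by rewrite /d2 -(dgc_cop_dif hC); exact: (fil_cop hF Fdy).
split; first exact: (fil_cop hF Fz).
by rewrite /d2 -(dgc_cop_dif hC); exact: (fil_cop hF Fdz).
Qed.

Let sdif2E (x y : page Fil r) : dif2 (tens x y) = tens (pd x) y + tens (sgn x) (pd y).
Proof. exact: (dtensE pdl (sgn_lin page_grading)). Qed.
Let sdif2_lin : linear (@dif2 _ _ (page Fil r)).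
Proof. exact: (dtens_lin pdl (sgn_lin page_grading)). Qed.

(** Passing to homology, this chain map yields the Kuenneth map of the next page. *)
Lemma page_cross_dif t : page_kunneth (dif2 t) = pd2 (page_kunneth t) :> sqsum Z2 B2.
Proof.
have kl := page_cross_lin.
move: t; apply: tens_ext => [||e e']; [exact: lin_comp kl sdif2_lin|exact: lin_comp pd2l kl|].
move: e; apply: (sqsum_ext hZ hB) => [||i x Zx].
- exact: lin_comp kl (lin_comp sdif2_lin (tens_linl _)).
- exact: lin_comp pd2l (lin_comp kl (tens_linl _)).
move: e'; apply: (sqsum_ext hZ hB) => [||j y Zy].
- exact: lin_comp kl (lin_comp sdif2_lin (tens_linr _)).
- exact: lin_comp pd2l (lin_comp kl (tens_linr _)).
rewrite sdif2E (linD kl) (pdE Zx) (pdE Zy) (page_sgn Zx).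
rewrite !page_crossE //; try by [exact: Zd|exact: Zsgn].
rewrite pd2E; last exact: Zr_tens.
rewrite (d2E x y) addrAC addrA /el2 (eclD B2 hZ2) //.
  by have := Zr_tens (Zd Zx) Zy; rewrite addrAC.
by have := Zr_tens (Zsgn Zx) (Zd Zy); rewrite addrA.
Qed.

Section Bijective.
Hypothesis kbij : bijective (@page_kunneth _ _ Fil r).

Let cross_cop (e : page Fil r) :
  page_kunneth (cop e) = scls Z2 B2 (smap 0 (@cop _ _ C) (rep e)).
Proof. exact: (preinvE _ _ kbij). Qed.

Lemma page_cross_cop q x : Z q x -> page_kunneth (cop (el q x)) = el2 q (cop x).
Proof.
move=> Zx; rewrite cross_cop.
apply: (etrans (smap_ecl hZ hB hZ2 hB2 cl cop_Zr cop_Br Zx)).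
by rewrite addr0.
Qed.

Lemma page_cop_lin : linear (@cop _ _ (page Fil r)).
Proof.
have h : linear (fun e : page Fil r => page_kunneth (cop e)).
  by apply: lin_eq (smap_cls_lin hZ hB hZ2 hB2 cl cop_Zr cop_Br) => e; rewrite cross_cop.
exact: (@lin_of_inj _ _ _ _ _ _ page_cross_lin (bij_inj kbij) h).
Qed.

(** Only the laws involving the differential are left. Compatibility with the coproduct is checked
    after the Kuenneth map, where it reduces to that of C. *)
Lemma page_dgc : (exists s, is_dgc s (coalg_of (page Fil r))) -> is_dgc (r%:Z - 1, - r%:Z) (page
  Fil r).
Proof.
move=> [s hP]; have copl := dgc_cop_linear hP; have epsl := dgc_eps_linear hP.
split.
- exact: (dgc_grading hP).
- exact: pdl.
- exact: copl.
- exact: epsl.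
- move=> [p q] _ [z [/= Zz pz ->]]; exists (d z); split.
  + exact: Zd.
  + by have := dgc_dif_pc hC pz; rewrite /= addrACA [_ - 1 + _]addrAC subrr add0r.
  + exact: pdE.
- exact: (dgc_cop_pc hP).
- exact: (dgc_eps_pc hP).
- exact: pdpd.
- exact: (dgc_coassoc hP).
- exact: (dgc_counitl hP).
- exact: (dgc_counitr hP).
- move=> e; apply: (bij_inj kbij); rewrite page_cross_dif.
  move: e; apply: (sqsum_ext hZ hB) => [||q x Zx].
  + exact: lin_comp page_cross_lin (lin_comp copl pdl).
  + exact: lin_comp pd2l (lin_comp page_cross_lin copl).
  have -> : dif (ecl Z B q x : page Fil r) = el (q - r%:Z) (d x) by exact: pdE.
  rewrite (page_cross_cop (Zd Zx)) (page_cross_cop Zx) pd2E /d ?(dgc_cop_dif hC) //.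
  by have := cop_Zr Zx; rewrite addr0.
- apply: (sqsum_ext (W := k^o) hZ hB) => [||q x Zx].
  + exact: lin_comp epsl pdl.
  + exact: lin_zero.
  have -> : dif (ecl Z B q x : page Fil r) = el (q - r%:Z) (d x) by exact: pdE.
  by rewrite (page_eps_ecl (Zd Zx)) (dgc_eps_dif hC); case: ifP.
Qed.
End Bijective.
End Page.

Lemma page0_bij : bijective (@page_kunneth _ _ Fil 0).
Proof.
(* Page 0 is the associated graded object only up to provable equalities of [Zr] and [Br] with
   filtration steps; generalizing over the four families allows them to be substituted in the
   types. *)
suff h (Z B : int -> set C) (Z2 B2 : int -> set (tensor C C)) :
    Z = Fil -> B = below Fil -> Z2 = Fil2 -> B2 = below Fil2 -> bijective (@cross _ _ Z B Z2 B2).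
  apply: h; [exact: (Zr0 dF)|exact: (Br0 d_lin hFs F1 dF)|exact: (Zr0 d2F)|
    exact: (Br0 d2_lin F2s F21 d2F)].
by move=> -> -> -> ->; exact: gr_cross_bij.
Qed.

Lemma page0_coalg : exists s, is_dgc s (coalg_of (page Fil 0)).
Proof.
exists 0.
suff h (Z B : int -> set C) (Z2 B2 : int -> set (tensor C C)) dd' :
    Z = Fil -> B = below Fil -> Z2 = Fil2 -> B2 = below Fil2 ->
    is_dgc 0 (coalg_of (@sqdgc _ C Z B Z2 B2 dd')).
  apply: h; [exact: (Zr0 dF)|exact: (Br0 d_lin hFs F1 dF)|exact: (Zr0 d2F)|
    exact: (Br0 d2_lin F2s F21 d2F)].
move=> eZ eB eZ2 eB2; subst Z B Z2 B2.
exact: (gr_is_dgc hC hF epsF 0).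
Qed.

Section NextPage.
Variable r : nat.
Hypotheses (kbij : bijective (@page_kunneth _ _ Fil r))
  (hP : is_dgc (r%:Z - 1, - r%:Z) (page Fil r)).
Let Z := Zr d Fil r.
Let B := Br d Fil r.
Let Z2 := Zr d2 Fil2 r.
Let B2 := Br d2 Fil2 r.
Let Z' := Zr d Fil r.+1.
Let B' := Br d Fil r.+1.
Let Z2' := Zr d2 Fil2 r.+1.
Let B2' := Br d2 Fil2 r.+1.
Let hZ : forall q, is_subspace (Z q) := Zr_subspace d_lin hFs r.
Let hB : forall q, is_subspace (B q) := Br_subspace d_lin hFs r.
Let hZ' : forall q, is_subspace (Z' q) := Zr_subspace d_lin hFs r.+1.
Let hB' : forall q, is_subspace (B' q) := Br_subspace d_lin hFs r.+1.
Let pd2 : sqsum Z2 B2 -> sqsum Z2 B2 := @pagedif _ _ d2 Fil2 r.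
Let pd2l : linear pd2. Proof. exact: pagedif_lin. Qed.
Let pd2d2 e : pd2 (pd2 e) = 0. Proof. exact: pagedif_pagedif. Qed.
Let H := hdgc (page Fil r).

Lemma page_deg_dif (i : int * int) : (-1) ^ deg (page Fil r) (i + (r%:Z - 1, - r%:Z)) =
  - (-1) ^ deg (page Fil r) i :> k.
Proof.
case: i => p q; rewrite -sign_pred; congr (_ ^ _).
by rewrite /=; lia.
Qed.
Let pdeg := page_deg_dif.
Let pdl := dgc_dif_linear hP.
Let pdpd := dgc_dif_dif hP.

(** Page r + 1 of the tensor square is the homology of its page r, which the Kuenneth map of page r
    identifies with the homology of E^r (x) E^r, hence with H(E^r) (x) H(E^r). In the resulting
    square every map except the Kuenneth map of page r + 1 is already known to be bijective.
    Compatibility with coproducts is conditional on the bijectivity of the latter, as [preinv] has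
    its meaning only then. *)
Lemma page_next : bijective (@page_kunneth _ _ Fil r.+1) /\
  exists psi : page Fil r.+1 -> H, [/\ linear psi, bijective psi,
    forall q z, Z' q z -> psi (page_cls Fil r.+1 q z) = hcls (@dif _ _ (page Fil r)) (page_cls
      Fil r q z),
    bijective (@page_kunneth _ _ Fil r.+1) -> forall x, cop (psi x) = tmap psi psi (cop x) &
    forall x, eps (psi x) = eps x].
Proof.
have [psi [psil psib psiE]] : exists psi : page Fil r.+1 -> H, [/\ linear psi, bijective psi &
    forall q z, Z' q z -> psi (ecl Z' B' q z) = hcls (@dif _ _ (page Fil r)) (ecl Z B q z)].
  exact: (page_homology d_lin dd hFs F1 r).
have [psi2 [psi2l psi2b psi2E]] : exists psi : sqsum Z2' B2' -> homology pd2, [/\ linear psi,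
  bijective psi &
    forall q z, Z2' q z -> psi (ecl Z2' B2' q z) = hcls pd2 (ecl Z2 B2 q z)].
  exact: (page_homology d2_lin d2d2 F2s F21 r).
pose hk : homology (@dif2 _ _ (page Fil r)) -> homology pd2 := hmap pd2 (@page_kunneth _ _ Fil r).
have sd2l := dif2_lin hP.
have hkl : linear hk.
  by apply: hmap_lin => //; [exact: page_cross_lin|exact: page_cross_dif].
have hkb : bijective hk.
  by apply: hmap_bij => //; [exact: page_cross_lin|exact: (dif2_dif2 hP pdeg)|exact:
    page_cross_dif].
have hkE t : dif2 t = 0 -> hk (hcls (@dif2 _ _ (page Fil r)) t) = hcls pd2 (page_kunneth t).
  by move=> t0; apply: hmapE => //; [exact: page_cross_lin|exact: page_cross_dif].
have kl := kunneth_lin hP pdeg.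
have k'l := @page_cross_lin r.+1.
have square t : psi2 (page_kunneth t) = hk (kunneth (tmap psi psi t)).
  move: t; apply: tens_ext => [||e e'].
  - exact: lin_comp psi2l k'l.
  - exact: lin_comp hkl (lin_comp kl (tmap_lin psil psil)).
  move: e; apply: (sqsum_ext hZ' hB') => [||i x Zx].
  - exact: lin_comp psi2l (lin_comp k'l (tens_linl _)).
  - exact: lin_comp hkl (lin_comp kl (lin_comp (tmap_lin psil psil) (tens_linl _))).
  move: e'; apply: (sqsum_ext hZ' hB') => [||j y Zy].
  - exact: lin_comp psi2l (lin_comp k'l (tens_linr _)).
  - exact: lin_comp hkl (lin_comp kl (lin_comp (tmap_lin psil psil) (tens_linr _))).
  rewrite (page_crossE Zx Zy) psi2E; last exact: Zr_tens.
  have cx := pagedif_Zr_succ d_lin dd hFs F1 Zx; have cy := pagedif_Zr_succ d_lin dd hFs F1 Zy.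
  rewrite (tmapE _ _ psil psil) (psiE _ _ Zx) (psiE _ _ Zy) (kunnethE hP pdeg cx cy).
  rewrite hkE; last exact: (dif2_cycle hP cx cy).
  by rewrite (page_crossE (Zr_succ F1 Zx) (Zr_succ F1 Zy)).
have RHSb : bijective (fun t => hk (kunneth (tmap psi psi t))).
  exact: bij_comp hkb (bij_comp (kunneth_bij hP pdeg) (tmap_bij psil psil psib psib)).
have kb' : bijective (@page_kunneth _ _ Fil r.+1).
  apply: bijective_of.
    move=> t u e; apply: (bij_inj RHSb); rewrite -!square.
    by congr psi2.
  move=> e2; have [g gK Kg] := RHSb; exists (g (psi2 e2)).
  by apply: (bij_inj psi2b); rewrite square Kg.
split=> //; exists psi; split=> // [_|].
  have h' x : hk (kunneth (cop (psi x))) = hk (kunneth (tmap psi psi (cop x))) ->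
      cop (psi x) = tmap psi psi (cop x).
    by move=> /(bij_inj hkb)/(bij_inj (kunneth_bij hP pdeg)).
  have copl' := page_cop_lin kb'.
  have hcl := hcop_lin hP pdeg.
  apply: (sqsum_ext hZ' hB') => [||q x Zx].
  - exact: lin_comp hcl psil.
  - exact: lin_comp (tmap_lin psil psil) copl'.
  apply: h'; rewrite -square [page_kunneth _](page_cross_cop kb' Zx).
  have cx := pagedif_Zr_succ d_lin dd hFs F1 Zx.
  rewrite (psiE _ _ Zx) [kunneth _](kunneth_cop_hcls hP pdeg cx).
  rewrite hkE; last exact: (cop_cycle hP cx).
  rewrite [page_kunneth _](page_cross_cop kbij (Zr_succ F1 Zx)) psi2E //.
  by have := cop_Zr Zx; rewrite addr0.
apply: (sqsum_ext (W := k^o) hZ' hB') => [||q x Zx].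
- exact: lin_comp (heps_lin hP) psil.
- exact: page_eps_lin.
rewrite (psiE _ _ Zx) (heps_hcls hP); last exact: (pagedif_Zr_succ d_lin dd hFs F1 Zx).
by rewrite [eps _](page_eps_ecl (Zr_succ F1 Zx)) [in RHS]page_eps_ecl.
Qed.

Lemma page_next_pc (psi : page Fil r.+1 -> H) : linear psi -> bijective psi ->
  (forall q z, Z' q z -> psi (page_cls Fil r.+1 q z) = hcls (@dif _ _ (page Fil r)) (page_cls Fil
    r q z)) ->
  forall i x, pc i x <-> pc i (psi x).
Proof.
move=> psil psib psiE.
apply: (@graded_inj_pc k _ (page Fil r.+1) H psi (@page_grading r.+1) _ psil (bij_inj psib)).
  by have [] := hdgc_grading hP.
move=> [p q] _ [z [/= Zz pz ->]]; exists (page_cls Fil r q z); split.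
- by exists z; split=> //; exact: (Zr_succ F1 Zz).
- exact: (pagedif_Zr_succ d_lin dd hFs F1 Zz).
- exact: psiE.
Qed.
End NextPage.

(** The Kuenneth map of page r + 1 is controlled by the dgc laws of page r, and the coproduct of
    page r + 1 by its Kuenneth map; so both statements share one induction. *)
Lemma page_kunneth_dgc r :
  bijective (@page_kunneth _ _ Fil r) /\ is_dgc (r%:Z - 1, - r%:Z) (page Fil r).
Proof.
elim: r => [|r [kbij hP]].
  have kbij := page0_bij; split=> //.
  exact: (page_dgc kbij page0_coalg).
have [kbij' [psi [psil psib psiE psicop psieps]]] := page_next kbij hP.
split=> //; apply: (page_dgc kbij'); exists 0.
have hH := hdgc_is_dgc hP (page_deg_dif r) 0.
apply: (@dgc_transport _ _ (coalg_of (page Fil r.+1)) (hdgc (page Fil r)) psi) => //.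
- exact: (page_next_pc hP psil psib psiE).
- exact: psicop.
- by move=> x; rewrite (lin0 psil).
Qed.

Lemma spectral_sequence : spectral_sequence_of_coalgebras Fil.
Proof.
move=> r; have [kbij hP] := page_kunneth_dgc r; split=> //.
have [kbij' [psi [psil psib psiE psicop psieps]]] := page_next kbij hP.
have psipc := page_next_pc hP psil psib psiE.
have [phi [phiI psiK phiK]] := coalg_iso_inverse psil psib psipc (psicop kbij') psieps.
exists phi; split=> // q z Zz.
by rewrite -psiE // psiK.
Qed.
End SpectralSequence.

(** * Normalized chains *)

Section SimplexIdentities.
Variable X : sset.
Implicit Types s t : simplex X.

Lemma sdim_face i s : sdim (sface i s) = (sdim s).-1.
Proof. by case: s => -[|n] x. Qed.
Lemma sdim_degen i s : sdim (sdegen i s) = (sdim s).+1.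
Proof. by case: s. Qed.

Lemma sface_sface s i j : (i < j <= sdim s)%N -> (1 < sdim s)%N ->
  sface i (sface j s) = sface j.-1 (sface i s).
Proof. by case: s => -[|[|n]] x //= /andP[ij jn] _; rewrite /smk (face_face _ ij jn). Qed.

Lemma degenerateP s : degenerate s <-> exists t i, (i <= sdim t)%N /\ s = sdegen i t.
Proof.
split=> [[n [x [i [le ->]]]]|[[n x] [i [le ->]]]]; last by exists n, x, i.
by exists (smk x), i.
Qed.

Lemma sface_degen_lt s i j : (i < j <= sdim s)%N -> sface i (sdegen j s) = sdegen j.-1 (sface i s).
Proof.
case: s => -[|n] x /= /andP[ij jn]; first by case: j jn ij.
by rewrite /smk face_degen_lt.
Qed.
Lemma sface_degen_id s j : (j <= sdim s)%N -> sface j (sdegen j s) = s.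
Proof. by case: s => n x jn; rewrite /= face_degen_eq. Qed.
Lemma sface_degen_succ s j : (j <= sdim s)%N -> sface j.+1 (sdegen j s) = s.
Proof. by case: s => n x jn; rewrite /= face_degen_succ. Qed.
Lemma sface_degen_gt s i j : (j.+1 < i <= (sdim s).+1)%N ->
  sface i (sdegen j s) = sdegen j (sface i.-1 s).
Proof.
case: s => -[|n] x /= /andP[ij jn]; first by case: i ij jn => [|[|i]].
by rewrite /smk face_degen_gt.
Qed.

(** Front and back faces are treated as iterated outer faces, which obey short commutation rules,
    unlike the folds in [svert]; [svert_front] and [svert_back] translate between the two. *)
Definition lastface s : simplex X := sface (sdim s) s.
Definition front i s : simplex X := iter (sdim s - i) lastface s.
Definition back i s : simplex X := iter i (sface 0) s.

Lemma sdim_lasts m s : sdim (iter m lastface s) = (sdim s - m)%N.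
Proof.
by elim: m => [|m IH]; rewrite ?subn0 //= /lastface sdim_face IH subnS.
Qed.
Lemma sdim_back i s : sdim (back i s) = (sdim s - i)%N.
Proof. by elim: i => [|i IH]; rewrite ?subn0 //= sdim_face IH subnS. Qed.
Lemma sdim_front i s : (i <= sdim s)%N -> sdim (front i s) = i.
Proof. by move=> le; rewrite /front sdim_lasts subKn. Qed.

Lemma front_id s : front (sdim s) s = s. Proof. by rewrite /front subnn. Qed.
Lemma frontS i s : (i < sdim s)%N -> front i s = lastface (front i.+1 s).
Proof. by move=> lt; rewrite /front subnS -(prednK (n := sdim s - i)) ?subn_gt0. Qed.
Lemma backS i s : back i.+1 s = sface 0 (back i s). Proof. by []. Qed.

Lemma lastface_face j s : (j < sdim s)%N -> (1 < sdim s)%N ->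
  lastface (sface j s) = sface j (lastface s).
Proof. by move=> jn n1; rewrite /lastface sdim_face [RHS]sface_sface ?jn ?leqnn. Qed.

(** The last m + 1 vertices are all dropped in the end, so it does not matter which of them goes
    first. *)
Lemma lasts_face_ge m j s : (sdim s - m <= j <= sdim s)%N -> (m < sdim s)%N ->
  iter m lastface (sface j s) = iter m.+1 lastface s.
Proof.
elim: m s => [|m IH] s; first by rewrite subn0 => jn _; rewrite /= /lastface; congr sface; lia.
have [->|ne] := eqVneq j (sdim s); first by rewrite -iterSr.
move=> jn ms; rewrite iterSr lastface_face; [|lia|lia].
rewrite IH; first by rewrite -iterSr.
all: by rewrite /lastface sdim_face; lia.
Qed.

Lemma lasts_face_lt m j s : (j + m < sdim s)%N ->
  iter m lastface (sface j s) = sface j (iter m lastface s).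
Proof.
elim: m => [|m IH] // jm; rewrite !iterS IH; last lia.
by rewrite lastface_face // sdim_lasts; lia.
Qed.

Lemma back_face_lt i j s : (i < j <= sdim s)%N -> back i (sface j s) = sface (j - i) (back i s).
Proof.
elim: i => [|i IH] ij; first by rewrite subn0.
rewrite !backS IH; last lia.
by rewrite sface_sface ?sdim_back; [congr sface; lia|lia|lia].
Qed.

Lemma back_face_ge i j s : (j <= i < sdim s)%N -> back i (sface j s) = back i.+1 s.
Proof.
elim: i j s => [|i IH] [|j] s ji; rewrite ?[back _.+1 (sface 0 s)]/back -?iterSr //.
rewrite /back iterSr sface_sface; [|lia|lia].
by rewrite -/(back i _) IH ?sdim_face /back -?iterSr //; lia.
Qed.

Lemma front_face_lt i j s : (i < j <= sdim s)%N -> front i (sface j s) = front i s.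
Proof.
move=> ij; rewrite /front sdim_face lasts_face_ge; [|lia|lia].
by congr (iter _ lastface _); lia.
Qed.

Lemma front_face_ge i j s : (j <= i < sdim s)%N -> front i (sface j s) = sface j (front i.+1 s).
Proof.
move=> ij; rewrite /front sdim_face lasts_face_lt; last lia.
by congr (sface _ (iter _ lastface _)); lia.
Qed.

Lemma front_front i j s : (j <= i <= sdim s)%N -> front j (front i s) = front j s.
Proof.
move=> ij; rewrite /front sdim_lasts -iterD; congr (iter _ lastface _); lia.
Qed.
Lemma back_back i j s : back i (back j s) = back (j + i) s.
Proof. by rewrite /back -iterD addnC. Qed.

Lemma back_lasts a c s : (a + c <= sdim s)%N ->
  back a (iter c lastface s) = iter c lastface (back a s).
Proof.
elim: c => [|c IH] // ac; rewrite !iterS -IH; last lia.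
case: a ac {IH} => [|a] // ac.
by rewrite {1}/lastface back_face_lt ?sdim_lasts; [rewrite /lastface sdim_back sdim_lasts|lia].
Qed.

Lemma back_front i j s : (j <= i <= sdim s)%N -> back j (front i s) = front (i - j) (back j s).
Proof.
by move=> ij; rewrite /front back_lasts ?sdim_back; [congr (iter _ lastface _)|]; lia.
Qed.

Lemma back_degen i j s : (i <= j <= sdim s)%N -> back i (sdegen j s) = sdegen (j - i) (back i s).
Proof.
elim: i => [|i IH] ij; first by rewrite subn0.
rewrite backS IH; last lia.
by rewrite sface_degen_lt ?sdim_back -?subnS //; lia.
Qed.

Lemma lasts_degen c j s : (j + c <= sdim s)%N ->
  iter c lastface (sdegen j s) = sdegen j (iter c lastface s).
Proof.
elim: c => [|c IH] // jc; rewrite !iterS IH; last lia.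
rewrite {1}/lastface sdim_degen sdim_lasts sface_degen_gt /lastface sdim_lasts //=.
by lia.
Qed.

(** The repeated vertices j and j + 1 both lie in the back part if i <= j and both in the front part
    otherwise. Hence the Alexander-Whitney map descends to normalized chains. *)
Lemma front_or_back_degenerate i s : degenerate s -> (i <= sdim s)%N ->
  degenerate (front i s) \/ degenerate (back i s).
Proof.
move=> /degenerateP[t [j [jt ->]]]; rewrite sdim_degen => le.
have [ij|ij] := leqP i j; [right|left]; apply/degenerateP.
  exists (back i t), (j - i)%N; rewrite sdim_back back_degen; last lia.
  by split=> //; lia.
exists (iter ((sdim t).+1 - i) lastface t), j; rewrite sdim_lasts; split; first lia.
by rewrite /front sdim_degen lasts_degen //; lia.
Qed.

(** A strictly increasing v repeats no vertex, so the second fold, which inserts degeneracies, does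
    nothing. *)
Lemma svert_increasing s v : sorted ltn v ->
  svert s v = foldr (fun i s' => if i \in v then s' else sface i s') s (iota 0 (sdim s).+1).
Proof.
move=> sv; rewrite /svert; set y := foldr _ _ _.
have h l : {subset l <= iota 0 (size v).-1} ->
    foldl (fun s' j => if nth 0%N v j == nth 0%N v j.+1 then sdegen j s' else s') y l = y.
  elim: l => [|j l IH] //= jl; rewrite ifF; first by apply: IH => i il; apply: jl;
    rewrite inE il orbT.
  have := jl j (mem_head _ _); rewrite mem_iota add0n /= => jv.
  have : (nth 0 v j < nth 0 v j.+1)%N by apply: (sorted_ltn_nth ltn_trans) => //; rewrite inE; lia.
  by move=> lt; apply/negbTE; rewrite neq_ltn lt.
exact: h.
Qed.

Lemma sorted_ival a b : sorted ltn (ival a b). Proof. exact: iota_ltn_sorted. Qed.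
Lemma mem_ival a b i : (a <= b)%N -> (i \in ival a b) = (a <= i <= b)%N.
Proof. by move=> ab; rewrite mem_iota; lia. Qed.

Lemma svert_ival s a b : (a <= b <= sdim s)%N ->
  svert s (ival a b) = back a (iter (sdim s - b) lastface s).
Proof.
move=> abn; rewrite (svert_increasing _ (sorted_ival a b)).
(* The vertices are cut into those before a, those from a to b and those after b; the fold starts
   with the last group. *)
have -> : (sdim s).+1 = (a + ((b - a).+1 + (sdim s - b)))%N by lia.
rewrite !iotaD !foldr_cat !add0n.
have memE i : (i \in ival a b) = (a <= i <= b)%N by rewrite mem_ival //; lia.
have hlast m c t : (c + m = (sdim t).+1)%N -> (b < c)%N ->
    foldr (fun i s' => if i \in ival a b then s' else sface i s') t (iota c m) = iter m lastface t.
  elim: m c => [|m IH] c cm bc //=; rewrite IH ?memE; [|lia|lia].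
  rewrite ifF; last lia.
  by rewrite /lastface sdim_lasts; congr sface; lia.
have hmid m c t : (a <= c)%N -> (c + m <= b.+1)%N ->
    foldr (fun i s' => if i \in ival a b then s' else sface i s') t (iota c m) = t.
  elim: m c => [|m IH] c ac cm //=; rewrite IH ?memE; [|lia|lia].
  by rewrite ifT //; lia.
have hfirst m t : (m <= a)%N -> (m <= sdim t)%N ->
    foldr (fun i s' => if i \in ival a b then s' else sface i s') t (iota 0 m) = back m t.
  elim: m t => [|m IH] t ma mt //; rewrite -addn1 iotaD foldr_cat /= add0n memE ifF; last lia.
  by rewrite IH ?sdim_face; [rewrite addn1 back_face_ge //|..]; lia.
rewrite (hlast (sdim s - b)%N (a + (b - a).+1)%N s); [|lia|lia].
rewrite (hmid (b - a).+1 a); [|lia|lia].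
by rewrite hfirst // sdim_lasts; lia.
Qed.

Lemma svert_front s i : (i <= sdim s)%N -> svert s (ival 0 i) = front i s.
Proof. by move=> le; rewrite svert_ival. Qed.
Lemma svert_back s i : (i <= sdim s)%N -> svert s (ival i (sdim s)) = back i s.
Proof. by move=> le; rewrite svert_ival ?le ?leqnn // subnn. Qed.
End SimplexIdentities.

Arguments lastface {X} s.
Arguments front {X} i s.
Arguments back {X} i s.

Section ChainTheory.
Variables (k : fieldType) (X : sset).
Implicit Types s t : simplex X.
Let NC := nchains k X.

Lemma chain_degenerate s : degenerate s -> chain k s = 0.
Proof. by move=> ds; apply/qclass0; apply: lspan_mem; exists s. Qed.

Section Ext.
Variables (V : lmodType k) (g : simplex X -> V).
Hypothesis g0 : forall s, degenerate s -> g s = 0.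
Let gS (u : freemod k (simplex X)) : (exists s, degenerate s /\ u = basis k s) -> lext g u = 0.
Proof. by move=> [s [ds ->]]; rewrite lext_basis g0. Qed.

Lemma chain_extE s : chain_ext g (chain k s) = g s.
Proof. by rewrite /chain_ext (quo_liftE (lext_lin g) gS) lext_basis. Qed.
Lemma chain_ext_lin : linear (chain_ext g : NC -> V).
Proof. exact: quo_lift_lin (lext_lin g) gS. Qed.
End Ext.

Lemma chain_ext_linF (V W : lmodType k) (g : W -> simplex X -> V) (c : NC) :
  (forall s, linear (fun w => g w s)) -> linear (fun w => chain_ext (g w) c).
Proof. exact: lext_linF. Qed.

Lemma chain_ind (P : NC -> Prop) : P 0 -> (forall x y, P x -> P y -> P (x + y)) ->
  (forall a s, P (a *: chain k s)) -> forall c, P c.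
Proof.
move=> P0 PD Ps c; rewrite -[c]qrepK; elim/freemod_ind: (qrep c).
- by rewrite (lin0 (@qclass_lin _ _ _)).
- by move=> f g Pf Pg; rewrite (linD (@qclass_lin _ _ _)); apply: PD.
- by move=> a s; rewrite (linZ _ (@qclass_lin _ _ _)); apply: Ps.
Qed.

Lemma chain_lin_ext (V : lmodType k) (f g : NC -> V) : linear f -> linear g ->
  (forall s, f (chain k s) = g (chain k s)) -> f =1 g.
Proof.
move=> hf hg fg; apply: chain_ind => [|x y fx fy|a s].
- by rewrite (lin0 hf) (lin0 hg).
- by rewrite (linD hf) (linD hg) fx fy.
- by rewrite (linZ _ hf) (linZ _ hg) fg.
Qed.

Local Notation C := (chains k X).

Lemma pc_chain s : pc (sdim s)%:Z (chain k s : C).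
Proof. by apply: lspan_mem; exists s. Qed.

Lemma chains_grading : is_grading C.
Proof.
pose pr (i : int) : C -> C := chain_ext (fun s => if (sdim s)%:Z == i then chain k s else 0).
have pr0 i s : degenerate s -> (if (sdim s)%:Z == i then chain k s else 0) = 0 :> NC.
  by move=> ds; rewrite chain_degenerate // if_same.
have prl i : linear (pr i) by exact: chain_ext_lin (pr0 i).
apply: (@grading_criterion _ _ C pr) => //.
- by move=> i; exact: lspan_subspace.
- move=> P P0 PD Pi; apply: chain_ind => // a s; apply: (Pi (sdim s)%:Z).
  by apply: subspZ; [exact: lspan_subspace|exact: pc_chain].
- move=> i; apply: lspan_sub => [|_ [s [si ->]]].
    exact: (subspace_eq0 (prl i) (@lin_id _ _)).
  by rewrite /mkset /pr (chain_extE (pr0 i)) si eqxx.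
- move=> i j x xj ij; move: x xj; apply: lspan_sub => [|_ [s [sj ->]]].
    exact: (subspace_eq0 (prl i) (@lin_zero _ _ _)).
  by rewrite /mkset /pr (chain_extE (pr0 i)) sj; case: eqP => // ji; case: ij.
Qed.

Lemma sgn_chain s : sgn (chain k s : C) = (-1) ^+ sdim s *: chain k s.
Proof. exact: (sgn_pc chains_grading (pc_chain s)). Qed.

(** The faces j and j + 1 of the j-th degeneracy of t coincide and have opposite signs; all other
    faces are degenerate. *)
Lemma boundary_degenerate s : degenerate s -> boundary k s = 0.
Proof.
move=> ds; have /degenerateP[t [j [jt sE]]] := ds.
have h i : (i <= (sdim t).+1)%N -> i <> j -> i <> j.+1 -> chain k (sface i s) = 0.
  move=> le ne1 ne2; apply: chain_degenerate; apply/degenerateP; rewrite sE.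
  have [ij|ij] := ltnP i j.
    by exists (sface i t), j.-1; rewrite sdim_face sface_degen_lt; [split=> //|]; lia.
  by exists (sface i.-1 t), j; rewrite sdim_face sface_degen_gt; [split=> //|]; lia.
have sd : sdim s = (sdim t).+1 by rewrite sE sdim_degen.
rewrite /boundary sd big_mkord.
have j2 : (j.+1 < (sdim t).+2)%N by lia.
have j1 : (j < (sdim t).+2)%N by lia.
rewrite (bigD1 (Ordinal j1)) //= (bigD1 (Ordinal j2)) /=; last by apply/eqP => -[]; lia.
rewrite big1 ?addr0; last first.
  move=> i /andP[/eqP ne1 /eqP ne2]; rewrite h ?scaler0 //.
  - by have := ltn_ord i; lia.
  - by move=> e; apply: ne1; apply: val_inj.
  - by move=> e; apply: ne2; apply: val_inj.
by rewrite sE sface_degen_id // sface_degen_succ // exprS mulN1r scaleNr subrr.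
Qed.

Definition dch : NC -> NC := chain_ext (@boundary k X).
Lemma dch_lin : linear dch. Proof. exact: chain_ext_lin boundary_degenerate. Qed.
Lemma dchE s : dch (chain k s) = boundary k s. Proof. exact: chain_extE boundary_degenerate s. Qed.
Lemma boundaryE n s : sdim s = n.+1 ->
  boundary k s = \sum_(0 <= i < n.+2) (-1) ^+ i *: chain k (sface i s).
Proof. by rewrite /boundary => ->. Qed.
Lemma boundary0 s : sdim s = 0%N -> boundary k s = 0.
Proof. by rewrite /boundary => ->. Qed.

Lemma dch_dch x : dch (dch x) = 0.
Proof.
move: x; apply: chain_lin_ext => [||s]; [exact: lin_comp dch_lin dch_lin|exact: lin_zero|].
rewrite dchE; case n: (sdim s) => [|[|m]].
- by rewrite boundary0 // (lin0 dch_lin).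
- rewrite (boundaryE n) (lin_sum _ _ _ dch_lin) big1 // => i _.
  by rewrite (linZ _ dch_lin) dchE boundary0 ?scaler0 // sdim_face n.
rewrite (boundaryE n) (lin_sum _ _ _ dch_lin).
pose a i j : NC := (-1) ^+ (i + j) *: chain k (sface j (sface i s)).
have -> : \sum_(0 <= i < m.+3) dch ((-1) ^+ i *: chain k (sface i s)) =
   \sum_(0 <= i < m.+3) \sum_(0 <= j < m.+2) a i j.
  apply: eq_bigr => i _; rewrite (linZ _ dch_lin) dchE (@boundaryE m) ?sdim_face ?n //.
  by rewrite scaler_sumr; apply: eq_bigr => j _; rewrite scalerA -exprD.
(* The simplicial identity pairs each term with j < i with the term (j, i - 1), of opposite sign. *)
have aE i j : (j < i <= m.+2)%N -> a i j = - a j i.-1.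
  move=> ji; rewrite /a sface_sface ?n //.
  have -> : (i + j = (j + i.-1).+1)%N by lia.
  by rewrite exprS mulN1r scaleNr.
rewrite (eq_bigr (fun i => \sum_(0 <= j < m.+2 | (i <= j)%N) a i j + \sum_(0 <= j < m.+2 | (j <
  i)%N) a i j)); last first.
  by move=> i _; rewrite (bigID (fun j => i <= j)%N) /=; congr (_ + _); apply: eq_bigl => j;
    rewrite ltnNge.
rewrite big_split /=.
have -> : \sum_(0 <= i < m.+3) \sum_(0 <= j < m.+2 | (i <= j)%N) a i j =
    \sum_(0 <= i < m.+2) \sum_(0 <= j < m.+2) (if (j <= i)%N then a j i else 0).
  rewrite big_nat_recr //= [X in _ + X]big_nat_cond [X in _ + X]big_pred0 ?addr0; last first.
    by move=> j; apply/negbTE; lia.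
  under eq_bigr do rewrite big_mkcond.
  by rewrite exchange_big_nat.
have -> : \sum_(0 <= i < m.+3) \sum_(0 <= j < m.+2 | (j < i)%N) a i j =
    \sum_(0 <= i < m.+2) \sum_(0 <= j < m.+2) (if (j <= i)%N then - a j i else 0).
  rewrite big_nat_recl // [X in X + _]big_pred0 // add0r [LHS]big_nat [RHS]big_nat.
  apply: eq_bigr => i /andP[_ im]; rewrite big_mkcond big_nat [RHS]big_nat.
  by apply: eq_bigr => j /andP[_ jm]; rewrite ltnS; case: ifP => // ji; rewrite aE //; lia.
rewrite -big_split big1 // => i _; rewrite -big_split big1 // => j _.
by rewrite /=; case: ifP => _; rewrite ?addr0 ?addrN.
Qed.

Lemma chain_eps_degenerate s : degenerate s -> (sdim s == 0%N)%:R = 0 :> k^o.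
Proof. by move=> /degenerateP[t [j [_ ->]]]; rewrite sdim_degen. Qed.

Lemma alexander_whitneyE s :
  alexander_whitney k s = \sum_(0 <= i < (sdim s).+1) tens (chain k (front i s)) (chain k (back i
    s)).
Proof.
rewrite /alexander_whitney big_nat [RHS]big_nat; apply: eq_bigr => i /andP[_ le].
by rewrite svert_front // svert_back.
Qed.

Lemma alexander_whitney_degenerate s : degenerate s -> alexander_whitney k s = 0.
Proof.
move=> ds; rewrite alexander_whitneyE big_nat big1 // => i /andP[_ le].
have [h|h] := front_or_back_degenerate ds (i := i) le.
  by rewrite chain_degenerate // tens0l.
by rewrite [X in tens _ X]chain_degenerate // tens0r.
Qed.

Definition awc : NC -> tensor NC NC := chain_ext (@alexander_whitney k X).
Lemma awc_lin : linear awc. Proof. exact: chain_ext_lin alexander_whitney_degenerate. Qed.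
Lemma awcE s : awc (chain k s) = \sum_(0 <= i < (sdim s).+1) tens (chain k (front i s)) (chain k
  (back i s)).
Proof. by rewrite -alexander_whitneyE; exact: chain_extE alexander_whitney_degenerate s. Qed.

Definition epsc : NC -> k := chain_ext (fun s => (sdim s == 0%N)%:R : k^o).
Lemma epsc_lin : linear (epsc : NC -> k^o). Proof. exact: chain_ext_lin chain_eps_degenerate. Qed.
Lemma epscE s : epsc (chain k s) = (sdim s == 0%N)%:R.
Proof. exact: (chain_extE chain_eps_degenerate s). Qed.

End ChainTheory.

(** Substitution i = j + l: cutting at i and then the front part at j amounts to cutting at j and
    then the back part at l. *)
Lemma triangle_sum (V : zmodType) (a : nat -> nat -> V) n :
  \sum_(0 <= i < n.+1) \sum_(0 <= j < i.+1) a i j =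
  \sum_(0 <= j < n.+1) \sum_(0 <= l < (n - j).+1) a (j + l)%N j.
Proof.
have -> : \sum_(0 <= i < n.+1) \sum_(0 <= j < i.+1) a i j =
    \sum_(0 <= i < n.+1) \sum_(0 <= j < n.+1) (if (j <= i)%N then a i j else 0).
  apply: eq_big_nat => i /andP[_ im].
  by rewrite (big_nat_widen _ _ n.+1) // big_mkcond; apply: eq_bigr => j _; rewrite ltnS.
rewrite exchange_big_nat /=; apply: eq_big_nat => j /andP[_ jm].
rewrite (big_cat_nat (n := j)) //=; last exact: ltnW.
rewrite big_nat big1 ?add0r; last by move=> i /andP[_ ij]; rewrite ifF //; lia.
rewrite -{1}[j]add0n big_addn subSn //.
by apply: eq_big_nat => i _; rewrite ifT ?leq_addl // addnC.
Qed.

(* The faces [p i i] of front parts cancel the faces [q i i] of back parts. *)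
Lemma face_sum (V : zmodType) (p q : nat -> nat -> V) n :
  (forall i, (i <= n)%N -> p i.+1 i.+1 = - q i i) ->
  \sum_(0 <= j < n.+2) \sum_(0 <= i < n.+1) (if (i < j)%N then q i j else p i.+1 j) =
  \sum_(0 <= i < n.+2) ((if i is i'.+1 then \sum_(0 <= j < i.+1) p i j else 0)
      + (if (i < n.+1)%N then \sum_(i <= j < n.+2) q i j else 0)).
Proof.
move=> pq; rewrite [RHS]big_split /= exchange_big_nat /=.
rewrite [X in _ = X + _]big_nat_recl //= add0r.
rewrite [X in _ = _ + X]big_nat_recr //= ltnn addr0 -big_split /=.
apply: eq_big_nat => i /andP[_ im].
rewrite im (big_cat_nat (n := i.+1)) //=; last by lia.
rewrite [X in _ = X + _]big_nat_recr //= [X in _ = _ + X]big_ltn; last lia.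
have -> : \sum_(0 <= j < i.+1) (if (i < j)%N then q i j else p i.+1 j) = \sum_(0 <= j < i.+1) p
  i.+1 j.
  by apply: eq_big_nat => j /andP[_ ji]; rewrite ifF //; lia.
have -> : \sum_(i.+1 <= j < n.+2) (if (i < j)%N then q i j else p i.+1 j) = \sum_(i.+1 <= j <
  n.+2) q i j.
  by apply: eq_big_nat => j /andP[ij _]; rewrite ifT.
by rewrite pq // -addrA addKr.
Qed.

Section ChainDgc.
Variables (k : fieldType) (X : sset).
Implicit Types s t : simplex X.
Local Notation C := (chains k X).
Let NC := nchains k X.
Local Notation ch := (chain k).

Let dif2E (x y : C) : dif2 (tens x y) = tens (dch x) y + tens (sgn x) (dch y).
Proof. exact: (dtensE (@dch_lin k X) (sgn_lin (chains_grading k X))). Qed.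
Let dif2_lin : linear (@dif2 _ _ C).
Proof. exact: (dtens_lin (@dch_lin k X) (sgn_lin (chains_grading k X))). Qed.

Lemma chains_coassoc (x : C) :
  tassoc (tmap (@awc k X) id (awc x)) = tmap id (@awc k X) (awc x).
Proof.
have al := @awc_lin k X; have idl := @lin_id k NC.
have l1 := tmap_lin al idl; have l2 := tmap_lin idl al.
have asl := @tassoc_lin k NC NC NC.
move: x; apply: chain_lin_ext => [||s].
- exact: lin_comp asl (lin_comp l1 al).
- exact: lin_comp l2 al.
pose n := sdim s.
pose a i j := tens (ch (front j s)) (tens (ch (back j (front i s))) (ch (back i s))).
have -> : tassoc (tmap (@awc k X) id (awc (ch s))) = \sum_(0 <= i < n.+1) \sum_(0 <= j < i.+1) a
  i j.
  rewrite awcE (lin_sum _ _ _ l1) (lin_sum _ _ _ asl); apply: eq_big_nat => i /andP[_ im].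
  rewrite (tmapE _ _ al idl) awcE (lin_sum _ _ _ (tens_linl _)) (lin_sum _ _ _ asl) sdim_front //.
  apply: eq_big_nat => j /andP[_ ji].
  by rewrite tassocE front_front //; apply/andP.
rewrite triangle_sum awcE (lin_sum _ _ _ l2); apply: eq_big_nat => j /andP[_ jm].
rewrite (tmapE _ _ idl al) awcE (lin_sum _ _ _ (tens_linr _)) sdim_back.
apply: eq_big_nat => l /andP[_ lm]; rewrite /a back_front; last lia.
by rewrite addKn back_back.
Qed.

(** Dropping vertex j affects the back part if it lies behind the cut and the front part otherwise;
    [q] and [p] record the two cases. The boundary of a product has in addition the faces at the
    cutting vertex, which cancel in pairs. *)
Lemma chains_cop_dif (x : C) : awc (dch x) = dif2 (awc x : tensor C C).
Proof.
have al := @awc_lin k X; have dl := @dch_lin k X.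
move: x; apply: chain_lin_ext => [||s]; [exact: lin_comp al dl|exact: lin_comp dif2_lin al|].
rewrite dchE awcE (lin_sum _ _ _ dif2_lin); case nE: (sdim s) => [|n].
  rewrite boundary0 // (lin0 al) big_nat1 dif2E !dchE !boundary0 ?sdim_back ?sdim_front ?nE //.
  by rewrite tens0l tens0r addr0.
rewrite (boundaryE k nE) (lin_sum _ _ _ al).
pose p i j := (-1) ^+ j *: tens (ch (sface j (front i s))) (ch (back i s)).
pose q i j := (-1) ^+ j *: tens (ch (front i s)) (ch (sface (j - i) (back i s))).
have -> : \sum_(0 <= j < n.+2) awc ((-1) ^+ j *: ch (sface j s)) =
    \sum_(0 <= j < n.+2) \sum_(0 <= i < n.+1) (if (i < j)%N then q i j else p i.+1 j).
  apply: eq_big_nat => j /andP[_ jn].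
  rewrite (linZ _ al) awcE sdim_face nE /= scaler_sumr.
  apply: eq_big_nat => i /andP[_ im]; case: ltnP => ij.
    by rewrite front_face_lt ?back_face_lt ?nE //; lia.
  by rewrite front_face_ge ?back_face_ge ?nE //; lia.
have -> : \sum_(0 <= i < n.+2) dif2 (tens (ch (front i s) : C) (ch (back i s))) =
    \sum_(0 <= i < n.+2) ((if i is i'.+1 then \sum_(0 <= j < i.+1) p i j else 0)
      + (if (i < n.+1)%N then \sum_(i <= j < n.+2) q i j else 0)).
  apply: eq_big_nat => i /andP[_ im].
  rewrite dif2E !dchE; congr (_ + _).
    case: i im => [|i] im; first by rewrite boundary0 ?tens0l // sdim_front ?nE.
    rewrite (@boundaryE _ _ i) ?sdim_front ?nE // (lin_sum _ _ _ (tens_linl _)).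
    by apply: eq_bigr => j _; rewrite (linZ _ (tens_linl _)).
  rewrite sgn_chain sdim_front ?nE //; case: ifP => iN; last first.
    by rewrite boundary0 ?tens0r // sdim_back nE; lia.
  rewrite (@boundaryE _ _ (n - i)) ?sdim_back ?nE; last lia.
  have -> : \sum_(i <= j < n.+2) q i j = \sum_(0 <= j < (n - i).+2) q i (j + i)%N.
    by rewrite -{1}[i]add0n big_addn; have -> : (n.+2 - i = (n - i).+2)%N by lia.
  rewrite (lin_sum _ _ _ (tens_linr _)); apply: eq_bigr => j _;
    rewrite (linZ _ (tens_linr _)) (linZ _ (tens_linl _)) scalerA /q.
  by rewrite addnK exprD.
apply: face_sum => i im; rewrite /p /q subnn -backS exprS mulN1r scaleNr;
  congr (- (_ *: tens (ch _) _)).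
by rewrite (frontS (i := i)) ?nE // /lastface sdim_front ?nE.
Qed.

Lemma chains_dgc : is_dgc (-1) C.
Proof.
have al := @awc_lin k X; have dl := @dch_lin k X; have el := @epsc_lin k X.
split.
- exact: chains_grading.
- exact: dl.
- exact: al.
- exact: el.
- move=> i; apply: lspan_sub => [|_ [s [<- ->]]].
    exact: (subspace_preim dl (lspan_subspace _)).
  rewrite /mkset [dif _]dchE; case n: (sdim s) => [|m].
    by rewrite boundary0 //; exact: (subsp0 (lspan_subspace _)).
  rewrite (boundaryE k n); apply: subsp_sum => [|j _]; first exact: lspan_subspace.
  apply: subspZ; first exact: lspan_subspace.
  have -> : m.+1%:Z + -1 = (sdim (sface j s))%:Z by rewrite sdim_face n; lia.
  exact: pc_chain.
- move=> i; apply: lspan_sub => [|_ [s [<- ->]]].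
    exact: (subspace_preim al (pc2_subspace _ _ _)).
  rewrite /mkset [cop _]awcE big_nat; apply: subsp_sum => [|i0 /andP[_ im]];
    first exact: pc2_subspace.
  have -> : (sdim s)%:Z = (sdim (front i0 s))%:Z + (sdim (back i0 s))%:Z.
    by rewrite sdim_front // sdim_back; lia.
  by apply: pc2_tens; apply: pc_chain.
- move=> i x xi i0; move: x xi; apply: lspan_sub => [|_ [s [si ->]]].
    exact: (subspace_preim el (@subspace0 _ _)).
  by rewrite /mkset [eps _]epscE -si in i0 *; case: (sdim s) i0.
- exact: dch_dch.
- exact: chains_coassoc.
- have eb : bilin (fun y z : C => eps y *: z).
    by split=> w; [apply: lin_scalel; exact: el|apply: lin_scale].
  apply: chain_lin_ext => [||s]; [exact: lin_comp (tlift_lin eb) al|by []|].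
  rewrite [cop _]awcE (lin_sum _ _ _ (tlift_lin eb)) big_nat_recl // big_nat big1 ?addr0.
    by rewrite (tliftE eb) [eps _]epscE sdim_front // eqxx scale1r.
  move=> i /andP[_ im]; rewrite (tliftE eb) [eps _]epscE sdim_front //.
  by rewrite scale0r.
- have eb : bilin (fun y z : C => eps z *: y).
    by split=> w; [apply: lin_scale|apply: lin_scalel; exact: el].
  apply: chain_lin_ext => [||s]; [exact: lin_comp (tlift_lin eb) al|by []|].
  rewrite [cop _]awcE (lin_sum _ _ _ (tlift_lin eb)) big_nat_recr //= big_nat big1 ?add0r.
    by rewrite (tliftE eb) [eps _]epscE sdim_back subnn eqxx scale1r front_id.
  move=> i /andP[_ im]; rewrite (tliftE eb) [eps _]epscE sdim_back.
  by rewrite subn_eq0 leqNgt im scale0r.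
- exact: chains_cop_dif.
- apply: (chain_lin_ext (V := k^o)) => [||s]; [exact: lin_comp el dl|exact: lin_zero|].
  rewrite -[LHS]/(epsc (dch (ch s))) dchE.
  case n: (sdim s) => [|m]; first by rewrite boundary0 // (lin0 el).
  rewrite (boundaryE k n) (lin_sum _ _ _ el) (eq_bigr (fun i => (-1) ^+ i *: ((m == 0%N)%:R :
    k^o))).
    case: m n => [|m] n; last by rewrite big1 // => i _; rewrite scaler0.
    by rewrite big_nat_recr // big_nat1 /= expr0 expr1 scaleN1r scale1r subrr.
  by move=> i _; rewrite (linZ _ el) epscE sdim_face n.
Qed.
End ChainDgc.

(** * Szczarba's twisting cochain *)

Section Kact.
Variables (k : fieldType) (G : groupType) (F : gset G).

Lemma kact_bilin : bilin (@kact k G F).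
Proof.
split=> [m|u]; first exact: lext_lin.
by apply: lext_linF => g; exact: lext_lin.
Qed.

Lemma kact_basis g (y : F) : kact (basis k g) (basis k y) = basis k (gop g y : F).
Proof. by rewrite /kact !lext_basis. Qed.

Lemma kact1 (m : freemod k F) : kact (basis k 1%g) m = m.
Proof.
move: m; apply: lin_basis_ext; [exact: kact_bilin.2|exact: lin_id|] => y.
by rewrite kact_basis gop1.
Qed.

Lemma kactA (a b : freemod k G) (m : freemod k F) : kact a (kact b m) = kact (gmul a b) m.
Proof.
have [hl hr] := kact_bilin; have [gl gr] := (lext_lin, lext_lin).
have gml (w : freemod k G) : linear (fun v => gmul v w) by exact: lext_lin.
have gmr (v : freemod k G) : linear (gmul v) by apply: lext_linF => g; exact: lext_lin.
move: a; apply: lin_basis_ext => [||g]; [exact: hl|exact: lin_comp (hl m) (gml b)|].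
move: b; apply: lin_basis_ext => [||h].
- exact: lin_comp (hr _) (hl m).
- exact: lin_comp (hl m) (gmr _).
move: m; apply: lin_basis_ext => [||y]; [exact: lin_comp (hr _) (hr _)|exact: hr|].
have -> : gmul (basis k g) (basis k h) = basis k (g * h)%g by rewrite /gmul /kact !lext_basis.
by rewrite !kact_basis gopM.
Qed.
End Kact.

Section GroupRing.
Variables (k : fieldType) (G : groupType).
Lemma gmul_bilin : bilin (@gmul k G). Proof. exact: (@kact_bilin k G (gset_self G)). Qed.
Lemma gmul_basis (g h : G) : gmul (basis k g) (basis k h) = basis k (g * h)%g.
Proof. exact: (@kact_basis k G (gset_self G)). Qed.
Lemma gmul1 (a : freemod k G) : gmul (basis k 1%g) a = a.
Proof. exact: (@kact1 k G (gset_self G)). Qed.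
End GroupRing.

(** * Transport along edges and the evaluation of F *)

Section Sublists.
Variable T : eqType.
(** Index set for expanding a product of factors 1 + t i over l. Sublists keep the order of l, which
    matters as the factors do not commute. *)
Fixpoint sublists (l : seq T) : seq (seq T) :=
  if l is x :: l' then map (cons x) (sublists l') ++ sublists l' else [:: [::]].

Lemma mem_sublists l q : (q \in sublists l) = subseq q l.
Proof.
elim: l q => [|x l IH] [|y q] //=.
  rewrite mem_cat IH sub0seq orbT //.
rewrite mem_cat IH; case: eqVneq => [->|yx].
  rewrite mem_map; last by move=> ? ? [].
  rewrite IH; case: (boolP (subseq q l)) => //= nq.
  apply/negbTE; apply: contra nq => h; apply: subseq_trans h; exact: subseq_cons.
by case: mapP => // -[q' _ [e _]]; rewrite e eqxx in yx.
Qed.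

Lemma sublists_uniq l : uniq l -> uniq (sublists l).
Proof.
elim: l => [|x l IH] //= /andP[xl ul]; rewrite cat_uniq IH // map_inj_uniq ?IH //;
  last by move=> ? ? [].
rewrite andbT; apply/hasPn => q ql; apply/mapP => -[q' _ e].
by move: ql xl; rewrite mem_sublists e => /mem_subseq -> //; rewrite mem_head.
Qed.
End Sublists.

Section Transport.
Variables (k : fieldType) (G : groupType) (X : sset) (tau : forall n, X n.+1 -> G).
Hypothesis tauP : twisting_function tau.
Implicit Types s : simplex X.

(** The value 1 on vertices makes face formulas such as [sface_tpair] hold in dimension 0, where
    [sface] is the identity. *)
Definition stau s : G :=
  match s with existT n x => match n return X n -> G with
    | 0 => fun=> 1%g | n'.+1 => fun x => tau x end x end.

Lemma stau_face0 s : (1 < sdim s)%N -> stau s = ((stau (sface 0 s))^-1 * stau (sface 1 s))%g.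
Proof. by case: s => -[|[|n]] x //= _; rewrite (tau_face0 tauP). Qed.
Lemma stau_face s i : (1 < i <= sdim s)%N -> stau (sface i s) = stau s.
Proof.
case: s i => -[|[|n]] x [|[|i]] //= lt; rewrite [in RHS](tau_face tauP x (i := i.+1)) //.
Qed.

Fixpoint trans (m : nat) s : G :=
  if m is m'.+1 then (trans m' (sface 0 s) * stau s)%g else 1%g.
(* The element T(s) of G. *)
Definition transport s : G := trans (sdim s) s.

Lemma transport0 s : sdim s = 0%N -> transport s = 1%g.
Proof. by rewrite /transport => ->. Qed.
Lemma transportS s : (0 < sdim s)%N -> transport s = (transport (sface 0 s) * stau s)%g.
Proof. by rewrite /transport sdim_face; case: (sdim s). Qed.

Lemma stau_lasts m s : (m < sdim s)%N -> stau (iter m lastface s) = stau s.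
Proof.
elim: m => [|m IH] // ms; rewrite iterS {1}/lastface stau_face ?IH ?sdim_lasts //; lia.
Qed.

Lemma transport_last s : (0 < sdim s)%N ->
  transport s = (stau (back (sdim s).-1 s) * transport (lastface s))%g.
Proof.
move en: (sdim s).-1 => n; elim: n s en => [|n IH] s en s0.
  have s1 : sdim s = 1%N by lia.
  rewrite transportS // !transport0 ?mul1g ?mulg1 // ?sdim_face /lastface ?sdim_face s1 //.
have s1 : (1 < sdim s)%N by lia.
rewrite transportS // IH ?sdim_face; [|lia|lia].
rewrite lastface_face // [transport (lastface s)]transportS; last by rewrite /lastface sdim_face;
  lia.
rewrite -/(iter 1 lastface s) stau_lasts //= mulgA; congr (_ * _ * _)%g.
by rewrite /back -iterSr.
Qed.

(** The relation [tau (face 1 x) = tau (face 0 x) * tau x] merges two consecutive edges into one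
    without changing their product. *)
Lemma transport_inner i s : (0 < i < sdim s)%N -> transport (sface i s) = transport s.
Proof.
move en: (sdim s) => n; elim: n i s en => [|n IH] i s en; first lia.
move=> ilt; have s1 : (1 < sdim s)%N by lia.
rewrite [RHS]transportS; last lia.
rewrite transportS ?sdim_face; last lia.
case: i ilt => [|[|i]] // ilt; last first.
  rewrite sface_sface; [|lia|lia]; rewrite stau_face; last lia.
  by rewrite IH // sdim_face en.
rewrite sface_sface; [|lia|lia].
rewrite [stau s]stau_face0 // [transport (sface 0 s)]transportS ?sdim_face; last lia.
by rewrite mulgA mulgK.
Qed.

Lemma transport_front_back i s : (i <= sdim s)%N ->
  transport s = (transport (back i s) * transport (front i s))%g.
Proof.
elim: i => [|i IH] le; first by rewrite [transport (front 0 s)]transport0 ?mulg1 // sdim_front.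
rewrite IH; last lia.
rewrite [transport (back i s)]transportS; last by rewrite sdim_back; lia.
rewrite [transport (front i.+1 s)]transport_last ?sdim_front // -frontS //= back_front; last lia.
rewrite subSn // subnn mulgA; congr (_ * _ * _)%g.
by rewrite stau_lasts // sdim_back; lia.
Qed.

Lemma back_succ_transport i s : (i < sdim s)%N ->
  transport (front i.+1 s) = (stau (back i s) * transport (front i s))%g.
Proof.
move=> le; rewrite [LHS]transport_last ?sdim_front // -frontS //= back_front; last lia.
by rewrite subSn // subnn; congr (_ * _)%g; rewrite stau_lasts // sdim_back; lia.
Qed.

(** Inversion reverses the product, so the inverses appear in the order of the edges, which is that
    of the factors t(x_1) ... t(x_k) in F. *)
Lemma transport_inv s : (transport s)^-1%g =
  foldr (fun g h => g * h)%g 1%g [seq (stau (back i s))^-1%g | i <- iota 0 (sdim s)].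
Proof.
rewrite /transport; move: (sdim s) => n; elim: n s => [|n IH] s; first by rewrite invg1.
rewrite /= invgM IH; congr (_ * foldr _ _ _)%g.
rewrite -[1%N]/(1 + 0)%N iotaDl -map_comp; apply: eq_map => i /=.
by rewrite /back -iterSr.
Qed.

Lemma szczarba0_degenerate s : degenerate s -> szczarba0 k tau s = 0.
Proof.
move=> [n [x [i [le ->]]]]; case: n x le => [|n] x //=.
by rewrite leqn0 => /eqP ->; rewrite (tau_degen0 tauP) invg1 subrr.
Qed.
Lemma szczarba_lin : linear (@szczarba k G X tau).
Proof. exact: chain_ext_lin szczarba0_degenerate. Qed.
Lemma szczarbaE s : szczarba tau (chain k s) = szczarba0 k tau s.
Proof. exact: chain_extE szczarba0_degenerate s. Qed.
Lemma szczarba_edge s : sdim s = 1%N -> szczarba tau (chain k s) = basis k (stau s)^-1%g - basis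
  k 1%g.
Proof. by rewrite szczarbaE; case: s => -[|[|n]] x. Qed.
Lemma szczarba_neq1 s : sdim s <> 1%N -> szczarba tau (chain k s) = 0.
Proof. by rewrite szczarbaE; case: s => -[|[|n]] x. Qed.

Lemma sum_by_size (T : eqType) (V : zmodType) (l : seq (seq T)) n (f : seq T -> V) :
  (forall q, q \in l -> size q <= n)%N ->
  \sum_(q <- l | size q != 0%N) f q =
  \sum_(1 <= i < n.+1) \sum_(q <- l | size q == i) f q.
Proof.
elim: l => [|q l IH] ln; first by rewrite big_nil big1 // => i _; rewrite big_nil.
rewrite big_cons IH; last by move=> q' ql; apply: ln; rewrite inE ql orbT.
rewrite [RHS](eq_bigr (fun i => (if i == size q then f q else 0) + \sum_(q' <- l | size q' == i)
  f q')).
  rewrite big_split /= -big_mkcond big_nat1_eq.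
  have := ln q (mem_head _ _); case: (size q) => [|m] le /=; first by rewrite add0r.
  by rewrite ltnS le.
by move=> i _; rewrite big_cons eq_sym; case: ifP; rewrite ?add0r.
Qed.

Section Breakpoints.
Variables (P : nat -> nat) (kk : nat).
Hypotheses (P0 : P 0 = 0%N) (P2 : forall r, (r < kk)%N -> P (2 * r).+2 = (P (2 * r).+1).+1)
  (Pmono : forall r, (r < kk)%N -> (P (2 * r).+2 <= P (2 * r).+3)%N).

(** Hypothesis [P2] makes every inner interval a single edge. The outer intervals then follow each
    other without gap, so that x_{k+1} is x itself. *)
Lemma flatten_ival r : (r <= kk)%N ->
  flatten [seq ival (P (2 * i)) (P (2 * i).+1) | i <- iota 0 r.+1] = iota 0 (P (2 * r).+1).+1.
Proof.
elim: r => [|r IH] rk; first by rewrite /= cats0 /ival muln0 P0 subn0.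
rewrite -[in iota 0 r.+2]addn1 iotaD map_cat flatten_cat IH; last lia.
have e2 : (2 * r.+1 = (2 * r).+2)%N by lia.
rewrite [map _ _]/= [flatten _]/= cats0 add0n /ival !e2 P2 //.
have := Pmono rk; rewrite P2 // => le.
have -> : (P (2 * r).+3).+1 = ((P (2 * r).+1).+1 + (P (2 * r).+3 - (P (2 * r).+1).+1).+1)%N by lia.
by rewrite iotaD.
Qed.

Let sum_ival r : (r < kk)%N ->
  (\sum_(0 <= i < r.+1) (P (2 * i).+1 - P (2 * i) + 1) = (P (2 * r).+1).+1)%N.
Proof.
elim: r => [|r IH] rk; first by rewrite big_nat1 muln0 P0 subn0 addn1.
rewrite big_nat_recr //= IH ?mulnS ?add2n; last lia.
have rk' : (r < kk)%N by lia.
by have := Pmono rk'; rewrite P2 //; lia.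
Qed.

(** With inner intervals of length 1, the second summand is the first plus k and the fourth is the
    third plus k. *)
Lemma eps_even : ~~ odd ((kk * kk.-1)./2 + \sum_(1 <= r < kk.+1) (kk.+1 - r) * (P (2 * r) - P (2
  * r).-1)
   + \sum_(1 <= r < kk.+1) P (2 * r).-1
   + \sum_(1 <= r < kk.+1)
       (P (2 * r) - P (2 * r).-1) * \sum_(0 <= i < r) (P (2 * i).+1 - P (2 * i) + 1))%N.
Proof.
have len r : (r < kk)%N -> (P (2 * r.+1) - P (2 * r.+1).-1 = 1)%N.
  by move=> rk; rewrite mulnS add2n /= P2 // subSnn.
rewrite !big_add1 /=.
rewrite (_ : \sum_(0 <= i < kk) (kk.+1 - i.+1) * _ = \sum_(0 <= i < kk) (i + 1))%N; last first.
  rewrite [RHS]big_nat_rev; apply: eq_big_nat => i /andP[_ ik]; rewrite len // muln1; lia.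
rewrite (_ : \sum_(0 <= i < kk) _ * _ = \sum_(0 <= i < kk) (P (2 * i.+1).-1 + 1))%N; last first.
  apply: eq_big_nat => i /andP[_ ik]; rewrite len // mul1n sum_ival // addn1.
  by rewrite mulnS.
rewrite !big_split /= !sum_nat_const_nat subn0 muln1.
have -> : (\sum_(0 <= i < kk) i = (kk * kk.-1)./2)%N by rewrite bin2_sum bin2.
by rewrite -!addnA !oddD; case: (odd _); case: (odd _); case: (odd _).
Qed.
End Breakpoints.

Section FrakF.
Variable s : simplex X.
Let n := sdim s.

Let t i : freemod k G := basis k (stau (back i s))^-1%g - basis k 1%g.

(** For a set q of edges (i, i + 1), this is the tuple p without its leading 0 whose inner intervals
    are these edges. *)
Fixpoint pairs_then (q : seq nat) : seq nat :=
  if q is i :: q' then i :: i.+1 :: pairs_then q' else [:: n].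

Lemma size_pairs q : size (pairs_then q) = (2 * size q).+1.
Proof. by elim: q => [|i q IH] //=; rewrite IH; lia. Qed.
Lemma nth_pairs_even q r : (r < size q)%N -> nth 0%N (pairs_then q) (2 * r) = nth 0%N q r.
Proof. by elim: q r => [|i q IH] [|r] // rq; rewrite mulnS /= IH. Qed.
Lemma nth_pairs_odd q r : (r < size q)%N -> nth 0%N (pairs_then q) (2 * r).+1 = (nth 0%N q r).+1.
Proof. by elim: q r => [|i q IH] [|r] // rq; rewrite mulnS /= IH. Qed.
Lemma nth_pairs_last q : nth 0%N (pairs_then q) (2 * size q) = n.
Proof. by elim: q => [|i q IH] //; rewrite [size _]/= mulnS /= IH. Qed.
Lemma pairs_inj : injective pairs_then.
Proof.
elim=> [|i q IH] [|j q'] // e; try by have := congr1 size e; rewrite !size_pairs /=; lia.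
by case: e => -> _ e'; rewrite (IH _ e').
Qed.

Lemma pairs_sorted x q : path leq x q -> sorted ltn q -> all (fun i => i < n)%N q -> (x <= n)%N ->
  path leq x (pairs_then q).
Proof.
elim: q x => [|i q IH] x /=; first by rewrite andbT.
move=> /andP[xi _] iq /andP[lti allq] xn; rewrite xi leqnSn /=.
apply: IH => //; last exact: (path_sorted iq).
by case: q iq {allq} => //= j q /andP[ij jq]; rewrite ij /=; apply: sub_path jq => a b; apply: ltnW.
Qed.

Let cond (kk : nat) (v : seq nat) :=
  [&& sorted leq v, nth 0 v 0 == 0 & nth 0 v (2 * kk).+1 == n]%N.
Let good (kk : nat) (v : seq nat) :=
  all (fun r => nth 0 v (2 * r) == (nth 0 v (2 * r).-1).+1)%N (iota 1 kk).

(** The left end points p_{2s-1} of the inner intervals form q; they increase strictly because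
    p_{2s-1} < p_{2s} <= p_{2s+1}. *)
Lemma pairs_ex kk v : size v = (2 * kk).+2 -> cond kk v -> good kk v ->
  exists q, [/\ size q = kk, subseq q (iota 0 n) & v = 0%N :: pairs_then q].
Proof.
move=> sv /and3P[sortv /eqP v0 /eqP vn] /allP gv.
pose q := mkseq (fun r => nth 0 v (2 * r).+1)%N kk.
have sq : size q = kk by rewrite size_mkseq.
have nq r : (r < kk)%N -> nth 0%N q r = nth 0%N v (2 * r).+1 by move=> rk; rewrite nth_mkseq.
have nv r : (r < kk)%N -> nth 0%N v (2 * r).+2 = (nth 0%N v (2 * r).+1).+1.
  move=> rk; have rI : r.+1 \in iota 1 kk by rewrite mem_iota; lia.
  by have /eqP := gv _ rI; rewrite mulnS.
have mono a b : (a <= b)%N -> (b < (2 * kk).+2)%N -> (nth 0 v a <= nth 0 v b)%N.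
  by move=> ab bk; apply: (sorted_leq_nth leq_trans leqnn) => //; rewrite inE sv; lia.
exists q; split=> //.
  have sortq : sorted ltn q.
    apply/(sortedP 0%N) => r; rewrite sq => rk; rewrite !nq; [|lia|lia].
    by rewrite /= -nv; [apply: mono; lia|lia].
  have qn : {subset q <= iota 0 n}.
    move=> x /(nthP 0%N)[r]; rewrite sq => rk <-; rewrite nq // mem_iota add0n leq0n /=.
    by rewrite -nv // -vn; apply: mono; lia.
  have -> : q = filter (mem q) (iota 0 n).
    apply: (irr_sorted_eq ltn_trans ltnn) => //.
      by apply: sorted_filter; [exact: ltn_trans|exact: iota_ltn_sorted].
    by move=> x; rewrite mem_filter andb_idr // => /qn.
  exact: filter_subseq.
apply: (@eq_from_nth _ 0%N); first by rewrite sv /= size_pairs sq.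
rewrite sv => -[|i] ilt //=.
have [r [|iE]] : exists r, i = (2 * r)%N \/ i = (2 * r).+1 by exists (i./2); lia.
  move=> iE; rewrite iE; have [rk|rk] := ltnP r kk.
    by rewrite nth_pairs_even ?sq // nq.
  have -> : r = kk by lia.
  by rewrite vn -sq nth_pairs_last.
have rk : (r < kk)%N by lia.
by rewrite iE nth_pairs_odd ?sq // nq // nv.
Qed.

Lemma pairs_cond q : subseq q (iota 0 n) ->
  [/\ cond (size q) (0%N :: pairs_then q), good (size q) (0%N :: pairs_then q) &
      all (fun i => i < n.+1)%N (0%N :: pairs_then q)].
Proof.
move=> qs; have sortq : sorted ltn q.
  by apply: (subseq_sorted ltn_trans qs); exact: iota_ltn_sorted.
have qn : all (fun i => i < n)%N q.
  by apply/allP => x /(mem_subseq qs); rewrite mem_iota.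
split.
- rewrite /cond /= nth_pairs_last eqxx !andbT; apply: pairs_sorted => //.
  by case: (q) sortq => //= a l; apply: sub_path => x y; apply: ltnW.
- apply/allP => r; rewrite mem_iota => rq; case: r rq => [|r] rq //.
  have rk : (r < size q)%N by lia.
  by rewrite mulnS /= nth_pairs_even // nth_pairs_odd.
elim: (q) qn => [|i l IH] /=; first by rewrite ltnS leqnn.
by move=> /andP[il /IH /= ->]; rewrite andbT; lia.
Qed.

Lemma frak_part_dim v r : (nth 0 v (2 * r).-1 <= nth 0 v (2 * r) <= n)%N ->
  sdim (frak_part s v r) = (nth 0 v (2 * r) - nth 0 v (2 * r).-1)%N.
Proof.
move=> le; rewrite /frak_part svert_ival // sdim_back sdim_lasts -/n; lia.
Qed.

Lemma foldr_gmul0 (l : seq (freemod k G)) : 0 \in l -> foldr (@gmul k G) (basis k 1%g) l = 0.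
Proof.
have [gl gr] := @gmul_bilin k G.
elim: l => [|x l IH] //=; rewrite inE => /orP[/eqP <-|/IH ->].
  exact: lin0 (gl _).
exact: lin0 (gr _).
Qed.

(** Some inner interval is a simplex of dimension other than 1, where Szczarba's cochain vanishes;
    one zero factor kills the product. *)
Lemma frakF_term0 kk v : size v = (2 * kk).+2 -> cond kk v -> ~~ good kk v ->
  frakF_term k tau n s kk v = 0.
Proof.
move=> sv /and3P[sortv /eqP v0 /eqP vn] /allPn[r rk ne].
rewrite /frakF_term foldr_gmul0 ?tens0l ?scaler0 //.
have mono a b : (a <= b)%N -> (b < (2 * kk).+2)%N -> (nth 0 v a <= nth 0 v b)%N.
  by move=> ab bk; apply: (sorted_leq_nth leq_trans leqnn) => //; rewrite inE sv; lia.
have rk' := rk; rewrite mem_iota in rk'.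
apply/mapP; exists r => //; rewrite szczarba_neq1 // frak_part_dim; last first.
  by rewrite -vn !mono //; lia.
have := mono (2 * r).-1 (2 * r)%N; move/eqP: ne; lia.
Qed.

Lemma frakF_term_pairs q : subseq q (iota 0 n) ->
  frakF_term k tau n s (size q) (0%N :: pairs_then q) =
  tens (foldr (@gmul k G) (basis k 1%g) (map t q)) (chain k s).
Proof.
move=> qs; set v := 0%N :: _; set kk := size q.
have qn r : (r < kk)%N -> (nth 0%N q r < n)%N.
  by move=> rk; have := mem_subseq qs (mem_nth 0%N rk); rewrite mem_iota.
have v1 r : (r < kk)%N -> nth 0%N v (2 * r).+1 = nth 0%N q r.
  by move=> rk; rewrite /= nth_pairs_even.
have v2 r : (r < kk)%N -> nth 0%N v (2 * r).+2 = (nth 0%N q r).+1.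
  by move=> rk; rewrite /= nth_pairs_odd.
have vl : nth 0%N v (2 * kk).+1 = n by rewrite /= nth_pairs_last.
have [/and3P[sortv _ _] _ _] := pairs_cond qs.
have mono a b : (a <= b)%N -> (b < (2 * kk).+2)%N -> (nth 0 v a <= nth 0 v b)%N.
  by move=> ab bk; apply: (sorted_leq_nth leq_trans leqnn) => //; rewrite inE /= size_pairs -/kk;
    lia.
have P2 r : (r < kk)%N -> nth 0%N v (2 * r).+2 = (nth 0%N v (2 * r).+1).+1.
  by move=> rk; rewrite v1 // v2.
have Pm r : (r < kk)%N -> (nth 0%N v (2 * r).+2 <= nth 0%N v (2 * r).+3)%N.
  by move=> rk; apply: mono; lia.
have lE : frak_last s kk v = s.
  rewrite /frak_last (flatten_ival (P := nth 0%N v) (erefl _) P2 Pm (leqnn kk)) vl.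
  by rewrite -[n in iota 0 n.+1]subn0 -/(ival 0 n) svert_front // front_id.
have partE r : (r < kk)%N -> szczarba tau (chain k (frak_part s v r.+1)) = t (nth 0%N q r).
  move=> rk; have h1 := v1 r rk; have h2 := v2 r rk.
  have le : (nth 0 v (2 * r.+1).-1 <= nth 0 v (2 * r.+1) <= n)%N.
    by rewrite mulnS [(_ + _).-1]/= [(2 + 2 * r)%N]/= h1 h2 leqnSn /=; exact: qn.
  have d1 : sdim (frak_part s v r.+1) = 1%N.
    by rewrite frak_part_dim // mulnS [(_ + _).-1]/= [(2 + 2 * r)%N]/= h1 h2 subSnn.
  rewrite szczarba_edge // /t; congr (basis k _^-1%g - _).
  rewrite /frak_part mulnS [(_ + _).-1]/= [(2 + 2 * r)%N]/= h1 h2 svert_ival; last first.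
    by rewrite leqnSn; exact: qn.
  have := qn r rk => lt; rewrite back_lasts -/n; last lia.
  by rewrite stau_lasts // sdim_back -/n; lia.
have epsE := eps_even (P := nth 0%N v) (erefl _) P2 Pm.
(* The last part is s itself, so its dimension and n add up to an even number, and the rest of the
   exponent is even by [eps_even]. *)
rewrite /frakF_term lE -/n -addnA -signr_odd oddD addnn odd_double addbF.
rewrite (negbTE epsE) expr0 scale1r; congr tens; congr foldr.
apply: (@eq_from_nth _ 0); first by rewrite !size_map size_iota.
rewrite size_map size_iota => r rk; rewrite (nth_map 0%N) ?size_iota // nth_iota // add1n partE //.
by rewrite (nth_map 0%N).
Qed.

Lemma sum_sublists (l : seq nat) :
  \sum_(q <- sublists l) foldr (@gmul k G) (basis k 1%g) (map t q) =
  foldr (@gmul k G) (basis k 1%g) [seq basis k (stau (back i s))^-1%g | i <- l].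
Proof.
have [gl gr] := @gmul_bilin k G.
elim: l => [|i l IH]; first by rewrite big_seq1.
rewrite /= big_cat big_map /= -(lin_sum _ _ _ (gr (t i))) IH.
by rewrite /t (linB (gl _)) gmul1 subrK.
Qed.

Lemma foldr_gmul_basis (l : seq G) :
  foldr (@gmul k G) (basis k 1%g) (map (fun g => basis k g) l) = basis k (foldr (fun g h => g *
    h)%g 1%g l).
Proof. by elim: l => //= g l ->; rewrite gmul_basis. Qed.

(* Only the p whose inner intervals have length 1 contribute to [frakF0]; they
   correspond to the subsets of the edges of s, and the sum is the expansion of
   the product of the elements [1 + t (edge)]. *)
Lemma frakF0E : frakF0 k tau s = tens (basis k (transport s)^-1%g) (chain k s).
Proof.
have tl := tens_linl (V := freemod k G) (chain k s).
have -> : tens (basis k (transport s)^-1%g) (chain k s) =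
    tens (\sum_(q <- sublists (iota 0 n)) foldr (@gmul k G) (basis k 1%g) (map t q)) (chain k s).
  by rewrite sum_sublists transport_inv -foldr_gmul_basis -map_comp.
have sz q : q \in sublists (iota 0 n) -> (size q <= n)%N.
  by rewrite mem_sublists => /size_subseq; rewrite size_iota.
(* The empty subset accounts for the summand 1 (x) x, which stands apart in [frakF0]; the other
   subsets are sorted by size to match the sum over k. *)
rewrite (lin_sum _ _ _ tl) (bigID (fun q : seq nat => size q == 0%N)) /=; congr (_ + _).
  rewrite big_mkcond (bigD1_seq [::]) /=; last exact: sublists_uniq (iota_uniq _ _).
    by rewrite big1 ?addr0 // => -[].
  by rewrite mem_sublists sub0seq.
rewrite -/n [RHS](sum_by_size _ sz).
apply: eq_big_nat => kk /andP[k1 kn].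
pose f (v : seq nat) := frakF_term k tau n s kk v.
(* Tuples with an inner interval of the wrong length are discarded; the remaining ones are then
   matched with the subsets of k edges. *)
transitivity (\sum_(v <- [seq map val (tval p) | p <- enum {: (2 * kk).+2.-tuple 'I_n.+1} &
    cond kk (map val (tval p)) && good kk (map val (tval p))]) f v).
  rewrite big_map big_filter big_enum_cond /= [LHS](bigID (fun p : (2 * kk).+2.-tuple 'I_n.+1 =>
    good kk (map val p))) /=.
  rewrite [X in _ + X]big1 ?addr0 // => p /andP[cp gp].
  by apply: frakF_term0 => //; rewrite size_map size_tuple.
transitivity (\sum_(v <- [seq 0%N :: pairs_then q | q <- sublists (iota 0 n) & size q == kk]) f
  v); last first.
  rewrite big_map big_filter big_seq_cond [RHS]big_seq_cond; apply: eq_bigr => q /andP[qs /eqP qk].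
  by rewrite /f -qk frakF_term_pairs // -mem_sublists.
apply: perm_big; apply: uniq_perm.
- rewrite map_inj_uniq; first by rewrite filter_uniq ?enum_uniq.
  by move=> p p' /(inj_map val_inj) /val_inj.
- rewrite map_inj_uniq ?filter_uniq ?sublists_uniq ?iota_uniq //.
  by move=> q q' [/pairs_inj].
move=> v; apply/mapP/mapP => -[].
  move=> p; rewrite mem_filter => /andP[/andP[cp gp] _] ->.
  have sp : size (map val (tval p)) = (2 * kk).+2 by rewrite size_map size_tuple.
  have [q [qk qs ->]] := pairs_ex sp cp gp.
  by exists q; rewrite // mem_filter qk eqxx mem_sublists.
move=> q; rewrite mem_filter mem_sublists => /andP[/eqP qk qs] ->.
have [cq gq aq] := pairs_cond qs; rewrite qk in cq gq.
have sv : size (0%N :: pairs_then q) == (2 * kk).+2 by rewrite /= size_pairs qk.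
pose w := [seq inord i : 'I_n.+1 | i <- 0%N :: pairs_then q].
have szw : size w == (2 * kk).+2 by rewrite size_map.
have wE : map val (Tuple szw) = 0%N :: pairs_then q.
  rewrite /= -[LHS]/(map val w) /w -map_comp -[RHS]map_id; apply/eq_in_map => i iq /=.
  by rewrite inordK //; exact: (allP aq).
by exists (Tuple szw) => //; rewrite mem_filter wE cq gq mem_enum.
Qed.
End FrakF.
End Transport.

(** * The twisted tensor product *)

Section TwistedTensor.
Variables (k : fieldType) (G : groupType) (X : sset) (F : gset G) (tau : forall n, X n.+1 -> G).
Hypothesis tauP : twisting_function tau.
Local Notation A := (twisted_tensor k F tau).
Local Notation Y := (twisted_product F tauP).
Local Notation D := (chains k Y).
Local Notation CX := (chains k X).
Local Notation CF := (Cset k F).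
Local Notation bs := (@basis k F).
Local Notation ch := (@chain k X).
Implicit Types (s : simplex X) (y : F).

Definition tpair s y : simplex Y := match s with existT n x => existT (fun n => (X n * F)%type) n
  (x, y) end.

Lemma tpair_ex (z : simplex Y) : exists s y, z = tpair s y.
Proof. by case: z => n [x y]; exists (existT _ n x), y. Qed.
Lemma sdim_tpair s y : sdim (tpair s y) = sdim s. Proof. by case: s. Qed.
Lemma sface_tpair i s y :
  sface i (tpair s y) = tpair (sface i s) (if i == 0%N then gop (stau tau s) y else y).
Proof. by case: s => -[|n] x //=; case: ifP => // _; rewrite gop1. Qed.
Lemma sdegen_tpair i s y : sdegen i (tpair s y) = tpair (sdegen i s) y.
Proof. by case: s. Qed.
Definition tfst (z : simplex Y) : simplex X := match z with existT n z' => existT _ n z'.1 end.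
Definition tsnd (z : simplex Y) : F := match z with existT n z' => z'.2 end.
Lemma tfst_tpair s y : tfst (tpair s y) = s. Proof. by case: s. Qed.
Lemma tsnd_tpair s y : tsnd (tpair s y) = y. Proof. by case: s. Qed.
Lemma degenerate_tpair s y : degenerate (tpair s y) <-> degenerate s.
Proof.
split=> /degenerateP[t [i [le e]]]; apply/degenerateP; last first.
  by exists (tpair t y), i; rewrite sdim_tpair sdegen_tpair e.
have [s' [y' tE]] := tpair_ex t; move: e; rewrite tE sdegen_tpair => e.
exists s', i; split; first by rewrite tE sdim_tpair in le.
by have := congr1 tfst e; rewrite !tfst_tpair.
Qed.

Lemma lasts_tpair m s y : (m <= sdim s)%N -> iter m lastface (tpair s y) = tpair (iter m lastface
  s) y.
Proof.
elim: m => [|m IH] le //; rewrite !iterS IH; last exact: ltnW.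
rewrite {1}/lastface sface_tpair sdim_tpair ifF // sdim_lasts; lia.
Qed.
Lemma front_tpair i s y : (i <= sdim s)%N -> front i (tpair s y) = tpair (front i s) y.
Proof. by move=> le; rewrite /front sdim_tpair lasts_tpair // leq_subr. Qed.
(** Each removal of vertex 0 moves the point of F by tau of the first edge, so i removals move it by
    T of the front part. *)
Lemma back_tpair i s y : (i <= sdim s)%N ->
  back i (tpair s y) = tpair (back i s) (gop (transport tau (front i s)) y).
Proof.
elim: i => [|i IH] le; first by rewrite transport0 ?gop1 // sdim_front.
rewrite backS IH; last exact: ltnW.
by rewrite sface_tpair /= -gopM back_succ_transport.
Qed.

Lemma aw_tpair s y : awc (chain k (tpair s y)) = \sum_(0 <= i < (sdim s).+1)
  tens (chain k (tpair (front i s) y)) (chain k (tpair (back i s) (gop (transport tau (front i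
    s)) y))).
Proof.
rewrite awcE sdim_tpair; apply: eq_big_nat => i /andP[_ le].
by rewrite front_tpair // back_tpair.
Qed.

Lemma chain_basis_ext (V : lmodType k) (f g : tensor CX CF -> V) : linear f -> linear g ->
  (forall s y, f (tens (ch s) (bs y)) = g (tens (ch s) (bs y))) -> f =1 g.
Proof.
move=> hf hg fg; apply: tens_ext => // c m.
move: c; apply: (chain_lin_ext (f := fun c => f (tens c m)) (g := fun c => g (tens c m))) => [||s].
- exact: lin_comp hf (tens_linl _).
- exact: lin_comp hg (tens_linl _).
move: m; apply: (lin_basis_ext (f := fun m => f (tens (ch s) m)) (g := fun m => g (tens (ch s)
  m))) => [||y].
- exact: lin_comp hf (tens_linr _).
- exact: lin_comp hg (tens_linr _).
exact: fg.
Qed.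

Let psi0 (c : CX) (m : CF) : D :=
  chain_ext (fun s => lext (fun y => chain k (tpair s (gop (transport tau s)^-1%g y))) m) c.
Definition psi : A -> D := tlift psi0.

Let psi0_deg (m : CF) s : degenerate s ->
  lext (fun y => chain k (tpair s (gop (transport tau s)^-1%g y))) m = 0.
Proof.
move=> ds; move: m; apply: lin_basis_ext; [exact: lext_lin|exact: lin_zero|] => y.
by rewrite lext_basis chain_degenerate //; apply/degenerate_tpair.
Qed.
Let psi0_bilin : bilin psi0.
Proof.
split=> [m|c]; first exact: chain_ext_lin (psi0_deg m).
by apply: chain_ext_linF => s; exact: lext_lin.
Qed.
Lemma psi_lin : linear psi. Proof. exact: tlift_lin psi0_bilin. Qed.
Lemma psiE s y : psi (tens (ch s) (bs y)) = chain k (tpair s (gop (transport tau s)^-1%g y)).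
Proof.
rewrite /psi (tliftE psi0_bilin) /psi0.
rewrite (chain_extE (psi0_deg (bs y))).
exact: lext_basis.
Qed.

Definition psi_inv : D -> A :=
  chain_ext (fun z => tens (ch (tfst z)) (bs (gop (transport tau (tfst z)) (tsnd z)))).
Let psi_inv_deg z : degenerate z ->
  tens (ch (tfst z)) (bs (gop (transport tau (tfst z)) (tsnd z))) = 0.
Proof.
have [s [y ->]] := tpair_ex z => /degenerate_tpair ds.
by rewrite tfst_tpair chain_degenerate // tens0l.
Qed.
Lemma psi_inv_lin : linear psi_inv. Proof. exact: chain_ext_lin psi_inv_deg. Qed.
Lemma psi_invE s y : psi_inv (chain k (tpair s y)) = tens (ch s) (bs (gop (transport tau s) y)).
Proof. by rewrite /psi_inv (chain_extE psi_inv_deg) tfst_tpair tsnd_tpair. Qed.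

Lemma psiK : cancel psi psi_inv.
Proof.
apply: (chain_basis_ext (f := fun t => psi_inv (psi t)) (g := fun t => t)) => [||s y] //.
  exact: lin_comp psi_inv_lin psi_lin.
by rewrite psiE psi_invE -gopM mulgV gop1.
Qed.
Lemma psi_invK : cancel psi_inv psi.
Proof.
apply: (chain_lin_ext (f := fun t => psi (psi_inv t)) (g := fun t => t)) => [||z] //.
  exact: lin_comp psi_lin psi_inv_lin.
have [s [y ->]] := tpair_ex z.
by rewrite psi_invE psiE -gopM mulVg gop1.
Qed.
Lemma psi_bij : bijective psi. Proof. by exists psi_inv; [exact: psiK|exact: psi_invK]. Qed.

Let kb := @kact_bilin k G F.
Let szl := @szczarba_lin k G X tau tauP.
Let sgl := sgn_lin (chains_grading k X).

Let tw1 (m : CF) (c1 c2 : CX) : A := tens (sgn c1) (kact (szczarba tau c2) m).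
Lemma tw1_bilin m : bilin (tw1 m).
Proof.
split=> c.
  exact: lin_comp (tens_linl _) sgl.
exact: lin_comp (tens_linr _) (lin_comp (kb.1 m) szl).
Qed.
Lemma tw1_linm t : linear (fun m => tlift (tw1 m) t : A).
Proof.
by apply: tlift_linF => c1 c2; exact: lin_comp (tens_linr _) (kb.2 _).
Qed.

Let dif0 (c : CX) (m : CF) : A := tens (dif c) m - tlift (tw1 m) (cop c).
Lemma tdif_bilin : bilin dif0.
Proof.
split=> [m|c].
  apply: lin_add; first exact: lin_comp (tens_linl m) (@dch_lin k X).
  by apply: lin_opp; exact: lin_comp (tlift_lin (tw1_bilin m)) (@awc_lin k X).
by apply: lin_add; [exact: tens_linr|apply: lin_opp; exact: tw1_linm].
Qed.
Lemma tdif_lin : linear (@dif _ _ A). Proof. exact: tlift_lin tdif_bilin. Qed.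
Lemma tdifE (c : CX) (m : CF) : dif (tens c m : A) = tens (dch c) m - tlift (tw1 m) (awc c).
Proof. exact: tliftE tdif_bilin c m. Qed.

(** In the twisting term only the summand whose second factor is the last edge survives, and the -1
    in its value tau^-1 - 1 removes the untwisted last face. So this differential twists the last
    face, while that of X x_tau F twists the first. *)
Lemma tdif_chain s y : dif (tens (ch s) (bs y) : A) =
  if sdim s is n.+1 then
    \sum_(0 <= i < n.+1) (-1) ^+ i *: tens (ch (sface i s)) (bs y)
    + (-1) ^+ n.+1 *: tens (ch (sface n.+1 s)) (bs (gop (stau tau (back n s))^-1%g y))
  else 0.
Proof.
rewrite tdifE dchE awcE (lin_sum _ _ _ (tlift_lin (tw1_bilin _))).
have twE i : tlift (tw1 (bs y)) (tens (ch (front i s)) (ch (back i s))) =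
    tens (sgn (ch (front i s) : CX)) (kact (szczarba tau (ch (back i s))) (bs y)).
  exact: tliftE (tw1_bilin _) _ _.
have tw0 i : (sdim s - i)%N <> 1%N -> tlift (tw1 (bs y)) (tens (ch (front i s)) (ch (back i s)))
  = 0.
  move=> ne; rewrite twE (szczarba_neq1 k tauP) ?sdim_back //.
  by rewrite (lin0 (kb.1 _)) tens0r.
case nE: (sdim s) => [|n].
  rewrite boundary0 // big_nat1 tens0l tw0 ?subr0 // nE; lia.
rewrite (boundaryE k nE) (lin_sum _ _ _ (tens_linl _)) big_nat_recr //= -addrA.
congr (_ + _); first by apply: eq_bigr => i _; rewrite (linZ _ (tens_linl _)).
rewrite big_nat_recr //= [X in _ - (_ + X)]tw0 ?addr0; last by rewrite nE; lia.
rewrite big_nat_recr //= big_nat big1 ?add0r; last first.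
  by move=> i /andP[_ im]; rewrite tw0 // nE; lia.
rewrite twE sgn_chain sdim_front ?nE // (szczarba_edge k tauP); last by rewrite sdim_back nE; lia.
rewrite (linB (kb.1 _)) kact_basis kact1 (linZ _ (tens_linl _)) (linB (tens_linr _)) /=.
have -> : front n s = sface n.+1 s.
  by rewrite frontS ?nE // -{1}nE front_id /lastface nE.
rewrite !(linZ _ (tens_linl _)) exprS mulN1r !scaleNr opprB addrA.
by rewrite addNr add0r.
Qed.

(** Acting by T(x)^-1 trades the twist of the first face for one of the last face: the product T(x)
    ends in tau x, begins with tau of the last edge, and is unchanged under inner faces. *)
Lemma psi_dif x : psi (dif x) = dif (psi x).
Proof.
move: x; apply: chain_basis_ext => [||s y].
- exact: lin_comp psi_lin tdif_lin.
- exact: lin_comp (@dch_lin k Y) psi_lin.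
rewrite psiE -[RHS]/(dch (chain k (tpair s (gop (transport tau s)^-1%g y)))) dchE tdif_chain.
case nE: (sdim s) => [|n]; first by rewrite boundary0 ?sdim_tpair // (lin0 psi_lin).
rewrite (@boundaryE k _ n) ?sdim_tpair // (linD psi_lin) (lin_sum _ _ _ psi_lin)
  [RHS]big_nat_recr //=.
rewrite (linZ _ psi_lin) psiE -gopM sface_tpair; congr (_ + _ *: chain k (tpair _ (gop _ y)));
  last first.
  rewrite -invgM; congr (_^-1)%g; rewrite [RHS](transport_last tauP) ?nE //.
  by rewrite /lastface nE.
apply: eq_big_nat => i /andP[_ im]; rewrite (linZ _ psi_lin) psiE sface_tpair.
congr (_ *: chain k (tpair _ _)); case: i im => [|i] im /=.
  by rewrite -gopM [in RHS]transportS ?nE // invgM mulgA mulgV mul1g.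
by rewrite transport_inner ?nE.
Qed.

Let fr0 s : degenerate s -> frakF0 k tau s = 0.
Proof. by move=> ds; rewrite (frakF0E k tauP) chain_degenerate // tens0r. Qed.
Lemma frakF_lin : linear (@frakF k G X tau). Proof. exact: chain_ext_lin fr0. Qed.
Lemma frakFE s : frakF tau (ch s) = tens (basis k (transport tau s)^-1%g) (ch s).
Proof. by rewrite /frakF (chain_extE fr0) (frakF0E k tauP). Qed.

(** The nested lifts of the coproduct are named from the inside out, since each level has to be
    known to be bilinear before it can be evaluated. *)
Let c3 (c1 : CX) (m1 m2 : CF) (a : freemod k G) (c' : CX) : tensor A A :=
  tens (tens c1 (kact a m1)) (tens c' m2).
Lemma c3_bilin c1 m1 m2 : bilin (c3 c1 m1 m2).
Proof.
split=> z; first exact: lin_comp (tens_linl _) (lin_comp (tens_linr _) (kb.1 m1)).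
exact: lin_comp (tens_linr _) (tens_linl _).
Qed.
Let c2 (c1 c2 : CX) (m1 m2 : CF) : tensor A A := tlift (c3 c1 m1 m2) (frakF tau c2).
Lemma c2_bilin c1 c2' : bilin (c2 c1 c2').
Proof.
split=> m; apply: tlift_linF => a c'.
  exact: lin_comp (tens_linl _) (lin_comp (tens_linr _) (kb.2 a)).
exact: lin_comp (tens_linr _) (tens_linr _).
Qed.
Let c1 (t : tensor CF CF) (a b : CX) : tensor A A := tlift (c2 a b) t.
Lemma c1_bilin t : bilin (c1 t).
Proof.
split=> c; apply: tlift_linF => m1 m2.
  by apply: tlift_linF => a c'; exact: lin_comp (tens_linl _) (tens_linl _).
exact: lin_comp (tlift_lin (c3_bilin _ _ _)) frakF_lin.
Qed.
Lemma c1_lint a b : linear (fun t => c1 t a b). Proof. exact: tlift_lin (c2_bilin a b). Qed.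
Let cop0 (c : CX) (m : CF) : tensor A A := tlift (c1 (cop m)) (cop c).
Lemma cset_cop_lin : linear (@cop _ _ CF). Proof. exact: lext_lin. Qed.
Lemma tcop_bilin : bilin cop0.
Proof.
split=> [m|c]; first exact: lin_comp (tlift_lin (c1_bilin _)) (@awc_lin k X).
by apply: tlift_linF => a b; exact: lin_comp (c1_lint a b) cset_cop_lin.
Qed.
Lemma tcop_lin : linear (@cop _ _ A). Proof. exact: tlift_lin tcop_bilin. Qed.
Lemma tcopE (c : CX) (m : CF) : cop (tens c m : A) = tlift (c1 (cop m)) (awc c).
Proof. exact: tliftE tcop_bilin c m. Qed.
Lemma c1E a b m1 m2 : c1 (tens m1 m2) a b = tlift (c3 a m1 m2) (frakF tau b).
Proof. exact: tliftE (c2_bilin a b) m1 m2. Qed.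

Lemma tcop_chain s y : cop (tens (ch s) (bs y) : A) = \sum_(0 <= i < (sdim s).+1)
  tens (tens (ch (front i s)) (bs (gop (transport tau (back i s))^-1%g y)))
       (tens (ch (back i s)) (bs y)).
Proof.
have cE : cop (bs y : CF) = tens (bs y) (bs y) by exact: lext_basis.
rewrite tcopE cE awcE (lin_sum _ _ _ (tlift_lin (c1_bilin _))); apply: eq_bigr => i _.
rewrite (tliftE (c1_bilin _)) c1E frakFE (tliftE (c3_bilin _ _ _)) /c3.
by rewrite kact_basis.
Qed.

(** T(x) is T of the back part times T of the front part. The inverse of the former, contributed by
    F, completes the inverse of the latter, contributed by [psi], to T(x)^-1. *)
Lemma psi_cop x : cop (psi x) = tmap psi psi (cop x).
Proof.
have ppl := tmap_lin psi_lin psi_lin.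
move: x; apply: chain_basis_ext => [||s y].
- exact: lin_comp (@awc_lin k Y) psi_lin.
- exact: lin_comp ppl tcop_lin.
rewrite psiE [LHS]aw_tpair tcop_chain (lin_sum _ _ _ ppl); apply: eq_big_nat => i /andP[_ le].
rewrite (tmapE _ _ psi_lin psi_lin) !psiE -!gopM (transport_front_back tauP le) invgM.
by rewrite mulgA mulgV mul1g.
Qed.

Let eps0 (c : CX) (m : CF) : k^o := eps c * eps m.
Lemma teps_bilin : bilin eps0.
Proof.
split=> [m a x z|c a x z]; rewrite /eps0.
  have -> : eps (a *: x + z : CX) = a * eps x + eps z by exact: (@epsc_lin k X a x z).
  by rewrite mulrDl -mulrA.
have -> : eps (a *: x + z : CF) = a * eps x + eps z by exact: (@lext_lin k F k^o (fun=> 1) a x z).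
by rewrite mulrDr /GRing.scale /= mulrCA.
Qed.
Lemma teps_lin : linear (@eps _ _ A : A -> k^o). Proof. exact: tlift_lin teps_bilin. Qed.
Lemma tepsE (c : CX) (m : CF) : eps (tens c m : A) = eps c * eps m. Proof. exact: tliftE
  teps_bilin c m. Qed.

Lemma psi_eps x : eps (psi x) = eps x.
Proof.
move: x; apply: (chain_basis_ext (V := k^o)) => [||s y].
- exact: lin_comp (@epsc_lin k Y) psi_lin.
- exact: teps_lin.
rewrite psiE tepsE [LHS]epscE sdim_tpair [eps (ch s : CX)]epscE.
have -> : eps (bs y : CF) = 1 by exact: (@lext_basis k F k^o (fun=> 1)).
by rewrite mulr1.
Qed.

Lemma psi_pc i x : pc i x <-> pc i (psi x).
Proof.
split.
  move: x; apply: pc2_sub => [|a b c m ab ca mb].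
    exact: (subspace_preim psi_lin (pc_subspace (chains_grading k Y) i)).
  rewrite /mkset; move: mb; rewrite /=; case: eqP => [b0 _|_ ->]; last first.
    by rewrite tens0r (lin0 psi_lin); exact: (subsp0 (pc_subspace (chains_grading k Y) i)).
  rewrite b0 addr0 in ab; subst a.
  move: c ca; apply: lspan_sub => [|_ [s [sd ->]]].
    exact: (subspace_preim (lin_comp psi_lin (tens_linl _)) (pc_subspace (chains_grading k Y) i)).
  rewrite /mkset; move: m; apply: freemod_ind => [|m m' hm hm'|a y].
  - by rewrite tens0r (lin0 psi_lin); exact: (subsp0 (pc_subspace (chains_grading k Y) i)).
  - by rewrite (linD (tens_linr _)) (linD psi_lin);
    exact: (subspD (pc_subspace (chains_grading k Y) i)).
  rewrite (linZ _ (tens_linr _)) (linZ _ psi_lin) psiE;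
    apply: (subspZ _ (pc_subspace (chains_grading k Y) i)).
  by rewrite -sd -(sdim_tpair s (gop (transport tau s)^-1%g y)); exact: pc_chain.
move=> h; rewrite -[x]psiK; move: (psi x) h; apply: lspan_sub => [|_ [z [zd ->]]].
  exact: (subspace_preim psi_inv_lin (pc2_subspace _ _ _)).
have [s [y zE]] := tpair_ex z; rewrite /mkset zE psi_invE -zd zE sdim_tpair.
rewrite -[(sdim s)%:Z]addr0; apply: pc2_tens; first exact: pc_chain.
by [].
Qed.

Lemma twisted_tensor_dgc : is_dgc (-1) A.
Proof.
apply: (dgc_transport psi_lin psi_bij psi_pc psi_cop psi_eps) => //.
- exact: psi_dif.
- exact: chains_dgc.
Qed.
End TwistedTensor.

(** * The filtration by powers of the augmentation ideal *)

Section AugmentationFiltration.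
Variables (k : fieldType) (G : groupType) (F : gset G).
Local Notation bg := (@basis k G).
Local Notation kG := (freemod k G).
Local Notation CF := (Cset k F).
Implicit Types (u a b : kG) (m : CF).

Let kl m : linear (fun u : kG => kact u m : CF) := (@kact_bilin k G F).1 m.
Let kr u : linear (fun m : CF => kact u m : CF) := (@kact_bilin k G F).2 u.

Lemma aug_lin (T : Type) : linear (@aug k T : freemod k T -> k^o).
Proof. exact: lext_lin. Qed.
Lemma aug_basis (T : Type) (x : T) : aug (basis k x) = 1.
Proof. exact: (@lext_basis k T k^o). Qed.
Lemma aug_kact u m : aug (kact u m) = aug u * aug m.
Proof.
move: u; apply: (@lin_basis_ext k G k^o (fun u => aug (kact u m)) (fun u => (aug u : k^o) * aug
  m)) => [||g].
- exact: lin_comp (@aug_lin F) (kl m).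
- exact: lin_scalel (aug m : k^o) (@aug_lin G).
rewrite aug_basis mul1r; move: m.
apply: (@lin_basis_ext k F k^o (fun m => aug (kact (bg g) m)) (fun m => aug m)) => [||y].
- exact: lin_comp (@aug_lin F) (kr _).
- exact: aug_lin.
by rewrite kact_basis !aug_basis.
Qed.

Lemma aug_pow_subspace p : is_subspace (@aug_pow k G p).
Proof. by case: p => [|p]; [exact: subspace_all|exact: lspan_subspace]. Qed.

Lemma filF_subspace q : is_subspace (@filF k G F q).
Proof. exact: lspan_subspace. Qed.

Lemma filF_all q m : 0 <= q -> filF q m.
Proof.
move=> q0; apply: lspan_mem; exists (bg 1%g), m; split; last by rewrite kact1.
have [/eqP ->|] : (q == 0) \/ ~~ (q <= 0) by lia.
  by [].
by move=> /negbTE ->.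
Qed.

Lemma filF_nat p : @filF k G F (- p%:Z) = [set m | m \in lspan [set w | exists u m', aug_pow p u
  /\ w = kact u m']].
Proof.
rewrite /filF; have -> : (- p%:Z <= 0) = true by lia.
by have -> : `|- p%:Z|%N = p by lia.
Qed.

Lemma filF_cases q : (exists p : nat, q = - p%:Z) \/ 0 <= q - 1.
Proof.
by have [q0|q0] := lerP q 0; [left; exists `|q|%N|right]; lia.
Qed.

End AugmentationFiltration.

Section GroupRingIdeal.
Variables (k : fieldType) (G : groupType).
Local Notation kG := (freemod k G).

Lemma aug_gmul (a b : kG) : aug (gmul a b) = aug a * aug b.
Proof. exact: (@aug_kact k G (gset_self G) a b). Qed.
Lemma gmulA (a b c : kG) : gmul a (gmul b c) = gmul (gmul a b) c.
Proof. exact: (@kactA k G (gset_self G) a b c). Qed.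

Lemma aug_pow_gmul p (a b : kG) : aug_pow p b -> aug_pow p (gmul a b).
Proof.
case: p => [|p] //; move: b.
apply: lspan_sub => [|_ [c [b [c0 pb ->]]]].
  exact: (subspace_preim ((@gmul_bilin k G).2 a) (aug_pow_subspace k G p.+1)).
rewrite /mkset gmulA; apply: lspan_mem; exists (gmul a c), b; split => //.
by rewrite /aug_ideal /mkset aug_gmul (c0 : aug c = 0) mulr0.
Qed.

Lemma aug_powS p : @aug_pow k G p.+1 `<=` aug_pow p.
Proof.
apply: lspan_sub; first exact: aug_pow_subspace.
by move=> _ [a [b [_ pb ->]]]; exact: aug_pow_gmul.
Qed.

Lemma aug_pow1 (u : kG) : aug_pow 1 u -> aug u = 0.
Proof.
move: u; apply: lspan_sub => [|_ [a [b [a0 _ ->]]]].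
  exact: (subspace_preim (@aug_lin k G) (subspace0 _)).
by rewrite /mkset aug_gmul (a0 : aug a = 0) mul0r.
Qed.
End GroupRingIdeal.

Section FilteredModule.
Variables (k : fieldType) (G : groupType) (F : gset G).
Local Notation bg := (@basis k G).
Local Notation bs := (@basis k F).
Local Notation kG := (freemod k G).
Local Notation CF := (Cset k F).
Implicit Types (u a b : kG) (m : CF).

Let kl m : linear (fun u : kG => kact u m : CF) := (@kact_bilin k G F).1 m.
Let kr u : linear (fun m : CF => kact u m : CF) := (@kact_bilin k G F).2 u.
Let fs := filF_subspace k F.

Lemma filF_kact q u m : filF q m -> filF q (kact u m : CF).
Proof.
move: m; apply: lspan_sub => [|_ [v [m' [pv ->]]]]; first exact: (subspace_preim (kr u) (fs q)).
rewrite /mkset kactA; apply: lspan_mem; exists (gmul u v), m'; split=> //.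
exact: aug_pow_gmul.
Qed.

Lemma filF_aug q a m : aug_ideal a -> filF q m -> filF (q - 1) (kact a m : CF).
Proof.
move=> a0; have [[p ->]|q1] := filF_cases q; last by move=> _; exact: filF_all.
have -> : - p%:Z - 1 = - p.+1%:Z by lia.
rewrite !filF_nat; move: m; apply: lspan_sub => [|_ [v [m' [pv ->]]]].
  by rewrite -filF_nat; exact: (subspace_preim (kr a) (fs _)).
rewrite /mkset kactA; apply: lspan_mem; exists (gmul a v), m'; split=> //.
by apply: lspan_mem; exists a, v.
Qed.

Lemma filF_incr q : @filF k G F (q - 1) `<=` filF q.
Proof.
have [[p ->]|q1] := filF_cases q; last by move=> m _; apply: filF_all; lia.
have -> : - p%:Z - 1 = - p.+1%:Z by lia.
rewrite !filF_nat; apply: lspan_sub => [|_ [v [m' [pv ->]]]]; first by rewrite -filF_nat.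
by apply: lspan_mem; exists v, m'; split=> //; exact: aug_powS.
Qed.

(** The differences g - 1 span the augmentation ideal. The correction by [aug u] lets the induction
    run over all u. *)
Lemma kact_aug (W : set CF) m : is_subspace W -> (forall g, W (kact (bg g - bg 1%g) m : CF)) ->
  forall u, W (kact u m - aug u *: m).
Proof.
move=> hW Wg; apply: freemod_ind => [|u v hu hv|a g].
- by rewrite (lin0 (kl m)) (lin0 (@aug_lin k G)) scale0r subrr; exact: subsp0.
- rewrite (linD (kl m)) (linD (@aug_lin k G)) scalerDl opprD addrACA.
  exact: subspD.
rewrite (linZ _ (kl m)) (linZ _ (@aug_lin k G)) aug_basis -scalerA -scalerBr scale1r.
by apply: subspZ => //; have := Wg g; rewrite (linB (kl m)) kact1.
Qed.

(** An induction principle for the powers of the augmentation ideal: each further power is reached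
    by differences g - 1 alone. *)
Lemma filF_gen p (W : set CF) : is_subspace W ->
  (forall g m, filF (- p%:Z) m -> W (kact (bg g - bg 1%g) m : CF)) ->
  filF (- p.+1%:Z) `<=` W.
Proof.
move=> hW Wg; rewrite filF_nat; apply: lspan_sub => // _ [u [m [pu ->]]].
move: u pu; apply: lspan_sub; first exact: (subspace_preim (kl m) hW).
move=> _ [a [b [a0 pb ->]]]; rewrite /mkset -kactA.
have := @kact_aug W (kact b m) hW _ a; rewrite (a0 : aug a = 0) scale0r subr0; apply => g.
by apply: Wg; rewrite filF_nat; apply: lspan_mem; exists b, m.
Qed.

Lemma cset_copE (y : F) : cop (bs y : CF) = tens (bs y) (bs y).
Proof. exact: lext_basis. Qed.
Let cl := @cset_cop_lin k G F.

Lemma cop_kact g m : cop (kact (bg g) m : CF) = tmap (kact (bg g)) (kact (bg g)) (cop m).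
Proof.
move: m; apply: lin_basis_ext => [||y].
- exact: lin_comp cl (kr _).
- exact: lin_comp (tmap_lin (kr _) (kr _)) cl.
by rewrite kact_basis !cset_copE (tmapE _ _ (kr _) (kr _)) !kact_basis.
Qed.

Lemma aug_ideal_basis g : aug_ideal (bg g - bg 1%g).
Proof. by rewrite /aug_ideal /mkset (linB (@aug_lin k G)) !aug_basis subrr. Qed.

(** As g is group-like, the coproduct of (g - 1) m is obtained from that of m by applying (g - 1)
    (x) g + 1 (x) (g - 1), and each summand lowers the total filtration by one. *)
Lemma filF_cop q m : filF q m -> pc2 (@filF k G F) (@filF k G F) q (cop m).
Proof.
have hp q' := pc2_subspace (@filF k G F) (@filF k G F) q'.
have h0 q' : 0 <= q' -> forall t, pc2 (@filF k G F) (@filF k G F) q' t.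
  move=> q0; apply: tens_ind => [|s t hs ht|x y]; first exact: subsp0.
    exact: subspD.
  by rewrite -[q']addr0; apply: pc2_tens; exact: filF_all.
have [[p ->]|q1] := filF_cases q; last by move=> _; apply: h0; lia.
elim: p m => [|p IH] m; first by move=> _; exact: h0.
move: m; apply: filF_gen => [|g m fm]; first exact: (subspace_preim cl (hp _)).
rewrite /mkset (linB (kl m)) kact1 (linB cl) cop_kact.
move: (cop m) (IH m fm); apply: pc2_sub => [|i j x y ij fx fy].
  exact: (subspace_preim (lin_add (tmap_lin (kr _) (kr _)) (lin_opp (@lin_id k _))) (hp _)).
rewrite /mkset (tmapE _ _ (kr _) (kr _)).
set gx := kact _ x; set gy := kact _ y.
have -> : tens gx gy - tens x y = tens (gx - x) gy + tens x (gy - y).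
  by rewrite (linB (tens_linl _)) (linB (tens_linr _)) addrA subrK.
have e z : kact (bg g) z - z = kact (bg g - bg 1%g) z :> CF by rewrite (linB (kl z)) kact1.
rewrite /gx /gy !e; apply: subspD => //; apply: pc2_tens_eq.
- by apply: filF_aug fx; exact: aug_ideal_basis.
- exact: filF_kact fy.
- lia.
- exact: fx.
- by apply: filF_aug fy; exact: aug_ideal_basis.
- lia.
Qed.

Lemma filF_aug0 m : filF (-1) m -> aug m = 0.
Proof.
rewrite -[(-1 : int)]/(- 1%:Z) filF_nat; move: m; apply: lspan_sub => [|_ [u [m [pu ->]]]].
  exact: (subspace_preim (@aug_lin k F) (subspace0 _)).
by rewrite /mkset aug_kact aug_pow1 // mul0r.
Qed.

Lemma filF_nilpotent N q : @aug_pow k G N = [set 0] -> q <= - N%:Z -> @filF k G F q `<=` [set 0].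
Proof.
move=> hN qN m hm; have {qN} := fil_mono filF_incr qN hm; rewrite filF_nat.
move: m {hm}; apply: lspan_sub; first exact: subspace0.
by move=> _ [u [m [pu ->]]]; move: pu; rewrite hN => ->; rewrite /mkset (lin0 (kl m)).
Qed.

Lemma cset_grading : is_grading CF.
Proof.
apply: (@grading_criterion _ _ CF (fun i m => if i == 0 then m else 0)).
- by move=> i /=; case: ifP => _; [exact: subspace_all|exact: subspace0].
- by move=> P _ _ P1 x; apply: (P1 0).
- by move=> i; case: (i == 0); [exact: lin_id|exact: lin_zero].
- by move=> i x /=; case: eqP => // _ ->.
- by move=> i j x /=; case: eqP => [->|_ ->] _; [case: eqP => // -> /(_ erefl)|case: ifP].
Qed.

Lemma cset_pc0 m : pc 0 m. Proof. by []. Qed.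

Lemma cset_dgc s : is_dgc s CF.
Proof.
have dl : linear (@dif _ _ CF) by exact: lin_zero.
split.
- exact: cset_grading.
- exact: dl.
- exact: cl.
- exact: aug_lin.
- move=> i x _; exact: (subsp0 (pc_subspace cset_grading _)).
- move=> i x; have [-> _|ne] := eqVneq i 0; last first.
    have hx : pc i x -> x = 0 by rewrite /= (negbTE ne).
    by move=> /hx ->; rewrite (lin0 cl); exact: (subsp0 (pc2_subspace _ _ _)).
  move: (cop x); apply: tens_ind => [|t t' ht ht'|y z].
  + exact: (subsp0 (pc2_subspace _ _ _)).
  + exact: (subspD (pc2_subspace _ _ _)).
  + exact: (@pc2_tens _ _ _ _ (@pc _ _ CF) (@pc _ _ CF) 0 0).
- by move=> i x /=; case: eqP => // _ -> _; exact: (lin0 (@aug_lin k F)).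
- by [].
- move=> x; move: x; apply: lin_basis_ext => [||y].
  + exact: lin_comp (@tassoc_lin _ _ _ _) (lin_comp (tmap_lin cl (@lin_id k _)) cl).
  + exact: lin_comp (tmap_lin (@lin_id k _) cl) cl.
  + rewrite cset_copE (tmapE _ _ cl (@lin_id k _)) (tmapE _ _ (@lin_id k _) cl) !cset_copE.
    exact: tassocE.
- have hb : bilin (fun y z : CF => eps y *: z).
    by split=> w; [exact: lin_scalel (@aug_lin k F)|exact: lin_scale (@lin_id k _)].
  move=> x; move: x; apply: lin_basis_ext => [||y]; [|exact: lin_id|].
    exact: lin_comp (tlift_lin hb) cl.
  by rewrite cset_copE (tliftE hb) [eps _]aug_basis scale1r.
- have hb : bilin (fun y z : CF => eps z *: y).
    by split=> w; [exact: lin_scale (@lin_id k _)|exact: lin_scalel (@aug_lin k F)].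
  move=> x; move: x; apply: lin_basis_ext => [||y]; [|exact: lin_id|].
    exact: lin_comp (tlift_lin hb) cl.
  by rewrite cset_copE (tliftE hb) [eps _]aug_basis scale1r.
- move=> x; rewrite (lin0 cl) /dif2.
  rewrite (@tlift_eq _ _ _ _ _ (fun _ _ => 0)).
    have hb : bilin (fun _ _ : CF => 0 : tensor CF CF) by split=> w; exact: lin_zero.
    move: (cop x); apply: tens_ind => [|t t' ht ht'|y z].
    + by rewrite (lin0 (tlift_lin hb)).
    + by rewrite (linD (tlift_lin hb)) -ht -ht' addr0.
    + by rewrite (tliftE hb).
  by move=> v w; rewrite tens0l tens0r addr0.
- by move=> x; exact: (lin0 (@aug_lin k F)).
Qed.

Lemma filF_filtered : is_filtered_dgc (@filF k G F).
Proof.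
split.
- exact: fs.
- move=> q x fx i; rewrite (hcomp_pc cset_grading (cset_pc0 x)) singleE.
  by case: ifP => _ //; exact: (subsp0 (fs q)).
- exact: filF_incr.
- by move=> q x _; exact: (subsp0 (fs q)).
- exact: filF_cop.
Qed.

End FilteredModule.

(** * The filtration of the twisted tensor product *)

Section TwistedFiltration.
Variables (k : fieldType) (G : groupType) (X : sset) (F : gset G) (tau : forall n, X n.+1 -> G).
Hypothesis tauP : twisting_function tau.
Local Notation A := (twisted_tensor k F tau).
Local Notation CX := (chains k X).
Local Notation CF := (Cset k F).
Local Notation Fil := (@twisted_fil k G X F tau).
Implicit Types (c : CX) (m : CF).

Let hA := twisted_tensor_dgc k F tauP.
Let kb := @kact_bilin k G F.

Lemma tfil_subspace q : is_subspace (Fil q). Proof. exact: lspan_subspace. Qed.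
Lemma tfil_tens q c m : filF q m -> Fil q (tens c m : A).
Proof. by move=> fm; apply: lspan_mem; exists c, m. Qed.
Lemma tfil_sub q (W : set A) : is_subspace W -> (forall c m, filF q m -> W (tens c m)) -> Fil q
  `<=` W.
Proof. by move=> hW Wt; apply: lspan_sub => // _ [c [m [fm ->]]]; exact: Wt. Qed.

Lemma pc_ttens i c m : pc i c -> pc i (tens c m : A).
Proof. by move=> ci; rewrite -[i]addr0; exact: (@pc2_tens _ _ _ _ (@pc _ _ CX) (@pc _ _ CF)). Qed.

Lemma sgn_ttens c m : sgn (tens c m : A) = tens (sgn c) m.
Proof.
have hg := dgc_grading hA; have sX := sgn_lin (chains_grading k X).
move: c; apply: (homog_ext (chains_grading k X)) => [||i c ci].
- exact: lin_comp (sgn_lin hg) (tens_linl m).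
- exact: lin_comp (tens_linl m) sX.
rewrite (sgn_pc (chains_grading k X) ci) (sgn_pc hg (pc_ttens m ci)).
by rewrite (linZ _ (tens_linl m)).
Qed.

Lemma szczarba_aug c : aug_ideal (szczarba tau c).
Proof.
have hl := lin_comp (@aug_lin k G) (@szczarba_lin k G X tau tauP).
move: c; apply: chain_ind => [|c c' hc hc'|a s]; rewrite /aug_ideal /mkset.
- exact: (lin0 hl).
- by rewrite (linD hl) [aug _]hc [aug _]hc' addr0.
rewrite (linZ _ hl); have [s1|s1] := eqVneq (sdim s) 1%N.
  by rewrite (szczarba_edge k tauP s1) (aug_ideal_basis k (stau tau s)^-1%g) scaler0.
by rewrite (szczarba_neq1 k tauP) ?(lin0 (@aug_lin k G)) ?scaler0 //; exact/eqP.
Qed.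

Lemma tw1_fil q m t : filF q m ->
  Fil (q - 1) (tlift (fun c1 c2 : CX => tens (sgn c1) (kact (szczarba tau c2) m)) t : A).
Proof.
move=> fm; have hb := tw1_bilin tauP m; have ss := tfil_subspace (q - 1).
move: t; apply: tens_ind => [|s t hs ht|a b].
- by rewrite (lin0 (tlift_lin hb)); exact: subsp0.
- by rewrite (linD (tlift_lin hb)); exact: subspD.
rewrite (tliftE hb); apply: tfil_tens; apply: filF_aug => //.
exact: szczarba_aug.
Qed.

(** The difference is the twisting term, which carries a value of t, an element of the augmentation
    ideal. *)
Lemma tdif_leading q x : Fil q x -> Fil (q - 1) (dif x - tmap (@dch k X) id x).
Proof.
have dl := dgc_dif_linear hA; have tl := tmap_lin (@dch_lin k X) (@lin_id k CF).
move: x; apply: tfil_sub => [|c m fm].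
  exact: (subspace_preim (lin_add dl (lin_opp tl)) (tfil_subspace _)).
rewrite /mkset (tmapE _ _ (@dch_lin k X) (@lin_id k CF)) (tdifE tauP) addrAC subrr add0r.
by apply: subspN; [exact: tfil_subspace|exact: tw1_fil].
Qed.

Lemma tfil_incr q : Fil (q - 1) `<=` Fil q.
Proof.
apply: tfil_sub; first exact: tfil_subspace.
by move=> c m fm; apply: tfil_tens; exact: filF_incr.
Qed.

Lemma tmap_tfil q (f : CX -> CX) x : linear f -> Fil q x -> Fil q (tmap f id x : A).
Proof.
move=> fl; have tl := tmap_lin fl (@lin_id k CF); move: x.
apply: tfil_sub => [|c m fm]; first exact: (subspace_preim tl (tfil_subspace _)).
by rewrite /mkset (tmapE _ _ fl (@lin_id k CF)); exact: tfil_tens.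
Qed.

Lemma tfil_eps0 x : Fil (-1) x -> eps x = 0.
Proof.
move: x; apply: tfil_sub => [|c m fm].
  exact: (subspace_preim (dgc_eps_linear hA) (subspace0 _)).
by rewrite /mkset tepsE [eps m](filF_aug0 fm) mulr0.
Qed.

Lemma tfil_filtered : is_filtered_dgc Fil.
Proof.
have hg := dgc_grading hA; have al := @awc_lin k X.
split.
- exact: tfil_subspace.
- move=> q; apply: tfil_sub => [|c m fm].
    split=> [i|a u v hu hv i].
      by rewrite (lin0 (hcompi_lin hg i)); exact: (subsp0 (tfil_subspace _)).
    by rewrite (hcompi_lin hg i); apply: (tfil_subspace _).2.
  rewrite /mkset; move: c; apply: (homog_ind (chains_grading k X)) => [i|c c' hc hc' i|j c cj i].
  + by rewrite tens0l (lin0 (hcompi_lin hg i)); exact: (subsp0 (tfil_subspace _)).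
  + by rewrite (linD (tens_linl _)) (linD (hcompi_lin hg i)); apply: (subspD (tfil_subspace _)).
  rewrite (hcomp_pc hg (pc_ttens m cj)) singleE; case: ifP => _; first exact: tfil_tens.
  exact: (subsp0 (tfil_subspace _)).
- exact: tfil_incr.
- move=> q x fx; rewrite -(subrK (tmap (@dch k X) id x) (dif x)).
  apply: (subspD (tfil_subspace _)); last exact: tmap_tfil (@dch_lin k X) fx.
  by apply: tfil_incr; exact: tdif_leading.
- move=> q; have hp := pc2_subspace Fil Fil q; apply: tfil_sub => [|c m fm].
    exact: (subspace_preim (dgc_cop_linear hA) hp).
  rewrite /mkset; move: c; apply: chain_ind => [|c c' hc hc'|a s].
  + by rewrite tens0l (lin0 (dgc_cop_linear hA)); exact: subsp0.
  + by rewrite (linD (tens_linl _)) (linD (dgc_cop_linear hA)); exact: subspD.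
  rewrite (linZ _ (tens_linl _)) (linZ _ (dgc_cop_linear hA)); apply: subspZ => //.
  (* On a simplex F has a single group element as coefficient, and the action of the group ring
     preserves the filtration of C(F). *)
  rewrite (tcopE tauP) awcE (lin_sum _ _ _ (tlift_lin (c1_bilin tauP _))).
  apply: subsp_sum => // i _; rewrite (tliftE (c1_bilin tauP _)).
  move: (cop m) (filF_cop fm); apply: pc2_sub => [|a' b x y ab fx fy].
    exact: (subspace_preim (c1_lint tau _ _) hp).
  rewrite /mkset c1E frakFE // (tliftE (c3_bilin _ _ _ _)).
  apply: pc2_tens_eq ab; apply: tfil_tens => //.
  exact: filF_kact.
Qed.

End TwistedFiltration.

(** * The first page *)

Section FirstPageGeneral.
Variables (k : fieldType) (V : lmodType k) (d : V -> V) (Fi : int -> set V).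
Hypotheses (d_lin : linear d) (dd : forall x, d (d x) = 0).
Hypotheses (hF : forall q, is_subspace (Fi q)) (F1 : forall q, Fi (q - 1) `<=` Fi q)
  (dF : forall q x, Fi q x -> Fi q (d x)).

Lemma Zr1_below q x : Fi (q - 1) x -> Zr d Fi 1%:Z q x.
Proof. by move=> fx; split; [exact: F1|exact: dF]. Qed.
(** For r = 1 the conditions on differentials in [Br] hold automatically, since d preserves the
    filtration; B^1 in filtration q is therefore F_{q-1} + d F_q. *)
Lemma Br1_below q x : Fi (q - 1) x -> Br d Fi 1%:Z q x.
Proof.
move=> fx; exists x, 0; split; last by rewrite (lin0 d_lin) addr0.
  by split=> //; rewrite subrr subr0; exact: dF.
by split; rewrite ?(lin0 d_lin); exact: subsp0.
Qed.
Lemma Br1_dif q x : Fi q x -> Br d Fi 1%:Z q (d x).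
Proof.
move=> fx; exists 0, x; split; last by rewrite add0r.
  by split; rewrite ?(lin0 d_lin); exact: subsp0.
by rewrite addrK; split=> //; rewrite subrr subr0; exact: dF.
Qed.
Lemma Br1E q x : Br d Fi 1%:Z q x -> exists y z, [/\ Fi (q - 1) y, Fi q z & x = y + d z].
Proof. by move=> [y [z [[fy _] [fz _] ->]]]; exists y, z; split=> //; move: fz; rewrite addrK. Qed.
Lemma Br1_Zr q x : Br d Fi 1%:Z q x -> Zr d Fi 1%:Z q x.
Proof.
move=> /Br1E[y [z [fy fz ->]]]; apply: subspD; first exact: Zr_subspace.
  exact: Zr1_below.
by split; [exact: dF|rewrite dd; exact: subsp0].
Qed.
End FirstPageGeneral.

Section GradedAction.
Variables (k : fieldType) (G : groupType) (F : gset G).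
Local Notation kG := (freemod k G).
Local Notation CF := (Cset k F).

Let kl (m : CF) : linear (fun u : kG => kact u m : CF) := (@kact_bilin k G F).1 m.

Lemma aug_pow_kact p (u : kG) (m : CF) q : aug_pow p u -> filF q m -> filF (q - p%:Z) (kact u m :
  CF).
Proof.
elim: p u => [|p IH] u pu fm; first by rewrite subr0; exact: filF_kact.
move: u pu; apply: lspan_sub => [|_ [a [b [a0 pb ->]]]].
  exact: (subspace_preim (kl m) (filF_subspace k F _)).
rewrite /mkset -kactA.
have -> : q - p.+1%:Z = q - p%:Z - 1 by lia.
by apply: filF_aug => //; exact: IH.
Qed.

Lemma filF_mul i j (a : kG) (m : CF) : filF (F := gset_self G) i a -> filF j m -> filF (i + j)
  (kact a m : CF).
Proof.
have fs := filF_subspace k F; move=> + fm.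
have [[p ->]|i1] := filF_cases i; last first.
  move=> _; apply: (fil_mono (@filF_incr k G F)) (filF_kact a fm); lia.
rewrite filF_nat; move: a; apply: lspan_sub => [|_ [u [v [pu ->]]]].
  exact: (subspace_preim (kl m) (fs _)).
rewrite /mkset -[kact u v]/(gmul u v) -kactA addrC.
by apply: aug_pow_kact => //; exact: filF_kact.
Qed.

Lemma gr_kact_bilin : bilin (@gr_kact k G F).
Proof.
apply: smul_cls_bilin => //; try exact: filF_subspace; try by move=> q; exact: filF_subspace.
- exact: kact_bilin.
- exact: filF_mul.
- by move=> i j a m _ fa fm; rewrite /below (_ : i + j - 1 = i - 1 + j); [exact: filF_mul|lia].
- by move=> i j a m fa _ fm; rewrite /below -addrA; exact: filF_mul.
Qed.

Lemma gr_kactE i j (a : kG) (m : CF) : filF (F := gset_self G) i a -> filF j m ->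
  gr_kact (gr_cls (C := Cset k (gset_self G)) (@filF k G (gset_self G)) i a) (gr_cls (@filF k G
    F) j m)
  = gr_cls (@filF k G F) (i + j) (kact a m).
Proof.
move=> fa fm; apply: smul_cls_ecl => //; try exact: filF_subspace; try by move=> q;
  exact: filF_subspace.
- exact: kact_bilin.
- exact: filF_mul.
- by move=> i' j' b n _ fb fn; rewrite /below (_ : i' + j' - 1 = i' - 1 + j');
  [exact: filF_mul|lia].
- by move=> i' j' b n fb _ fn; rewrite /below -addrA; exact: filF_mul.
Qed.
End GradedAction.

Section TwistingClass.
Variables (k : fieldType) (G : groupType) (X : sset) (tau : forall n, X n.+1 -> G).
Hypothesis tauP : twisting_function tau.
Local Notation CX := (chains k X).
Local Notation bg := (@basis k G).
Local Notation FG := (@filF k G (gset_self G)).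
Implicit Types (c z : CX).

Let szl := @szczarba_lin k G X tau tauP.
Let hX := chains_dgc k X.

Lemma filG_mul (a b : freemod k G) q : aug_ideal a -> FG q b -> FG (q - 1) (gmul a b).
Proof. exact: filF_aug. Qed.

Lemma filG_aug (a : freemod k G) : aug_ideal a -> FG (-1) a.
Proof.
move=> a0; have -> : a = gmul a (bg 1%g).
  move: a {a0}; apply: lin_basis_ext => [||g]; [exact: lin_id|exact: (@gmul_bilin k G).1|].
  by rewrite gmul_basis mulg1.
by rewrite -[-1]add0r; apply: filG_mul => //; exact: filF_all.
Qed.

(** This makes [tstar] well defined. Only 2-simplices contribute; if g0 and g2 are the values of tau
    on faces 0 and 2, then g0 g2 is that on face 1, and the alternating sum is minus the product of
    g2^-1 - 1 and g0^-1 - 1. *)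
Lemma szczarba_boundary c : FG (-1 - 1) (szczarba tau (dch c)).
Proof.
have sF := filF_subspace k (gset_self G) (-1 - 1).
move: c; apply: chain_ind => [|c c' hc hc'|a s].
- by rewrite (lin0 (@dch_lin k X)) (lin0 szl); exact: subsp0.
- by rewrite (linD (@dch_lin k X)) (linD szl); exact: subspD.
rewrite (linZ _ (@dch_lin k X)) (linZ _ szl); apply: subspZ => //; rewrite dchE.
case nE: (sdim s) => [|n]; first by rewrite boundary0 // (lin0 szl); exact: subsp0.
rewrite (boundaryE k nE) (lin_sum _ _ _ szl).
have [n1|n1] := eqVneq n 1%N; last first.
  rewrite big1; first exact: subsp0.
  move=> i _; rewrite (linZ _ szl) (szczarba_neq1 k tauP) ?scaler0 // sdim_face nE; exact/eqP.
move: nE; rewrite {}n1 => s2.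
have s1 i : sdim (sface i s) = 1%N by rewrite sdim_face s2.
rewrite !big_nat_recr //= big_nil add0r !(linZ _ szl) !(szczarba_edge k tauP) //.
set g0 := stau tau (sface 0 s); set g2 := stau tau (sface 2 s).
have -> : stau tau (sface 1 s) = (g0 * g2)%g.
  have h2 : g2 = stau tau s by rewrite /g2 (stau_face tauP) ?s2.
  by rewrite h2 [stau tau s](stau_face0 tauP) ?s2 // mulgA mulgV mul1g.
have -> : (-1) ^+ 0 *: (bg g0^-1%g - bg 1%g) + (-1) ^+ 1 *: (bg (g0 * g2)^-1%g - bg 1%g) +
    (-1) ^+ 2 *: (bg g2^-1%g - bg 1%g) = - gmul (bg g2^-1%g - bg 1%g) (bg g0^-1%g - bg 1%g).
  rewrite (linB ((@gmul_bilin k G).1 _)) !(linB ((@gmul_bilin k G).2 _)) !gmul_basis !mul1g mulg1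
    invgM.
  rewrite expr0 expr1 sqrrN expr1n !scale1r scaleN1r.
  move: (bg g0^-1%g) (bg _) (bg 1%g) (bg g2^-1%g) => x y z t.
  by rewrite !opprB !addrA subrK (ACl (1*4*3*2)).
apply: subspN => //; apply: filG_mul; first exact: aug_ideal_basis.
by apply: filG_aug; exact: aug_ideal_basis.
Qed.

Lemma szczarba_hcomp c : szczarba tau (hcomp c 1 : CX) = szczarba tau c.
Proof.
have hg := chains_grading k X.
move: c; apply: (homog_ext hg) => [||i c ci].
- exact: lin_comp szl (hcompi_lin hg 1).
- exact: szl.
have [i1|i1] := eqVneq i 1; first by rewrite i1 in ci; rewrite (hcomp_id hg ci).
rewrite (hcomp_neq hg ci) ?(lin0 szl); last by move=> e; rewrite e eqxx in i1.
move: c ci; apply: lspan_sub => [|_ [s [sd ->]]].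
  exact: (subspace_eq0 (@lin_zero k _ _) szl).
by rewrite /mkset (szczarba_neq1 k tauP) // => s1; rewrite -sd s1 eqxx in i1.
Qed.

(** [tstar] picks a representative of the component of degree 1. Another choice changes t by an
    element of the square of the augmentation ideal, and t sees only degree 1. *)
Lemma tstar_hcls z : dif z = 0 -> tstar tau (hcls (@dif _ _ CX) z : hdgc CX) =
  gr_cls (C := Cset k (gset_self G)) FG (-1) (szczarba tau z).
Proof.
have sF q := filF_subspace k (gset_self G) q.
have sB q : is_subspace (below FG q) by exact: sF.
move=> dz; rewrite /tstar; have [_ ->//] := hdgc_grading hX.
have d1 : dif (hcomp z 1 : CX) = 0 by exact: (hcomp_cycle hX 1 dz).
have [x ->] := hrep_hcls (dgc_dif_linear hX) d1.
rewrite (linD szl) szczarba_hcomp.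
have f1 c : FG (-1) (szczarba tau c) by apply: filG_aug; exact: szczarba_aug.
apply/(ecl_eq sF sB); [|exact: f1|].
  by apply: (subspD (sF _)); exact: f1.
by rewrite addrAC subrr add0r; exact: szczarba_boundary.
Qed.
End TwistingClass.

Section FirstPage.
Variables (k : fieldType) (G : groupType) (X : sset) (F : gset G) (tau : forall n, X n.+1 -> G).
Hypothesis tauP : twisting_function tau.
Local Notation A := (twisted_tensor k F tau).
Local Notation CX := (chains k X).
Local Notation CF := (Cset k F).
Local Notation Fil := (@twisted_fil k G X F tau).
Local Notation H := (hdgc CX).
Local Notation FF := (@filF k G F).
Local Notation E := (grF k F).
Local Notation P := (first_page k F tau).
Local Notation hc := (hcls (@dif _ _ CX)).
Local Notation gc := (gr_cls FF).
Local Notation Z := (Zr (@dif _ _ A) Fil 1%:Z).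
Local Notation B := (Br (@dif _ _ A) Fil 1%:Z).
Local Notation pg := (page Fil 1).
Local Notation pcl := (page_cls Fil 1).
Implicit Types (c : CX) (m : CF).

Let hA := twisted_tensor_dgc k F tauP.
Let hX := chains_dgc k X.
Let hF := tfil_filtered k F tauP.
Let hFF := @filF_filtered k G F.
Let dl := dgc_dif_linear hA.
Let dd := dgc_dif_dif hA.
Let cdl := dgc_dif_linear hX.
Let cdd := dgc_dif_dif hX.
Let sF := @tfil_subspace k G X F tau.
Let F1 := fil_incr hF.
Let dF := fil_dif hF.
Let sFF := @filF_subspace k G F.
Let sBF q : is_subspace (below FF q). Proof. exact: sFF. Qed.
Let sZ q : is_subspace (Z q). Proof. exact: Zr_subspace. Qed.
Let sB q : is_subspace (B q). Proof. exact: Br_subspace. Qed.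
Let B1 := Br1_below dl sF dF.
Let BZ := Br1_Zr dl dd sF F1 dF.
Let Bd := Br1_dif dl sF dF.

Lemma Zr1_tens q c m : dif c = 0 -> filF q m -> Z q (tens c m : A).
Proof.
move=> dc fm; have ft := tfil_tens tau c fm; split=> //.
have := tdif_leading tauP ft.
by rewrite (tmapE _ _ (@dch_lin k X) (@lin_id k CF)) [dch c]dc tens0l subr0.
Qed.

Let phi0 (h : H) (e : E) : pg := scls Z B (smap 0 (fun m : CF => tens (rep h) m : A) (rep e)).
Let fZ (c : CX) : dif c = 0 -> forall q m, FF q m -> Z (q + 0) (tens c m : A).
Proof. by move=> dc q m fm; rewrite addr0; exact: Zr1_tens. Qed.
Let fB (c : CX) : forall q m, FF q m -> below FF q m -> B (q + 0) (tens c m : A).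
Proof. by move=> q m _ fm; rewrite addr0; apply: B1; exact: tfil_tens. Qed.
Let hr (h : H) : dif (rep h : CX) = 0. Proof. exact: hrep_cycle cdl h. Qed.

Let phi0_linr h : linear (phi0 h).
Proof. exact: (smap_cls_lin sFF sBF sZ sB (tens_linr (rep h : CX)) (fZ (hr h)) (fB _)). Qed.
Let phi0_gc h q m : FF q m -> phi0 h (gc q m) = pcl q (tens (rep h : CX) m).
Proof.
move=> fm; rewrite -[q in RHS]addr0.
exact: (smap_ecl sFF sBF sZ sB (tens_linr (rep h : CX)) (fZ (hr h)) (fB _) fm).
Qed.
Let pcl_lin q m : FF q m -> forall a (u v : CX), dif u = 0 -> dif v = 0 ->
  pcl q (tens (a *: u + v) m) = a *: pcl q (tens u m) + pcl q (tens v m).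
Proof.
move=> fm a u v du dv; rewrite (tens_linl m).
exact: (ecl_lin B sZ a (Zr1_tens du fm) (Zr1_tens dv fm)).
Qed.
(** The boundary of c (x) m is [dif c] (x) m up to the twisting term, which has lower filtration. *)
Let pcl_bound q m : FF q m -> forall c, pcl q (tens (dif c) m) = 0.
Proof.
move=> fm c; apply/(ecl_eq0 sZ sB (Zr1_tens (cdd c) fm)).
have ft := tfil_tens tau c fm; have := tdif_leading tauP ft.
rewrite (tmapE _ _ (@dch_lin k X) (@lin_id k CF)) => h.
rewrite -[tens (dif c) m](subKr (dif (tens c m : A))).
by apply: (subspB (sB q)); [exact: Bd|exact: B1].
Qed.

Let phi0_lin e : linear (fun h => phi0 h e).
Proof.
move: e; apply: (sqsum_ind sFF sBF) => [|e e' he he'|q m fm].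
- by apply: lin_eq (@lin_zero k _ _) => h; rewrite (lin0 (phi0_linr h)).
- by apply: lin_eq (lin_add he he') => h; rewrite (linD (phi0_linr h)).
apply: lin_eq (h_lift_lin cdl (pcl_lin fm) (pcl_bound fm)) => h.
by rewrite -phi0_gc.
Qed.

Definition first_phi : P -> pg := tlift phi0.
Let phi0_bilin : bilin phi0. Proof. by split=> [e|h]; [exact: phi0_lin|exact: phi0_linr]. Qed.
Lemma first_phi_lin : linear first_phi. Proof. exact: tlift_lin phi0_bilin. Qed.
Lemma first_phiE c q m : dif c = 0 -> FF q m -> first_phi (tens (hc c : H) (gc q m)) = pcl q
  (tens c m).
Proof.
move=> dc fm; rewrite /first_phi (tliftE phi0_bilin) phi0_gc //.
exact: (h_liftE cdl (pcl_lin fm) (pcl_bound fm) dc).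
Qed.

Lemma first_ext (V : lmodType k) (f g : P -> V) : linear f -> linear g ->
  (forall c q m, dif c = 0 -> FF q m -> f (tens (hc c : H) (gc q m)) = g (tens (hc c : H) (gc q
    m))) -> f =1 g.
Proof.
move=> fl gl fg; apply: tens_ext => // h e; move: h; apply: homology_ind => // c dc.
move: e; apply: (sqsum_ext sFF sBF (F := fun e => f (tens (hc c : H) e)) (G := fun e => g (tens
  (hc c : H) e))).
- exact: lin_comp fl (tens_linr _).
- exact: lin_comp gl (tens_linr _).
by move=> q m fm; exact: fg.
Qed.

Section Inverse.
Variables (s : CX -> CX) (rho : int -> CF -> E).
Hypotheses (s_lin : linear s) (dsd : forall x, dif (s (dif x)) = dif x).
Hypotheses (rl : forall q, linear (rho q)) (rE : forall q m, FF q m -> rho q m = gc q m).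
Let pi : CX -> H := hpi (@dif _ _ CX) s.
Let pil : linear pi := hpi_lin cdl cdd s_lin dsd.
(** The inverse in filtration q before passage to the page: defined on all of A, it kills F_{q-1}
    and the boundaries of F_q. *)
Let pr q := tmap pi (rho q) : A -> P.
Let prl q : linear (pr q) := tmap_lin pil (rl q).

Let pr_below q x : Fil (q - 1) x -> pr q x = 0.
Proof.
move: x; apply: tfil_sub => [|c m fm]; first exact: (subspace_preim (prl q) (subspace0 _)).
rewrite /mkset /pr (tmapE _ _ pil (rl q)) rE; last exact: filF_incr.
have -> : gc q m = 0 by apply/(ecl_eq0 sFF sBF) => //; exact: filF_incr.
exact: tens0r.
Qed.
Let pr_dif q x : Fil q x -> pr q (dif x) = 0.
Proof.
move=> fx; rewrite -(subrK (tmap (@dch k X) id x) (dif x)) (linD (prl q)).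
rewrite (pr_below (tdif_leading tauP fx)) add0r.
move: x {fx}; apply: (tens_ext (f := fun x => pr q (tmap (@dch k X) id x)) (g := fun _ => 0)).
- exact: lin_comp (prl q) (tmap_lin (@dch_lin k X) (@lin_id k _)).
- exact: lin_zero.
move=> c m; rewrite (tmapE _ _ (@dch_lin k X) (@lin_id k CF)) /pr (tmapE _ _ pil (rl q)).
by rewrite /pi (hpi_d cdl cdd s_lin dsd) tens0l.
Qed.

Lemma first_inverse : exists psi : pg -> P, linear psi /\ forall q z, Z q z -> psi (pcl q z) = pr
  q z.
Proof.
apply: (sqlift sZ sB) => [q a u v _ _|q v _ /(Br1E)[y [z [fy fz ->]]]]; first exact: prl.
by rewrite (linD (prl q)) pr_below // pr_dif // addr0.
Qed.

(** The round trip amounts to applying p to the left factor, and is compared with the identity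
    through the homotopy s. *)
Lemma first_pr q z : Fil q z -> Z q (tmap (hproj (@dif _ _ CX) s) id z) /\
  first_phi (pr q z) = pcl q (tmap (hproj (@dif _ _ CX) s) id z).
Proof.
have hl := hproj_lin cdl s_lin; have tl' := tmap_lin hl (@lin_id k CF).
move: z; apply: tfil_sub => [|c m fm].
  split=> [|a u v [zu eu] [zv ev]].
    rewrite (lin0 tl') (lin0 (prl q)) (lin0 first_phi_lin); split; first exact: (subsp0 (sZ q)).
    exact/esym/(ecl0 sZ sB q).
  split; first exact: ((subspace_preim tl' (sZ q)).2 a u v zu zv).
  have e := first_phi_lin a (pr q u) (pr q v); rewrite eu ev in e.
  apply: (etrans (congr1 first_phi (prl q a u v)) (etrans e _)).
  exact: esym (etrans (congr1 (pcl q) (tl' a u v)) (ecl_lin B sZ a zu zv)).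
rewrite /mkset (tmapE _ _ hl (@lin_id k CF)) /pr (tmapE _ _ pil (rl q)) rE //.
have dh := d_hproj cdl cdd dsd c.
by split; [exact: Zr1_tens|exact: first_phiE].
Qed.

Lemma first_phi_bij : bijective first_phi.
Proof.
have [psi [psl psE]] := first_inverse.
have k1 : cancel first_phi psi.
  apply: first_ext => [||c q m dc fm]; [exact: lin_comp psl first_phi_lin|exact: lin_id|].
  rewrite first_phiE // psE; last exact: Zr1_tens.
  by rewrite /pr (tmapE _ _ pil (rl q)) rE // /pi (hpi_cycle cdl cdd s_lin dsd).
exists psi => //.
apply: (sqsum_ext sZ sB) => [||q z zz]; [exact: lin_comp first_phi_lin psl|exact: lin_id|].
rewrite psE //; have [fz dz] := zz; have [zp ->] := first_pr fz.
apply/esym/(ecl_eq sZ sB) => //.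
have sfl := tmap_lin s_lin (@lin_id k CF); have tdl := tmap_lin (@dch_lin k X) (@lin_id k CF).
have hl := hproj_lin cdl s_lin.
(* This is 1 - p = d s + s d on the left factor. Modulo lower filtration d (x) 1 is d_t, so the
   first term is a boundary; the second has lower filtration because d_t z has, z being in Z^1. *)
have -> : z - tmap (hproj (@dif _ _ CX) s) id z =
    tmap (@dch k X) id (tmap s id z) + tmap s id (tmap (@dch k X) id z).
  move: z {zz fz dz zp}; apply: tens_ext => [||c m].
  - exact: lin_add (@lin_id k _) (lin_opp (tmap_lin hl (@lin_id k CF))).
  - exact: lin_add (lin_comp tdl sfl) (lin_comp sfl tdl).
  rewrite (tmapE _ _ hl (@lin_id k CF)) !(tmapE _ _ s_lin (@lin_id k CF)).
  rewrite !(tmapE _ _ (@dch_lin k X) (@lin_id k CF)) (tmapE _ _ s_lin (@lin_id k CF)).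
  rewrite /hproj !(linB (tens_linl m)) -[X in _ - X]addrA -opprD.
  exact: subKr.
have fs := tmap_tfil s_lin fz.
apply: (subspD (sB q)).
  rewrite -[tmap _ _ _](subKr (dif (tmap s id z : A))).
  apply: (subspB (sB q)); first exact: Bd.
  by apply: B1; exact: (tdif_leading tauP fs).
apply: B1; apply: tmap_tfil => //.
rewrite -[tmap _ _ _](subKr (dif z : A)).
by apply: (subspB (sF _)) => //; exact: (tdif_leading tauP fz).
Qed.

End Inverse.

End FirstPage.

(** * Compatibility of the comparison map with the dgc structures *)

Section FirstPageDgc.
Variables (k : fieldType) (G : groupType) (X : sset) (F : gset G) (tau : forall n, X n.+1 -> G).
Hypothesis tauP : twisting_function tau.
Local Notation A := (twisted_tensor k F tau).
Local Notation CX := (chains k X).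
Local Notation CF := (Cset k F).
Local Notation Fil := (@twisted_fil k G X F tau).
Local Notation H := (hdgc CX).
Local Notation FF := (@filF k G F).
Local Notation E := (grF k F).
Local Notation P := (first_page k F tau).
Local Notation hc := (hcls (@dif _ _ CX)).
Local Notation gc := (gr_cls FF).
Local Notation Z := (Zr (@dif _ _ A) Fil 1%:Z).
Local Notation B := (Br (@dif _ _ A) Fil 1%:Z).
Local Notation Fil2 := (pc2 Fil Fil).
Local Notation Z2 := (Zr (@dif2 _ _ A) Fil2 1%:Z).
Local Notation B2 := (Br (@dif2 _ _ A) Fil2 1%:Z).
Local Notation pg := (page Fil 1).
Local Notation pcl := (page_cls Fil 1).
Local Notation phi := (@first_phi k G X F tau).
Implicit Types (c : CX) (m : CF).

Let hA := twisted_tensor_dgc k F tauP.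
Let hX := chains_dgc k X.
Let hF := tfil_filtered k F tauP.
Let hFF := @filF_filtered k G F.
Let dl := dgc_dif_linear hA.
Let dd := dgc_dif_dif hA.
Let cdl := dgc_dif_linear hX.
Let cdd := dgc_dif_dif hX.
Let sF := @tfil_subspace k G X F tau.
Let F1 := fil_incr hF.
Let dF := fil_dif hF.
Let sFF := @filF_subspace k G F.
Let sBF q : is_subspace (below FF q). Proof. exact: sFF. Qed.
Let sZ q : is_subspace (Z q). Proof. exact: Zr_subspace. Qed.
Let sB q : is_subspace (B q). Proof. exact: Br_subspace. Qed.
Let B1 := Br1_below dl sF dF.
Let BZ := Br1_Zr dl dd sF F1 dF.
Let Bd := Br1_dif dl sF dF.
Let degX (i : int) : (-1) ^ deg CX (i + -1) = - (-1) ^ deg CX i :> k. Proof. exact: sign_pred. Qed.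
Let hgH := (hdgc_grading hX).1.
Let hdeg (i : int) : deg A i = i. Proof. by []. Qed.
Let epsF := @tfil_eps0 k G X F tau tauP.
Let hpage := page_kunneth_dgc hA hF hdeg epsF 1.
Let phil := first_phi_lin (F := F) (k := k) tauP.

Lemma tstar_lin : linear (@tstar k G X tau).
Proof.
have sG q : is_subspace (@filF k G (gset_self G) q) by exact: filF_subspace.
have sBG q : is_subspace (below (@filF k G (gset_self G)) q) by exact: filF_subspace.
have szl := @szczarba_lin k G X tau tauP.
have f1 (c : CX) : filF (F := gset_self G) (-1) (szczarba tau c).
  by apply: filG_aug; exact: szczarba_aug.
have gl (a : k) (u v : CX) : dif u = 0 -> dif v = 0 ->
  gr_cls (C := Cset k (gset_self G)) (@filF k G (gset_self G)) (-1) (szczarba tau (a *: u + v)) =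
  a *: gr_cls (C := Cset k (gset_self G)) (@filF k G (gset_self G)) (-1) (szczarba tau u)
  + gr_cls (C := Cset k (gset_self G)) (@filF k G (gset_self G)) (-1) (szczarba tau v).
  move=> _ _; rewrite szl.
  exact: (ecl_lin (below (@filF k G (gset_self G))) sG a (f1 u) (f1 v)).
have gB (c : CX) : gr_cls (C := Cset k (gset_self G)) (@filF k G (gset_self G)) (-1) (szczarba
  tau (dif c)) = 0.
  by apply/(ecl_eq0 sG sBG (f1 _)); exact: szczarba_boundary.
apply: lin_eq (h_lift_lin cdl gl gB) => h.
by rewrite -(tstar_hcls tauP) ?hrepK //; exact: hrep_cycle cdl h.
Qed.

Let D (e : E) (h1 h2 : H) : P := tens (sgn h1) (gr_kact (tstar tau h2) e).
Let D_bilin e : bilin (D e).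
Proof.
split=> h; first exact: lin_comp (tens_linl _) (sgn_lin hgH).
exact: lin_comp (tens_linr _) (lin_comp ((gr_kact_bilin k F).1 e) tstar_lin).
Qed.
Let dP0 (h : H) (e : E) : P := - tlift (D e) (cop h).
Let dP_bilin : bilin dP0.
Proof.
split=> [e|h].
  exact: lin_opp (lin_comp (tlift_lin (D_bilin e)) (hcop_lin hX degX)).
apply: lin_opp; apply: tlift_linF => h1 h2.
exact: lin_comp (tens_linr _) ((gr_kact_bilin k F).2 _).
Qed.
Lemma first_dif_lin : linear (@dif _ _ P). Proof. exact: tlift_lin dP_bilin. Qed.
Lemma first_difE h e : dif (tens h e : P) = - tlift (D e) (cop h).
Proof. exact: tliftE dP_bilin h e. Qed.

Let sF2 q : is_subspace (Fil2 q). Proof. exact: pc2_subspace. Qed.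
Let d2l := dif2_lin hA.
Let d2d2 := dif2_dif2 hA (@sign_pred k).
Let F21 := fil2_incr hF.
Let d2F := fil2_dif2 hA hF.
Let sZ2 q : is_subspace (Z2 q). Proof. exact: Zr_subspace. Qed.
Let sB2 q : is_subspace (B2 q). Proof. exact: Br_subspace. Qed.
Let B21 := Br1_below d2l sF2 d2F.
Let BZ2 := Br1_Zr d2l d2d2 sF2 F21 d2F.
Let Bd2 := Br1_dif d2l sF2 d2F.

(** The coproduct with [cop m] and [cop c] freed, so that the two can vary independently over
    arbitrary tensors. *)
Definition twist_cop (w : tensor CF CF) (t : tensor CX CX) : tensor A A :=
  tlift (fun a b : CX => tlift (fun m1 m2 : CF =>
    tlift (fun (u : freemod k G) (c' : CX) => tens (tens a (kact u m1)) (tens c' m2))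
      (frakF tau b)) w) t.
Lemma twist_cop_linr w : linear (twist_cop w).
Proof. exact: tlift_lin (c1_bilin tauP w). Qed.
Lemma twist_cop_linl t : linear (fun w => twist_cop w t).
Proof. by apply: tlift_linF => a b; exact: c1_lint. Qed.

(* frakF b is 1 (x) b modulo the augmentation ideal. *)
Lemma twist_cop_leading i j m1 m2 (a b : CX) : FF i m1 -> FF j m2 ->
  Fil2 (i + j - 1) (twist_cop (tens m1 m2) (tens a b) - tens (tens a m1 : A) (tens b m2 : A)).
Proof.
move=> f1 f2.
have hl : linear (fun b => twist_cop (tens m1 m2) (tens a b) - tens (tens a m1 : A) (tens b m2 :
  A)).
  apply: lin_add; first exact: lin_comp (twist_cop_linr _) (tens_linr _).
  by apply: lin_opp; exact: lin_comp (tens_linr _) (tens_linl _).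
move: b; apply: chain_ind => [|b b' hb hb'|x s].
- by move: (lin0 hl) => /= ->; exact: subsp0.
- by move: (linD hl b b') => /= ->; exact: subspD.
move: (linZ x hl (chain k s)) => /= ->; apply: subspZ => //.
rewrite /twist_cop (tliftE (c1_bilin tauP _)) (c1E tau) frakFE // (tliftE (c3_bilin tau _ _ _)).
set g := basis k _; rewrite -(linB (tens_linl _)) -(linB (tens_linr _)).
apply: (@pc2_tens_eq _ _ _ _ _ _ (i - 1) j);
  [apply: tfil_tens|exact: tfil_tens f2|by rewrite addrAC].
have -> : kact g m1 - m1 = kact (g - basis k 1%g) m1 :> CF.
  by rewrite (linB ((@kact_bilin k G F).1 m1)) kact1.
by apply: filF_aug f1; exact: aug_ideal_basis.
Qed.

Lemma first_cop_lin : linear (@cop _ _ P).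
Proof.
apply: tlift_lin; split=> [e|h].
  exact: lin_comp ((@tswap_bilin _ _ _ _ _).1 _) (hcop_lin hX degX).
exact: lin_comp ((@tswap_bilin _ _ _ _ _).2 _) (gr_cop_lin (cset_dgc k F 0) hFF).
Qed.
Lemma first_copE (h : H) (e : E) : cop (tens h e : P) = tswap (cop h) (cop e).
Proof.
apply: (tliftE (f := fun (h : H) (m : E) => tswap (cop h) (cop m))); split=> [e'|h'].
  exact: lin_comp ((@tswap_bilin _ _ _ _ _).1 _) (hcop_lin hX degX).
exact: lin_comp ((@tswap_bilin _ _ _ _ _).2 _) (gr_cop_lin (cset_dgc k F 0) hFF).
Qed.

Section WithInverse.
Variables (s : CX -> CX).
Hypotheses (s_lin : linear s) (dsd : forall x, dif (s (dif x)) = dif x).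
Let pi : CX -> H := hpi (@dif _ _ CX) s.
Let pil : linear pi := hpi_lin cdl cdd s_lin dsd.
Let pic z : dif z = 0 -> pi z = hc z := hpi_cycle cdl cdd s_lin dsd (z := z).

Let cop_pi c : dif c = 0 -> cop (hc c : H) = tmap pi pi (cop c).
Proof.
move=> dc; apply: (hpi_kunneth hX degX s_lin dsd); first exact: (cop_cycle hX).
exact: (kunneth_cop_hcls hX degX).
Qed.

(** For fixed m both sides are linear in the cycle [cop c] of the tensor square of C(X), so
    [cycle_ext] compares them. *)
Lemma first_phi_dif x : phi (dif x) = dif (phi x).
Proof.
move: x; apply: first_ext => [||c q m dc fm].
- exact: lin_comp phil first_dif_lin.
- exact: lin_comp (dgc_dif_linear hpage.2) phil.
rewrite first_phiE // first_difE.
have zc := Zr1_tens tauP dc fm.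
have -> : dif (pcl q (tens c m)) = pcl (q - 1) (dif (tens c m : A)).
  exact: (pagedif_ecl dl dd sF zc).
(* [rho] extends the class map of filtration q - 1, which turns the right-hand side into a linear
   map on all tensors. *)
have [rho [rl rE]] := ecl_ext B sZ (q - 1).
have tb := tw1_bilin tauP m; pose T := tlift (fun c1 c2 : CX => tens (sgn c1) (kact (szczarba tau
  c2) m)) : tensor CX CX -> A.
have TE a b : T (tens a b) = tens (sgn a) (kact (szczarba tau b) m) by exact: tliftE tb a b.
have tl : linear T := tlift_lin tb.
have dE : dif (tens c m : A) = - T (cop c).
  by rewrite (tdifE tauP) [dch c]dc tens0l sub0r.
have <- : rho (dif (tens c m : A)) = pcl (q - 1) (dif (tens c m : A)).
  apply: rE; split; last by rewrite dd; exact: subsp0.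
  by case: zc.
rewrite dE (linN rl) (linN phil) (cop_pi dc); congr (- _).
have ml := tmap_lin pil pil.
apply: (cycle_ext hX degX (f := fun t => phi (tlift (D (gc q m)) (tmap pi pi t))) (g := fun t =>
  rho (T t))).
- exact: lin_comp phil (lin_comp (tlift_lin (D_bilin _)) ml).
- exact: lin_comp rl tl.
- move=> z z' dz dz'; rewrite (tmapE _ _ pil pil) (tliftE (D_bilin _)) !pic // /D (hsgn hX) //.
  rewrite (tstar_hcls tauP) // TE.
  have f1 : filF (F := gset_self G) (-1) (szczarba tau z') by apply: filG_aug; exact: szczarba_aug.
  have f2 : FF (q - 1) (kact (szczarba tau z') m) by apply: filF_aug => //; exact: szczarba_aug.
  have dsz : dif (sgn z) = 0 by rewrite (sgn_dif hX degX) dz (lin0 (sgn_lin (dgc_grading hX)))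
    oppr0.
  rewrite (gr_kactE f1 fm) addrC first_phiE // rE //.
  exact: (Zr1_tens tauP).
(* Boundaries go to zero: a term with d on its left factor is a value of d_t up to lower filtration,
   and t (d y) lies in the square of the augmentation ideal. *)
- move=> x y; rewrite (hpi_dif2 hX s_lin dsd) (lin0 (tlift_lin (D_bilin _))) (lin0 phil).
  apply/esym; rewrite (dif2E hX) (linD tl) !TE (sgnK (dgc_grading hX)) -[sgn (dif x)]opprK
    -(sgn_dif hX degX).
  rewrite (linN (tens_linl _)).
  have f2 : FF (q - 1) (kact (szczarba tau y) m) by apply: filF_aug => //; exact: szczarba_aug.
  have b1 : B (q - 1) (tens (dif (sgn x)) (kact (szczarba tau y) m) : A).
    rewrite -[tens _ _](subKr (dif (tens (sgn x) (kact (szczarba tau y) m) : A))).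
    apply: (subspB (sB _)); first by apply: Bd; exact: tfil_tens.
    apply: B1; have := tdif_leading tauP (tfil_tens tau (sgn x) f2).
    by rewrite (tmapE _ _ (@dch_lin k X) (@lin_id k CF)).
  have b2 : B (q - 1) (tens x (kact (szczarba tau (dif y)) m) : A).
    apply: B1; apply: tfil_tens; rewrite -addrA addrC.
    by apply: filF_mul => //; exact: szczarba_boundary.
  have bt : B (q - 1) (- tens (dif (sgn x)) (kact (szczarba tau y) m) + tens x (kact (szczarba
    tau (dif y)) m) : A).
    by apply: (subspD (sB _)) => //; exact: (subspN (sB _)).
  by rewrite rE; [apply/(ecl_eq0 sZ sB)=> //; exact: BZ|exact: BZ].
- exact: (cop_cycle hX).
Qed.

Section Symbol.
Variables (q : int) (rho2 : tensor CF CF -> sqsum (pc2 FF FF) (below (pc2 FF FF)))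
  (rhoA : tensor A A -> sqsum Z2 B2).
Hypotheses (r2l : linear rho2) (r2E : forall w, pc2 FF FF q w -> rho2 w = ecl _ _ q w).
Hypotheses (rAl : linear rhoA) (rAE : forall w, Z2 q w -> rhoA w = ecl Z2 B2 q w).
Let cr := @cross _ CF FF (below FF) (pc2 FF FF) (below (pc2 FF FF)).
Let crb : bijective cr := gr_cross_bij sFF (fil_incr hFF).
(** The inverse Kuenneth map of gr(F) after the class map of filtration q: a linear stand-in for the
    coproduct of a class in which [cop m] may be replaced by any w. *)
Let S (w : tensor CF CF) : tensor E E := preinv 0 cr (rho2 w).
Let crS w : cr (S w) = rho2 w. Proof. exact: preinvE. Qed.
Let S_lin : linear S.
Proof.
apply: (lin_of_inj (gr_cross_lin sFF)); first exact: bij_inj crb.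
exact: lin_eq r2l.
Qed.
Let SE i j m1 m2 : i + j = q -> FF i m1 -> FF j m2 -> S (tens m1 m2) = tens (gc i m1) (gc j m2).
Proof.
move=> ij f1 f2; apply: (bij_inj crb); rewrite crS r2E; last exact: pc2_tens_eq ij.
by rewrite -ij; apply/esym; exact: gr_crossE.
Qed.
Let ml := tmap_lin pil pil.
Let kl := page_cross_lin hA hF hdeg (r := 1).
Let ppl := tmap_lin phil phil.

(** By linearity w may be taken to be m1 (x) m2 and, by [cycle_ext], t a product of cycles or a
    boundary; there [twist_cop] equals its untwisted part up to lower filtration. *)
Lemma first_kunneth w t : pc2 FF FF q w -> dif2 t = 0 ->
  page_kunneth (tmap phi phi (tswap (tmap pi pi t) (S w))) = rhoA (twist_cop w t).
Proof.
move=> fw dt.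
have tsl := @tswap_bilin k H E H E.
have cyc : forall w t, dif2 t = 0 -> pc2 FF FF q w ->
    page_kunneth (tmap phi phi (tswap (tmap pi pi t) (S w))) - rhoA (twist_cop w t) = 0.
  move=> {w t fw dt} w t dt; move: w; apply: pc2_sub => [|i j m1 m2 ij f1 f2].
    have l1 : linear (fun w => page_kunneth (tmap phi phi (tswap (tmap pi pi t) (S w)))).
      have e1 := lin_comp (tsl.2 (tmap pi pi t)) S_lin.
      have e2 := lin_comp ppl e1.
      have e3 := lin_comp kl e2.
      exact: e3.
    have l2 := lin_comp rAl (twist_cop_linl t).
    exact: (subspace_preim (lin_add l1 (lin_opp l2)) (subspace0 _)).
  rewrite /mkset; apply/eqP; rewrite subr_eq0; apply/eqP; rewrite (SE ij f1 f2).
  move: t dt; apply: (cycle_ext hX degX (f := fun t => page_kunneth (tmap phi phi (tswap (tmap pi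
    pi t) (tens (gc i m1) (gc j m2)))))
     (g := fun t => rhoA (twist_cop (tens m1 m2) t))).
  - exact: lin_comp kl (lin_comp ppl (lin_comp (tsl.1 _) ml)).
  - exact: lin_comp rAl (twist_cop_linr _).
  - move=> z z' dz dz'; rewrite (tmapE _ _ pil pil) tswapE (tmapE _ _ phil phil) !pic //
    !first_phiE //.
    have z1 := Zr1_tens tauP dz f1; have z2 := Zr1_tens tauP dz' f2.
    have zz := Zr_tens hA hF z1 z2; rewrite ij in zz.
    rewrite (page_crossE hA hF hdeg z1 z2) ij -(rAE zz).
    apply/eqP; rewrite -subr_eq0 -(linB rAl); apply/eqP.
    have b : B2 q (tens (tens z m1 : A) (tens z' m2 : A) - twist_cop (tens m1 m2) (tens z z')).
      by rewrite -opprB; apply: (subspN (sB2 _)); apply: B21; rewrite -ij; exact: twist_cop_leading.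
    by rewrite rAE; [apply/(ecl_eq0 sZ2 sB2)=> //; exact: BZ2|exact: BZ2].
  move=> x y; rewrite (hpi_dif2 hX s_lin dsd) (lin0 (tsl.1 _)) (lin0 ppl) (lin0 kl); apply/esym.
  (* Modulo lower filtration [twist_cop] and d_t may be replaced by their untwisted parts; what is
     left is the boundary of the product of x (x) m1 and y (x) m2. *)
  have b : B2 q (twist_cop (tens m1 m2) (dif2 (tens x y : tensor CX CX))).
    rewrite (dif2E hX) (linD (twist_cop_linr _)).
    pose T (a b : CX) := tens (tens a m1 : A) (tens b m2 : A).
    have lead a b : B2 q (twist_cop (tens m1 m2) (tens a b) - T a b).
      by apply: B21; rewrite -ij; exact: twist_cop_leading.
    have lower i' (c : CX) m : FF i' m -> Fil (i' - 1) (dif (tens c m : A) - tens (dif c) m).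
      move=> fm; have := tdif_leading tauP (tfil_tens tau c fm).
      by rewrite (tmapE _ _ (@dch_lin k X) (@lin_id k CF)).
    have t1 : B2 q (tens (dif (tens x m1 : A)) (tens y m2 : A) - T (dif x) y).
      rewrite -(linB (tens_linl _)); apply: B21; apply: (@pc2_tens_eq _ _ _ _ _ _ (i - 1) j).
      - exact: lower.
      - exact: tfil_tens.
      - by rewrite addrAC ij.
    have t2 : B2 q (tens (tens (sgn x) m1 : A) (dif (tens y m2 : A)) - T (sgn x) (dif y)).
      rewrite -(linB (tens_linr _)); apply: B21; apply: (@pc2_tens_eq _ _ _ _ _ _ i (j - 1)).
      - exact: tfil_tens.
      - exact: lower.
      - by rewrite addrA ij.
    have t0 : B2 q (tens (dif (tens x m1 : A)) (tens y m2 : A) + tens (tens (sgn x) m1 : A) (dif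
      (tens y m2 : A))).
      have ft : Fil2 q (tens (tens x m1 : A) (tens y m2 : A)).
        by apply: pc2_tens_eq ij; exact: tfil_tens.
      by have := Bd2 ft; rewrite (dif2E hA) (sgn_ttens tauP).
    rewrite -(subrK (T (dif x) y) (twist_cop _ (tens (dif x) y))).
    rewrite -(subrK (T (sgn x) (dif y)) (twist_cop _ (tens (sgn x) (dif y)))).
    rewrite addrACA; apply: (subspD (sB2 q)); first exact: (subspD (sB2 q)).
    rewrite -[T (dif x) y](subKr (tens (dif (tens x m1 : A)) (tens y m2 : A))).
    rewrite -[T (sgn x) (dif y)](subKr (tens (tens (sgn x) m1 : A) (dif (tens y m2 : A)))).
    rewrite addrACA; apply: (subspD (sB2 q)) => //.
    by apply: (subspD (sB2 q)); exact: (subspN (sB2 q)).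
  by rewrite rAE; [apply/(ecl_eq0 sZ2 sB2)=> //; exact: BZ2|exact: BZ2].
by apply/eqP; rewrite -subr_eq0; apply/eqP; exact: cyc.
Qed.

Lemma first_cop_gc c m : dif c = 0 -> FF q m ->
  cop (phi (tens (hc c : H) (gc q m))) = tmap phi phi (cop (tens (hc c : H) (gc q m) : P)).
Proof.
move=> dc fm; have zc := Zr1_tens tauP dc fm.
have fc := filF_cop fm.
have cgc : cop (gc q m) = S (cop m).
  apply: (bij_inj crb); rewrite crS r2E //.
  exact: (gr_cross_cop (cset_dgc k F 0) hFF fm).
apply: (bij_inj hpage.1); rewrite first_phiE // (page_cross_cop hA hF hpage.1 zc).
rewrite first_copE cgc (cop_pi dc) first_kunneth //; last exact: (cop_cycle hX).
have -> : twist_cop (cop m) (cop c) = cop (tens c m : A) by rewrite (tcopE tauP).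
by rewrite rAE //; have := cop_Zr hA hF zc; rewrite addr0.
Qed.
End Symbol.

Lemma first_phi_cop x : cop (phi x) = tmap phi phi (cop x).
Proof.
move: x; apply: first_ext => [||c q m dc fm].
- exact: lin_comp (page_cop_lin hA hF hdeg hpage.1) phil.
- exact: lin_comp (tmap_lin phil phil) first_cop_lin.
have [rho2 [r2l r2E]] := ecl_ext (below (pc2 FF FF)) (fun q => pc2_subspace FF FF q) q.
have [rhoA [rAl rAE]] := ecl_ext B2 sZ2 q.
exact: (first_cop_gc r2l r2E rAl rAE).
Qed.

Lemma first_eps_bilin : bilin (fun (h : H) (e : E) => eps h * eps e : k^o).
Proof.
have ge := dgc_eps_linear (gr_is_dgc (cset_dgc k F 0) hFF (@filF_aug0 k G F) 0).
split=> [e|h].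
  exact: lin_scalel (eps e : k^o) (heps_lin hX).
by apply: (lin_eq (f := fun e : E => eps h *: (eps e : k^o))); last exact: (lin_scale (eps h) ge).
Qed.

Lemma first_phi_eps x : eps (phi x) = eps x.
Proof.
move: x; apply: (first_ext (V := k^o)) => [||c q m dc fm].
- exact: lin_comp (dgc_eps_linear hpage.2) phil.
- exact: tlift_lin first_eps_bilin.
rewrite first_phiE // [RHS](tliftE first_eps_bilin) (page_eps_ecl hA hF epsF (Zr1_tens tauP dc fm)).
rewrite (heps_hcls hX dc) [eps (gc q m)](sqdgc_eps_ecl _ _ _ sFF sBF (@aug_lin k F) _ fm);
  last first.
  by move=> x _; exact: filF_aug0.
by case: ifP => _; rewrite ?tepsE ?mulr0.
Qed.

Lemma first_phi_pc pq x : pc pq x -> pc pq (phi x).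
Proof.
have hp := pc_subspace (dgc_grading hpage.2) pq.
move: x; apply: lspan_sub => [|_ [h [e [[c [pcc dc ->]] [m [fm ->]] ->]]]].
  exact: (subspace_preim phil hp).
rewrite /mkset first_phiE //; exists (tens c m); split => //; last exact: pc_ttens.
exact: (Zr1_tens tauP).
Qed.

End WithInverse.

Lemma first_page_iso : exists phi : P -> pg, is_dgc_iso (D := pg) phi /\
  forall c q m, dif c = 0 -> FF q m -> phi (tens (hc c) (gc q m)) = pcl q (tens c m).
Proof.
have [s [sl dsd]] := generalized_inverse cdl.
have [rho rP] := choice (fun q => ecl_ext (below FF) sFF q).
exists phi; split; last by move=> c q m dc fm; exact: first_phiE.
split; last exact: (first_phi_dif sl dsd).
split.
- exact: phil.
- exact: (first_phi_bij tauP sl dsd (fun q => (rP q).1) (fun q => (rP q).2)).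
- exact: first_phi_pc.
- exact: (first_phi_cop sl dsd).
- exact: first_phi_eps.
Qed.
End FirstPageDgc.

(** * Convergence *)

Section HomologyCop.
Variables (k : fieldType) (I : zmodType) (C : dgc k I) (s0 : I).
Hypotheses (hC : is_dgc s0 C) (degC : forall i, (-1) ^ deg C (i + s0) = - (-1) ^ deg C i :> k).

Lemma cop_hcls s (s_lin : linear s) (dsd : forall x, dif (s (dif x)) = dif x) (z : C) : dif z = 0 ->
  cop (hcls (@dif _ _ C) z : hdgc C) = tmap (hpi (@dif _ _ C) s) (hpi (@dif _ _ C) s) (cop z).
Proof.
move=> dz; apply: (hpi_kunneth hC degC s_lin dsd); first exact: (cop_cycle hC).
exact: (kunneth_cop_hcls hC degC).
Qed.
End HomologyCop.

Section HomologyIso.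
Variables (k : fieldType) (I : zmodType) (C D : dgc k I) (s0 : I) (f : C -> D).
Hypotheses (hC : is_dgc s0 C) (hD : is_dgc s0 D).
Hypotheses (degC : forall i, (-1) ^ deg C (i + s0) = - (-1) ^ deg C i :> k)
  (degD : forall i, (-1) ^ deg D (i + s0) = - (-1) ^ deg D i :> k).
Hypotheses (f_lin : linear f) (f_bij : bijective f) (f_pc : forall i x, pc i x -> pc i (f x))
  (f_cop : forall x, cop (f x) = tmap f f (cop x)) (f_eps : forall x, eps (f x) = eps x)
  (f_dif : forall x, f (dif x) = dif (f x)).
Let hf : hdgc C -> hdgc D := hmap (@dif _ _ D) f.

(** The coproducts of the two homologies are expressed through unrelated generalized inverses. The
    composites of f with the extended class maps agree on cycles and vanish on boundaries, so
    [cycle_ext] applies. *)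
Lemma homology_iso : is_coalg_iso hf.
Proof.
have dl := dgc_dif_linear hC; have dd := dgc_dif_dif hC.
have el := dgc_dif_linear hD; have ee := dgc_dif_dif hD.
have hl : linear hf by exact: hmap_lin.
have hE z : dif z = 0 -> hf (hcls (@dif _ _ C) z) = hcls (@dif _ _ D) (f z) by exact: hmapE.
have fz z : dif z = 0 -> dif (f z) = 0 by move=> dz; rewrite -f_dif dz (lin0 f_lin).
split.
- exact: hl.
- exact: hmap_bij.
- move=> i x [z [pz dz ->]]; exists (f z); split; [exact: f_pc|exact: fz|exact: hE].
- apply: homology_ind => // z dz; rewrite hE //.
  have [s [sl dsd]] := generalized_inverse dl; have [s' [sl' dsd']] := generalized_inverse el.
  rewrite (cop_hcls hC degC sl dsd dz) (cop_hcls hD degD sl' dsd' (fz z dz)) f_cop.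
  have pil := hpi_lin dl dd sl dsd; have pil' := hpi_lin el ee sl' dsd'.
  rewrite (tmap_comp _ pil pil hl hl) (tmap_comp _ f_lin f_lin pil' pil').
  have l1 := lin_comp hl pil; have l2 := lin_comp pil' f_lin.
  apply: (cycle_ext hC degC (tmap_lin l2 l2) (tmap_lin l1 l1)); last exact: (cop_cycle hC).
    move=> x y dx dy; rewrite (tmapE _ _ l1 l1) (tmapE _ _ l2 l2) /=.
    by rewrite !(hpi_cycle dl dd sl dsd) // !(hpi_cycle el ee sl' dsd') ?hE //; exact: fz.
  have p1 x : hf (hpi (@dif _ _ C) s (dif x)) = 0.
    by rewrite (hpi_d dl dd sl dsd) (lin0 hl).
  have p2 x : hpi (@dif _ _ D) s' (f (dif x)) = 0.
    by rewrite f_dif (hpi_d el ee sl' dsd').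
  move=> x y; rewrite (dif2E hC) (linD (tmap_lin l1 l1)) (linD (tmap_lin l2 l2)).
  by rewrite !(tmapE _ _ l1 l1) !(tmapE _ _ l2 l2) !p1 !p2 !tens0l !tens0r.
- apply: homology_ind => // z dz; rewrite hE // (heps_hcls hD) ?(heps_hcls hC) //.
  exact: fz.
Qed.
End HomologyIso.

(** * Convergence for bounded filtrations *)

Section BoundedConvergence.
Variables (k : fieldType) (C H : dgc k int) (Fil : int -> set C) (sH : int).
Hypotheses (hC : is_dgc (-1) C) (hF : is_filtered_dgc Fil).
Hypotheses (hdeg : forall i, deg C i = i) (epsF : forall x, Fil (-1) x -> eps x = 0).
Variables (a : int) (n : nat).
Hypotheses (Fa : forall x, Fil a x -> x = 0) (Fb : forall x, Fil (a + n%:Z) x).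
Hypotheses (hH : is_dgc sH H) (H0 : forall h : H, dif h = 0).
Variable Theta : hdgc C -> H.
Hypothesis hTheta : is_coalg_iso Theta.

Let hg := dgc_grading hC.
Let d := @dif _ _ C.
Let d2 := @dif2 _ _ C.
Let dl : linear d := dgc_dif_linear hC.
Let dd : forall x, d (d x) = 0 := dgc_dif_dif hC.
Let sF := fil_subspace hF.
Let F1 := fil_incr hF.
Let dF := fil_dif hF.
Let Fil2 := pc2 Fil Fil.
Let sF2 q : is_subspace (Fil2 q). Proof. exact: pc2_subspace. Qed.
Let degC (i : int) : (-1) ^ deg C (i + -1) = - (-1) ^ deg C i :> k.
Proof. by rewrite !hdeg; exact: sign_pred. Qed.
Let d2l : linear d2 := dif2_lin hC.
Let d2d2 t : d2 (d2 t) = 0 := dif2_dif2 hC degC t.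
(** The filtration of the tensor square runs from 2a to 2(a + n). For q > 2a every tensor thus has
    filtration q + 2n = q + R - 1, the index of the bounding elements in [Br]. *)
Let R : nat := (2 * n).+1.
Let Z := Zr d Fil R.
Let B := Br d Fil R.
Let Z2 := Zr d2 Fil2 R.
Let B2 := Br d2 Fil2 R.
Let sZ q : is_subspace (Z q). Proof. exact: Zr_subspace. Qed.
Let sB q : is_subspace (B q). Proof. exact: Br_subspace. Qed.
Let sZ2 q : is_subspace (Z2 q). Proof. exact: Zr_subspace. Qed.
Let sB2 q : is_subspace (B2 q). Proof. exact: Br_subspace. Qed.
Let hp := page_kunneth_dgc hC hF hdeg epsF.
Let hc := hcls d.
Let el (q : int) (z : C) : page Fil R := ecl Z B q z.
Let el2 := ecl Z2 B2.
Let theta z : H := Theta (hc z).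
Let Tl := iso_linear hTheta.

Let Flow q x : q <= a -> Fil q x -> x = 0.
Proof. by move=> qa fx; apply: Fa; exact: (fil_mono F1 qa). Qed.
Let Fhigh q x : a + n%:Z <= q -> Fil q x.
Proof. by move=> aq; apply: (fil_mono F1 aq). Qed.
Let cycZ q z : Fil q z -> d z = 0 -> Z q z.
Proof. by move=> fz dz; split=> //; rewrite dz; exact: subsp0. Qed.
Let cycZ2 q z : Fil2 q z -> d2 z = 0 -> Z2 q z.
Proof. by move=> fz dz; split=> //; rewrite dz; exact: subsp0. Qed.
Let Zcyc (r : nat) q z : (n <= r)%N -> q <= a + n%:Z -> Zr d Fil r q z -> d z = 0.
Proof. by move=> nr qb [_ dz]; apply: Flow dz; lia. Qed.
(** Above a + n elements of [Zr] need not be cycles, but z already has filtration q - 1, so its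
    class is zero. *)
Let Zhigh (r : nat) q z : a + n%:Z < q -> Zr d Fil r q z -> Br d Fil r q z.
Proof.
move=> qb [fz dz]; exists z, 0; split; last by rewrite (lin0 dl) addr0.
  split; first by apply: Fhigh; lia.
  by have -> : q - 1 - (r%:Z - 1) = q - r%:Z by lia.
by split; rewrite ?(lin0 dl); exact: subsp0.
Qed.

Lemma page_stable_dif (r : nat) : (R <= r)%N -> forall e : page Fil r, dif e = 0.
Proof.
move=> Rr; have szr q : is_subspace (Zr d Fil r q) by exact: Zr_subspace.
have sbr q : is_subspace (Br d Fil r q) by exact: Br_subspace.
have pl := dgc_dif_linear (hp r).2.
apply: (sqsum_ind szr sbr) => [|x y hx hy|q z zz]; first exact: lin0.
  by rewrite (linD pl) hx hy addr0.
rewrite [LHS](pagedif_ecl dl dd sF zz); have [qb|qb] := lerP q (a + n%:Z).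
  by rewrite (Zcyc _ qb zz) ?(ecl0 szr sbr) //; rewrite /R in Rr; lia.
have zb := Zhigh qb zz.
have e0 : ecl (Zr d Fil r) (Br d Fil r) q z = 0 by apply/(ecl_eq0 szr sbr zz).
by rewrite -(pagedif_ecl dl dd sF zz) e0; exact: (lin0 pl).
Qed.

(** Up to a + n the differential of z falls below a and vanishes; beyond that the classes are
    zero. *)
Let page_ind (Q : page Fil R -> Prop) : Q 0 -> (forall x y, Q x -> Q y -> Q (x + y)) ->
  (forall q z, Fil q z -> d z = 0 -> Q (el q z)) -> forall e, Q e.
Proof.
move=> Q0 QD Qz; apply: (sqsum_ind sZ sB) => // q z zz.
have [qb|qb] := lerP q (a + n%:Z).
  by apply: Qz; [case: zz|apply: (Zcyc _ qb zz); rewrite /R; lia].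
by have -> : ecl Z B q z = 0 by apply/(ecl_eq0 sZ sB zz); exact: Zhigh.
Qed.
Let page_ext (V : lmodType k) (f g : page Fil R -> V) : linear f -> linear g ->
  (forall q z, Fil q z -> d z = 0 -> f (el q z) = g (el q z)) -> f =1 g.
Proof.
move=> fl gl fg; apply: page_ind => // [|x y hx hy]; first by rewrite (lin0 fl) (lin0 gl).
by rewrite (linD fl) (linD gl) hx hy.
Qed.

Let W q : set (tensor C C) := [set t | t \in lspan [set t' | exists i j x y,
  [/\ i + j = q, Fil i x /\ d x = 0, Fil j y /\ d y = 0 & t' = tens x y]]].
Let sW q : is_subspace (W q). Proof. exact: lspan_subspace. Qed.
Let W_F q t : W q t -> Fil2 q t /\ d2 t = 0.
Proof.
move: t; apply: lspan_sub; first exact: (subspaceI (sF2 q) (cycles_subspace d2l)).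
move=> _ [i [j [x [y [ij [fx dx] [fy dy] ->]]]]]; split; first exact: pc2_tens_eq ij.
exact: (dif2_cycle hC).
Qed.
Let W_incr q : W (q - 1) `<=` W q.
Proof.
apply: lspan_sub; first exact: sW.
move=> _ [i [j [x [y [ij [fx dx] [fy dy] ->]]]]]; apply: lspan_mem; exists (i + 1), j, x, y.
split=> //; first by lia.
by split=> //; apply: F1; rewrite addrK.
Qed.
Let F2low q t : q <= 2%:Z * a -> Fil2 q t -> t = 0.
Proof.
move=> qa; move: t; apply: pc2_sub => [|i j x y ij fx fy]; first exact: subspace0.
have [ia|ia] := lerP i a; first by rewrite (Flow ia fx) /mkset tens0l.
by rewrite (@Flow j y) /mkset ?tens0r //; lia.
Qed.
Let F2high q t : 2%:Z * (a + n%:Z) <= q -> Fil2 q t.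
Proof.
move=> qa; move: t; apply: tens_ind => [|s t hs ht|x y]; [exact: subsp0|exact: subspD|].
by apply: (@pc2_tens_eq _ _ _ _ _ _ (a + n%:Z) (q - (a + n%:Z))) => //; [apply: Fhigh; lia|lia].
Qed.

Lemma cycle_products q w : Fil2 q w -> d2 w = 0 -> exists u v, [/\ W q u & w = u + d2 v].
Proof.
have [P2 [P2l P2E]] := sqproj_ex sZ2 sB2.
have kb := (hp R).1; have kl := page_cross_lin hC hF hdeg (r := R).
(* Although t is an arbitrary tensor of classes, the part of filtration q' of its Kuenneth image is
   represented by products of cycles, as page R is generated by classes of cycles. *)
have prod q' t : exists u, W q' u /\ P2 q' (page_kunneth (t : tensor (page Fil R) (page Fil R)))
  = el2 q' u.
  have Q0 : exists u, W q' u /\ (0 : sqsum Z2 B2) = el2 q' u.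
    by exists 0; split; [exact: subsp0|rewrite /el2 (ecl0 sZ2 sB2)].
  have QD e e' : (exists u, W q' u /\ e = el2 q' u) -> (exists u, W q' u /\ e' = el2 q' u) ->
      exists u, W q' u /\ e + e' = el2 q' u.
    move=> [u [Wu ->]] [u' [Wu' ->]]; exists (u + u'); split; first exact: subspD.
    have [fu du] := W_F Wu; have [fu' du'] := W_F Wu'.
    by rewrite /el2 (eclD B2 sZ2) //; exact: cycZ2.
  have l : linear (fun t => P2 q' (page_kunneth (t : tensor (page Fil R) (page Fil R)))).
    exact: lin_comp (P2l q') kl.
  move: t; apply: tens_ind => [|t t' ht ht'|e e'].
  - by rewrite (lin0 l).
  - by rewrite (linD l); exact: QD.
  move: e; apply: page_ind => [|x y hx hy|i x fx dx].
  - by rewrite tens0l (lin0 l).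
  - by rewrite (linD (tens_linl _)) (linD l); exact: QD.
  move: e'; apply: page_ind => [|y y' hy hy'|j y fy dy].
  - by rewrite tens0r (lin0 l).
  - by rewrite (linD (tens_linr _)) (linD l); exact: QD.
  rewrite (page_crossE hC hF hdeg (cycZ fx dx) (cycZ fy dy)) P2E; last first.
    by apply: (Zr_tens hC hF); exact: cycZ.
  case: eqP => // ij; exists (tens x y); split; last by rewrite -ij.
  by apply: lspan_mem; exists i, j, x, y.
have [qa|qa] := lerP q (2%:Z * a).
  by move=> fw _; rewrite (F2low qa fw); exists 0, 0; split;
    [exact: subsp0|rewrite (lin0 d2l) addr0].
have {qa} -> : q = 2%:Z * a + (absz (q - 2%:Z * a)%R)%:Z by lia.
(* Induction on m = q - 2a; at 2a the filtration of the tensor square is zero. *)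
elim: {q}(absz _) w => [|m IH] w fw dw.
  by rewrite addr0 in fw; rewrite (F2low _ fw) //; exists 0, 0; split;
    [exact: subsp0|rewrite (lin0 d2l) addr0].
move: fw; set q := (_ + _ : int) => fw.
have [t tE] : exists t, page_kunneth t = el2 q w.
  by have [g _ gK] := kb; exists (g (el2 q w)); rewrite gK.
have [u [Wu]] := prod q t; rewrite tE P2E; last exact: cycZ2.
have [fu du] := W_F Wu.
(* Equality of the classes of w and u means w - u = y + d2 z with y of filtration q - 1. As y is
   again a cycle, the induction hypothesis applies to it. *)
rewrite eqxx => /(ecl_eq sZ2 sB2 (cycZ2 fw dw) (cycZ2 fu du))[y [z [[fy _] _ wE]]].
have fy' : Fil2 (2%:Z * a + m%:Z) y by have <- : q - 1 = 2%:Z * a + m%:Z by rewrite /q; lia.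
have dy : d2 y = 0.
  have -> : y = w - u - d2 z by rewrite wE addrK.
  by rewrite !(linB d2l) dw du d2d2 !subr0.
have [u' [v' [Wu' yE]]] := IH y fy' dy.
exists (u + u'), (v' + z); split.
  by apply: subspD => //; apply: W_incr; have -> : q - 1 = 2%:Z * a + m%:Z by rewrite /q; lia.
by rewrite -[LHS](subrK u) wE yE (linD d2l) [LHS]addrC !addrA.
Qed.

Let FH q : set H := Theta @` (Hfil Fil q).
Let FHP q h : FH q h <-> exists z, [/\ Fil q z, d z = 0 & h = theta z].
Proof.
split=> [[_ [z [fz dz ->]] <-]|[z [fz dz ->]]]; first by exists z.
by exists (hc z) => //; exists z.
Qed.
Let theta_lin c (u v : C) : d u = 0 -> d v = 0 -> theta (c *: u + v) = c *: theta u + theta v.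
Proof. by move=> du dv; rewrite /theta /hc (hcls_linZ dl) // Tl. Qed.
Let theta0 : theta 0 = 0. Proof. by rewrite /theta /hc (hcls0 dl) (lin0 Tl). Qed.
Let theta_surj h : exists z, d z = 0 /\ h = theta z.
Proof.
have [g _ gK] := iso_bij hTheta; rewrite -(gK h); exists (rep (g h)); split;
  first exact: hrep_cycle.
by rewrite /theta /hc hrepK.
Qed.
Let theta_mem q z : Fil q z -> d z = 0 -> FH q (theta z).
Proof. by move=> fz dz; apply/FHP; exists z. Qed.
Let theta_pc i z : pc i z -> d z = 0 -> pc i (theta z).
Proof. by move=> pz dz; apply: (iso_pc hTheta); exists z. Qed.
Let theta_eps z : d z = 0 -> eps (theta z) = eps z.
Proof. by move=> dz; rewrite (iso_eps hTheta) (heps_hcls hC). Qed.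
Let theta_inj u v : d u = 0 -> d v = 0 -> theta u = theta v -> range d (u - v).
Proof. by move=> du dv /(bij_inj (iso_bij hTheta)) /(hcls_eq dl du dv). Qed.
Let theta_hcomp z i : d z = 0 -> hcomp (theta z) i = theta (hcomp z i).
Proof.
move=> dz; have [gH hcE] := hdgc_grading hC; rewrite /theta /hc -hcE //.
move: (hcls d z); apply: (homog_ext gH (f := fun x => hcomp (Theta x) i) (g := fun x => Theta
  (hcomp (x : hdgc C) i))) => [||j x px].
- exact: lin_comp (hcompi_lin (dgc_grading hH) i) Tl.
- exact: lin_comp Tl (hcompi_lin gH i).
rewrite (hcomp_pc gH px) (hcomp_pc (dgc_grading hH) (iso_pc hTheta px)) !singleE.
by case: ifP => _ //; rewrite (lin0 Tl).
Qed.

Let sFH q : is_subspace (FH q).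
Proof.
split=> [|c u v]; first by apply/FHP; exists 0; split; rewrite ?theta0 //;
  [exact: subsp0|exact: lin0].
move=> /FHP[x [fx dx ->]] /FHP[y [fy dy ->]]; apply/FHP; exists (c *: x + y); split.
- exact: (sF q).2.
- by rewrite dl dx dy scaler0 addr0.
- by rewrite theta_lin.
Qed.
Let FH1 q : FH (q - 1) `<=` FH q.
Proof. by move=> h /FHP[z [fz dz ->]]; apply: theta_mem => //; exact: F1. Qed.

(** Extends [theta] from cycles to all chains, so that coproducts in H are computed by th (x) th on
    representatives. *)
Let thpi : exists th : C -> H, [/\ linear th, forall z, d z = 0 -> th z = theta z,
  forall x, th (d x) = 0 & forall z, d z = 0 -> cop (theta z) = tmap th th (cop z)].
Proof.
have [s [sl dsd]] := generalized_inverse dl.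
have pil := hpi_lin dl dd sl dsd.
exists (fun x => Theta (hpi d s x)); split.
- exact: lin_comp Tl pil.
- by move=> z dz; rewrite (hpi_cycle dl dd sl dsd).
- by move=> x; rewrite (hpi_d dl dd sl dsd) (lin0 Tl).
move=> z dz; rewrite (iso_cop hTheta) (cop_hcls hC degC sl dsd dz).
by rewrite (tmap_comp _ pil pil Tl Tl).
Qed.

Let th_d2 (th : C -> H) t : linear th -> (forall x, th (d x) = 0) -> tmap th th (d2 t) = 0.
Proof.
move=> tl td; move: t; apply: (tens_ext (f := fun t => tmap th th (d2 t)) (g := fun=> 0)) => [||x
  y].
- exact: lin_comp (tmap_lin tl tl) d2l.
- exact: lin_zero.
by rewrite /d2 (dif2E hC) (linD (tmap_lin tl tl)) !(tmapE _ _ tl tl) !td tens0l tens0r addr0.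
Qed.

Lemma limit_filtered : is_filtered_dgc FH.
Proof.
split.
- exact: sFH.
- move=> q h /FHP[z [fz dz ->]] i; rewrite theta_hcomp //.
  by apply: theta_mem; [exact: (fil_graded hF)|exact: (hcomp_cycle hC)].
- exact: FH1.
- by move=> q h _; rewrite H0; exact: subsp0.
move=> q h /FHP[z [fz dz ->]]; have [th [tl tE td ->//]] := thpi.
have [u [v [Wu ->]]] := cycle_products (fil_cop hF fz) (cop_cycle hC dz).
rewrite (linD (tmap_lin tl tl)) th_d2 // addr0.
move: u {z fz dz v} Wu; apply: lspan_sub;
  first exact: (subspace_preim (tmap_lin tl tl) (pc2_subspace _ _ _)).
move=> _ [i [j [x [y [ij [fx dx] [fy dy] ->]]]]]; rewrite /mkset (tmapE _ _ tl tl) !tE //.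
by apply: pc2_tens_eq ij; exact: theta_mem.
Qed.
Let hFH := limit_filtered.

Let gc := gr_cls FH.
Let sBH q : is_subspace (below FH q). Proof. exact: sFH. Qed.
Let epsH h : FH (-1) h -> eps h = 0.
Proof. by move=> /FHP[z [fz dz ->]]; rewrite theta_eps // epsF. Qed.
Let hgr := gr_is_dgc hH hFH epsH 0.

(** For q > a every chain has filtration q + R - 1, so any bounding chain is admissible in [Br]. *)
Let Bstab q z : Fil q z -> range d z -> B q z.
Proof.
move=> fz [v _ vE]; have [qa|qa] := lerP q a.
  by rewrite (Flow qa fz); exact: (subsp0 (sB q)).
exists 0, v; split; last by rewrite add0r.
  by split; rewrite ?(lin0 dl); exact: subsp0.
split; first by apply: Fhigh; rewrite /R; lia.
by rewrite vE; have -> : q + R%:Z - 1 - (R%:Z - 1) = q by lia.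
Qed.
Let B2stab q w : Fil2 q w -> range d2 w -> B2 q w.
Proof.
move=> fw [v _ vE]; have [qa|qa] := lerP q (2%:Z * a).
  by rewrite (F2low qa fw); exact: (subsp0 (sB2 q)).
exists 0, v; split; last by rewrite add0r.
  by split; rewrite ?(lin0 d2l); exact: subsp0.
split; first by apply: F2high; rewrite /R; lia.
by rewrite vE; have -> : q + R%:Z - 1 - (R%:Z - 1) = q by lia.
Qed.
Let Bcyc q z : Fil q z -> d z = 0 -> FH (q - 1) (theta z) -> B q z.
Proof.
move=> fz dz /FHP[z' [fz' dz' e]].
have -> : z = z' + (z - z') by rewrite addrCA subrr addr0.
apply: (subspD (sB q)); last first.
  apply: Bstab; last exact: theta_inj.
  by apply: (subspB (sF q)) => //; exact: F1.
exists z', 0; split; last by rewrite (lin0 dl) addr0.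
  by split=> //; rewrite dz'; exact: subsp0.
by split; rewrite ?(lin0 dl); exact: subsp0.
Qed.

Let limit_map : exists phi : page Fil R -> gr FH, linear phi /\
  forall q z, Fil q z -> d z = 0 -> phi (el q z) = gc q (theta z).
Proof.
(* Above a + n elements of Z are not cycles in general and [theta] would be meaningless on them; the
   page is zero there, hence the value 0. *)
pose f q z : gr FH := if q <= a + n%:Z then gc q (theta z) else 0.
have zc q z : Z q z -> q <= a + n%:Z -> d z = 0.
  by move=> zz qb; apply: (Zcyc _ qb zz); rewrite /R; lia.
have [phi [pl pE]] : exists F : sqsum Z B -> gr FH, linear F /\ forall q z, Z q z -> F (ecl Z B q
  z) = f q z.
  apply: (sqlift sZ sB) => [q c u v zu zv|q v zv bv]; rewrite /f; case: ifP => qb.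
  - have du := zc _ _ zu qb; have dv := zc _ _ zv qb; rewrite theta_lin //.
    exact: (ecl_lin (below FH) sFH c (theta_mem (proj1 zu) du) (theta_mem (proj1 zv) dv)).
  - by rewrite scaler0 addr0.
  - have dv := zc _ _ zv qb.
    apply/(ecl_eq0 sFH sBH (theta_mem (proj1 zv) dv)).
    case: bv => y [w [zy _ vE]].
    have dy : d y = 0 by apply: (Flow _ (proj2 zy)); rewrite /R; lia.
    have <- : theta y = theta v.
      rewrite vE -[d w]scale1r addrC theta_lin //.
      by rewrite [theta (d w)]/theta /hc (hcls_bound dl dd) (lin0 Tl) scaler0 add0r.
    by apply: theta_mem => //; case: zy.
  - by [].
exists phi; split=> // q z fz dz; rewrite [LHS](pE q z (cycZ fz dz)) /f; case: ifP => // /negbT qb.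
apply/esym/(ecl_eq0 sFH sBH (theta_mem fz dz)); apply: theta_mem => //.
by apply: Fhigh; rewrite -ltNge in qb; lia.
Qed.

Section LimitIso.
Variable phi : page Fil R -> gr FH.
Hypotheses (pl : linear phi) (pE : forall q z, Fil q z -> d z = 0 -> phi (el q z) = gc q (theta z)).

Lemma limit_bij : bijective phi.
Proof.
apply: bijective_of.
  have [P [Pl PE]] := sqproj_ex sZ sB; have [Q [Ql QE]] := sqproj_ex sFH sBH.
  apply: lin_inj => // e e0; apply: (decomposition_sep Pl (sqproj_dec sZ sB Pl PE)) => q.
  rewrite (lin0 (Pl q)).
  have pq : phi (P q e) = Q q (phi e).
    move: e {e0}; apply: page_ext => [||i z fz dz].
    - exact: lin_comp pl (Pl q).
    - exact: lin_comp (Ql q) pl.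
    rewrite (PE q _ _ (cycZ fz dz)) pE // (QE q _ _ (theta_mem fz dz)).
    by case: ifP => _; [rewrite [LHS](pE fz dz)|exact: (lin0 pl)].
  have [z [fz dz zE]] : exists z, [/\ Fil q z, d z = 0 & P q e = el q z].
    move: e {e0 pq}; apply: page_ind => [|x y [u [fu du uE]] [v [fv dv vE]]|i z fz dz].
    - exists 0; split; [exact: subsp0|exact: lin0|].
      by rewrite (lin0 (Pl q)) /el (ecl0 sZ sB).
    - exists (u + v); split; [exact: subspD|by rewrite (linD dl) du dv addr0|].
      by rewrite (linD (Pl q)) uE vE /el (eclD B sZ) //; exact: cycZ.
    rewrite (PE q _ _ (cycZ fz dz)); case: eqP => [<-|_]; first by exists z.
    by exists 0; split; [exact: subsp0|exact: lin0|rewrite /el (ecl0 sZ sB)].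
  move: pq; rewrite e0 (lin0 (Ql q)) zE pE // => /(ecl_eq0 sFH sBH (theta_mem fz dz)) th0.
  by apply/(ecl_eq0 sZ sB (cycZ fz dz)); exact: Bcyc.
apply: (sqsum_ind sFH sBH) => [|x y [u <-] [v <-]|q h /FHP[z [fz dz ->]]].
- by exists 0; exact: lin0.
- by exists (u + v); rewrite (linD pl).
by exists (el q z); rewrite pE.
Qed.

Lemma limit_pc pq e : pc pq e -> pc pq (phi e).
Proof.
move=> [z [zz pz ->]]; have [qb|qb] := lerP pq.2 (a + n%:Z).
  have dz : d z = 0 by apply: (Zcyc _ qb zz); rewrite /R; lia.
  have fz := proj1 zz; rewrite [phi _](pE fz dz); exists (theta z); split=> //.
  - exact: theta_mem.
  - exact: theta_pc.
have -> : scls Z B (single pq.2 z) = 0 by apply/(ecl_eq0 sZ sB zz); exact: Zhigh.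
by rewrite (lin0 pl); exact: (subsp0 (pc_subspace (dgc_grading hgr) pq)).
Qed.

(** The coproduct of z is replaced by a homologous sum u of products of cycles, on which both
    Kuenneth maps are explicit. *)
Lemma limit_cop e : cop (phi e) = tmap phi phi (cop e).
Proof.
have kb := (hp R).1; have kl := page_cross_lin hC hF hdeg (r := R).
have ppl := tmap_lin pl pl; have gl := gr_cross_lin sFH.
have hdegH := gr_cross_bij sFH FH1.
have sFH2 q : is_subspace (pc2 FH FH q) by exact: pc2_subspace.
have sBH2 q : is_subspace (below (pc2 FH FH) q) by exact: pc2_subspace.
have [th [tl tE td tcop]] := thpi; have ttl := tmap_lin tl tl.
move: e; apply: page_ext => [||q z fz dz].
- exact: lin_comp (gr_cop_lin hH hFH) pl.
- exact: lin_comp ppl (page_cop_lin hC hF hdeg kb).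
have zz := cycZ fz dz.
have [u [v [Wu cE]]] := cycle_products (fil_cop hF fz) (cop_cycle hC dz).
have [fu du] := W_F Wu.
(* A single tensor t of classes has to represent u on page R and, through phi, the image of u in the
   tensor square of H; it is built along the span [W]. The last clause keeps the memberships under
   which classes may be added. *)
have [t [t1 t2 _]] : exists t, [/\ page_kunneth t = el2 q u,
    cross (pc2 FH FH) (below (pc2 FH FH)) (tmap phi phi t) = ecl (pc2 FH FH) (below (pc2 FH FH))
      q (tmap th th u) &
    (Z2 q u /\ pc2 FH FH q (tmap th th u))].
  move: u {cE fu du} Wu; apply: lspan_ind => [|x y|c x].
  - exists 0; rewrite (lin0 kl) (lin0 ppl) (lin0 gl) (lin0 ttl) /el2 (ecl0 sZ2 sB2) (ecl0 sFH2
    sBH2).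
    by split=> //; split; exact: subsp0.
  - move=> [t [t1 t2 [t3 t4]]] [t' [t1' t2' [t3' t4']]]; exists (t + t').
    rewrite (linD kl) (linD ppl) (linD gl) (linD ttl) t1 t2 t1' t2'.
    split; [by rewrite /el2 (eclD B2 sZ2)|by rewrite (eclD _ sFH2)|].
    by split; exact: subspD.
  move=> [i [j [x1 [y1 [ij [fx dx] [fy dy] ->]]]]].
  have zx := cycZ fx dx; have zy := cycZ fy dy.
  exists (c *: tens (el i x1) (el j y1)).
  have z2 : Z2 q (tens x1 y1) by rewrite -ij; exact: (Zr_tens hC hF).
  have f2 : pc2 FH FH q (tens (theta x1) (theta y1)) by apply: pc2_tens_eq ij; exact: theta_mem.
  rewrite (linZ _ kl) (linZ _ ppl) (linZ _ gl) (linZ _ ttl) (tmapE _ _ pl pl) (tmapE _ _ tl tl)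
    !tE // !pE //.
  rewrite (page_crossE hC hF hdeg zx zy) ij (gr_crossE sFH (theta_mem fx dx) (theta_mem fy dy)) ij.
  split; [by rewrite /el2 (eclZ sZ2 sB2)|by rewrite (eclZ sFH2 sBH2)|].
  by split; exact: subspZ.
(* u and [cop z] differ by d2 v, whose class on page R is zero by [B2stab]. *)
have <- : t = cop (el q z).
  apply: (bij_inj kb); rewrite (page_cross_cop hC hF kb zz) t1 cE.
  apply/(ecl_eq sZ2 sB2); [exact: cycZ2|by rewrite -cE;
    exact: cycZ2 (fil_cop hF fz) (cop_cycle hC dz)|].
  rewrite opprD addrA subrr add0r; apply: (subspN (sB2 q)); apply: B2stab; last by exists v.
  have -> : d2 v = cop z - u by rewrite cE addrC addKr.
  by apply: (subspB (sF2 q)) => //; exact: (fil_cop hF).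
apply: (bij_inj hdegH); rewrite t2 pE // (gr_cross_cop hH hFH (theta_mem fz dz)) tcop //.
by rewrite cE (linD ttl) th_d2 // addr0.
Qed.

Lemma limit_eps e : eps (phi e) = eps e.
Proof.
move: e; apply: (page_ext (V := k^o)) => [||q z fz dz].
- exact: lin_comp (dgc_eps_linear hgr) pl.
- exact: (dgc_eps_linear (hp R).2).
rewrite pE // (page_eps_ecl hC hF epsF (cycZ fz dz)).
rewrite [LHS](sqdgc_eps_ecl _ _ _ sFH sBH (dgc_eps_linear hH) _ (theta_mem fz dz));
  last by move=> x _; exact: epsH.
by case: ifP => // _; exact: theta_eps.
Qed.
End LimitIso.

Lemma bounded_convergence : converges_to Fil H.
Proof.
exists Theta; split=> //=; split.
- exact: limit_filtered.
- exists a, (a + n%:Z); split; apply/seteqP; split=> h //=.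
  + by move=> /FHP[z [fz dz ->]]; rewrite (Fa fz) theta0.
  + by move=> ->; exact: (subsp0 (sFH a)).
  + by move=> _; have [z [dz ->]] := theta_surj h; exact: theta_mem.
exists R; split; first exact: page_stable_dif.
have [phi [pl pE]] := limit_map; exists phi; split=> //; split.
- exact: pl.
- exact: limit_bij.
- exact: limit_pc.
- exact: limit_cop.
- exact: limit_eps.
Qed.

End BoundedConvergence.

Theorem proposition11p2 (k : fieldType) (G : groupType) (F : gset G) (X : sset)
    (tau : forall n, X n.+1 -> G) (tauP : twisting_function tau) :
  let C := @twisted_tensor k G X F tau in
  let Fil := @twisted_fil k G X F tau in
  let P := @first_page k G X F tau in
  [/\ is_dgc (-1) C /\ is_filtered_dgc Fil,
      spectral_sequence_of_coalgebras Fil,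
      exists phi : P -> page Fil 1,
        is_dgc_iso (D := page Fil 1) phi /\
        forall (c : chains k X) q (m : Cset k F), dif c = 0 -> filF q m ->
          phi (tens (hcls (@dif _ _ (chains k X)) c) (gr_cls (@filF k G F) q m))
          = page_cls Fil 1 q (tens c m)
    & aug_nilpotent k G ->
      converges_to Fil (hdgc (chains k (twisted_product F tauP)))].
Proof.
move=> C Fil P.
have hA : is_dgc (-1) C := twisted_tensor_dgc k F tauP.
have hF : is_filtered_dgc Fil := tfil_filtered k F tauP.
have hdeg i : deg C i = i by [].
have epsF x : Fil (-1) x -> eps x = 0 by exact: tfil_eps0.
split; [by []|exact: spectral_sequence|exact: first_page_iso|].
move=> [N aN].
have hD := chains_dgc k (twisted_product F tauP).
have psiI : is_coalg_iso (C := hdgc C) (D := hdgc (chains k (twisted_product F tauP)))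
    (hmap (@dif _ _ (chains k (twisted_product F tauP))) (@psi k G X F tau tauP)).
  apply: (homology_iso hA hD); try exact: sign_pred.
  - exact: psi_lin.
  - exact: psi_bij.
  - by move=> i x /psi_pc.
  - exact: psi_cop.
  - exact: psi_eps.
  - exact: psi_dif.
(* If the N-th power of the augmentation ideal is zero, the filtration vanishes at - N, and it is
   everything at 0 = - N + N. *)
apply: (bounded_convergence (a := - N%:Z) (n := N) hA hF hdeg epsF _ _ (hdgc_is_dgc hD
  (@sign_pred k) 0) _ psiI) => //.
- apply: tfil_sub; first exact: subspace0.
  by move=> c m /(filF_nilpotent aN (lexx _)) ->; exact: tens0r.
- have sF := @tfil_subspace k G X F tau (- N%:Z + N%:Z).
  apply: tens_ind => [|x y|c m]; [exact: (subsp0 sF)|exact: (subspD sF)|].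
  by apply: tfil_tens; apply: filF_all; rewrite addNr.
Qed.
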